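(* Let $\Omega\subset\mathbb C$ be a domain, $0\le R<\infty$, $0\le L<\infty$, $0\le M<\infty$, $0<\alpha<1$, and let $\mathcal H=\mathcal H(z,\xi)$ be a continuous complex-valued function on $\Omega\times\widehat{\mathbb C}_R$, where $\widehat{\mathbb C}_R=\{\xi : R<|\xi|\le\infty\}$, such that $$|\mathcal H(z,\xi_1)-\mathcal H(z,\xi_2)|\le L\,\Big|\frac1{\xi_1}-\frac1{\xi_2}\Big|\quad\text{for } z\in\Omega,\ \xi_1,\xi_2\in\widehat{\mathbb C}_R,$$ $$\sup_{z\in\Omega}|\mathcal H(z,\xi)|+\sup_{z_1\ne z_2}\frac{|\mathcal H(z_1,\xi)-\mathcal H(z_2,\xi)|}{|z_1-z_2|^\alpha}\le M\quad\text{for } |\xi|>R.$$ Then there is a constant $\lambda_\circ=\lambda_\circ(\mathcal H)$, depending only on $\mathcal H$ (and not on $h$), such that the following holds. Suppose that a function $h\in\mathscr W^{1,2}(\Omega)\cap\mathscr L^\infty(\Omega)$ with $h_{\bar z}\in\mathscr L^\infty(\Omega)$ is a solution of $h_{\bar z}=\mathcal H(z,h_z)$. Then $h$ is locally Lipschitz. Moreover, for almost every $z\in\Omega$, $$|\nabla h(z)|\le\frac{3}{r}\,\mathrm{osc}_\Omega[h]+4\,\|h_{\bar z}\|_{\mathscr L^\infty(\Omega)}+6\lambda_\circ,\qquad r=\min\{\mathrm{dist}(z,\partial\Omega),1\}.$$ In particular, $$\limsup_{z\to\partial\Omega}|\nabla h(z)|\cdot\mathrm{dist}(z,\partial\Omega)\le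 3\,\mathrm{osc}_\Omega[h].$$ If, in addition, $h$ is continuous up to the boundary (extends continuously to $\overline\Omega$), then $$\limsup_{z\to\partial\Omega}|\nabla h(z)|\cdot\mathrm{dist}(z,\partial\Omega)=0.$$
   Context: $h_z=\partial h/\partial z$, $h_{\bar z}=\partial h/\partial\bar z$ are complex (weak) partial derivatives; $|\nabla h(z)|:=|h_z(z)|+|h_{\bar z}(z)|$; $\mathrm{osc}_\Omega[h]:=\sup_{a,b\in\Omega}|h(a)-h(b)|$ (for the continuous representative of $h$). Sobolev functions are identified when equal a.e. The convention $1/\infty=0$ is used, and $\widehat{\mathbb C}_R$ is topologized as a subset of the Riemann sphere. If $\Omega=\mathbb C$, $\mathrm{dist}(z,\partial\Omega)=\infty$ and the boundary statements are void. A function $h\in \mathscr W^{1,2}_{\mathrm{loc}}(\Omega)$ is said to be a solution of $h_{\bar z}=\mathcal H(z,h_z)$ if $h_{\bar z}(z)=\mathcal H(z,h_z(z))$ holds for almost every $z\in\Omega$ for which $|h_z(z)|>R$. No assumption on the sign of the Jacobian is made. The limsup as $z\to\partial\Omega$ is an essential limsup (null sets of $z$ are disregarded), taken as $z\in\Omega$ approaches an arbitrary point of $\partial\Omega\subset\mathbb C$. *)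

(* Defs.v *)
From HB Require Import structures.
From mathcomp Require Import all_boot all_order all_algebra.
From mathcomp Require Import complex.
From mathcomp Require Import all_classical all_reals all_analysis.
From mathcomp Require Import ess_sup_inf hoelder.

Set Implicit Arguments.
Unset Strict Implicit.
Unset Printing Implicit Defensive.
Import Order.TTheory GRing.Theory Num.Theory.
Import numFieldNormedType.Exports.

Local Open Scope classical_set_scope.
Local Open Scope ring_scope.

(* [R[i]] has no topology in the library; as a [numFieldType] it gets its usual
   one, induced by the complex modulus. *)
Definition C (R : realType) : numFieldType := R[i]%C.

Section Plane.
Variable R : realType.
Implicit Types (z w : C R) (A D Omega : set (C R)) (f h hx hy : C R -> C R).

(* The norm of [C R] is [C R]-valued. The norm of [R * R], on the other hand, is
   the maximum norm, so it is never used for distances. *)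
Definition cmod z : R := complex.Re `|z|.

Definition imunit : C R := Complex 0 1.

Definition toC (p : R * R) : C R := Complex p.1 p.2.

Definition leb2 : {measure set (measurableTypeR R * measurableTypeR R)%type
                     -> \bar R} :=
  (@lebesgue_measure R \x @lebesgue_measure R)%E.

Definition ae_on A (P : C R -> Prop) : Prop :=
  {ae leb2, forall p : R * R, A (toC p) -> P (toC p)}.

Definition domain Omega : Prop :=
  [/\ open Omega, connected Omega & Omega !=set0].

Definition bdry A : set (C R) := closure A `\` A°.

(* Equal to [+oo] when [A] is empty. *)
Definition dist z A : \bar R :=
  ereal_inf [set (cmod (z - w))%:E | w in A].

Definition osc A f : \bar R :=
  ereal_sup [set (cmod (f a - f b))%:E | a in A & b in A].

Definition Lpnorm A (p : \bar R) f : \bar R :=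
  ('N[leb2]_p[patch (cst 0) (toC @^-1` A) (fun q => (cmod (f (toC q)))%:E)])%E.

Definition cmeasurable A f : Prop :=
  measurable_fun (toC @^-1` A : set (measurableTypeR R * measurableTypeR R))
    (fun q => complex.Re (f (toC q)) : measurableTypeR R) /\
  measurable_fun (toC @^-1` A : set (measurableTypeR R * measurableTypeR R))
    (fun q => complex.Im (f (toC q)) : measurableTypeR R).

Definition in_Lp A (p : \bar R) f : Prop :=
  cmeasurable A f /\ (Lpnorm A p f < +oo)%E.

(* Essential limit superior at [w] of [F], along points of [A]: the infimum over
   [delta > 0] of the essential suprema over the points of [A] at distance less
   than [delta] from [w]. Patching by [-oo] disregards the points outside. *)
Definition ess_limsup A w (F : C R -> \bar R) : \bar R :=
  ereal_inf
    [set ess_sup leb2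
           (patch (cst -oo%E) (toC @^-1` [set z | A z /\ cmod (z - w) < delta])
              (fun q => F (toC q)))
    | delta in [set delta : R | 0 < delta]].

Definition ex : R * R := (1, 0).
Definition ey : R * R := (0, 1).

Fixpoint Cn (n : nat) (phi : R * R -> R) : Prop :=
  match n with
  | 0%N => continuous phi
  | n'.+1 => [/\ (forall p, derivable phi p ex /\ derivable phi p ey),
                 Cn n' (fun p => 'D_ex phi p) & Cn n' (fun p => 'D_ey phi p)]
  end.

Definition support (phi : R * R -> R) : set (R * R) :=
  closure [set p | phi p <> 0].

Definition test_function Omega (phi : R * R -> R) : Prop :=
  [/\ (forall n, Cn n phi), compact (support phi)
    & support phi `<=` toC @^-1` Omega].

Definition weak_partial Omega (v : R * R) (u w : C R -> R) : Prop :=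
  forall phi, test_function Omega phi ->
    \int[leb2]_(p in toC @^-1` Omega) (u (toC p) * 'D_v phi p) =
    - \int[leb2]_(p in toC @^-1` Omega) (w (toC p) * phi p).

Definition cweak_partial Omega (v : R * R) f g : Prop :=
  weak_partial Omega v (fun z => complex.Re (f z)) (fun z => complex.Re (g z)) /\
  weak_partial Omega v (fun z => complex.Im (f z)) (fun z => complex.Im (g z)).

Definition W12 Omega h hx hy : Prop :=
  [/\ in_Lp Omega 2%:E h, in_Lp Omega 2%:E hx, in_Lp Omega 2%:E hy,
      cweak_partial Omega ex h hx & cweak_partial Omega ey h hy].

Definition W12loc Omega h hx hy : Prop :=
  [/\ (forall K : set (C R), compact K -> K `<=` Omega ->
         [/\ in_Lp K 2%:E h, in_Lp K 2%:E hx & in_Lp K 2%:E hy]),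
      cweak_partial Omega ex h hx & cweak_partial Omega ey h hy].

Definition d_z hx hy z : C R := 2^-1 * (hx z - imunit * hy z).
Definition d_zbar hx hy z : C R := 2^-1 * (hx z + imunit * hy z).

Definition gradmod hx hy z : R := cmod (d_z hx hy z) + cmod (d_zbar hx hy z).

(* The Riemann sphere; [None] is the point at infinity. *)
Definition Csphere : topologicalType := one_point_compactification (C R).

Definition outside (rad : R) : set Csphere :=
  fun xi : option (C R) => if xi is Some x then rad < cmod x else True.

Definition sinv (xi : Csphere) : C R :=
  if (xi : option (C R)) is Some x then x^-1 else 0.

Definition finite_pt (x : C R) : Csphere := (Some x : option (C R)).

Definition is_solution Omega (rad : R) (H : C R -> Csphere -> C R) h hx hy
    : Prop :=
  W12loc Omega h hx hy /\
  ae_on Omega (fun z => rad < cmod (d_z hx hy z) ->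
    d_zbar hx hy z = H z (finite_pt (d_z hx hy z))).

Definition sup_mod Omega f : \bar R :=
  ereal_sup [set (cmod (f z))%:E | z in Omega].

Definition holder_seminorm Omega (alpha : R) f : \bar R :=
  ereal_sup [set q | exists z1 z2 : C R, [/\ Omega z1, Omega z2, z1 <> z2
    & q = (cmod (f z1 - f z2) / (cmod (z1 - z2) `^ alpha))%:E]].

End Plane.

(* Main.v *)
(* At almost every centre z0 one shows |h(z) - h(z0)| <= Lam |z - z0| on a disc, with Lam of
   the required size. Freeze the field at z0: K is H(z0, .) cut off near |w| = Lam0, so that it
   is globally 1/100-Lipschitz, and W is defined implicitly by
   h(z0 + u) - h(z0) = W u + K(W) conj(u). Where |W| is large, the Lipschitz and Hoelder
   conditions on H make W a quasiregular function up to an error of order |u|^(alpha - 1), and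
   near |u| = r it is bounded by osc / r + M. Since the Jacobian is a null Lagrangian, Re W obeys
   a Caccioppoli inequality on its superlevel sets, and so do the real parts of -W and of iW,
   -iW; De Giorgi's iteration, fed by Sobolev's inequality, turns this into a maximum principle
   bounding W. The singularity at u = 0 is removable for almost every z0, because logarithmic
   cut-offs have small energy and the difference quotients of h are square integrable in z0.
   W has no derivatives a priori: difference quotients replace them throughout, and the null
   Lagrangian identity becomes the translation invariance of the integral.
   The growth estimate, applied first with osc replaced by 2 sup |h|, yields a locally Lipschitz
   representative; applied to it on discs with radius up to dist(z, bdry), it bounds the gradient
   and gives the boundary statements. *)

Require Import Defs.
From HB Require Import structures.
From mathcomp Require Import all_boot all_order all_algebra.
From mathcomp Require Import complex ring lra.
From mathcomp Require Import all_classical all_reals all_analysis.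
From mathcomp Require Import measurable_realfun ess_sup_inf.
Import Order.TTheory GRing.Theory Num.Theory Num.Def.
Import numFieldNormedType.Exports.
Set Implicit Arguments.
Unset Strict Implicit.
Unset Printing Implicit Defensive.
Local Open Scope classical_set_scope.
Local Open Scope ring_scope.

Import Order.TTheory GRing.Theory Num.Theory.

(** * Translations and the discrete null Lagrangian *)

(** The hypotheses concern large values only, hence the argument lives on superlevel sets of [Re W].
    Taking the level above the values of [|W|] near the outer circle keeps these sets away from it,
    so cut-offs are needed only at the origin, and their contribution tends to 0. What remains on
    the right of the energy inequality is a weighted measure of the superlevel set; the iteration
    closes because [|u|^(2 alpha - 2)] is integrable in the plane. Testing with [eta^2 psi(Re W)]
    rests on [det D(psi(u), v) = psi'(u) det D(u, v)]. For increments of step [t] this holds up to a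
    remainder, and the increments are controlled in L2 only, so each remainder is dominated before
    [t] tends to 0. The null set of bad centres has to be fixed before the radius and the
    oscillation, since the gradient estimate chooses both in terms of the centre. *)

Notation pl R := (measurableTypeR R * measurableTypeR R)%type.

Section Translation.
Context {R : realType}.

Definition tr (a p : R * R) : R * R := (p.1 + a.1, p.2 + a.2).

Lemma measurable_tr (a : R * R) : measurable_fun setT (tr a : pl R -> pl R).
Proof.
apply/measurable_fun_pair; apply: measurable_funD => //.
Qed.

Lemma measurable_addr_r (a : R) : measurable_fun setT
  (+%R ^~ a : measurableTypeR R -> measurableTypeR R).
Proof. exact: measurable_funD. Qed.

Lemma lebesgue_measure_translation (a : R) (A : set R) : measurable A ->
  pushforward (@lebesgue_measure R)
   (+%R ^~ a : measurableTypeR R -> measurableTypeR R) A = lebesgue_measure A.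
Proof.
pose f : {mfun (measurableTypeR R) >-> (measurableTypeR R)} :=
  HB.pack (+%R ^~ a : measurableTypeR R -> measurableTypeR R)
  (isMeasurableFun.Build _ _ _ _ _ (measurable_addr_r a)).
move=> mA; apply/esym.
apply: (@lebesgue_measure_unique R (pushforward (@lebesgue_measure R) f)) => //= _ [[b c]] _ <-.
rewrite /pushforward/=.
rewrite (_ : _ @^-1` _ = `]b - a, c - a]%classic); last first.
  by apply/seteqP; split=> x /=; rewrite !in_itv/= ltrBlDr lerBrDr.
rewrite !lebesgue_measure_itv/= !lte_fin ltrD2r.
by case: ifP => //; rewrite -!EFinD opprB addrA subrK.
Qed.

Lemma leb2_translation (a : R * R) (X : set (pl R)) : measurable X ->
  leb2 R X = leb2 R (tr a @^-1` X).
Proof.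
pose f : {mfun (pl R) >-> (pl R)} :=
  HB.pack (tr a : pl R -> pl R) (isMeasurableFun.Build _ _ _ _ _ (measurable_tr a)).
move=> mX; rewrite -/(pushforward (leb2 R) f X).
apply: product_measure_unique => // A B mA mB.
transitivity (lebesgue_measure ((+%R ^~ a.1 : R -> measurableTypeR R) @^-1` A) *
  lebesgue_measure ((+%R ^~ a.2 : R -> measurableTypeR R) @^-1` B))%E; last first.
  by congr (_ * _)%E; exact: lebesgue_measure_translation.
apply: product_measure1E.
- by have := measurable_addr_r a.1 measurableT mA; rewrite setTI.
- by have := measurable_addr_r a.2 measurableT mB; rewrite setTI.
Qed.

Lemma ge0_integral_tr (a : R * R) (f : pl R -> \bar R) :
  measurable_fun setT f -> (forall p, 0 <= f p)%E ->
  (\int[leb2 R]_p f (tr a p) = \int[leb2 R]_p f p)%E.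
Proof.
move=> mf f0.
pose t : {mfun (pl R) >-> (pl R)} :=
  HB.pack (tr a : pl R -> pl R) (isMeasurableFun.Build _ _ _ _ _ (measurable_tr a)).
have := @ge0_integral_pushforward _ _ _ _ _ _ (measurable_tr a) (leb2 R) setT f
  measurableT mf (fun y _ => f0 y).
rewrite preimage_setT => <-.
apply: (@eq_measure_integral _ _ _ _ (leb2 R) (pushforward (leb2 R) t)) => A mA _.
exact/esym/(leb2_translation a).
Qed.

Lemma ae_tr (a : R * R) (P : R * R -> Prop) :
  {ae leb2 R, forall p, P p} -> {ae leb2 R, forall p, P (tr a p)}.
Proof.
move=> [N [mN N0 sN]]; exists (tr a @^-1` N); split.
- by have := measurable_tr a measurableT mN; rewrite setTI.
- exact: eq_trans (esym (leb2_translation a mN)) N0.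
- by move=> p /= np; apply: sN.
Qed.

End Translation.

Ltac meas := repeat (first [ match goal with
  | H : ?P |- ?P => exact H
  | |- measurable_fun _ (fun=> ?c) => exact: measurable_cst
  | |- measurable_fun _ (fun p => ?f (tr ?a p)) =>
      match goal with H : measurable_fun setT f |- _ => exact: (measurableT_comp H (measurable_tr a)) end
  | |- measurable_fun _ (fun p => `|@?f p|) =>
      apply: (measurableT_comp (@normr_measurable _ setT) (_ : measurable_fun _ f))
  | |- measurable_fun _ (fun p => _ - _) => apply: measurable_funB
  | |- measurable_fun _ (fun p => _ + _) => apply: measurable_funD
  | |- measurable_fun _ (fun p => _ * _) => apply: measurable_funM
  | |- measurable_fun _ (fun p => - _) => apply: measurable_funN
  | |- measurable_fun _ (fun p => maxr _ _) => apply: measurable_maxr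
  | |- measurable_fun _ (fun p => minr _ _) => apply: measurable_minr
  | |- measurable_fun _ (fun p => _ ^+ _) => apply: measurable_funX
  end | exact: measurable_fst | exact: measurable_snd | exact: measurable_id | assumption ]).

(** * Bounded functions of bounded support and the discrete Jacobian *)

Section Tame.
Context {R : realType}.
Implicit Types (f g v : pl R -> R).

Lemma leb2_box (a b c d : R) : a <= b -> c <= d ->
  leb2 R (`[a, b] `*` `[c, d]) = ((b - a) * (d - c))%:E.
Proof.
move=> ab cd.
transitivity (lebesgue_measure `[a, b]%classic * lebesgue_measure `[c, d]%classic)%E.
  exact: product_measure1E.
rewrite !lebesgue_measure_itv/= !lte_fin.
case: ifPn => ab'; last first.
  have -> : a = b by apply/eqP; rewrite eq_le ab /= leNgt.
  by rewrite subrr mul0r mul0e.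
case: ifPn => cd'; last first.
  have -> : c = d by apply/eqP; rewrite eq_le cd /= leNgt.
  by rewrite subrr mulr0 mule0.
by rewrite -!EFinB -EFinM.
Qed.

Definition box (B : R) : set (pl R) := `[- B, B] `*` `[- B, B].

Lemma measurable_box (B : R) : measurable (box B).
Proof. by apply: measurableX. Qed.

Lemma boxP (B : R) p : box B p <-> `|p.1| <= B /\ `|p.2| <= B.
Proof. by rewrite /box /= !in_itv /= -!ler_norml. Qed.

Lemma leb2_boxE (B : R) : 0 <= B -> leb2 R (box B) = (4 * B ^+ 2)%:E.
Proof.
by move=> B0; rewrite leb2_box; [congr (_%:E); ring | lra | lra].
Qed.

(** A class in which integrals are finite for trivial reasons and which is closed under sums,
    products and translations, so that integrals of functions without sign can be translated
    freely. *)
Definition tame f := measurable_fun setT f /\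
  exists B : R, forall p, `|f p| <= B /\ (f p != 0 -> box B p).

Lemma tame_integrable f : tame f -> (leb2 R).-integrable setT (EFin \o f).
Proof.
move=> [mf [B Bf]].
have B0 : 0 <= B by apply: le_trans (Bf (0, 0)).1.
have mE : measurable_fun setT (EFin \o f) by exact/measurable_EFinP.
apply/integrableP; split => //.
have -> : (\int[leb2 R]_x `|(EFin \o f) x| = \int[leb2 R]_(x in box B) `|(EFin \o f) x|)%E.
  rewrite [RHS]integral_mkcond; apply: eq_integral => p _.
  rewrite patchE; case: ifPn => //; rewrite notin_setE => nb /=.
  by case: (eqVneq (f p) 0) => [->|/(Bf p).2//]; rewrite normr0.
apply: (@le_lt_trans _ _ (\int[leb2 R]_(x in box B) B%:E)%E).
  apply: ge0_le_integral => //.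
  - exact: measurable_box.
  - by apply: measurableT_comp => //; exact: measurable_funTS.
  - by move=> p _; rewrite /= lee_fin (Bf p).1.
rewrite integral_cst; last exact: measurable_box.
by rewrite [X in (_ * X)%E](leb2_boxE B0) -EFinM ltry.
Qed.

Lemma tameD f g : tame f -> tame g -> tame (fun p => f p + g p).
Proof.
move=> [mf [B Bf]] [mg [B' Bg]]; split; first by meas.
exists (B + B') => p; split.
  by rewrite (le_trans (ler_normD _ _))// lerD ?(Bf p).1 ?(Bg p).1.
have B0 : 0 <= B by apply: le_trans (Bf p).1.
have B'0 : 0 <= B' by apply: le_trans (Bg p).1.
have [f0|/(Bf p).2/boxP[h1 h2] _] := eqVneq (f p) 0; last by apply/boxP; lra.
by rewrite f0 add0r => /(Bg p).2/boxP[h1 h2]; apply/boxP; lra.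
Qed.

Lemma tameN f : tame f -> tame (fun p => - f p).
Proof.
move=> [mf [B Bf]]; split; first by meas.
by exists B => p; rewrite normrN oppr_eq0.
Qed.

Lemma tameB f g : tame f -> tame g -> tame (fun p => f p - g p).
Proof. by move=> tf /tameN; exact: tameD. Qed.

Lemma tameM f g : tame f -> tame g -> tame (fun p => f p * g p).
Proof.
move=> [mf [B Bf]] [mg [B' Bg]]; split; first by meas.
exists (maxr (B * B') B) => p; split.
  by rewrite le_max normrM ler_pM ?(Bf p).1 ?(Bg p).1.
rewrite mulf_eq0 negb_or => /andP[/(Bf p).2/boxP[h1 h2] _].
by apply/boxP; rewrite !le_max h1 h2 !orbT.
Qed.

Lemma tame_tr f a : tame f -> tame (fun p => f (tr a p)).
Proof.
move=> [mf [B Bf]]; split; first by meas.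
exists (B + `|a.1| + `|a.2|) => p; split.
  by rewrite -addrA (le_trans (Bf _).1)// lerDl addr_ge0.
move=> /(Bf _).2/boxP[]; rewrite /tr /= => h1 h2.
have k1 := ler_normB (p.1 + a.1) a.1; have k2 := ler_normB (p.2 + a.2) a.2.
have n1 := normr_ge0 a.1; have n2 := normr_ge0 a.2.
rewrite addrK in k1; rewrite addrK in k2.
by apply/boxP; lra.
Qed.

Lemma integral_sub_tr g a : tame g ->
  (\int[leb2 R]_p (g p - g (tr a p))%:E = 0)%E.
Proof.
move=> tg; have ig := tame_integrable tg; have igt := tame_integrable (tame_tr a tg).
have [mg _] := tg; have mt := measurable_tr a.
transitivity (\int[leb2 R]_p ((EFin \o g) p) - \int[leb2 R]_p ((EFin \o g) (tr a p)))%E.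
  by rewrite -integralB.
suff -> : (\int[leb2 R]_p ((EFin \o g) (tr a p)) = \int[leb2 R]_p ((EFin \o g) p))%E.
  by rewrite subee// integrable_fin_num.
have mE : measurable_fun setT (EFin \o g) by exact/measurable_EFinP.
rewrite [LHS]integralE [RHS]integralE; congr (_ - _)%E.
  rewrite -[RHS](ge0_integral_tr a); [|exact: measurable_funepos|by []].
  by apply: eq_integral => p _; rewrite !funeposE.
rewrite -[RHS](ge0_integral_tr a); [|exact: measurable_funeneg|by []].
by apply: eq_integral => p _; rewrite !funenegE.
Qed.

(** Twice the signed area of the image under [(f, v)] of the triangle with vertices [p], [p + t e1],
    [p + t e2]; divided by [t^2] it is a discrete Jacobian. *)
Definition cell (t : R) f v (p : R * R) :=
  (f (tr (t, 0) p) - f p) * (v (tr (0, t) p) - v p) -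
  (f (tr (0, t) p) - f p) * (v (tr (t, 0) p) - v p).

Lemma tame_cell t f v : tame f -> tame v -> tame (cell t f v).
Proof.
by move=> tf tv; apply: tameB; apply: tameM; apply: tameB => //; exact: tame_tr.
Qed.

(* Up to translations, the signed areas of the triangles
   [(p, p + t e1, p + t e2)] and [(p, p - t e1, p - t e2)] cancel edge by edge:
   this is the discrete form of the fact that the Jacobian is a null Lagrangian. *)
Lemma integral_cell t f v : tame f -> tame v ->
  (\int[leb2 R]_p (cell t f v p + cell (- t) f v p)%:E = 0)%E.
Proof.
move=> tf tv.
pose d (g : pl R -> R) a p := g p - g (tr a p).
pose g1 p := f p * v (tr (- t, 0) p).
pose g2 p := f p * v (tr (0, t) p).
pose g3 p := f p * v (tr (0, - t) p).
pose g4 p := f p * v (tr (t, 0) p).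
pose g5 p := f (tr (t, 0) p) * v (tr (0, t) p).
pose g6 p := f (tr (0, t) p) * v (tr (t, 0) p).
have t1 : tame g1 by apply: tameM => //; exact: tame_tr.
have t2 : tame g2 by apply: tameM => //; exact: tame_tr.
have t3 : tame g3 by apply: tameM => //; exact: tame_tr.
have t4 : tame g4 by apply: tameM => //; exact: tame_tr.
have t5 : tame g5 by apply: tameM => //; exact: tame_tr.
have t6 : tame g6 by apply: tameM => //; exact: tame_tr.
have td g a : tame g -> tame (d g a) by move=> tg; apply: tameB => //; exact: tame_tr.
have int0 g a : tame g -> (\int[leb2 R]_p (d g a p)%:E = 0)%E by exact: integral_sub_tr.
have add0 (g h : pl R -> R) : tame g -> tame h -> (\int[leb2 R]_p (g p)%:E = 0 ->
    \int[leb2 R]_p (h p)%:E = 0 -> \int[leb2 R]_p (g p + h p)%:E = 0)%E.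
  move=> tg th g0 h0.
  transitivity (\int[leb2 R]_p (g p)%:E + \int[leb2 R]_p (h p)%:E)%E.
    by rewrite -integralD//; [exact: tame_integrable|exact: tame_integrable].
  by rewrite g0 h0 add0e.
have sub0 (g h : pl R -> R) : tame g -> tame h -> (\int[leb2 R]_p (g p)%:E = 0 ->
    \int[leb2 R]_p (h p)%:E = 0 -> \int[leb2 R]_p (g p - h p)%:E = 0)%E.
  move=> tg th g0 h0.
  transitivity (\int[leb2 R]_p (g p)%:E - \int[leb2 R]_p (h p)%:E)%E.
    by rewrite -integralB//; [exact: tame_integrable|exact: tame_integrable].
  by rewrite g0 h0 sube0.
pose e1 p := d g1 (t, 0) p - d g2 (0, - t) p.
pose e2 p := d g4 (- t, 0) p - d g3 (0, t) p.
pose e3 p := d g5 (- t, - t) p - d g6 (- t, - t) p.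
have te1 : tame e1 by apply: tameB; apply: td.
have te2 : tame e2 by apply: tameB; apply: td.
have te3 : tame e3 by apply: tameB; apply: td.
transitivity (\int[leb2 R]_p (e1 p + e2 p + e3 p)%:E)%E.
  apply: eq_integral => -[x y] _; congr (_%:E).
  rewrite /cell /e1 /e2 /e3 /d /g1 /g2 /g3 /g4 /g5 /g6 /tr /=.
  rewrite !(addr0, subrK, addrK, addNr).
  ring.
apply: (add0 _ _); [exact: tameD|by []| |].
- apply: (add0 _ _) => //.
  + by apply: (sub0 _ _); [exact: td|exact: td|exact: int0|exact: int0].
  + by apply: (sub0 _ _); [exact: td|exact: td|exact: int0|exact: int0].
- by apply: (sub0 _ _); [exact: td|exact: td|exact: int0|exact: int0].
Qed.

(** The form in which a null Lagrangian is used: [D] has no sign, and the integral of [X] is not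
    known to be finite beforehand. An infinite integral of [Y] is a trivial case, and otherwise
    [D + Y] is integrable. *)
Lemma integral_le_of_le_add (X Y D : pl R -> R) :
  measurable_fun setT X -> (forall p, 0 <= X p) ->
  measurable_fun setT Y -> (forall p, 0 <= Y p) ->
  tame D -> (\int[leb2 R]_p (D p)%:E = 0)%E ->
  {ae leb2 R, forall p, X p <= D p + Y p} ->
  (\int[leb2 R]_p (X p)%:E <= \int[leb2 R]_p (Y p)%:E)%E.
Proof.
move=> mX X0 mY Y0 tD D0 le.
have [Yoo|] := eqVneq (\int[leb2 R]_p (Y p)%:E)%E +oo%E; first by rewrite Yoo leey.
rewrite -ltey => Yfin.
have iY : (leb2 R).-integrable setT (EFin \o Y).
  apply/integrableP; split; first exact/measurable_EFinP.
  by under eq_integral do rewrite /= ger0_norm//.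
have iD := tame_integrable tD; have [mD _] := tD.
have -> : (\int[leb2 R]_p (Y p)%:E = \int[leb2 R]_p (D p + Y p)%:E)%E.
  transitivity (\int[leb2 R]_p (D p)%:E + \int[leb2 R]_p (Y p)%:E)%E.
    by rewrite D0 add0e.
  by rewrite -integralD.
have iDY : (leb2 R).-integrable setT (EFin \o (fun p => D p + Y p)).
  by have := integrableD measurableT iD iY; apply: eq_integrable.
(* [D + Y] is nonnegative only almost everywhere, hence the truncation before monotonicity of
   nonnegative integrals is applied. *)
have -> : (\int[leb2 R]_p (D p + Y p)%:E = \int[leb2 R]_p (maxr 0 (D p + Y p))%:E)%E.
  apply: ae_eq_integral => //.
  - by apply/measurable_EFinP; meas.
  - by apply/measurable_EFinP; meas.
  - apply: filterS le => p h _; congr (_%:E).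
    by rewrite max_r// (le_trans (X0 p)).
apply: ae_ge0_le_integral => //.
- by move=> p _; rewrite lee_fin.
- exact/measurable_EFinP.
- by move=> p _; rewrite lee_fin le_max lexx.
- by apply/measurable_EFinP; meas.
- by apply: filterS le => p h _; rewrite lee_fin le_max h orbT.
Qed.

Definition sw (p : R * R) : R * R := (p.2, p.1).

Lemma measurable_sw : measurable_fun setT (sw : pl R -> pl R).
Proof. exact: measurable_swap. Qed.

Lemma leb2_swap (X : set (pl R)) : measurable X ->
  leb2 R X = leb2 R (sw @^-1` X).
Proof.
pose f : {mfun (pl R) >-> (pl R)} :=
  HB.pack (sw : pl R -> pl R) (isMeasurableFun.Build _ _ _ _ _ measurable_sw).
move=> mX; rewrite -/(pushforward (leb2 R) f X).
apply: product_measure_unique => // A B mA mB.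
rewrite muleC; transitivity (leb2 R (B `*` A)); last exact: product_measure1E.
have <- : sw @^-1` (A `*` B) = B `*` A by apply/seteqP; split=> -[x y] [].
by [].
Qed.

Lemma ge0_integral_swap (f : pl R -> \bar R) :
  measurable_fun setT f -> (forall p, 0 <= f p)%E ->
  (\int[leb2 R]_p f (sw p) = \int[leb2 R]_p f p)%E.
Proof.
move=> mf f0.
pose t : {mfun (pl R) >-> (pl R)} :=
  HB.pack (sw : pl R -> pl R) (isMeasurableFun.Build _ _ _ _ _ measurable_sw).
have := @ge0_integral_pushforward _ _ _ _ _ _ measurable_sw (leb2 R) setT f
  measurableT mf (fun y _ => f0 y).
rewrite preimage_setT => <-.
apply: (@eq_measure_integral _ _ _ _ (leb2 R) (pushforward (leb2 R) t)) => A mA _.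
exact/esym/leb2_swap.
Qed.

End Tame.

Lemma ae_mono d (T : measurableType d) (R : realType) (m : {measure set T -> \bar R})
    (P Q : T -> Prop) : {ae m, forall x, P x} -> (forall x, P x -> Q x) ->
  {ae m, forall x, Q x}.
Proof. by move=> aeP PQ; apply: filterS aeP. Qed.

Lemma ae_mono2 d (T : measurableType d) (R : realType) (m : {measure set T -> \bar R})
    (P1 P2 Q : T -> Prop) : {ae m, forall x, P1 x} -> {ae m, forall x, P2 x} ->
  (forall x, P1 x -> P2 x -> Q x) -> {ae m, forall x, Q x}.
Proof. by move=> ae1 ae2 PQ; apply: filterS2 ae1 ae2. Qed.

(** Convergence holds only almost everywhere, so [g] is compared with the pointwise lower limit,
    whose measurability is obtained by writing it as minus an upper limit. *)
Lemma fatou_ae d (T : measurableType d) (R : realType)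
    (m : {measure set T -> \bar R}) (u : nat -> T -> R) (g : T -> R) :
  (forall n, measurable_fun setT (u n)) -> (forall n x, 0 <= u n x) ->
  measurable_fun setT g -> (forall x, 0 <= g x) ->
  {ae m, forall x, u n x @[n --> \oo] --> g x} ->
  (\int[m]_x (g x)%:E <= limn_einf (fun n => \int[m]_x (u n x)%:E))%E.
Proof.
move=> mu u0 mg g0 ug.
have mE n : measurable_fun setT (EFin \o u n) by exact/measurable_EFinP.
have E0 n x : setT x -> (0 <= (EFin \o u n) x)%E by move=> _; rewrite lee_fin.
apply: le_trans (fatou m measurableT mE E0).
apply: ae_ge0_le_integral => //.
- by move=> x _; rewrite lee_fin.
- exact/measurable_EFinP.
- move=> x _; rewrite limn_einf_lim; apply: lime_ge; first exact: is_cvg_einfs.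
  by apply: nearW => n; apply: le_ereal_inf_tmp => _ [k /= _ <-]; rewrite lee_fin.
- rewrite (_ : (fun x => _) = (fun x => - limn_esup (fun n => - (EFin \o u n) x))%E).
    apply: measurableT_comp => //.
    by apply: (@measurable_fun_limn_esup _ _ _ _ (fun n x => - (EFin \o u n) x)%E) => n; exact: measurableT_comp.
  apply/funext => x; rewrite -(limn_einfN (fun n => - (EFin \o u n) x)%E).
  by congr limn_einf; apply/funext => n; apply/esym/oppeK.
- apply: (ae_mono ug) => x cx _.
  have cu : (EFin \o u n) x @[n --> \oo] --> (g x)%:E.
    by apply: cvg_EFin => //; apply: nearW.
  by rewrite (cvg_limn_einf_sup cu).1.
Qed.

Lemma limn_einf_le_near (R : realType) (u : nat -> \bar R) c :
  (\forall n \near \oo, u n <= c)%E -> (limn_einf u <= c)%E.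
Proof.
move=> [N _ uN]; rewrite limn_einf_lim; apply: lime_le; first exact: is_cvg_einfs.
apply: nearW => n; apply: (@le_trans _ _ (u (maxn n N))).
  by apply: ereal_inf_lbound; exists (maxn n N) => //=; exact: leq_maxl.
by apply: uN => /=; exact: leq_maxr.
Qed.

(** * Averages over segments and Sobolev's inequality *)

Section Average.
Context {R : realType}.
Implicit Types (f g : pl R -> R) (t : R).
Local Notation mu := (@lebesgue_measure R).

(** The minimum and maximum allow both signs of [t]: the null Lagrangian identity pairs the step [t]
    with [-t], and so does the adjoint of averaging. *)
Definition seg t (x : R) : set R := `[minr x (x + t), maxr x (x + t)].

Lemma segP t x a : seg t x a <-> minr x (x + t) <= a /\ a <= maxr x (x + t).
Proof. by rewrite /seg /= in_itv /=; split=> [/andP[]|[-> ->]]. Qed.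

Lemma measurable_seg t x : measurable (seg t x).
Proof. exact: measurable_itv. Qed.

Lemma seg_sym t x a : seg t x a <-> seg (- t) a x.
Proof. by rewrite !segP !minEle !maxEle; do ! case: ifP; lra. Qed.

Lemma seg_dist t x a : seg t x a -> `|x - a| <= `|t|.
Proof.
rewrite segP !minEle !maxEle ler_norml => -[].
by case: (leP 0 t) => t0; [rewrite ger0_norm //|rewrite ltr0_norm //];
  do ! case: ifP; lra.
Qed.

Lemma lebesgue_seg t x : mu (seg t x) = `|t|%:E.
Proof.
rewrite /seg lebesgue_measure_itv /= lte_fin.
case: (ltgtP t 0) => [t0|t0|->].
- rewrite min_r ?max_l; [|lra..]; rewrite ltr0_norm// ifT; last lra.
  by rewrite -EFinB; congr (_%:E); ring.
- rewrite min_l ?max_r; [|lra..]; rewrite gtr0_norm// ifT; last lra.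
  by rewrite -EFinB; congr (_%:E); ring.
- by rewrite addr0 minxx maxxx ltxx normr0.
Qed.

(** The indicator of [seg], written as inequalities in both variables so that the joint
    measurability required by Fubini's theorem is visible. *)
Definition isegx t (p : R * R) (a : R) : R :=
  if (minr p.1 (p.1 + t) <= a) && (a <= maxr p.1 (p.1 + t)) then 1 else 0.

Lemma isegxE t p a : isegx t p a = \1_(seg t p.1) a.
Proof. by rewrite /isegx indicE /seg mem_setE in_itv /=; case: ifP. Qed.

Lemma isegx_ge0 t p a : 0 <= isegx t p a.
Proof. by rewrite /isegx; case: ifP. Qed.

Definition Sx t f (p : R * R) : \bar R :=
  (\int[mu]_(a in seg t p.1) (f (a, p.2))%:E)%E.

Lemma SxE t f p : Sx t f p = (\int[mu]_a (f (a, p.2) * isegx t p a)%:E)%E.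
Proof.
rewrite /Sx integral_mkcond; apply: eq_integral => a _.
by rewrite patchE isegxE indicE; case: ifP; rewrite ?mulr1 ?mulr0.
Qed.

Lemma measurable_isegx t d (T : measurableType d) (P : T -> pl R) (a : T -> measurableTypeR R) :
  measurable_fun setT P -> measurable_fun setT a ->
  measurable_fun setT (fun x => isegx t (P x) (a x)).
Proof.
move=> mP ma.
have m1 : measurable_fun setT (fun x => (P x).1).
  exact: (measurableT_comp measurable_fst mP).
apply: measurable_fun_ifT => //; apply: measurable_and; apply: measurable_fun_ler => //; meas.
Qed.

Lemma measurable_section1 f (y : R) : measurable_fun setT f ->
  measurable_fun setT (fun a : measurableTypeR R => f (a, y)).
Proof. by move=> mf; exact: measurable_fun_pair1. Qed.

Lemma measurable_Sx t f : measurable_fun setT f -> (forall p, 0 <= f p) ->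
  measurable_fun setT (Sx t f : pl R -> \bar R).
Proof.
move=> mf f0; rewrite (_ : Sx t f = fun p => (\int[mu]_a (f (a, p.2) * isegx t p a)%:E)%E); last first.
  by apply/funext => p; exact: SxE.
pose F (z : pl R * measurableTypeR R) := (f (z.2, z.1.2) * isegx t z.1 z.2)%:E.
have mF : measurable_fun setT F.
  apply/measurable_EFinP; apply: measurable_funM; last first.
    by apply: measurable_isegx; [exact: measurable_fst|exact: measurable_snd].
  apply: (measurableT_comp mf); apply/measurable_fun_pair.
    exact: measurable_snd.
  exact: (measurableT_comp measurable_snd measurable_fst).
have F0 z : (0 <= F z)%E by rewrite lee_fin mulr_ge0 // isegx_ge0.
exact: (@measurable_fun_fubini_tonelli_F _ _ _ _ R mu F mF F0).
Qed.

Lemma Sx_ge0 t f p : (forall p, 0 <= f p) -> (0 <= Sx t f p)%E.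
Proof. by move=> f0; apply: integral_ge0 => a _; rewrite lee_fin. Qed.

(** Fubini's theorem: by [seg_sym] the starting points of the segments that contain a given [a] form
    a segment of length [|t|]. *)
Lemma integral_Sx t f : measurable_fun setT f -> (forall p, 0 <= f p) ->
  (\int[leb2 R]_p Sx t f p = `|t|%:E * \int[leb2 R]_p (f p)%:E)%E.
Proof.
move=> mf f0.
have mS := measurable_Sx t mf f0.
have mE : measurable_fun setT (EFin \o f) by exact/measurable_EFinP.
have E0 p : (0 <= (EFin \o f) p)%E by rewrite lee_fin.
rewrite [LHS](@fubini_tonelli2 _ _ _ _ R mu mu (Sx t f) mS (fun p => Sx_ge0 t p f0)).
rewrite [in RHS](@fubini_tonelli2 _ _ _ _ R mu mu (EFin \o f) mE E0).
rewrite -ge0_integralZl//; last 2 first.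
  exact: (@measurable_fun_fubini_tonelli_G _ _ _ _ R mu (EFin \o f) mE E0).
  by move=> y _; apply: integral_ge0.
apply: eq_integral => y _; rewrite /fubini_G.
under eq_integral do rewrite SxE /=.
pose F (z : pl R) := (f (z.2, y) * isegx t (z.1, y) z.2)%:E.
have mF : measurable_fun setT F.
  apply/measurable_EFinP; apply: measurable_funM; last first.
    apply: measurable_isegx; last exact: measurable_snd.
    by apply/measurable_fun_pair => //; exact: measurable_fst.
  by apply: (measurableT_comp mf); apply/measurable_fun_pair => //; exact: measurable_snd.
have F0 z : (0 <= F z)%E by rewrite lee_fin mulr_ge0 // isegx_ge0.
have := @fubini_tonelli _ _ _ _ R mu mu F mF F0; rewrite /F /= => ->.
rewrite -ge0_integralZl//; last 2 first.
  by apply/measurable_EFinP; exact: measurable_section1.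
  by move=> a _; rewrite lee_fin.
apply: eq_integral => a _.
transitivity (\int[mu]_(x in seg (- t) a) (f (a, y))%:E)%E.
  rewrite [RHS]integral_mkcond; apply: eq_integral => x _.
  rewrite patchE isegxE indicE.
  have [h|h] := pselect (seg (- t) a x).
    have h' : seg t x a by apply/seg_sym.
    by rewrite !mem_set ?mulr1.
  have h' : ~ seg t x a by move=> /seg_sym.
  by rewrite !memNset ?mulr0.
rewrite integral_cst; last exact: measurable_seg.
by rewrite [X in (_ * X)%E]lebesgue_seg normrN muleC.
Qed.

(** An infinite integral yields the value 0 through [fine]; for a square integrable [f] this
    concerns a null set only. *)
Definition avg t f (p : R * R) : R := fine (Sx t f p) / `|t|.

Lemma measurable_avg t f : measurable_fun setT f -> (forall p, 0 <= f p) ->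
  measurable_fun setT (avg t f : pl R -> R).
Proof.
move=> mf f0; apply: measurable_funM => //.
apply: (measurableT_comp _ (measurable_Sx t mf f0)).
exact: fine_measurable.
Qed.

Lemma avg_ge0 t f p : (forall p, 0 <= f p) -> 0 <= avg t f p.
Proof. by move=> f0; rewrite /avg divr_ge0// fine_ge0// Sx_ge0. Qed.

(** Jensen's inequality, obtained by integrating [2 m f <= f^2 + m^2] over the segment with [m] the
    mean of [f]. If the segment integral is infinite, the left side is 0. *)
Lemma avg_sqr t f p : measurable_fun setT f -> (forall p, 0 <= f p) -> t != 0 ->
  ((avg t f p ^+ 2)%:E <= (`|t|^-1)%:E * Sx t (fun q => (f q ^+ 2)%R) p)%E.
Proof.
move=> mf f0 t0.
have nt0 : 0 < `|t| by rewrite normr_gt0.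
have S0 : (0 <= Sx t f p)%E by exact: Sx_ge0.
have [Sfin|] := boolP (Sx t f p \is a fin_num); last first.
  rewrite fin_numE negb_and !negbK => /orP[/eqP S|/eqP S]; first by rewrite S in S0.
  rewrite /avg S /= mul0r expr0n /=; apply: mule_ge0.
    by rewrite lee_fin invr_ge0 ltW.
  by apply: Sx_ge0 => q; rewrite sqr_ge0.
have m0 := avg_ge0 t p f0; set m := avg t f p in m0 *.
have Sm : Sx t f p = (m * `|t|)%:E by rewrite /m /avg divfK ?gt_eqF// fineK.
rewrite lee_pdivlMl//.
have ms := measurable_section1 p.2 mf.
have : (\int[mu]_(a in seg t p.1) (2 * m * f (a, p.2))%:E <=
   \int[mu]_(a in seg t p.1) (f (a, p.2) ^+ 2 + m ^+ 2)%:E)%E.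
  apply: ge0_le_integral => //.
  - exact: measurable_seg.
  - by move=> a _; rewrite lee_fin; apply: mulr_ge0 => //; apply: mulr_ge0.
  - by apply/measurable_EFinP; apply: measurable_funTS; meas.
  - by apply/measurable_EFinP; apply: measurable_funTS; meas.
  - move=> a _; rewrite lee_fin -subr_ge0.
    by have := sqr_ge0 (f (a, p.2) - m); rewrite !expr2; lra.
under eq_integral do rewrite EFinM.
rewrite ge0_integralZl//; last 4 first.
- exact: measurable_seg.
- by apply/measurable_EFinP; apply: measurable_funTS.
- by move=> a _; rewrite lee_fin.
- by rewrite lee_fin; apply: mulr_ge0.
rewrite -/(Sx t f p) Sm.
under [X in (_ <= X)%E]eq_integral do rewrite EFinD.
rewrite ge0_integralD//; last 4 first.
- exact: measurable_seg.
- by move=> a _; rewrite lee_fin sqr_ge0.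
- by apply/measurable_EFinP; apply: measurable_funTS; meas.
- by move=> a _; rewrite lee_fin sqr_ge0.
rewrite integral_cst; last exact: measurable_seg.
rewrite [X in (_ + _ * X)%E]lebesgue_seg -!EFinM -leeBlDr// -EFinB.
by apply: le_trans; rewrite lee_fin expr2; lra.
Qed.

Lemma integral_avg_sqr t f : measurable_fun setT f -> (forall p, 0 <= f p) -> t != 0 ->
  (\int[leb2 R]_p (avg t f p ^+ 2)%:E <= \int[leb2 R]_p (f p ^+ 2)%:E)%E.
Proof.
move=> mf f0 t0.
have nt0 : 0 < `|t| by rewrite normr_gt0.
have mf2 : measurable_fun setT (fun p => f p ^+ 2) by meas.
have f20 p : 0 <= f p ^+ 2 by rewrite sqr_ge0.
apply: (@le_trans _ _ (\int[leb2 R]_p ((`|t|^-1)%:E * Sx t (fun q => f q ^+ 2)%R p))%E).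
  apply: ge0_le_integral => //.
  - by move=> p _; rewrite lee_fin sqr_ge0.
  - by apply/measurable_EFinP; apply: measurable_funX; exact: measurable_avg.
  - by apply: measurable_funeM; exact: measurable_Sx.
  - by move=> p _; exact: avg_sqr.
rewrite ge0_integralZl//; last 2 first.
- exact: measurable_Sx.
- by move=> p _; exact: Sx_ge0.
by rewrite integral_Sx// muleA -EFinM mulVf ?mul1e// gt_eqF.
Qed.


Lemma ae_fubini2 (N : set (pl R)) : measurable N ->
  {ae mu, forall y : R, {ae mu, forall x : R, ~ N (x, y)}} -> leb2 R N = 0%E.
Proof.
move=> mN aeN.
have mI : measurable_fun setT (EFin \o (\1_N : pl R -> R)).
  exact/measurable_EFinP.
have I0 p : (0 <= (EFin \o (\1_N : pl R -> R)) p)%E by rewrite lee_fin.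
have := @fubini_tonelli2 _ _ _ _ R mu mu _ mI I0.
rewrite integral_indic// setIT => ->.
have mG := @measurable_fun_fubini_tonelli_G _ _ _ _ R mu _ mI I0.
rewrite -[RHS](@integral0 _ _ _ mu setT).
apply: ae_eq_integral => //.
apply: (ae_mono aeN) => y Ny _ /=.
rewrite /fubini_G /=.
rewrite -[RHS](@integral0 _ _ _ mu setT).
apply: ae_eq_integral => //.
  by apply/measurable_EFinP; exact: (@measurable_fun_pair1 _ _ _ _ _ _ (\1_N : pl R -> R)).
by apply: (ae_mono Ny) => x Nx _ /=; rewrite indicE memNset.
Qed.

(** Segments with end point [x] shrink nicely to [x], so Lebesgue's differentiation theorem applies
    to them; local integrability follows from [g <= 1 + g^2]. *)
Lemma seg_avg_cvg (g : R -> R) (t_ : nat -> R) : measurable_fun setT g ->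
  (forall x, 0 <= g x) -> (\int[mu]_x (g x ^+ 2)%:E < +oo)%E ->
  (forall n, t_ n != 0) -> t_ @ \oo --> 0 ->
  {ae mu, forall x, fine (\int[mu]_(a in seg (t_ n) x) (g a)%:E) / `|t_ n|
     @[n --> \oo] --> g x}.
Proof.
move=> mg g0 g2 tn0 t0.
have loc : locally_integrable setT g.
  split => //; first exact: openT.
  move=> K _ cK.
  have mK := compact_measurable cK.
  have Kfin : (mu K < +oo)%E by exact: compact_finite_measure.
  apply: (@le_lt_trans _ _ (\int[mu]_(x in K) (1 + g x ^+ 2)%:E)%E).
    apply: ge0_le_integral => //.
    - by apply/measurable_EFinP; apply: measurable_funTS; meas.
    - by apply/measurable_EFinP; apply: measurable_funTS; meas.
    - move=> x _; rewrite lee_fin ger0_norm//.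
      by have := sqr_ge0 (g x - 1); have := sqr_ge0 (g x); rewrite !expr2; lra.
  under eq_integral do rewrite EFinD.
  rewrite ge0_integralD//; last 2 first.
    by move=> x _; rewrite lee_fin sqr_ge0.
    by apply/measurable_EFinP; apply: measurable_funTS; meas.
  rewrite integral_cst// mul1e lte_add_pinfty//.
  apply: le_lt_trans g2; apply: ge0_subset_integral => //.
    by apply/measurable_EFinP; meas.
  by move=> x _; rewrite lee_fin sqr_ge0.
pose E (x : R) n := seg (t_ n) x.
have hE x : nicely_shrinking x (E x).
  split=> [n|]; first exact: measurable_seg.
  have tp n : 0 < 2 * `|t_ n| by rewrite mulr_gt0// normr_gt0.
  (* The open ball of radius [2 |t|] contains the segment of length [|t|], and its measure [4 |t|]
     is 4 times that of the segment. *)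
  exists (4, fun n => PosNum (tp n)); split => //=.
  - rewrite -(mulr0 2); apply: cvgM; first exact: cvg_cst.
    by rewrite -(normr0 R); apply: cvg_norm.
  - move=> n a /seg_dist h; rewrite /ball /=.
    by apply: le_lt_trans h _; have := tp n; lra.
  - move=> n; have -> : mu (E x n) = `|t_ n|%:E by exact: lebesgue_seg.
    apply: (@le_trans _ _ ((2 * `|t_ n|) *+ 2)%:E).
      by rewrite lebesgue_measure_ball//; exact: ltW.
    have -> : (4 * `|t_ n|%:E = (4 * `|t_ n|)%:E)%E by [].
    by rewrite lee_fin -mulr_natl; lra.
apply: (ae_mono (lebesgue_differentiation loc)) => x lx.
have := nice_lebesgue_differentiation hE loc lx.
move/fine_cvg; apply: cvg_trans; apply: near_eq_cvg; near=> n => /=.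
rewrite /E [X in inve X]lebesgue_seg inver normr_eq0 (negbTE (tn0 n)) mulrC.
set I := (\int[_]_(_ in _) _)%E.
have Ifin : I \is a fin_num.
  rewrite ge0_fin_numE; last by apply: integral_ge0 => a _; rewrite lee_fin.
  have [_ _ /(_ (seg (t_ n) x)) ]:= loc; rewrite /seg => h.
  have := h (@subsetT _ _) (@segment_compact _ _ _); apply: le_lt_trans.
  rewrite le_eqVlt; apply/orP; left; apply/eqP; apply: eq_integral => a _.
  by rewrite ger0_norm.
by rewrite -(fineK Ifin) -EFinM.
Unshelve. all: by end_near. Qed.

(** Differentiation on almost every horizontal line. The exceptional set is described by the upper
    limit [L] of the deviations, which makes it measurable, so that null sections imply a null
    set. *)
Lemma avg_cvg f (t_ : nat -> R) : measurable_fun setT f -> (forall p, 0 <= f p) ->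
  (\int[leb2 R]_p (f p ^+ 2)%:E < +oo)%E -> (forall n, t_ n != 0) -> t_ @ \oo --> 0 ->
  {ae leb2 R, forall p, avg (t_ n) f p @[n --> \oo] --> f p}.
Proof.
move=> mf f0 f2 tn0 t0.
pose L (p : pl R) := limn_esup (fun n => `|avg (t_ n) f p - f p|%:E).
have mL : measurable_fun setT L.
  apply: (@measurable_fun_limn_esup _ _ _ _ (fun n (p : pl R) => `|avg (t_ n) f p - f p|%:E)).
  move=> n; apply/measurable_EFinP.
  have ma := measurable_avg (t_ n) mf f0.
  by apply: (measurableT_comp (@normr_measurable _ setT)); meas.
have Lcvg p : avg (t_ n) f p @[n --> \oo] --> f p -> L p = 0%E.
  move=> c; have c' : `|avg (t_ n) f p - f p|%:E @[n --> \oo] --> 0%E.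
    apply: cvg_EFin; first by near=> n.
    rewrite /comp /= -(normr0 R) -(subrr (f p)).
    by apply: cvg_norm; apply: cvgB => //; exact: cvg_cst.
  by rewrite /L (is_cvg_limn_esupE (cvgP _ c')) (cvg_lim _ c').
pose N := L @^-1` (~` [set 0%E]).
have mN : measurable N.
  by have := mL measurableT (~` [set 0%E]); rewrite setTI; apply; exact: measurableC.
have N0 : leb2 R N = 0%E.
  apply: ae_fubini2 => //.
  have mf2 : measurable_fun setT (fun p => (f p ^+ 2)%:E) by apply/measurable_EFinP; meas.
  have f20 p : (0 <= (f p ^+ 2)%:E)%E by rewrite lee_fin sqr_ge0.
  have ae1 : {ae mu, forall y : R, (\int[mu]_x (f (x, y) ^+ 2)%:E < +oo)%E}.
    have iG : mu.-integrable setT (fubini_G mu (fun p => (f p ^+ 2)%:E)).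
      apply/integrableP; split; first exact: (@measurable_fun_fubini_tonelli_G _ _ _ _ R mu _ mf2 f20).
      have := f2; rewrite (@fubini_tonelli2 _ _ _ _ R mu mu _ mf2 f20).
      apply: le_lt_trans; rewrite le_eqVlt; apply/orP; left; apply/eqP.
      by apply: eq_integral => y _; rewrite gee0_abs// integral_ge0.
    apply: (ae_mono (integrable_ae measurableT iG)) => y /(_ I).
    by rewrite ge0_fin_numE ?integral_ge0.
  apply: (ae_mono ae1) => y yfin.
  have := @seg_avg_cvg (fun x => f (x, y)) t_ (measurable_section1 y mf) (fun x => f0 (x, y)) yfin tn0 t0.
  move=> h; apply: (ae_mono h) => x cx; apply: contrapT => /contrapT; rewrite /N /=; apply; exact: Lcvg.
exists N; split => // p /= np Lp; apply: np.
have Lp' : (limn_esup (fun n => `|avg (t_ n) f p - f p|%:E) <= 0)%E by rewrite -/(L p) Lp.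
have := limn_esup_le_cvg Lp' (fun n => _).
move=> /(_ (fun n => ltac:(rewrite lee_fin; exact: normr_ge0))) /fine_cvg /= c.
by apply/subr_cvg0; apply: norm_cvg0.
Unshelve. all: by end_near. Qed.

(** Convergence almost everywhere together with the contraction [integral_avg_sqr] forces
    convergence in L2: Fatou's lemma is applied to [u n], which equals [(avg f + f)^2] and tends to
    [4 f^2]. *)
Lemma L2_avg_cvg f (t_ : nat -> R) : measurable_fun setT f -> (forall p, 0 <= f p) ->
  (\int[leb2 R]_p (f p ^+ 2)%:E < +oo)%E -> (forall n, t_ n != 0) -> t_ @ \oo --> 0 ->
  (\int[leb2 R]_p ((avg (t_ n) f p - f p) ^+ 2)%:E @[n --> \oo] --> 0)%E.
Proof.
move=> mf f0 f2 tn0 t0.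
have ma n := measurable_avg (t_ n) mf f0.
pose c := (\int[leb2 R]_p (f p ^+ 2)%:E)%E.
pose e n := (\int[leb2 R]_p ((avg (t_ n) f p - f p) ^+ 2)%:E)%E.
pose u n (p : pl R) := 2 * avg (t_ n) f p ^+ 2 + 2 * f p ^+ 2 - (avg (t_ n) f p - f p) ^+ 2.
have u0 n p : 0 <= u n p.
  by rewrite /u; have := sqr_ge0 (avg (t_ n) f p + f p); rewrite !expr2; lra.
have e0 n : (0 <= e n)%E by apply: integral_ge0 => p _; rewrite lee_fin sqr_ge0.
have c0 : (0 <= c)%E by apply: integral_ge0 => p _; rewrite lee_fin sqr_ge0.
have mu_ n : measurable_fun setT (EFin \o u n : pl R -> _) by have man := ma n; apply/measurable_EFinP; rewrite /u; meas.
have ue n : (\int[leb2 R]_p (u n p)%:E + e n <= 4%:E * c)%E.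
  have man := ma n.
  rewrite -ge0_integralD//; last 4 first.
    by move=> p _; rewrite lee_fin.
    by exact: mu_.
    by move=> p _; rewrite lee_fin sqr_ge0.
    by apply/measurable_EFinP; meas.
  rewrite (_ : 4%:E * c = 2%:E * c + 2%:E * c)%E; last first.
    by rewrite -ge0_muleDl//; congr (_ * _)%E; rewrite -EFinD; congr (_%:E); ring.
  apply: (@le_trans _ _ (2%:E * (\int[leb2 R]_p (avg (t_ n) f p ^+ 2)%:E) + 2%:E * c)%E); last first.
    by apply: leeD => //; rewrite lee_pmul2l//; exact: integral_avg_sqr.
  rewrite -!ge0_integralZl//; last 4 first.
    by apply/measurable_EFinP; meas.
    by move=> p _; rewrite lee_fin sqr_ge0.
    by apply/measurable_EFinP; meas.
    by move=> p _; rewrite lee_fin sqr_ge0.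
  rewrite -ge0_integralD//; last 4 first.
    by move=> p _; rewrite mule_ge0// lee_fin sqr_ge0.
    by apply/measurable_EFinP; meas.
    by move=> p _; rewrite mule_ge0// lee_fin sqr_ge0.
    by apply/measurable_EFinP; meas.
  rewrite le_eqVlt; apply/orP; left; apply/eqP; apply: eq_integral => p _.
  by rewrite -!EFinM -!EFinD /u; congr (_%:E); rewrite addrNK.
have cfin : c \is a fin_num by rewrite ge0_fin_numE.
have efin n : e n \is a fin_num.
  rewrite ge0_fin_numE//; apply: le_lt_trans (_ : _ <= 4%:E * c)%E _.
    by apply: le_trans (ue n); rewrite leeDr// integral_ge0// => p _; rewrite lee_fin.
  by rewrite lte_mul_pinfty.
have fat : (4%:E * c <= limn_einf (fun n => \int[leb2 R]_p (u n p)%:E))%E.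
  have mg : measurable_fun setT (fun p => 4 * f p ^+ 2) by meas.
  have g0 p : 0 <= 4 * f p ^+ 2 by rewrite mulr_ge0 ?sqr_ge0.
  have mu1 n : measurable_fun setT (u n) by apply/measurable_EFinP.
  rewrite -ge0_integralZl//; last 2 first.
    by apply/measurable_EFinP; meas.
    by move=> p _; rewrite lee_fin sqr_ge0.
  apply: (@fatou_ae _ _ _ (leb2 R) u (fun p => 4 * f p ^+ 2) mu1 u0 mg g0).
  apply: (ae_mono (avg_cvg mf f0 f2 tn0 t0)) => p cp.
  rewrite (_ : 4 * f p ^+ 2 = 2 * f p ^+ 2 + 2 * f p ^+ 2 - (f p - f p) ^+ 2); last by ring.
  apply: cvgB; first apply: cvgD.
  - by apply: cvgM; [exact: cvg_cst|exact: cvgM].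
  - exact: cvg_cst.
  - by apply: cvgM; apply: cvgB => //; exact: cvg_cst.
have fat2 : (4%:E * c <= limn_einf (fun n => 4%:E * c + (- e n)))%E.
  apply: le_trans fat _; rewrite !limn_einf_lim.
  apply: lee_lim; [exact: is_cvg_einfs|exact: is_cvg_einfs|].
  apply: nearW => n; rewrite /einfs; apply: le_ereal_inf_tmp => _ [k /= nk <-].
  apply: le_trans (_ : (\int[leb2 R]_p (u k p)%:E <= _)%E).
    by apply: ereal_inf_lbound; exists k.
  by rewrite leeBrDr.
rewrite limn_einf_shift in fat2; last by rewrite fin_numM.
have : (limn_esup e <= 0)%E.
  move: fat2; rewrite (limn_einfN e) -(fineK cfin) -EFinM.
  case: (limn_esup e) => [r| |] //=.
  by rewrite -EFinD !lee_fin; lra.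
by move/limn_esup_le_cvg; exact.
Unshelve. all: by end_near. Qed.

End Average.

(** * Sobolev's inequality from the decreases of a function *)

Section Sobolev.
Context {R : realType}.
Implicit Types (f g : pl R -> R) (t : R).
Local Notation mu := (@lebesgue_measure R).

Lemma ae_sw (P : R * R -> Prop) :
  {ae leb2 R, forall p, P p} -> {ae leb2 R, forall p, P (sw p)}.
Proof.
move=> [N [mN N0 sN]]; exists (sw @^-1` N); split.
- by have := measurable_sw measurableT mN; rewrite setTI.
- exact: eq_trans (esym (leb2_swap mN)) N0.
- by move=> p /= np; apply: sN.
Qed.

Lemma measurable_comp_sw f : measurable_fun setT f ->
  measurable_fun setT (fun p => f (sw p)).
Proof. by move=> mf; exact: (measurableT_comp mf measurable_sw). Qed.

Lemma ge0_integral_translation1 (t : R) (D : set R) (g : R -> \bar R) :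
  measurable D -> measurable_fun setT g -> (forall x, 0 <= g x)%E ->
  (\int[mu]_(x in (fun x : R => (x + t)%R) @^-1` D) g (x + t)%R = \int[mu]_(x in D) g x)%E.
Proof.
move=> mD mg g0.
pose T : {mfun (measurableTypeR R) >-> (measurableTypeR R)} :=
  HB.pack (+%R ^~ t : measurableTypeR R -> measurableTypeR R)
  (isMeasurableFun.Build _ _ _ _ _ (measurable_addr_r t)).
have <- := @ge0_integral_pushforward _ _ _ _ _ _ (measurable_addr_r t) mu D g
  mD (measurable_funTS mg) (fun y _ => g0 y).
apply: (@eq_measure_integral _ _ _ _ mu (pushforward mu T)) => A mA _.
exact: lebesgue_measure_translation.
Qed.

(** Only decreases are kept: on a line they already control a function that vanishes far away, and
    for a truncated function a decrease starts at a point of the superlevel set, where the energy is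
    available. *)
Definition dec t f (p : R * R) : R := maxr 0 (f p - f (tr (t, 0) p)).
Definition decy t f (p : R * R) : R := maxr 0 (f p - f (tr (0, t) p)).

Lemma measurable_dec t f : measurable_fun setT f -> measurable_fun setT (dec t f : pl R -> R).
Proof. by move=> mf; rewrite /dec; meas. Qed.

Lemma measurable_decy t f : measurable_fun setT f -> measurable_fun setT (decy t f : pl R -> R).
Proof. by move=> mf; rewrite /decy; meas. Qed.

Lemma dec_ge0 t f p : 0 <= dec t f p. Proof. by rewrite /dec le_max lexx. Qed.
Lemma decy_ge0 t f p : 0 <= decy t f p. Proof. by rewrite /decy le_max lexx. Qed.

Lemma tame_section_fin f (y : R) : tame f -> (forall p, 0 <= f p) ->
  (\int[mu]_a (f (a, y))%:E < +oo)%E.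
Proof.
move=> [mf [B Bf]] f0.
have B0 : 0 <= B by apply: le_trans (Bf (0, 0)).1.
apply: (@le_lt_trans _ _ (\int[mu]_(a in `[(- B)%R, B]%classic) B%:E)%E).
  rewrite [leRHS]integral_mkcond; apply: ge0_le_integral => //.
  - by move=> a _; rewrite lee_fin.
  - by apply/measurable_EFinP; exact: measurable_section1.
  - by apply/(measurable_restrictT _ _).1.
  - move=> a _; rewrite patchE; case: ifPn => [_|].
      by rewrite lee_fin -(ger0_norm (f0 _)) (Bf _).1.
    rewrite notin_setE /= in_itv /= => na; rewrite lee_fin.
    have [->//|/(Bf _).2/boxP[/= + _]] := eqVneq (f (a, y)) 0.
    by rewrite ler_norml => /na.
rewrite integral_cst//; have := lebesgue_measure_itv `[- B, B].
rewrite /= lte_fin => e; rewrite [X in (_ * X)%E]e.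
by case: ifP => _; rewrite ?mule0 ?ltry// -EFinB -EFinM ltry.
Qed.

(** Integrating [f a - f (a + t)] over the half-line from [x] leaves the integral over [[x, x + t]]:
    the discrete form of bounding [f x] by the integral of the negative part of its derivative. *)
Lemma Sx_le_dec t f p : tame f -> (forall p, 0 <= f p) -> 0 < t ->
  (Sx t f p <= \int[mu]_a (dec t f (a, p.2))%:E)%E.
Proof.
move=> tf f0 t0; have [mf _] := tf; case: p => x y /=.
pose g (a : R) := (f (a, y))%:E.
have mg : measurable_fun setT g by apply/measurable_EFinP; exact: measurable_section1.
have g0 a : (0 <= g a)%E by rewrite lee_fin.
have md : measurable_fun setT (fun a : R => (dec t f (a, y))%:E).
  by apply/measurable_EFinP; apply: measurable_section1; exact: measurable_dec.
have d0 a : (0 <= (dec t f (a, y))%:E)%E by rewrite lee_fin dec_ge0.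
have segE : seg t x = `[x, x + t]%classic.
  by rewrite /seg min_l ?max_r//; lra.
pose X := (\int[mu]_(a in `[(x + t)%R, +oo[%classic) g a)%E.
have X0 : (0 <= X)%E by exact: integral_ge0.
have Xfin : X \is a fin_num.
  rewrite ge0_fin_numE//; apply: le_lt_trans (tame_section_fin y tf f0).
  by apply: ge0_subset_integral => //.
have mgt : measurable_fun setT (fun a : R => g (a + t)).
  exact: (measurableT_comp mg (measurable_addr_r t)).
have XE : X = (\int[mu]_(a in `[x, +oo[%classic) g (a + t)%R)%E.
  rewrite /X -(ge0_integral_translation1 t)//.
  congr (integral _ _ _); apply/seteqP; split=> a /=; rewrite !in_itv /= !andbT; lra.
have : (\int[mu]_(a in `[x, +oo[%classic) g a <= X + \int[mu]_a (dec t f (a, y))%:E)%E.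
  apply: (@le_trans _ _ (\int[mu]_(a in `[x, +oo[%classic) (g (a + t)%R + (dec t f (a, y))%:E))%E).
    apply: ge0_le_integral => //.
    - exact: measurable_funTS.
    - by apply: measurable_funTS; exact: emeasurable_funD.
    - move=> a _; rewrite /g -EFinD lee_fin /dec /tr /= addr0.
      by rewrite -lerBlDl le_max lexx orbT.
  rewrite ge0_integralD//; last 2 first.
    exact: measurable_funTS.
    exact: measurable_funTS.
  by rewrite XE leeD2l//; apply: ge0_subset_integral.
have -> : (\int[mu]_(a in `[x, +oo[%classic) g a = Sx t f (x, y) + X)%E.
  have -> : `[x, +oo[%classic = `[x, x + t]%classic `|` `](x + t), +oo[%classic.
    apply/seteqP; split=> a /=; rewrite !in_itv /= ?andbT.
      by move=> xa; have [h|h] := leP a (x + t); [left; rewrite xa|right].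
    by move=> [/andP[]//|]; lra.
  rewrite ge0_integral_setU//=; last 2 first.
    exact: measurable_funTS.
    apply/disj_setPS => a /= []; rewrite !in_itv /= andbT => /andP[_ h1] h2.
    by have := lt_le_trans h2 h1; rewrite ltxx.
  by rewrite /Sx segE /X integral_itv_obnd_cbnd//; exact: measurable_funTS.
by move=> h; rewrite -(leeD2lE _ _ Xfin) (addeC X (Sx t f (x, y))).
Qed.

Lemma avg_le_dec t f p : tame f -> (forall p, 0 <= f p) -> 0 < t ->
  ((avg t f p)%:E <= (t^-1)%:E * fubini_G mu (fun p => (dec t f p)%:E) p.2)%E.
Proof.
move=> tf f0 t0; have S0 : (0 <= Sx t f p)%E by exact: Sx_ge0.
have Sfin : Sx t f p \is a fin_num.
  rewrite ge0_fin_numE//; apply: le_lt_trans (tame_section_fin p.2 tf f0).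
  apply: ge0_subset_integral => //; first exact: measurable_seg.
  - by apply/measurable_EFinP; apply: measurable_section1; case: tf.
  - by move=> a _; rewrite lee_fin.
rewrite /avg gtr0_norm// mulrC EFinM fineK//.
by rewrite lee_pmul2l ?lte_fin ?invr_gt0//; exact: Sx_le_dec.
Qed.

Lemma tame_sw f : tame f -> tame (fun p => f (sw p)).
Proof.
move=> [mf [B Bf]]; split; first exact: measurable_comp_sw.
exists B => p; split; first exact: (Bf _).1.
by move=> /(Bf _).2/boxP[? ?]; apply/boxP.
Qed.

(* This is the proof of the Gagliardo-Nirenberg-Sobolev inequality in the plane,
   with the derivatives replaced by the decreasing parts of difference quotients. *)
Lemma sobolev_dec f (t_ : nat -> R) (a b : R) : tame f -> (forall p, 0 <= f p) ->
  (forall n, 0 < t_ n) -> t_ @ \oo --> 0 -> 0 <= a -> 0 <= b ->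
  (\forall n \near \oo, \int[leb2 R]_p (dec (t_ n) f p)%:E <= (t_ n * a)%:E)%E ->
  (\forall n \near \oo, \int[leb2 R]_p (decy (t_ n) f p)%:E <= (t_ n * b)%:E)%E ->
  (\int[leb2 R]_p (f p ^+ 2)%:E <= (a * b)%:E)%E.
Proof.
move=> tf f0 t0 tc a0 b0 ha hb; have [mf _] := tf.
have tfs := tame_sw tf; have [mfs _] := tfs.
have fs0 p : 0 <= f (sw p) by [].
pose u n (p : pl R) := avg (t_ n) f p * avg (t_ n) (fun q => f (sw q)) (sw p).
have ma n := measurable_avg (t_ n) mf f0.
have mas n := measurable_comp_sw (measurable_avg (t_ n) mfs fs0).
have sqfin (g : pl R -> R) : tame g -> (\int[leb2 R]_p (g p ^+ 2)%:E < +oo)%E.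
  move=> tg; have /tame_integrable/integrableP[_] := tameM tg tg.
  by under eq_integral do rewrite /= -expr2 ger0_norm ?sqr_ge0//.
have tn0 n : t_ n != 0 by rewrite gt_eqF.
apply: (@le_trans _ _ (limn_einf (fun n => \int[leb2 R]_p (u n p)%:E))%E).
  apply: (@fatou_ae _ _ _ (leb2 R) u (fun p => f p ^+ 2)).
  - by move=> n; apply: measurable_funM; [exact: ma|exact: mas].
  - by move=> n p; apply: mulr_ge0; exact: avg_ge0.
  - by meas.
  - by move=> p; rewrite sqr_ge0.
  - apply: (ae_mono2 (avg_cvg mf f0 (sqfin _ tf) tn0 tc) (ae_sw (avg_cvg mfs fs0 (sqfin _ tfs) tn0 tc))).
    move=> p h1 h2; rewrite expr2; apply: cvgM => //.
    by move: h2; case: (p).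
apply: limn_einf_le_near; near=> n.
have Ha : (\int[leb2 R]_p (dec (t_ n) f p)%:E <= (t_ n * a)%:E)%E by near: n.
have Hb : (\int[leb2 R]_p (decy (t_ n) f p)%:E <= (t_ n * b)%:E)%E by near: n.
have tn := t0 n; set t := t_ n in tn Ha Hb *.
have md : measurable_fun setT (fun p => (dec t f p)%:E) by apply/measurable_EFinP; exact: measurable_dec.
have d0 p : (0 <= (dec t f p)%:E)%E by rewrite lee_fin dec_ge0.
have mdy : measurable_fun setT (fun p => (decy t f p)%:E) by apply/measurable_EFinP; exact: measurable_decy.
have dy0 p : (0 <= (decy t f p)%:E)%E by rewrite lee_fin decy_ge0.
pose al := fubini_G mu (fun p => (dec t f p)%:E).
pose be := fubini_F mu (fun p => (decy t f p)%:E).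
have mal : measurable_fun setT al by exact: (@measurable_fun_fubini_tonelli_G _ _ _ _ R mu _ md d0).
have mbe : measurable_fun setT be by exact: (@measurable_fun_fubini_tonelli_F _ _ _ _ R mu _ mdy dy0).
have al0 y : (0 <= al y)%E by exact: integral_ge0.
have be0 y : (0 <= be y)%E by exact: integral_ge0.
have ale p : ((avg t f p)%:E <= (t^-1)%:E * al p.2)%E by exact: avg_le_dec.
have bee p : ((avg t (fun q => f (sw q)) (sw p))%:E <= (t^-1)%:E * be p.1)%E.
  apply: le_trans (avg_le_dec _ tfs fs0 tn) _.
  rewrite le_eqVlt; apply/orP; left; apply/eqP; congr (_ * _)%E.
have it : (0 <= (t^-1)%:E)%E by rewrite lee_fin invr_ge0 ltW.
(* One factor depends on the second coordinate only and the other on the first only, so the integral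
   of the product splits into a product of integrals. *)
apply: (@le_trans _ _ (\int[leb2 R]_p (((t^-1)%:E * al p.2) * ((t^-1)%:E * be p.1)))%E).
  apply: ge0_le_integral => //.
  - by move=> p _; rewrite lee_fin mulr_ge0// avg_ge0.
  - by apply/measurable_EFinP; apply: measurable_funM; [exact: ma|exact: mas].
  - apply: emeasurable_funM; apply: measurable_funeM.
      exact: (measurableT_comp mal measurable_snd).
    exact: (measurableT_comp mbe measurable_fst).
  - move=> p _; rewrite EFinM; apply: lee_pmul => //; rewrite lee_fin; exact: avg_ge0.
have mF : measurable_fun setT (fun p : pl R => (t^-1)%:E * al p.2 * ((t^-1)%:E * be p.1))%E.
  apply: emeasurable_funM; apply: measurable_funeM.
    exact: (measurableT_comp mal measurable_snd).
  exact: (measurableT_comp mbe measurable_fst).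
have F0 (p : pl R) : (0 <= (t^-1)%:E * al p.2 * ((t^-1)%:E * be p.1))%E.
  by apply: mule_ge0; apply: mule_ge0.
rewrite [leLHS](@fubini_tonelli2 _ _ _ _ R mu mu _ mF F0).
have -> : (\int[mu]_y fubini_G mu (fun p : pl R => (t^-1)%:E * al p.2 * ((t^-1)%:E * be p.1)) y =
   ((t^-1)%:E * \int[mu]_y al y) * ((t^-1)%:E * \int[mu]_x be x))%E.
  rewrite -[in RHS]ge0_integralZl// -[in RHS]ge0_integralZl//.
  rewrite -ge0_integralZr//.
  - apply: eq_integral => y _; rewrite /fubini_G /= ge0_integralZl//.
    + exact: measurable_funeM.
    + by move=> x _; exact: mule_ge0.
    + exact: mule_ge0.
  - exact: measurable_funeM.
  - by move=> y _; exact: mule_ge0.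
  - by apply: integral_ge0 => x _; exact: mule_ge0.
have -> : (\int[mu]_y al y = \int[leb2 R]_p (dec t f p)%:E)%E.
  by rewrite [RHS](@fubini_tonelli2 _ _ _ _ R mu mu _ md d0).
have -> : (\int[mu]_x be x = \int[leb2 R]_p (decy t f p)%:E)%E.
  by rewrite [RHS](@fubini_tonelli1 _ _ _ _ R mu mu _ mdy dy0).
rewrite EFinM; apply: lee_pmul.
- by apply: mule_ge0 => //; exact: integral_ge0.
- by apply: mule_ge0 => //; exact: integral_ge0.
- by rewrite lee_pdivrMl// -EFinM.
- by rewrite lee_pdivrMl// -EFinM.
Unshelve. all: by end_near. Qed.

End Sobolev.

(** * Weak derivatives and difference quotients *)

Section Bump.
Context {R : realType}.
Implicit Types (f g : R -> R) (x : R).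

Fixpoint C1n (n : nat) f : Prop :=
  match n with
  | 0 => continuous f
  | n'.+1 => exists f', (forall x, is_derive x 1 f (f' x)) /\ C1n n' f'
  end.

Lemma is_derive_continuous f f' : (forall x, is_derive x 1 f (f' x)) -> continuous f.
Proof.
move=> d x; apply: differentiable_continuous; apply/derivable1_diffP.
by have [] := d x.
Qed.

Lemma C1nS n f : C1n n.+1 f -> C1n n f.
Proof.
elim: n f => [|n IH] f [f' [d c]].
  exact: is_derive_continuous d.
by exists f'; split => //; exact: IH.
Qed.

Lemma C1n_ext n f g : f =1 g -> C1n n f -> C1n n g.
Proof. by move=> /funext ->. Qed.

Lemma C1nD n f g : C1n n f -> C1n n g -> C1n n (fun x => f x + g x).
Proof.
elim: n f g => [|n IH] f g.
  by move=> cf cg x; apply: cvgD; [exact: cf|exact: cg].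
move=> [f' [df cf]] [g' [dg cg]]; exists (fun x => f' x + g' x); split.
  by move=> x; apply: is_deriveD.
exact: IH.
Qed.

Lemma C1nM n f g : C1n n f -> C1n n g -> C1n n (fun x => f x * g x).
Proof.
elim: n f g => [|n IH] f g.
  by move=> cf cg x; apply: cvgM; [exact: cf|exact: cg].
move=> sf sg; have [f' [df cf]] := sf; have [g' [dg cg]] := sg.
exists (fun x => f x * g' x + g x * f' x); split.
  by move=> x; apply: is_deriveM.
by apply: C1nD; apply: IH => //; exact: C1nS.
Qed.

Lemma C1n_cst n (c : R) : C1n n (fun=> c).
Proof.
elim: n c => [|n IH] c; first by move=> x; exact: cvg_cst.
by exists (fun=> 0); split => // x; exact: is_derive_cst.
Qed.

Lemma is_derive_cvg f x (df : R) :
  h^-1 *: (f (h + x) - f x) @[h --> 0^'] --> df -> is_derive x 1 f df.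
Proof.
move=> c.
have e : (fun h : R => h^-1 *: ((f \o shift x) (h *: (1 : R)) - f x)) =
    (fun h => h^-1 *: (f (h + x) - f x)).
  by apply/funext => h; rewrite /= /GRing.scale /= mulr1.
split; first by apply/cvg_ex; exists df; rewrite e.
by apply: cvg_lim => //; rewrite e.
Qed.

Lemma is_derive_affine (a b x : R) : is_derive x 1 (fun y : R => a * y + b) a.
Proof.
apply: is_derive_cvg; apply: cvg_near_cst; near=> h.
have h0 : h != 0 by near: h; exact: nbhs_dnbhs_neq.
by rewrite /GRing.scale /=; field.
Unshelve. all: by end_near. Qed.

Lemma C1n_affine n f (a b : R) : C1n n f -> C1n n (fun x => f (a * x + b)).
Proof.
elim: n f => [|n IH] f.
  move=> cf x; apply: continuous_comp; last exact: cf.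
  exact: (is_derive_continuous (fun y => is_derive_affine a b y)).
move=> [f' [df cf]]; exists (fun x => f' (a * x + b) * a); split.
  move=> x; have := @is_derive1_comp R f (fun y => a * y + b) x _ _ (df _) (is_derive_affine a b x).
  by [].
by apply: C1nM; [exact: IH|exact: C1n_cst].
Qed.

(** Used at [y = 1/h] for small positive [h], where it shows that [P(1/h) exp(-1/h)] is flat at
    0. *)
Lemma poly_le_expR (P : {poly R}) :
  exists C, 0 <= C /\ forall y, 0 <= y -> `|P.[y]| <= C * expR y.
Proof.
elim/poly_ind: P => [|P c [C [C0 IH]]].
  by exists 0; split=> // y _; rewrite horner0 normr0 mul0r.
suff [D [D0 hD]] : exists D, 0 <= D /\ forall y, 0 <= y -> `|P.[y]| * y <= D * expR y.
  exists (D + `|c|); split; first by rewrite addr_ge0.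
  move=> y y0; rewrite hornerMXaddC (le_trans (ler_normD _ _))// mulrDl lerD//.
    by rewrite normrM (ger0_norm y0) hD.
  rewrite -[leLHS]mulr1 ler_wpM2l// -expR0 ler_expR//.
clear IH C C0 c.
have [n [C [C0 hC]]] : exists n C, 0 <= C /\ forall y, 0 <= y -> `|P.[y]| * y <= C * (1 + y ^+ n.+1).
  elim/poly_ind: P => [|P c [n [C [C0 IH]]]].
    by exists 0%N, 0; split=> // y _; rewrite horner0 normr0 !mul0r.
  exists n.+1, (C + C + `|c| + `|c|); split; first by rewrite !addr_ge0.
  move=> y y0; rewrite hornerMXaddC.
  have h1 : `|P.[y] * y + c| <= `|P.[y]| * y + `|c|.
    by rewrite (le_trans (ler_normD _ _))// normrM (ger0_norm y0).
  have h2 := IH y y0; have c0 := normr_ge0 c.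
  have h3 : y <= 1 + y ^+ n.+2.
    have [y1|y1] := leP y 1; first by rewrite (le_trans y1)// lerDl exprn_ge0.
    by rewrite (@le_trans _ _ (y ^+ n.+2)) ?lerDr// -[leLHS]expr1 ler_weXn2l ?ltW.
  have h4 : (1 + y ^+ n.+1) * y <= 2 * (1 + y ^+ n.+2).
    by rewrite mulrDl mul1r -exprSr; have := exprn_ge0 n.+2 y0; lra.
  apply: (@le_trans _ _ ((C * (1 + y ^+ n.+1) + `|c|) * y)).
    by rewrite ler_wpM2r//; lra.
  rewrite mulrDl -mulrA; apply: (@le_trans _ _ (C * (2 * (1 + y ^+ n.+2)) + `|c| * (1 + y ^+ n.+2))).
    by rewrite lerD// ler_wpM2l.
  have := exprn_ge0 n.+2 y0; set z := y ^+ n.+2 => z0.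
  have : 0 <= `|c| * (1 + z) by rewrite mulr_ge0//; lra.
  by rewrite !mulrDl !mulrDr; lra.
exists (C * (1 + (n.+1)`!%:R)); split; first by rewrite mulr_ge0// addr_ge0.
move=> y y0; apply: le_trans (hC y y0) _; rewrite -mulrA ler_wpM2l// mulrDl mul1r.
have h := expR_ge1Dxn n y0.
have fp : 0 < (n.+1)`!%:R :> R by rewrite ltr0n fact_gt0.
have h' : y ^+ n.+1 / (n.+1)`!%:R <= expR y - 1 by lra.
move: h'; rewrite ler_pdivrMr// => h'.
have : 1 <= expR y by rewrite -expR0 ler_expR.
move=> E1; apply: lerD => //; apply: le_trans h' _.
by rewrite mulrBl mul1r mulrC; lra.
Qed.

(** The functions [P(1/x) exp(-1/x)] form a class closed under differentiation, [P] being replaced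
    by [X^2 (P - P')]; smoothness of every order then needs a single induction. *)
Definition eP (P : {poly R}) (x : R) : R :=
  if x <= 0 then 0 else P.[x^-1] * expR (- x^-1).

Lemma is_derive_eP (P : {poly R}) x : is_derive x 1 (eP P) (eP ('X^2 * (P - P^`())) x).
Proof.
have [x0|x0|->] := ltgtP x 0.
- have -> : eP ('X^2 * (P - P^`())) x = 0 by rewrite /eP ltW.
  apply: is_derive_cvg; apply: cvg_near_cst; near=> h.
  have hx : `|h| < - x by near: h; apply: dnbhs0_lt; rewrite oppr_gt0.
  rewrite /eP !ifT ?subrr ?scaler0//; first exact: ltW.
  by have := ler_norm h; lra.
- rewrite {2}/eP leNgt x0 /=.
  have xn0 : x != 0 by rewrite gt_eqF.
  have dV : is_derive x 1 (fun y : R => y^-1) (- x ^- 2).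
    by apply: is_derive_eq; [exact: (@is_deriveV R id x 1)|rewrite /GRing.scale /= mulr1].
  have dVN : is_derive x 1 (fun y : R => - y^-1) (x ^- 2).
    have := is_deriveN dV; rewrite opprK; exact.
  have dE : is_derive x 1 (fun y : R => expR (- y^-1)) (expR (- x^-1) * x ^- 2).
    exact: (@is_derive1_comp R expR (fun y => - y^-1)).
  have dP : is_derive x 1 (fun y : R => P.[y^-1]) (P^`().[x^-1] * - x ^- 2).
    exact: (@is_derive1_comp R (horner P) (fun y => y^-1)).
  have H : is_derive x 1 (fun y : R => P.[y^-1] * expR (- y^-1))
      (('X^2 * (P - P^`())).[x^-1] * expR (- x^-1)).
    apply: (is_derive_eq (is_deriveM dP dE)).
    rewrite /GRing.scale /= hornerM hornerXn hornerD hornerN exprVn.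
    by ring.
  apply: near_eq_is_derive H; near=> y.
  rewrite /eP leNgt ifF//; apply/negbTE; rewrite negbK; near: y.
  exact: lt_nbhsr.
- apply: is_derive_cvg.
  have z Q : eP Q 0 = 0 by rewrite /eP lexx.
  rewrite !z.
  (* The polynomial [X^2 P] supplies one power of [1/h] for the difference quotient and one more,
     which makes the quotient at most [C h]. *)
  have [C [C0 hC]] := poly_le_expR ('X^2 * P).
  have C1 : 0 < C + 1 by lra.
  apply/cvgrPdist_le => e e0; near=> h.
  rewrite sub0r normrN subr0 addr0 /eP.
  case: ifPn => [_|]; first by rewrite scaler0 normr0 ltW.
  rewrite -ltNge => h0; rewrite /GRing.scale /=.
  have hV0 : 0 <= h^-1 by rewrite invr_ge0 ltW.
  apply: (@le_trans _ _ (C * h)).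
    have := hC _ hV0; rewrite hornerM hornerXn => H.
    have -> : h^-1 * (P.[h^-1] * expR (- h^-1)) = h^-1 ^+ 2 * P.[h^-1] * expR (- h^-1) * h.
      by field; rewrite gt_eqF.
    rewrite 2!normrM (gtr0_norm h0) (gtr0_norm (expR_gt0 _)).
    apply: ler_wpM2r; first exact: ltW.
    by rewrite expRN ler_pdivrMr ?expR_gt0.
  have hl : `|h| < e / (C + 1) by near: h; apply: dnbhs0_lt; rewrite divr_gt0.
  rewrite gtr0_norm// ltr_pdivlMr// in hl.
  apply: le_trans (ltW hl); rewrite mulrC; apply: ler_wpM2l; first exact: ltW.
  by lra.
Unshelve. all: by end_near. Qed.

Lemma C1n_eP n (P : {poly R}) : C1n n (eP P).
Proof.
elim: n P => [|n IH] P; first exact: (is_derive_continuous (is_derive_eP P)).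
by exists (eP ('X^2 * (P - P^`()))); split; [exact: is_derive_eP|exact: IH].
Qed.

(* [sbump k a b] is smooth, vanishes off [(a, b)], and increases to the indicator
   function of [(a, b)] as [k] tends to infinity. *)
Definition sbump (k : nat) (a b : R) (x : R) : R :=
  eP 1 (k.+1%:R * x + - k.+1%:R * a) * eP 1 (- k.+1%:R * x + k.+1%:R * b).

Lemma C1n_sbump n k a b : C1n n (sbump k a b).
Proof. by apply: C1nM; apply: C1n_affine; exact: C1n_eP. Qed.

Lemma eP1_bound x : 0 <= eP 1 x <= 1.
Proof.
rewrite /eP; case: (leP x 0) => x0; first by rewrite lexx ler01.
rewrite hornerC mul1r expR_ge0 -[leRHS]expR0 ler_expR oppr_le0 invr_ge0.
exact: ltW.
Qed.

Lemma sbump_bound k a b x : 0 <= sbump k a b x <= 1.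
Proof.
have /andP[h1 h2] := eP1_bound (k.+1%:R * x + - k.+1%:R * a).
have /andP[h3 h4] := eP1_bound (- k.+1%:R * x + k.+1%:R * b).
by rewrite /sbump mulr_ge0//= mulr_ile1.
Qed.

Lemma sbump_out k a b x : ~ (a < x < b) -> sbump k a b x = 0.
Proof.
have k0 : 0 < k.+1%:R :> R by rewrite ltr0n.
move=> /negP; rewrite negb_and -!leNgt /sbump /eP => /orP[xa|bx].
  rewrite ifT ?mul0r// mulNr -mulrBr.
  by rewrite pmulr_rle0// subr_le0.
rewrite mulrC ifT ?mul0r// mulNr addrC -mulrBr.
by rewrite pmulr_rle0// subr_le0.
Qed.

Lemma cvg_sbump a b x : sbump k a b x @[k --> \oo] --> (\1_(`]a, b[%classic) x : R).
Proof.
rewrite indicE; case: (boolP (x \in _)) => [|]; last first.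
  rewrite notin_setE /= in_itv /= => h; apply: cvg_near_cst; apply: nearW => k.
  by rewrite sbump_out.
rewrite inE /= in_itv /= => /andP[ax xb].
have key (c : R) : 0 < c -> eP 1 (k.+1%:R * c) @[k --> \oo] --> (1 : R).
  move=> c0.
  have -> : (fun k : nat => eP 1 (k.+1%:R * c)) = (fun k => expR (- (c^-1 * k.+1%:R^-1))).
    apply/funext => k; rewrite /eP leNgt mulr_gt0//= hornerC mul1r invfM.
    by rewrite mulrC.
  rewrite -[X in _ --> X]expR0; apply: continuous_cvg; first exact: continuous_expR.
  rewrite -[X in _ --> X]oppr0; apply: cvgN; rewrite -[X in _ --> X](mulr0 c^-1); apply: cvgM; first exact: cvg_cst.
  exact: cvg_harmonic.
have -> : (fun k => sbump k a b x) = (fun k => eP 1 (k.+1%:R * (x - a)) * eP 1 (k.+1%:R * (b - x))).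
  by apply/funext => k; rewrite /sbump; congr (eP 1 _ * eP 1 _); ring.
by rewrite -[1%:R]mulr1; apply: cvgM; apply: key; rewrite subr_gt0.
Qed.

Lemma is_derive_tensor_x (al be : R -> R) (al' : R) (p : R * R) : is_derive p.1 1 al al' ->
  is_derive p (ex R) (fun q : R * R => al q.1 * be q.2) (al' * be p.2).
Proof.
move=> [d v].
have e : (fun h : R => h^-1 *: (((fun q : R * R => al q.1 * be q.2) \o shift p) (h *: ex R) - al p.1 * be p.2)) =
   (fun h => h^-1 *: ((al \o shift p.1) (h *: (1 : R)) - al p.1) * be p.2).
  apply/funext => h; rewrite /= /GRing.scale /= mulr0 add0r.
  by rewrite -mulrBl mulrA.
have c : (fun h => h^-1 *: ((al \o shift p.1) (h *: (1 : R)) - al p.1)) @ 0^' --> al'.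
  by rewrite -v; exact: d.
have c2 : (fun h => h^-1 *: ((al \o shift p.1) (h *: (1 : R)) - al p.1) * be p.2) @ 0^' --> al' * be p.2.
  by apply: cvgM => //; exact: cvg_cst.
split; first by apply/cvg_ex; exists (al' * be p.2); rewrite e.
by rewrite /derive; apply: cvg_lim => //; rewrite e.
Qed.

Lemma is_derive_tensor_y (al be : R -> R) (be' : R) (p : R * R) : is_derive p.2 1 be be' ->
  is_derive p (ey R) (fun q : R * R => al q.1 * be q.2) (al p.1 * be').
Proof.
move=> [d v].
have e : (fun h : R => h^-1 *: (((fun q : R * R => al q.1 * be q.2) \o shift p) (h *: ey R) - al p.1 * be p.2)) =
   (fun h => al p.1 * (h^-1 *: ((be \o shift p.2) (h *: (1 : R)) - be p.2))).
  apply/funext => h; rewrite /= /GRing.scale /= mulr0 add0r.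
  by rewrite -mulrBr mulrCA.
have c : (fun h => h^-1 *: ((be \o shift p.2) (h *: (1 : R)) - be p.2)) @ 0^' --> be'.
  by rewrite -v; exact: d.
have c2 : (fun h => al p.1 * (h^-1 *: ((be \o shift p.2) (h *: (1 : R)) - be p.2))) @ 0^' --> al p.1 * be'.
  by apply: cvgM => //; exact: cvg_cst.
split; first by apply/cvg_ex; exists (al p.1 * be'); rewrite e.
by rewrite /derive; apply: cvg_lim => //; rewrite e.
Qed.

Lemma Cn_tensor n (al be : R -> R) : C1n n al -> C1n n be ->
  Cn n (fun p : R * R => al p.1 * be p.2).
Proof.
elim: n al be => [|n IH] al be.
  move=> ca cb p; apply: cvgM.
    by apply: (@cvg_comp _ _ _ fst al); [exact: cvg_fst|exact: ca].
  by apply: (@cvg_comp _ _ _ snd be); [exact: cvg_snd|exact: cb].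
move=> sa sb; have [a' [da ca]] := sa; have [b' [db cb]] := sb; split.
- by move=> p; split; [have [] := is_derive_tensor_x be (da p.1)|have [] := is_derive_tensor_y al (db p.2)].
- have -> : (fun p : R * R => 'D_(ex R) (fun p0 : R * R => al p0.1 * be p0.2) p) = (fun p => a' p.1 * be p.2).
    by apply/funext => p; have [_ ->] := is_derive_tensor_x be (da p.1).
  by apply: IH => //; exact: C1nS.
- have -> : (fun p : R * R => 'D_(ey R) (fun p0 : R * R => al p0.1 * be p0.2) p) = (fun p => al p.1 * b' p.2).
    by apply/funext => p; have [_ ->] := is_derive_tensor_y al (db p.2).
  by apply: IH => //; exact: C1nS.
Qed.

End Bump.

(** * Square integrable functions and a Dynkin argument for vanishing integrals *)

Section L2.
Context {R : realType}.
Implicit Types (f g : pl R -> R) (t : R).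
Local Notation mu := (@lebesgue_measure R).

Definition L2 f := measurable_fun setT f /\ (\int[leb2 R]_p (f p ^+ 2)%:E < +oo)%E.

Lemma L2_integrable f : L2 f -> (leb2 R).-integrable setT (EFin \o (fun p => f p ^+ 2)).
Proof.
move=> [mf f2]; apply/integrableP; split; first by apply/measurable_EFinP; meas.
by under eq_integral do rewrite /= ger0_norm ?sqr_ge0//.
Qed.

Lemma L2_le (f : pl R -> R) (g : pl R -> R) : measurable_fun setT f ->
  (forall p, 0 <= g p) -> (leb2 R).-integrable setT (EFin \o g) ->
  (forall p, f p ^+ 2 <= g p) -> L2 f.
Proof.
move=> mf g0 /integrableP[mg ig] fg; split => //.
apply: le_lt_trans ig; apply: ge0_le_integral => //.
- by move=> p _; rewrite lee_fin sqr_ge0.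
- by apply/measurable_EFinP; meas.
- by apply: measurableT_comp.
- by move=> p _; rewrite /= lee_fin ger0_norm.
Qed.

Lemma integrable_add (f g : pl R -> R) : (leb2 R).-integrable setT (EFin \o f) ->
  (leb2 R).-integrable setT (EFin \o g) ->
  (leb2 R).-integrable setT (EFin \o (fun p => f p + g p)).
Proof.
move=> fi gi; have := integrableD measurableT fi gi.
by apply: eq_integrable.
Qed.

Lemma integrable_scale (k : R) (f : pl R -> R) : (leb2 R).-integrable setT (EFin \o f) ->
  (leb2 R).-integrable setT (EFin \o (fun p => k * f p)).
Proof.
move=> fi; have := integrableZl measurableT k fi.
by apply: eq_integrable.
Qed.

Lemma L2D f g : L2 f -> L2 g -> L2 (fun p => f p + g p).
Proof.
move=> Lf Lg; have [mf _] := Lf; have [mg _] := Lg.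
apply: (@L2_le _ (fun p => 2 * f p ^+ 2 + 2 * g p ^+ 2)).
- by meas.
- by move=> p; rewrite addr_ge0// mulr_ge0// sqr_ge0.
- by apply: integrable_add; apply: integrable_scale; exact: L2_integrable.
- by move=> p; have := sqr_ge0 (f p - g p); rewrite !expr2; lra.
Qed.

Lemma L2Z k f : L2 f -> L2 (fun p => k * f p).
Proof.
move=> Lf; have [mf _] := Lf.
apply: (@L2_le _ (fun p => k ^+ 2 * f p ^+ 2)).
- by meas.
- by move=> p; rewrite mulr_ge0// sqr_ge0.
- by apply: integrable_scale; exact: L2_integrable.
- by move=> p; rewrite exprMn.
Qed.

Lemma L2B f g : L2 f -> L2 g -> L2 (fun p => f p - g p).
Proof.
move=> Lf Lg; have := L2D Lf (L2Z (-1) Lg).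
by under eq_fun do rewrite mulN1r.
Qed.

Lemma L2_tr f a : L2 f -> L2 (fun p => f (tr a p)).
Proof.
move=> [mf f2]; split; first by meas.
rewrite (ge0_integral_tr a (f := fun p => (f p ^+ 2)%:E))//.
  by apply/measurable_EFinP; meas.
by move=> p; rewrite lee_fin sqr_ge0.
Qed.

Lemma L2_sw f : L2 f -> L2 (fun p => f (sw p)).
Proof.
move=> [mf f2]; split; first exact: measurable_comp_sw.
rewrite (ge0_integral_swap (f := fun p => (f p ^+ 2)%:E))//.
  by apply/measurable_EFinP; meas.
by move=> p; rewrite lee_fin sqr_ge0.
Qed.

Lemma tame_L2 f : tame f -> L2 f.
Proof.
move=> tf; have [mf _] := tf.
apply: (@L2_le _ (fun p => f p * f p)) => //.
- by move=> p; rewrite -expr2 sqr_ge0.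
- by apply: tame_integrable; exact: tameM.
Qed.

Lemma L2_maxr0 f : L2 f -> L2 (fun p => maxr 0 (f p)).
Proof.
move=> Lf; have [mf _] := Lf; apply: (@L2_le _ (fun p => f p ^+ 2)).
- by meas.
- by move=> p; exact: sqr_ge0.
- exact: L2_integrable.
- by move=> p; case: (leP 0 (f p)) => // _; rewrite expr0n sqr_ge0.
Qed.

Lemma L2_avg t f : L2 f -> (forall p, 0 <= f p) -> t != 0 -> L2 (avg t f).
Proof.
move=> [mf f2] f0 t0; split; first exact: measurable_avg.
by apply: le_lt_trans f2; exact: integral_avg_sqr.
Qed.

Lemma L2M_integrable f g : L2 f -> L2 g ->
  (leb2 R).-integrable setT (EFin \o (fun p => f p * g p)).
Proof.
move=> Lf Lg; have [mf _] := Lf; have [mg _] := Lg.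
have i : (leb2 R).-integrable setT (EFin \o (fun p => f p ^+ 2 + g p ^+ 2)).
  by apply: integrable_add; exact: L2_integrable.
apply: le_integrable i => //.
  by apply/measurable_EFinP; meas.
move=> p _ /=; rewrite lee_fin [leRHS]ger0_norm ?addr_ge0 ?sqr_ge0// normrM.
rewrite -(real_normK (num_real (f p))) -(real_normK (num_real (g p))).
by have := sqr_ge0 (`|f p| - `|g p|); have := sqr_ge0 `|f p|; have := sqr_ge0 `|g p|; rewrite !expr2; lra.
Qed.

Lemma tame_bump k (a b c d : R) : tame (fun p => sbump k a b p.1 * sbump k c d p.2).
Proof.
have cb (e e' : R) : continuous (sbump k e e' : R -> R) by exact: (C1n_sbump 0).
have mb (e e' : R) : measurable_fun setT (sbump k e e' : R -> R).
  exact: continuous_measurable_fun.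
split.
  apply: measurable_funM.
    by apply: (measurableT_comp (mb a b)); exact: measurable_fst.
  by apply: (measurableT_comp (mb c d)); exact: measurable_snd.
exists (maxr 1 (`|a| + `|b| + `|c| + `|d|)) => p.
have /andP[h1 h2] := sbump_bound k a b p.1.
have /andP[h3 h4] := sbump_bound k c d p.2.
split.
  by rewrite le_max; apply/orP; left; rewrite (ger0_norm (mulr_ge0 h1 h3)) -(mulr1 1); exact: (ler_pM h1 h3 h2 h4).
rewrite mulf_eq0 negb_or => /andP[k1 k2].
have /andP[q1 q2] : a < p.1 < b.
  by apply: contrapT => /(sbump_out k) e; rewrite e eqxx in k1.
have /andP[q3 q4] : c < p.2 < d.
  by apply: contrapT => /(sbump_out k) e; rewrite e eqxx in k2.
have := ler_norm a; have := ler_norm b; have := ler_norm c; have := ler_norm d.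
have := ler_norm (- a); have := ler_norm (- b); have := ler_norm (- c); have := ler_norm (- d).
rewrite !normrN => *.
by apply/boxP; rewrite !le_max; split; apply/orP; right; rewrite ler_norml; lra.
Qed.

Lemma Sx_adjoint t f g : measurable_fun setT f -> (forall p, 0 <= f p) ->
  measurable_fun setT g -> (forall p, 0 <= g p) ->
  (\int[leb2 R]_p (Sx t f p * (g p)%:E) = \int[leb2 R]_p ((f p)%:E * Sx (- t) g p))%E.
Proof.
move=> mf f0 mg g0.
have mS := measurable_Sx t mf f0.
have mSg := measurable_Sx (- t) mg g0.
have mL : measurable_fun setT (fun p : pl R => Sx t f p * (g p)%:E)%E.
  by apply: emeasurable_funM => //; exact/measurable_EFinP.
have L0 p : (0 <= Sx t f p * (g p)%:E)%E by apply: mule_ge0; [exact: Sx_ge0|rewrite lee_fin].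
have mR : measurable_fun setT (fun p : pl R => (f p)%:E * Sx (- t) g p)%E.
  by apply: emeasurable_funM => //; exact/measurable_EFinP.
have R0 p : (0 <= (f p)%:E * Sx (- t) g p)%E by apply: mule_ge0; [rewrite lee_fin|exact: Sx_ge0].
rewrite [LHS](@fubini_tonelli2 _ _ _ _ R mu mu _ mL L0).
rewrite [RHS](@fubini_tonelli2 _ _ _ _ R mu mu _ mR R0).
apply: eq_integral => y _; rewrite /fubini_G.
pose F (z : pl R) := (f (z.2, y) * isegx t (z.1, y) z.2 * g (z.1, y))%:E.
have mF : measurable_fun setT F.
  apply/measurable_EFinP; apply: measurable_funM; first apply: measurable_funM.
  - by apply: (measurableT_comp mf); apply/measurable_fun_pair => //; exact: measurable_snd.
  - apply: measurable_isegx; last exact: measurable_snd.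
    by apply/measurable_fun_pair => //; exact: measurable_fst.
  - by apply: (measurableT_comp mg); apply/measurable_fun_pair => //; exact: measurable_fst.
have F0 z : (0 <= F z)%E by rewrite lee_fin !mulr_ge0 // isegx_ge0.
have := @fubini_tonelli _ _ _ _ R mu mu F mF F0; rewrite /F /= => e.
have mfs := measurable_section1 y mf; have mgs := measurable_section1 y mg.
have mi1 (x : R) : measurable_fun setT (fun a : measurableTypeR R => isegx t (x, y) a).
  by apply: measurable_isegx => //; exact: measurable_cst.
have mi2 (a : R) : measurable_fun setT (fun x : measurableTypeR R => isegx t (x, y) a).
  by apply: measurable_isegx => //; apply/measurable_fun_pair => //; exact: measurable_cst.
transitivity (\int[mu]_x \int[mu]_a (f (a, y) * isegx t (x, y) a * g (x, y))%:E)%E.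
  apply: eq_integral => x _; rewrite SxE /= -ge0_integralZr//.
  - by apply/measurable_EFinP; meas; exact: mi1.
  - by move=> a _; rewrite lee_fin mulr_ge0 // isegx_ge0.
  - by rewrite lee_fin.
rewrite e; apply: eq_integral => a _; rewrite SxE /=.
rewrite -ge0_integralZl//; last 3 first.
- apply/measurable_EFinP; apply: measurable_funM => //.
  by apply: measurable_isegx => //; exact: measurable_cst.
- by move=> x _; rewrite lee_fin mulr_ge0 // isegx_ge0.
- by rewrite lee_fin.
apply: eq_integral => x _; rewrite -EFinM; congr (_%:E).
rewrite -mulrA; congr (_ * _); rewrite mulrC; congr (_ * _).
rewrite !isegxE !indicE; have [h|h] := pselect (seg t x a).
  by rewrite !mem_set//; apply/seg_sym; rewrite opprK.
have h' : ~ seg (- t) a x by move=> /seg_sym; rewrite opprK.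
by rewrite !memNset.
Qed.

(** The sets whose preimage under [pi], cut with [D], has zero integral form a Dynkin system. This
    is applied to both coordinate projections, generated by rays, and to the identity, generated by
    rectangles. *)
Lemma dynkin_integral0 d (T : measurableType d) (pi : pl R -> T) (G : set (set T))
    (g : pl R -> R) (D : set (pl R)) :
  @measurable _ T = <<s G >> -> setI_closed G -> measurable_fun setT pi ->
  measurable D -> (leb2 R).-integrable setT (EFin \o g) ->
  (\int[leb2 R]_(p in D) (g p)%:E = 0)%E ->
  (forall A, G A -> \int[leb2 R]_(p in pi @^-1` A `&` D) (g p)%:E = 0)%E ->
  forall A, measurable A -> (\int[leb2 R]_(p in pi @^-1` A `&` D) (g p)%:E = 0)%E.
Proof.
move=> GE GI mpi mD ig D0 G0.
have mpre A : measurable A -> measurable (pi @^-1` A `&` D).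
  by move=> mA; apply: measurableI => //; have := mpi measurableT A mA; rewrite setTI.
have iS E : measurable E -> (leb2 R).-integrable E (EFin \o g).
  by move=> mE; apply: integrableS ig.
pose P (A : set T) := (\int[leb2 R]_(p in pi @^-1` A `&` D) (g p)%:E = 0)%E.
move=> A mA; have sA : <<s G >> A by rewrite -GE.
apply: (@dynkin_induction _ T G P GE GI) sA.
- by rewrite /P preimage_setT setTI.
- by move=> B GB; exact: G0.
- move=> S mS PS; rewrite /P.
  have e : D = (pi @^-1` S `&` D) `|` (pi @^-1` (~` S) `&` D).
    by rewrite -setIUl -preimage_setU setUv preimage_setT setTI.
  have dj : [disjoint (pi @^-1` S `&` D) & (pi @^-1` (~` S) `&` D)].
    by apply/disj_setPS => p [[Sp _] [nSp _]].
  have := D0; rewrite {1}e integral_setU//=; last 3 first.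
  - exact: mpre.
  - by apply: mpre; exact: measurableC.
  - by apply: measurable_funTS; case/integrableP: ig.
  by rewrite [X in (X + _ = 0)%E -> _](PS : _ = _) add0e.
- move=> F mF tF PF; rewrite /P preimage_bigcup setI_bigcupl.
  rewrite integral_bigcup//.
  - by rewrite eseries0// => k _ _; exact: PF.
  - move=> i j _ _ [p [[Fi _] [Fj _]]]; apply: tF => //.
    by exists (pi p).
  - by move=> k; exact: mpre.
  - apply: iS; apply: bigcupT_measurable => k; exact: mpre.
Qed.

Definition inte (f : pl R -> R) := (leb2 R).-integrable setT (EFin \o f).
Definition Iint (f : pl R -> R) : R := \int[leb2 R]_p f p.

Lemma inte_ext f g : f =1 g -> inte f -> inte g.
Proof. by move=> /funext ->. Qed.

Lemma inteD f g : inte f -> inte g -> inte (fun p => f p + g p).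
Proof. exact: integrable_add. Qed.

Lemma inteZ k f : inte f -> inte (fun p => k * f p).
Proof. exact: integrable_scale. Qed.

Lemma inteB f g : inte f -> inte g -> inte (fun p => f p - g p).
Proof.
move=> fi gi; apply: inte_ext (inteD fi (inteZ (-1) gi)) => p.
by rewrite mulN1r.
Qed.

Lemma inteM f g : L2 f -> L2 g -> inte (fun p => f p * g p).
Proof. exact: L2M_integrable. Qed.

Lemma Iint_ext f g : f =1 g -> Iint f = Iint g.
Proof. by move=> /funext ->. Qed.

Lemma IintB f g : inte f -> inte g -> Iint (fun p => f p - g p) = Iint f - Iint g.
Proof. by move=> fi gi; exact: RintegralB. Qed.

Lemma IintZ k f : inte f -> Iint (fun p => k * f p) = k * Iint f.
Proof. by move=> fi; exact: RintegralZl. Qed.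

End L2.

(** * Increments as averages of the weak derivative, tested against bumps *)

Section FTC.
Context {R : realType}.
Implicit Types (f g : pl R -> R).
Local Notation mu := (@lebesgue_measure R).

Lemma Iint_tr (g : pl R -> R) a : inte g -> Iint (fun p => g (tr a p)) = Iint g.
Proof.
move=> /integrableP[mg _]; rewrite /Iint /Rintegral; congr fine.
transitivity (\int[leb2 R]_p ((EFin \o g) (tr a p)))%E; first by [].
rewrite [LHS]integralE [RHS]integralE; congr (_ - _)%E.
  rewrite -[RHS](ge0_integral_tr a); [|exact: measurable_funepos|by []].
  by apply: eq_integral => p _; rewrite !funeposE.
rewrite -[RHS](ge0_integral_tr a); [|exact: measurable_funeneg|by []].
by apply: eq_integral => p _; rewrite !funenegE.
Qed.

(** The segment integral of [f^2] is integrable in the plane, hence finite almost everywhere, and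
    [f <= 1 + f^2]. This is what makes [fine] harmless in [avg]. *)
Lemma ae_Sx_fin f t : L2 f -> (forall p, 0 <= f p) ->
  {ae leb2 R, forall p, Sx t f p \is a fin_num}.
Proof.
move=> [mf f2] f0.
have mf2 : measurable_fun setT (fun p => f p ^+ 2) by meas.
have f20 p : 0 <= f p ^+ 2 by exact: sqr_ge0.
have i : (leb2 R).-integrable setT (Sx t (fun p => f p ^+ 2)).
  apply/integrableP; split; first exact: measurable_Sx.
  under eq_integral do rewrite gee0_abs ?Sx_ge0//.
  by rewrite integral_Sx// lte_mul_pinfty.
apply: (ae_mono (integrable_ae measurableT i)) => p /(_ I) fin.
rewrite ge0_fin_numE ?Sx_ge0//.
have ms := measurable_section1 p.2 mf.
apply: (@le_lt_trans _ _ (\int[mu]_(a in seg t p.1) (1 + (f (a, p.2) ^+ 2)%:E))%E).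
  apply: ge0_le_integral => //.
  - exact: measurable_seg.
  - by move=> a _; rewrite lee_fin.
  - by apply/measurable_EFinP; exact: measurable_funTS.
  - by apply: emeasurable_funD => //; apply/measurable_EFinP; apply: measurable_funTS; meas.
  - move=> a _; rewrite -EFinD lee_fin.
    by have := sqr_ge0 (f (a, p.2) - 1); have := f20 (a, p.2); rewrite !expr2; lra.
rewrite ge0_integralD//; last 3 first.
- exact: measurable_seg.
- by move=> a _; rewrite lee_fin.
- by apply/measurable_EFinP; apply: measurable_funTS; meas.
rewrite integral_cst; last exact: measurable_seg.
rewrite [X in (_ * X + _)%E]lebesgue_seg lte_add_pinfty//.
  by rewrite -EFinM ltry.
by move: fin; rewrite ge0_fin_numE// Sx_ge0.
Qed.

Lemma tame_Sx_fin f t p : tame f -> (forall p, 0 <= f p) -> Sx t f p \is a fin_num.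
Proof.
move=> tf f0; rewrite ge0_fin_numE ?Sx_ge0//.
apply: le_lt_trans (tame_section_fin p.2 tf f0); apply: ge0_subset_integral => //.
- exact: measurable_seg.
- by apply/measurable_EFinP; apply: measurable_section1; case: tf.
- by move=> a _; rewrite lee_fin.
Qed.

(* Averaging over [[p, p + t e1]] is adjoint to averaging over [[p - t e1, p]]; this moves
   the weak derivative onto a test function that is itself a primitive. *)
Lemma avg_adjoint f g t : L2 f -> (forall p, 0 <= f p) -> tame g -> (forall p, 0 <= g p) ->
  Iint (fun p => avg t f p * g p) = Iint (fun p => f p * avg (- t) g p).
Proof.
move=> Lf f0 tg g0; have [mf _] := Lf; have [mg _] := tg.
rewrite /Iint /Rintegral; congr fine.
have it : (0 <= `|t|^-1 :> R) by rewrite invr_ge0.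
transitivity ((`|t|^-1)%:E * \int[leb2 R]_p (Sx t f p * (g p)%:E))%E.
  rewrite -ge0_integralZl//; last 2 first.
  - by apply: emeasurable_funM; [exact: measurable_Sx|exact/measurable_EFinP].
  - by move=> p _; apply: mule_ge0; [exact: Sx_ge0|rewrite lee_fin].
  apply: ae_eq_integral => //.
  - by apply/measurable_EFinP; apply: measurable_funM => //; exact: measurable_avg.
  - apply: measurable_funeM.
    by apply: emeasurable_funM; [exact: measurable_Sx|exact/measurable_EFinP].
  - apply: (ae_mono (ae_Sx_fin t Lf f0)) => p fin _.
    by rewrite -(fineK fin) -!EFinM /avg; congr (_%:E); ring.
rewrite Sx_adjoint// -ge0_integralZl//.
- apply: eq_integral => p _; have fin := tame_Sx_fin (- t) p tg g0.
  by rewrite -(fineK fin) -!EFinM /avg normrN; congr (_%:E); ring.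
- by apply: emeasurable_funM; [exact/measurable_EFinP|exact: measurable_Sx].
- by move=> p _; apply: mule_ge0; [rewrite lee_fin|exact: Sx_ge0].
Qed.

Section Primitive.
Variables (k : nat) (a b : R).
Local Notation f := (sbump k a b).

Let cf : continuous (f : R -> R). Proof. exact: (C1n_sbump 0). Qed.
Let mf : measurable_fun setT (f : R -> R). Proof. exact: continuous_measurable_fun. Qed.

Lemma sbump_integrable (D : set R) : measurable D -> mu.-integrable D (EFin \o f).
Proof.
move=> mD; apply: (@integrableS _ _ _ _ setT) => //.
apply/integrableP; split; first exact/measurable_EFinP.
have -> : (\int[mu]_x `|(EFin \o f) x| = \int[mu]_(x in `]a, b[) (f x)%:E)%E.
  rewrite [RHS]integral_mkcond; apply: eq_integral => x _.
  rewrite patchE /=; case: ifPn => [_|].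
    by have /andP[h _] := sbump_bound k a b x; rewrite ger0_norm.
  rewrite notin_setE /= in_itv /= => h.
  by rewrite sbump_out// normr0.
apply: (@le_lt_trans _ _ (\int[mu]_(x in `]a, b[) 1)%E).
  apply: ge0_le_integral => //.
  - by move=> x _; rewrite lee_fin; have /andP[] := sbump_bound k a b x.
  - by apply/measurable_EFinP; exact: measurable_funTS.
  - by move=> x _; rewrite lee_fin; have /andP[] := sbump_bound k a b x.
rewrite integral_cst// mul1e.
have := lebesgue_measure_itv `]a, b[; rewrite /= lte_fin => ->.
by case: ifP => _; rewrite ?ltry// -EFinB ltry.
Qed.

Definition prim (x : R) : R := \int[mu]_(s in `]-oo, x]) f s.

Lemma is_derive_prim (x : R) : is_derive x 1 prim (f x).
Proof.
have x1 : x < x + 1 by rewrite ltrDl.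
have i := sbump_integrable (@measurable_itv R (Interval -oo%O (BRight (x + 1)))).
have [d e] := @continuous_FTC1 R f -oo%O x (x + 1) x1 i (ltNyr _) (@cf x).
by apply: DeriveDef; [exact: d|rewrite -derive1E; exact: e].
Qed.

(** The sign restores the orientation, which [seg] forgets when [t] is negative. *)
Lemma prim_diff t x : t != 0 ->
  fine (\int[mu]_(s in seg (- t) x) (f s)%:E) = Num.sg t * (prim x - prim (x - t)).
Proof.
move=> t0.
have key (u v : R) : u <= v -> fine (\int[mu]_(s in `[u, v]) (f s)%:E) = prim v - prim u.
  move=> uv; have := @Rintegral_itvB R f -oo%O (BRight v) u.
  rewrite -/(prim v) -/(prim u) => ->.
  - by rewrite Rintegral_itv_obnd_cbnd//; exact: sbump_integrable.
  - by apply: sbump_integrable; exact: measurable_itv.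
  - by [].
  - by rewrite bnd_simp.
rewrite /seg; case: (ltgtP t 0) t0 => // t0 _.
- rewrite min_l ?max_r; [|lra..]; rewrite ltr0_sg// key; [ring|lra].
- rewrite min_r ?max_l; [|lra..]; rewrite gtr0_sg// key; [ring|lra].
Qed.

End Primitive.

(* Tensor products suffice as test functions, since [sbump] tensors approximate the
   indicators of rectangles. *)
Definition weak_x (U w : pl R -> R) (O : set (R * R)) :=
  forall (al be al' : R -> R) (a b c d : R),
   (forall n, C1n n al) -> (forall n, C1n n be) -> (forall x : R, is_derive x 1 al (al' x)) ->
   (forall x, ~ (a <= x <= b) -> al x = 0) -> (forall y, ~ (c <= y <= d) -> be y = 0) ->
   `[a, b] `*` `[c, d] `<=` O ->
   Iint (fun p => U p * (al' p.1 * be p.2)) = - Iint (fun p => w p * (al p.1 * be p.2)).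

Variables (U w : pl R -> R) (O : set (R * R)).
Hypotheses (LU : L2 U) (Lw : L2 w) (weak : weak_x U w O).

Definition pos_part f (p : R * R) := maxr 0 (f p).
Definition neg_part f (p : R * R) := maxr 0 (- f p).

Lemma L2_pos_part f : L2 f -> L2 (pos_part f). Proof. exact: L2_maxr0. Qed.
Lemma L2_neg_part f : L2 f -> L2 (neg_part f).
Proof.
move=> Lf; apply: L2_maxr0; have := L2Z (-1) Lf.
by under eq_fun do rewrite mulN1r.
Qed.

Lemma pos_part_ge0 f p : 0 <= pos_part f p. Proof. by rewrite le_max lexx. Qed.
Lemma neg_part_ge0 f p : 0 <= neg_part f p. Proof. by rewrite le_max lexx. Qed.

Lemma pos_neg_part f p : f p = pos_part f p - neg_part f p.
Proof.
rewrite /pos_part /neg_part; have [h|h] := leP 0 (f p).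
  by rewrite max_l ?subr0// oppr_le0.
by rewrite max_r ?oppr_ge0 1?ltW// sub0r opprK.
Qed.

(** The average of a function without sign; the two parts are averaged separately because the
    estimates for [avg] rest on Tonelli's theorem. *)
Definition savg t f (p : R * R) : R := avg t (pos_part f) p - avg t (neg_part f) p.

Lemma L2_savg t f : L2 f -> t != 0 -> L2 (savg t f).
Proof.
move=> Lf t0; apply: L2B; apply: L2_avg => //.
- exact: L2_pos_part.
- exact: pos_part_ge0.
- exact: L2_neg_part.
- exact: neg_part_ge0.
Qed.

(** The weak derivative is tested against [al p.1 * be p.2], where [al] is the signed integral of
    the bump from [x - t] to [x]. Its derivative is the bump minus a translate, which yields the
    increment of [U], while adjointness turns [w * al] into an average of [w]. The support of [al]
    is that of the bump widened by [t], whence the minimum and maximum. *)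
Lemma ftc_sbump k (a b c d t : R) : t != 0 ->
  `[minr a (a + t), maxr b (b + t)] `*` `[c, d] `<=` O ->
  Iint (fun p => (U (tr (t, 0) p) - U p - t * savg t w p) *
     (sbump k a b p.1 * sbump k c d p.2)) = 0.
Proof.
move=> t0 hO.
pose g (p : pl R) := sbump k a b p.1 * sbump k c d p.2.
have tg : tame g by exact: tame_bump.
have g0 p : 0 <= g p.
  have /andP[h1 h2] := sbump_bound k a b p.1.
  by have /andP[h3 h4] := sbump_bound k c d p.2; exact: mulr_ge0.
have Lg := tame_L2 tg; have tgt := tame_tr (- t, 0) tg; have Lgt := tame_L2 tgt.
have LUt := L2_tr (t, 0) LU.
pose al x := prim k a b x - prim k a b (x - t).
pose al' x := sbump k a b x - sbump k a b (x - t).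
pose be := sbump k c d.
have dal (x : R) : is_derive x 1 al (al' x).
  have h : is_derive x 1 (fun y => prim k a b (1 * y + - t)) (sbump k a b (1 * x + - t) * 1).
    exact: (@is_derive1_comp R (prim k a b) (fun y => 1 * y + - t) x _ _ (is_derive_prim k a b _) (is_derive_affine 1 (- t) x)).
  have := is_deriveB (is_derive_prim k a b x) h.
  rewrite mulr1 mul1r /al /al'.
  have -> // : prim k a b - (fun y : R => prim k a b (1 * y - t)) = (fun y => prim k a b y - prim k a b (y - t)).
  by apply/funext => y; rewrite -[RHS]/(_ - _) !fctE mul1r.
have cal' n : C1n n al'.
  have := C1nD (C1n_sbump n k a b) (C1nM (C1n_cst n (-1)) (C1n_affine 1 (- t) (C1n_sbump n k a b))).
  by apply: C1n_ext => x; rewrite /al' mul1r mulN1r.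
have cal n : C1n n al.
  case: n => [|n]; first exact: is_derive_continuous dal.
  by exists al'.
have alE x : al x = Num.sg t * fine (\int[mu]_(s in seg (- t) x) (sbump k a b s)%:E).
  rewrite prim_diff// mulrA -expr2 sqr_sg t0 mul1r //.
have al0 x : ~ (minr a (a + t) <= x <= maxr b (b + t)) -> al x = 0.
  move=> h; rewrite alE [X in fine X](_ : _ = 0%E) ?mulr0//.
  apply: integral0_eq => s /seg_sym; rewrite opprK segP => -[h1 h2].
  rewrite sbump_out// => /andP[h3 h4]; apply: h.
  apply/andP; split.
    apply: le_trans h1; rewrite le_min !ge_min (ltW h3) lerD2r (ltW h3) orbT //.
  apply: (le_trans h2); rewrite ge_max !le_max (ltW h4) lerD2r (ltW h4) orbT //.
have be0 y : ~ (c <= y <= d) -> be y = 0.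
  move=> hy; rewrite /be sbump_out// => /andP[h1 h2]; apply: hy.
  by rewrite !ltW.
have W := weak cal (fun n => C1n_sbump n k c d) dal al0 be0 hO.
have avgE p : avg (- t) g p = t^-1 * (al p.1 * be p.2).
  rewrite /avg normrN.
  have -> : Sx (- t) g p = ((be p.2)%:E * \int[mu]_(s in seg (- t) p.1) (sbump k a b s)%:E)%E.
    have ms := measurable_seg (- t) p.1.
    have mb : measurable_fun (seg (- t) p.1) (fun s => (sbump k a b s)%:E).
      apply/measurable_EFinP; apply: measurable_funTS.
      exact: (continuous_measurable_fun (C1n_sbump 0 k a b)).
    have b0 s : seg (- t) p.1 s -> (0 <= (sbump k a b s)%:E)%E.
      by rewrite lee_fin; have /andP[] := sbump_bound k a b s.
    have be1 : (0 <= (be p.2)%:E)%E.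
      by rewrite lee_fin; have /andP[] := sbump_bound k c d p.2.
    apply: eq_trans (ge0_integralZl mu ms mb b0 be1).
    by apply: eq_integral => s _; rewrite -EFinM /g /= mulrC.
  have fin : (\int[mu]_(s in seg (- t) p.1) (sbump k a b s)%:E)%E \is a fin_num.
    by apply: integrable_fin_num; [exact: measurable_seg|apply: sbump_integrable; exact: measurable_seg].
  rewrite fineM// alE /=; set J := fine (\int[mu]_(s in seg (- t) p.1) (sbump k a b s)%:E)%E.
  have -> : t^-1 = Num.sg t / `|t|.
    by rewrite {1}(numEsg t) invfM invr_sg.
  have s2 : Num.sg t * Num.sg t = 1 by rewrite -expr2 sqr_sg t0.
  rewrite [RHS](_ : _ = (Num.sg t * Num.sg t) * (be p.2 * J / `|t|)); last by ring.
  by rewrite s2 mul1r.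
have Lp := L2_pos_part Lw; have Ln := L2_neg_part Lw.
have Lap : L2 (avg t (pos_part w)) by apply: L2_avg => //; exact: pos_part_ge0.
have Lan : L2 (avg t (neg_part w)) by apply: L2_avg => //; exact: neg_part_ge0.
have Lag : L2 (avg (- t) g) by apply: L2_avg; rewrite ?oppr_eq0.
have i1 : inte (fun p => U (tr (t, 0) p) * g p) by exact: inteM.
have i2 : inte (fun p => U p * g p) by exact: inteM.
have i3 : inte (fun p => savg t w p * g p) by apply: inteM => //; exact: L2_savg.
have i4 : inte (fun p => U p * g (tr (- t, 0) p)) by exact: inteM.
have i5 : inte (fun p => avg t (pos_part w) p * g p) by exact: inteM.
have i6 : inte (fun p => avg t (neg_part w) p * g p) by exact: inteM.
have i7 : inte (fun p => pos_part w p * avg (- t) g p) by exact: inteM.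
have i8 : inte (fun p => neg_part w p * avg (- t) g p) by exact: inteM.
have i9 : inte (fun p => w p * (al p.1 * be p.2)).
  apply: inte_ext (inteZ t (inteM Lw Lag)) => p.
  by rewrite avgE mulrCA mulVKf.
have E1 : Iint (fun p => U (tr (t, 0) p) * g p) = Iint (fun p => U p * g (tr (- t, 0) p)).
  rewrite -(Iint_tr (t, 0) i4).
  by apply: Iint_ext => -[x y]; rewrite /tr /= !addr0 addrK.
have E2 : Iint (fun p => savg t w p * g p) = t^-1 * Iint (fun p => w p * (al p.1 * be p.2)).
  transitivity (Iint (fun p => avg t (pos_part w) p * g p) - Iint (fun p => avg t (neg_part w) p * g p)).
    by rewrite -(IintB i5 i6); apply: Iint_ext => p; rewrite /savg mulrBl.
  rewrite (avg_adjoint _ Lp (pos_part_ge0 w) tg g0) (avg_adjoint _ Ln (neg_part_ge0 w) tg g0).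
  rewrite -(IintB i7 i8) -(IintZ _ i9); apply: Iint_ext => p.
  by rewrite avgE [in RHS](pos_neg_part w p); ring.
transitivity (Iint (fun p => U (tr (t, 0) p) * g p) - Iint (fun p => U p * g p) -
    t * Iint (fun p => savg t w p * g p)).
  rewrite -(IintZ t i3) -(IintB i1 i2) -(IintB (inteB i1 i2) (inteZ t i3)).
  by apply: Iint_ext => p; rewrite /g; ring.
have i10 : inte (fun p => U p * (al' p.1 * be p.2)).
  apply: inte_ext (inteB i2 i4) => p.
  by rewrite /g /be /al' /tr /= addr0; ring.
have E3 : Iint (fun p => U p * g (tr (- t, 0) p)) - Iint (fun p => U p * g p) =
    Iint (fun p => w p * (al p.1 * be p.2)).
  transitivity (-1 * Iint (fun p => U p * (al' p.1 * be p.2))); last first.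
    by rewrite mulN1r [X in - X]W opprK.
  rewrite -(IintB i4 i2) -(IintZ _ i10); apply: Iint_ext => p.
  by rewrite /g /be /al' /tr /= addr0; ring.
by rewrite E2 mulrA divff// mul1r E1 E3 subrr.
Qed.

End FTC.

Definition II {R : realType} (f : pl R -> R) : \bar R := (\int[leb2 R]_p (f p)%:E)%E.
Arguments II {R} f%_ring_scope.

Section II.
Context {R : realType}.
Implicit Types (f g : pl R -> R).

Lemma II_ge0 f : (forall p, 0 <= f p) -> (0 <= II f)%E.
Proof. by move=> f0; apply: integral_ge0 => p _; rewrite lee_fin. Qed.

Lemma II_ext f g : f =1 g -> II f = II g.
Proof. by move=> /funext ->. Qed.

Lemma II_le_ae f g : measurable_fun setT f -> measurable_fun setT g ->
  (forall p, 0 <= f p) -> (forall p, 0 <= g p) ->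
  {ae leb2 R, forall p, f p <= g p} -> (II f <= II g)%E.
Proof.
move=> mf mg f0 g0 fg; apply: ae_ge0_le_integral => //.
- by move=> p _; rewrite lee_fin.
- exact/measurable_EFinP.
- by move=> p _; rewrite lee_fin.
- exact/measurable_EFinP.
- by apply: (ae_mono fg) => p h _; rewrite lee_fin.
Qed.

Lemma II_le f g : measurable_fun setT f -> measurable_fun setT g ->
  (forall p, 0 <= f p) -> (forall p, f p <= g p) -> (II f <= II g)%E.
Proof.
move=> mf mg f0 fg; apply: II_le_ae => //; last exact: aeW.
by move=> p; apply: le_trans (fg p).
Qed.

Lemma IID f g : measurable_fun setT f -> measurable_fun setT g ->
  (forall p, 0 <= f p) -> (forall p, 0 <= g p) -> II (fun p => f p + g p) = (II f + II g)%E.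
Proof.
move=> mf mg f0 g0; rewrite /II -ge0_integralD//.
- by move=> p _; rewrite lee_fin.
- exact/measurable_EFinP.
- by move=> p _; rewrite lee_fin.
- exact/measurable_EFinP.
Qed.

Lemma IIZ k f : measurable_fun setT f -> (forall p, 0 <= f p) -> 0 <= k ->
  II (fun p => k * f p) = (k%:E * II f)%E.
Proof.
move=> mf f0 k0; rewrite /II -ge0_integralZl//.
- exact/measurable_EFinP.
- by move=> p _; rewrite lee_fin.
Qed.

Lemma II_tr f a : measurable_fun setT f -> (forall p, 0 <= f p) ->
  II (fun p => f (tr a p)) = II f.
Proof.
move=> mf f0; apply: (ge0_integral_tr a (f := fun p => (f p)%:E)).
- exact/measurable_EFinP.
- by move=> p; rewrite lee_fin.
Qed.

Lemma II_sw f : measurable_fun setT f -> (forall p, 0 <= f p) ->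
  II (fun p => f (sw p)) = II f.
Proof.
move=> mf f0; apply: (ge0_integral_swap (f := fun p => (f p)%:E)).
- exact/measurable_EFinP.
- by move=> p; rewrite lee_fin.
Qed.

Lemma ae_rat2 (P : rat * rat -> R * R -> Prop) :
  (forall q, {ae leb2 R, forall p, P q p}) -> {ae leb2 R, forall p, forall q, P q p}.
Proof.
move=> h; have H : {ae leb2 R, forall p : pl R, forall n : nat,
    if @unpickle (rat * rat)%type n is Some q then P q p else True}.
  apply/ae_foralln => n; case: (unpickle n) => [q|]; first exact: h.
  exact: aeW.
apply: (ae_mono H) => p hp q; have := hp (pickle q).
by rewrite pickleK.
Qed.

End II.

(** * Increments as averages of the weak derivative, almost everywhere and in L2 *)

Section FTC2.
Context {R : realType}.
Implicit Types (f g : pl R -> R).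
Local Notation mu := (@lebesgue_measure R).

Definition obox (a b c d : R) : set (pl R) := `]a, b[ `*` `]c, d[.

Lemma measurable_obox a b c d : measurable (obox a b c d).
Proof. exact: measurableX. Qed.

Lemma oboxP a b c d p : obox a b c d p <-> (a < p.1 < b) /\ (c < p.2 < d).
Proof. by rewrite /obox /= !in_itv. Qed.

Lemma tame_indic (D : set (pl R)) B : measurable D -> D `<=` box B -> tame (\1_D : pl R -> R).
Proof.
move=> mD DB; split; first exact: measurable_indic.
exists (maxr 1 B) => p; rewrite indicE; split.
  by rewrite le_max normr_nat; case: (_ \in _); rewrite ?lexx ?ler01.
case: (boolP (p \in D)) => [|_]; last by rewrite eqxx.
rewrite inE => /DB/boxP[h1 h2] _; apply/boxP.
by rewrite !le_max h1 h2 !orbT.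
Qed.

Lemma tame_obox a b c d : tame (\1_(obox a b c d) : pl R -> R).
Proof.
apply: (@tame_indic _ (`|a| + `|b| + `|c| + `|d|)); first exact: measurable_obox.
move=> p /oboxP[/andP[q1 q2] /andP[q3 q4]].
have := ler_norm a; have := ler_norm b; have := ler_norm c; have := ler_norm d.
have := ler_norm (- a); have := ler_norm (- b); have := ler_norm (- c); have := ler_norm (- d).
by rewrite !normrN => *; apply/boxP; rewrite !ler_norml; split; apply/andP; split; lra.
Qed.

Lemma indic_obox a b c d p :
  \1_(obox a b c d) p = \1_(`]a, b[%classic) p.1 * \1_(`]c, d[%classic) p.2 :> R.
Proof.
rewrite !indicE -natrM mulnb; congr (nat_of_bool _)%:R.
apply/idP/idP; first by rewrite inE => -[h1 h2]; apply/andP; rewrite !inE.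
by move=> /andP[]; rewrite !inE.
Qed.

Lemma integral_obox_indic G a b c d :
  (\int[leb2 R]_(p in obox a b c d) (G p)%:E = \int[leb2 R]_p (G p * \1_(obox a b c d) p)%:E)%E.
Proof.
rewrite integral_mkcond; apply: eq_integral => p _; rewrite patchE indicE.
by case: (_ \in _); rewrite ?mulr1 ?mulr0.
Qed.

(** Dominated convergence: the tensor bumps are at most the indicator of the open rectangle and
    converge to it. *)
Lemma obox_limit G a b c d : L2 G ->
  (forall k, Iint (fun p => G p * (sbump k a b p.1 * sbump k c d p.2)) = 0) ->
  (\int[leb2 R]_(p in obox a b c d) (G p)%:E = 0)%E.
Proof.
move=> LG h; rewrite integral_obox_indic; have [mG _] := LG.
have tI := tame_obox a b c d; have [mI _] := tI.
have LI := tame_L2 tI.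
pose F k (p : pl R) := (G p * (sbump k a b p.1 * sbump k c d p.2))%:E.
have iF k : (leb2 R).-integrable setT (F k).
  by apply: (inteM LG); apply: tame_L2; exact: tame_bump.
have DC := @dominated_convergence _ _ _ (leb2 R) setT measurableT F
  (fun p => (G p * \1_(obox a b c d) p)%:E) (fun p => (`|G p * \1_(obox a b c d) p|)%:E)
  (fun k => measurable_int _ (iF k)).
have m1 : measurable_fun setT (fun p : pl R => (G p * \1_(obox a b c d) p)%:E).
  by apply/measurable_EFinP; meas.
have c1 : {ae leb2 R, forall p, [set: pl R] p -> F k p @[k --> \oo] --> (G p * \1_(obox a b c d) p)%:E}.
  apply: aeW => p _; apply: cvg_EFin; first exact: nearW.
  rewrite /comp /= indic_obox; apply: cvgM; first exact: cvg_cst.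
  by apply: cvgM; exact: cvg_sbump.
have i1 : (leb2 R).-integrable setT (fun p : pl R => (`|G p * \1_(obox a b c d) p|)%:E).
  exact: (integrable_norm (inteM LG LI)).
have d1 : {ae leb2 R, forall p, forall n : nat, [set: pl R] p -> (`|F n p| <= (`|G p * \1_(obox a b c d) p|)%:E)%E}.
  apply: aeW => p n _; rewrite /F lee_fin normrM [in leRHS]normrM ler_wpM2l//.
  have /andP[h1 h2] := sbump_bound n a b p.1.
  have /andP[h3 h4] := sbump_bound n c d p.2.
  rewrite (ger0_norm (mulr_ge0 h1 h3)) indicE normr_nat.
  case: (boolP (p \in _)) => [_|].
    by rewrite -(mulr1 1%:R); exact: (ler_pM h1 h3 h2 h4).
  rewrite notin_setE => np.
  have [e|/negP e] := boolP (a < p.1 < b); last by rewrite (sbump_out n e) mul0r.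
  have [e'|/negP e'] := boolP (c < p.2 < d); last by rewrite (sbump_out n e') mulr0.
  by exfalso; apply: np; apply/oboxP.
have [_ _ cv] := DC m1 c1 i1 d1.
have F0 k : (\int[leb2 R]_p F k p = 0)%E.
  have := h k; rewrite /Iint /Rintegral -/(F k).
  have fin : (\int[leb2 R]_p F k p)%E \is a fin_num by exact: integrable_fin_num.
  by move=> e; rewrite -(fineK fin); congr (_%:E).
rewrite -(cvg_lim _ cv)//.
have -> : [sequence (\int[leb2 R]_p F n p)%E]_n = (fun=> 0%E) by apply/funext => k; exact: F0.
by rewrite lim_cst.
Qed.

Lemma setI_closed_ray : setI_closed (@RGenOInfty.G R).
Proof.
move=> _ _ [x ->] [y ->]; exists (maxr x y); apply/seteqP; split=> z /=; rewrite !in_itv /= !andbT gt_max.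
  by move=> [-> ->].
by move=> /andP[].
Qed.

(** Vanishing integrals pass from rectangles to Borel sets in the first coordinate, then in the
    second, then to all Borel sets of the plane; a function whose integrals all vanish is 0 almost
    everywhere. *)
Lemma ae0_of_boxes (G : pl R -> R) (a0 b0 c0 d0 : R) : L2 G ->
  (forall a b c d, a0 <= a -> b <= b0 -> c0 <= c -> d <= d0 ->
     (\int[leb2 R]_(p in obox a b c d) (G p)%:E = 0)%E) ->
  {ae leb2 R, forall p, obox a0 b0 c0 d0 p -> G p = 0}.
Proof.
move=> LG h; have [mG _] := LG; set Q := obox a0 b0 c0 d0.
have tQ := tame_obox a0 b0 c0 d0.
pose g p := G p * \1_Q p.
have ig : inte g by apply: (inteM LG); exact: tame_L2.
have mQ : measurable Q by exact: measurable_obox.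
have gE (E : set (pl R)) : E `<=` Q -> (\int[leb2 R]_(p in E) (g p)%:E = \int[leb2 R]_(p in E) (G p)%:E)%E.
  move=> EQ; apply: eq_integral => p /[!inE] /EQ Qp.
  by rewrite /g indicE mem_set// mulr1.
have GR : @measurable _ (measurableTypeR R) = <<s @RGenOInfty.G R >>.
  exact: RGenOInfty.measurableE.
have sub a b c d : a0 <= a -> b <= b0 -> c0 <= c -> d <= d0 -> obox a b c d `<=` Q.
  move=> ha hb hc hd p /oboxP[/andP[k1 k2] /andP[k3 k4]]; apply/oboxP.
  rewrite (le_lt_trans ha k1) (lt_le_trans k2 hb).
  by rewrite (le_lt_trans hc k3) (lt_le_trans k4 hd).
have hg a b c d : a0 <= a -> b <= b0 -> c0 <= c -> d <= d0 ->
     (\int[leb2 R]_(p in obox a b c d) (g p)%:E = 0)%E.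
  by move=> ha hb hc hd; rewrite gE ?h//; exact: sub.
have S1 c : c0 <= c -> forall A, measurable A ->
    (\int[leb2 R]_(p in (@fst R R : pl R -> measurableTypeR R) @^-1` A `&` obox a0 b0 c d0) (g p)%:E = 0)%E.
  move=> hc; apply: (dynkin_integral0 GR setI_closed_ray measurable_fst) => //.
  - exact: measurable_obox.
  - exact: hg.
  - move=> _ [x ->].
    rewrite (_ : _ `&` _ = obox (maxr x a0) b0 c d0); last first.
      apply/seteqP; split=> p; rewrite /obox /= !in_itv /= !andbT gt_max.
        by move=> [-> [/andP[-> ->] ->]].
      by move=> [/andP[/andP[-> ->] ->] ->].
    by apply: hg => //; rewrite le_max lexx orbT.
have S2 A : measurable A -> forall B, measurable B ->
    (\int[leb2 R]_(p in (@snd R R : pl R -> measurableTypeR R) @^-1` B `&` ((@fst R R : pl R -> measurableTypeR R) @^-1` A `&` Q)) (g p)%:E = 0)%E.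
  move=> mA; apply: (dynkin_integral0 GR setI_closed_ray measurable_snd) => //.
  - by apply: measurableI => //; rewrite -[X in measurable X]setTI; exact: measurable_fst.
  - exact: S1.
  - move=> _ [y ->].
    rewrite (_ : _ `&` _ = (@fst R R : pl R -> measurableTypeR R) @^-1` A `&` obox a0 b0 (maxr y c0) d0); last first.
      apply/seteqP; split=> p; rewrite /Q /obox /= !in_itv /= !andbT gt_max.
        by move=> [-> [pA [/andP[-> ->] /andP[-> ->]]]].
      by move=> [pA [/andP[-> ->] /andP[/andP[-> ->] ->]]].
    by apply: S1 => //; rewrite le_max lexx orbT.
have S3 E : measurable E -> (\int[leb2 R]_(p in idfun @^-1` E `&` Q) (g p)%:E = 0)%E.
  pose XX : set (set (pl R)) := [set A `*` B | A in @measurable _ (measurableTypeR R) & B in @measurable _ (measurableTypeR R)].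
  apply: (dynkin_integral0 (T := pl R) (pi := idfun) (G := XX)) => //.
  - exact: measurable_prod_measurableType.
  - move=> _ _ [A1 mA1 [B1 mB1 <-]] [A2 mA2 [B2 mB2 <-]].
    exists (A1 `&` A2); first exact: measurableI.
    by exists (B1 `&` B2); [exact: measurableI|rewrite setXI].
  - exact: measurable_id.
  - exact: hg.
  - move=> _ [A mA [B mB <-]].
    have := S2 A mA B mB; congr (_ = _); congr (integral _ _ _).
    by apply/seteqP; split=> p; [move=> [h1 [h2 h3]]|move=> [[h1 h2] h3]].
have := @integral_ae_eq _ _ _ (leb2 R) Q mQ (cst 0%E) (EFin \o g) (integrableS measurableT mQ (@subsetT _ _) ig) (@measurable_cst _ _ _ _ Q 0%E).
move=> H; have {H} : ae_eq (leb2 R) Q (EFin \o g) (cst 0%E).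
  apply: H => E EQ mE; rewrite integral0.
  rewrite -(S3 E mE); congr (integral _ _ _); apply/seteqP; split=> p /=; last by case.
  by move=> Ep; split=> //; exact: EQ.
move=> H; apply: (ae_mono H) => p /= hp Qp; have := hp Qp => /= -[].
by rewrite /g indicE mem_set// mulr1.
Qed.

Variables (U w : pl R -> R) (O : set (R * R)).
Hypotheses (LU : L2 U) (Lw : L2 w) (weak : weak_x U w O).

Lemma ftc_obox (a b c d t : R) : t != 0 ->
  `[minr a (a + t), maxr b (b + t)] `*` `[c, d] `<=` O ->
  {ae leb2 R, forall p, obox a b c d p -> U (tr (t, 0) p) - U p = t * savg t w p}.
Proof.
move=> t0 hO.
pose G (p : pl R) := U (tr (t, 0) p) - U p - t * savg t w p.
have LG : L2 G.
  apply: L2B; first by apply: L2B => //; exact: L2_tr.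
  by apply: L2Z; exact: L2_savg.
have : {ae leb2 R, forall p, obox a b c d p -> G p = 0}.
  apply: ae0_of_boxes => // a' b' c' d' ha hb hc hd.
  apply: obox_limit => // k; apply: (ftc_sbump LU Lw weak k t0).
  apply: subset_trans hO => p /=; rewrite !in_itv /= !ge_min !le_max.
  move=> [/andP[h1 h2] /andP[h3 h4]]; split; apply/andP; split.
  - by case/orP: h1 => h1; apply/orP; [left|right]; lra.
  - by case/orP: h2 => h2; apply/orP; [left|right]; lra.
  - exact: le_trans h3.
  - exact: le_trans hd.
by move=> H; apply: (ae_mono H) => p hp /hp /eqP; rewrite /G subr_eq0 => /eqP.
Qed.

(** Measured in the maximum norm, to match the rectangles on which weak derivatives are tested. *)
Definition margin (S : set (R * R)) (e : R) :=
  forall p, S p -> forall q : R * R, `|q.1 - p.1| <= e -> `|q.2 - p.2| <= e -> O q.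

Lemma rat_near (x e : R) : 0 < e -> exists q : rat, `|x - ratr q| < e.
Proof.
move=> e0; have [q] := @rat_in_itvoo R (x - e) (x + e) ltac:(lra).
rewrite in_itv /= => /andP[h1 h2]; exists q.
by rewrite ltr_norml; lra.
Qed.

(** Countably many squares of half-side [e / 2] with rational centres cover [S]. A square that meets
    [S] at [p] lies within [e] of [p], and the step adds at most another [e]. *)
Lemma ftc_margin (S : set (R * R)) (e t : R) : t != 0 -> `|t| <= e -> margin S (2 * e) ->
  {ae leb2 R, forall p, S p -> U (tr (t, 0) p) - U p = t * savg t w p}.
Proof.
move=> t0 te hS; have e0 : 0 < e by apply: lt_le_trans te; rewrite normr_gt0.
pose h := e / 2.
pose Q (q : rat * rat) := obox (ratr q.1 - h) (ratr q.1 + h) (ratr q.2 - h) (ratr q.2 + h).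
have H : {ae leb2 R, forall p, forall q : rat * rat,
   `[minr (ratr q.1 - h) (ratr q.1 - h + t), maxr (ratr q.1 + h) (ratr q.1 + h + t)] `*` `[ratr q.2 - h, ratr q.2 + h] `<=` O ->
   Q q p -> U (tr (t, 0) p) - U p = t * savg t w p}.
  apply: ae_rat2 => q.
  have [hq|hq] := pselect (`[minr (ratr q.1 - h) (ratr q.1 - h + t), maxr (ratr q.1 + h) (ratr q.1 + h + t)] `*` `[ratr q.2 - h, ratr q.2 + h] `<=` O); last first.
    by apply: aeW => p /hq.
  by apply: (ae_mono (ftc_obox t0 hq)) => p hp _; exact: hp.
have h0 : 0 < h by rewrite /h; lra.
apply: (ae_mono H) => p hp Sp.
have [q1 hq1] := rat_near p.1 h0; have [q2 hq2] := rat_near p.2 h0.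
move: hq1 hq2; rewrite !ltr_norml => /andP[k1 k2] /andP[k3 k4].
apply: (hp (q1, q2)); last by apply/oboxP => /=; split; apply/andP; split; lra.
move=> z /=; rewrite !in_itv /= => -[/andP[z1 z2] /andP[z3 z4]].
move: te; rewrite ler_norml => /andP[t1 t2].
apply: (hS _ Sp); rewrite ler_norml; rewrite /h in k1 k2 k3 k4 z1 z2 z3 z4 *; last by apply/andP; split; lra.
apply/andP; split.
  by move: z1; rewrite ge_min => /orP[]; lra.
by move: z2; rewrite le_max => /orP[]; lra.
Qed.

Definition rem_x (t : R) (p : R * R) : R := (U (tr (t, 0) p) - U p) / t - w p.

Lemma measurable_rem_x t : measurable_fun setT (rem_x t : pl R -> R).
Proof. by have [mU _] := LU; have [mw _] := Lw; rewrite /rem_x; meas. Qed.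

Lemma savg_L2_cvg (t_ : nat -> R) : (forall n, t_ n != 0) -> t_ @ \oo --> 0 ->
  (II (fun p => ((savg (t_ n) w p - w p) ^+ 2)%R) @[n --> \oo] --> 0)%E.
Proof.
move=> tn0 t0.
have Lp := L2_pos_part Lw; have Ln := L2_neg_part Lw.
have [mp p2] := Lp; have [mn n2] := Ln.
have c1 := L2_avg_cvg mp (pos_part_ge0 w) p2 tn0 t0.
have c2 := L2_avg_cvg mn (neg_part_ge0 w) n2 tn0 t0.
have ma n := measurable_avg (t_ n) mp (pos_part_ge0 w).
have mb n := measurable_avg (t_ n) mn (neg_part_ge0 w).
have [mw _] := Lw.
apply: (@squeeze_cvge _ _ _ _ (fun=> 0%E) _ (fun n => 2%:E * II (fun p => ((avg (t_ n) (pos_part w) p - pos_part w p) ^+ 2)%R) + 2%:E * II (fun p => ((avg (t_ n) (neg_part w) p - neg_part w p) ^+ 2)%R))%E).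
- apply: nearW => n; have man := ma n; have mbn := mb n.
  rewrite II_ge0 /=; last by move=> p; exact: sqr_ge0.
  rewrite -!IIZ//; [|by meas|by move=> p; exact: sqr_ge0|by meas|by move=> p; exact: sqr_ge0].
  rewrite -IID; [|by meas|by meas|by move=> p; rewrite mulr_ge0// sqr_ge0|by move=> p; rewrite mulr_ge0// sqr_ge0].
  apply: II_le; [by rewrite /savg; meas|by meas|by move=> p; exact: sqr_ge0|].
  move=> p; rewrite /savg [in X in _ - X](pos_neg_part w p).
  set x := avg _ _ p; set y := avg _ (neg_part w) p; set z := pos_part w p; set v := neg_part w p.
  by have := sqr_ge0 (x - z + (y - v)); rewrite !expr2; lra.
- exact: cvg_cst.
- rewrite -[X in _ --> X](adde0 0%E); apply: cvgeD => //.
    by rewrite -[X in _ --> X](mule0 2%:E); apply: cvgeM => //; exact: cvg_cst.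
  by rewrite -[X in _ --> X](mule0 2%:E); apply: cvgeM => //; exact: cvg_cst.
Qed.

(** By [ftc_margin] the remainder is eventually the deviation of [w] from its average, which tends
    to 0 in L2. *)
Lemma rem_x_cvg (S : set (pl R)) e (t_ : nat -> R) : measurable S -> 0 < e -> margin S e ->
  (forall n, t_ n != 0) -> t_ @ \oo --> 0 ->
  (II (fun p => (\1_S p * rem_x (t_ n) p ^+ 2)%R) @[n --> \oo] --> 0)%E.
Proof.
move=> mS e0 hS tn0 t0; have [mw _] := Lw.
have e2 : 0 < e / 2 by lra.
apply: (@squeeze_cvge _ _ _ _ (fun=> 0%E) _ (fun n => II (fun p => ((savg (t_ n) w p - w p) ^+ 2)%R))).
- have : \forall n \near \oo, `|t_ n| <= e / 2.
    by move/cvgrPdist_le : t0 => /(_ _ e2); apply: filterS => n; rewrite sub0r normrN.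
  apply: filterS => n tn.
  have I0 p : 0 <= (\1_S p : R) by rewrite indicE.
  have mr := measurable_rem_x (t_ n).
  have [ms _] := L2_savg Lw (tn0 n).
  rewrite II_ge0 /=; last by move=> p; rewrite mulr_ge0// sqr_ge0.
  apply: II_le_ae.
  + by apply: measurable_funM; [exact: measurable_indic|meas].
  + by meas.
  + by move=> p; rewrite mulr_ge0// sqr_ge0.
  + by move=> p; exact: sqr_ge0.
  + have hS' : margin S (2 * (e / 2)) by rewrite mulrCA divff ?mulr1.
    apply: (ae_mono (ftc_margin (tn0 n) tn hS')) => p hp.
    rewrite indicE; case: (boolP (p \in S)) => [/set_mem Sp|_]; last by rewrite mul0r sqr_ge0.
    by rewrite mul1r /rem_x hp// mulrAC divff// mul1r.
- exact: cvg_cst.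
- exact: savg_L2_cvg.
Qed.

(** Averages contract the L2 norm; the factor 2 is the price for averaging the positive and the
    negative part separately. *)
Lemma translation_x (S : set (pl R)) e t : measurable S -> margin S (2 * e) -> `|t| <= e ->
  (II (fun p => (\1_S p * (U (tr (t, 0) p) - U p) ^+ 2)%R) <= (2 * t ^+ 2)%:E * II (fun p => (w p ^+ 2)%R))%E.
Proof.
move=> mS hS te; have [mw w2] := Lw; have [mU _] := LU.
have I0 p : 0 <= (\1_S p : R) by rewrite indicE.
have [->|t0] := eqVneq t 0.
  rewrite expr0n /= mulr0 mul0e.
  rewrite (II_ext (g := fun=> 0)); last first.
    by move=> -[x y]; rewrite /tr /= !addr0 subrr expr0n /= mulr0.
  by rewrite /II integral0.
have Lp := L2_pos_part Lw; have Ln := L2_neg_part Lw.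
have [mp p2] := Lp; have [mn n2] := Ln.
have ma := measurable_avg t mp (pos_part_ge0 w).
have mb := measurable_avg t mn (neg_part_ge0 w).
have t2 : 0 <= 2 * t ^+ 2 by rewrite mulr_ge0// sqr_ge0.
apply: (@le_trans _ _ (II (fun p => (2 * t ^+ 2) * (avg t (pos_part w) p ^+ 2 + avg t (neg_part w) p ^+ 2)))).
  apply: II_le_ae.
  - by apply: measurable_funM; [exact: measurable_indic|meas].
  - by meas.
  - by move=> p; rewrite mulr_ge0// sqr_ge0.
  - by move=> p; exact: mulr_ge0 t2 (addr_ge0 (sqr_ge0 _) (sqr_ge0 _)).
  - apply: (ae_mono (ftc_margin t0 te hS)) => p hp.
    rewrite indicE; case: (boolP (p \in S)) => [/set_mem Sp|_]; last first.
      by rewrite mul0r; exact: mulr_ge0 t2 (addr_ge0 (sqr_ge0 _) (sqr_ge0 _)).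
    rewrite mul1r hp// /savg; set x := avg _ _ p; set y := avg _ _ p.
    rewrite -subr_ge0 [leRHS](_ : _ = t ^+ 2 * (x + y) ^+ 2); last by ring.
    by rewrite mulr_ge0 ?sqr_ge0.
rewrite IIZ//; [|by meas|by move=> p; rewrite addr_ge0// sqr_ge0].
rewrite IID; [|by meas|by meas|by move=> p; exact: sqr_ge0|by move=> p; exact: sqr_ge0].
apply: lee_wpmul2l; first by rewrite lee_fin.
apply: (@le_trans _ _ (II (fun p => (pos_part w p ^+ 2)%R) + II (fun p => (neg_part w p ^+ 2)%R))%E).
  by apply: leeD; apply: integral_avg_sqr => //; [exact: pos_part_ge0|exact: neg_part_ge0].
rewrite -IID; [|by meas|by meas|by move=> p; exact: sqr_ge0|by move=> p; exact: sqr_ge0].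
apply: II_le; [by meas|by meas|by move=> p; rewrite addr_ge0// sqr_ge0|].
move=> p; rewrite /pos_part /neg_part; have [h|h] := leP 0 (w p).
  by rewrite max_l ?oppr_le0// expr0n addr0.
by rewrite expr0n add0r max_r ?sqrrN// oppr_ge0 ltW.
Qed.

End FTC2.

(** * The energy inequality on superlevel sets *)

Section Pointwise.
Context {R : realType}.
Implicit Types (x y z t k s a b u n e G B E : R).

Definition pp x : R := maxr 0 x.

Lemma pp_ge0 x : 0 <= pp x. Proof. by rewrite le_max lexx. Qed.

Lemma pp_ge x : x <= pp x. Proof. by rewrite le_max lexx orbT. Qed.

Lemma pp_pos x : 0 <= x -> pp x = x.
Proof. by move=> x0; rewrite /pp max_r. Qed.

Lemma pp_neg x : x <= 0 -> pp x = 0.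
Proof. by move=> x0; rewrite /pp max_l. Qed.

(** Equal to 0, [z^2 / 2] and [z - 1/2] on the three ranges separated by 0 and 1; it is [psi] with
    [s = 0] and [k = 1]. *)
Definition phi z : R := (pp z ^+ 2 - pp (z - 1) ^+ 2) / 2.
Definition dphi z : R := pp z - pp (z - 1).

Lemma phi_cases z : [\/ [/\ z <= 0, phi z = 0 & dphi z = 0],
  [/\ 0 <= z, z <= 1, phi z = z ^+ 2 / 2 & dphi z = z] |
  [/\ 1 <= z, phi z = z - 2^-1 & dphi z = 1]].
Proof.
rewrite /phi /dphi; have [h|h] := leP z 0.
  by apply: Or31; rewrite !pp_neg; try lra; split; rewrite // ?expr0n /= ?subrr ?mul0r.
have [h'|h'] := leP z 1.
  by apply: Or32; rewrite (pp_pos (ltW h)) (pp_neg (x := z - 1)); [split; lra|lra].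
by apply: Or33; rewrite (pp_pos (ltW h)) (pp_pos (x := z - 1)); [split; lra|lra].
Qed.

(** The quadratic bound makes the remainder small for small increments; the linear one allows
    domination when the increments are merely square integrable. *)
Lemma phi_taylor z z' : `|phi z' - phi z - dphi z * (z' - z)| <= `|z' - z| /\
   `|phi z' - phi z - dphi z * (z' - z)| <= (z' - z) ^+ 2.
Proof.
have H : `|phi z' - phi z - dphi z * (z' - z)| <= `|z' - z|.
  have [[h1 -> ->]|[h1 h2 -> ->]|[h1 -> ->]] := phi_cases z;
  have [[k1 -> _]|[k1 k2 -> _]|[k1 -> _]] := phi_cases z';
  rewrite ler_norml; have [d|d] := leP 0 (z' - z); rewrite ?(ger0_norm d) ?(ltr0_norm d);
  apply/andP; split; nra.
split=> //.
have s1 := sqr_ge0 (z' - z); have s2 := sqr_ge0 (z' - 1); have s3 := sqr_ge0 (z - 1).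
have [[h1 -> ->]|[h1 h2 -> ->]|[h1 -> ->]] := phi_cases z;
have [[k1 -> _]|[k1 k2 -> _]|[k1 -> _]] := phi_cases z';
rewrite ler_norml; apply/andP; split; nra.
Qed.

Lemma phi_lip z z' : `|phi z' - phi z| <= `|z' - z|.
Proof.
have [[h1 -> _]|[h1 h2 -> _]|[h1 -> _]] := phi_cases z;
have [[k1 -> _]|[k1 k2 -> _]|[k1 -> _]] := phi_cases z';
rewrite ler_norml; have [d|d] := leP 0 (z' - z); rewrite ?(ger0_norm d) ?(ltr0_norm d);
apply/andP; split; nra.
Qed.

(** The last inequality bounds [phi] by the square root of its derivative; this lets the term with
    the gradient of the cut-off be absorbed into the energy, which carries the weight [dphi]. *)
Lemma phi_bounds z : [/\ 0 <= phi z, phi z <= pp z, 0 <= dphi z, dphi z <= 1 &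
  phi z ^+ 2 <= dphi z * pp z ^+ 2].
Proof.
have [[h1 -> ->]|[h1 h2 -> ->]|[h1 -> ->]] := phi_cases z.
- by rewrite pp_neg// expr0n /= mulr0; split.
- rewrite pp_pos//; have h3 : z ^+ 2 <= z by rewrite expr2 ler_piMl.
  have h4 := sqr_ge0 z; split=> //; [lra|lra|].
  rewrite -subr_ge0 [leRHS](_ : _ = z ^+ 3 * (1 - z / 4)); last by field.
  by apply: mulr_ge0; [exact: exprn_ge0|lra].
- by rewrite pp_pos; [split; nra|lra].
Qed.

(* A C^{1,1} approximation of [(x - s)_+]: its derivative [dpsi s k] grows linearly
   from 0 to 1 on [[s, s + k]]. *)
Definition psi s k x : R := k * phi ((x - s) / k).
Definition dpsi s k x : R := dphi ((x - s) / k).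

Lemma pp_divr x k : 0 < k -> pp (x / k) = pp x / k.
Proof.
move=> k0; have [h|h] := leP 0 x.
  by rewrite !pp_pos// divr_ge0// ltW.
by rewrite !pp_neg ?mul0r// ?ltW// pmulr_llt0 ?invr_gt0.
Qed.

Lemma psi_bounds s k x : 0 < k -> [/\ 0 <= psi s k x, psi s k x <= pp (x - s),
  0 <= dpsi s k x, dpsi s k x <= 1 & psi s k x ^+ 2 <= dpsi s k x * pp (x - s) ^+ 2].
Proof.
move=> k0; have [h1 h2 h3 h4 h5] := phi_bounds ((x - s) / k); rewrite /psi /dpsi.
have kn : k != 0 by rewrite gt_eqF.
split=> //.
- by rewrite mulr_ge0// ltW.
- rewrite pp_divr// in h2; have := ler_wpM2l (ltW k0) h2.
  by rewrite [X in _ <= X]mulrCA divff ?mulr1.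
- rewrite pp_divr// in h5; rewrite exprMn.
  have := ler_wpM2l (sqr_ge0 k) h5.
  by rewrite (_ : k ^+ 2 * (dphi ((x - s) / k) * (pp (x - s) / k) ^+ 2) = dphi ((x - s) / k) * pp (x - s) ^+ 2)//; field.
Qed.

Lemma psi0 s k x : 0 < k -> x <= s -> psi s k x = 0 /\ dpsi s k x = 0.
Proof.
move=> k0 xs; rewrite /psi /dpsi.
have h : (x - s) / k <= 0 by rewrite pmulr_lle0 ?invr_gt0// subr_le0.
have [[_ -> ->]|[h1 h2 -> ->]|[h1 _ _]] := phi_cases ((x - s) / k); rewrite ?mulr0//; last lra.
by rewrite (_ : (x - s) / k = 0) ?expr0n /= ?mul0r ?mulr0//; lra.
Qed.

Lemma dpsi1 s k x : 0 < k -> s + k <= x -> dpsi s k x = 1.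
Proof.
move=> k0 xs; rewrite /dpsi.
have h : 1 <= (x - s) / k by rewrite ler_pdivlMr// mul1r; lra.
by have [[h1 _ _]|[h1 h2 _ ->]|[h1 _ ->]] := phi_cases ((x - s) / k) => //; lra.
Qed.

Lemma psi_lip s k x x' : 0 < k -> `|psi s k x' - psi s k x| <= `|x' - x|.
Proof.
move=> k0; rewrite /psi -mulrBr normrM (gtr0_norm k0).
apply: (le_trans (ler_wpM2l (ltW k0) (phi_lip _ _))).
rewrite (_ : (x' - s) / k - (x - s) / k = (x' - x) / k); last by rewrite -mulrBl; congr (_ / _); ring.
by rewrite normrM normfV (gtr0_norm k0) mulrCA divff ?mulr1// gt_eqF.
Qed.

Lemma psi_taylor s k x x' : 0 < k ->
  `|psi s k x' - psi s k x - dpsi s k x * (x' - x)| <= `|x' - x| * minr 1 (`|x' - x| / k).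
Proof.
move=> k0; have kn : k != 0 by rewrite gt_eqF.
have [h1 h2] := phi_taylor ((x - s) / k) ((x' - s) / k).
rewrite (_ : (x' - s) / k - (x - s) / k = (x' - x) / k) in h1 h2; last by rewrite -mulrBl; congr (_ / _); ring.
have -> : psi s k x' - psi s k x - dpsi s k x * (x' - x) =
   k * (phi ((x' - s) / k) - phi ((x - s) / k) - dphi ((x - s) / k) * ((x' - x) / k)).
  by rewrite /psi /dpsi; field.
rewrite normrM (gtr0_norm k0).
have e : `|(x' - x) / k| = `|x' - x| / k by rewrite normrM normfV (gtr0_norm k0).
have [m|m] := leP 1 (`|x' - x| / k).
  rewrite mulr1; apply: (le_trans (ler_wpM2l (ltW k0) h1)).
  by rewrite e mulrCA divff ?mulr1.
apply: (le_trans (ler_wpM2l (ltW k0) h2)).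
rewrite -real_normK ?num_real// e.
by rewrite [leLHS](_ : _ = `|x' - x| * (`|x' - x| / k))//; field.
Qed.

(** A product rule for the difference quotient of [eta^2 psi(u)], with the derivative of [psi] as
    main term; [a] is the quotient of [u], and [G] bounds that of [eta]. *)
Lemma quot_bound s k t u0 a e0 e1 G B n : 0 < k -> t != 0 -> 0 <= e0 <= 1 -> 0 <= e1 <= 1 ->
  `|e1 - e0| <= `|t| * G -> 0 <= G -> psi s k u0 <= B -> `|a| <= n ->
  `|(e1 ^+ 2 * psi s k (u0 + t * a) - e0 ^+ 2 * psi s k u0) / t - e0 ^+ 2 * dpsi s k u0 * a| <=
   n * minr 1 (`|t| * n / k) + 2 * G * e0 * psi s k u0 + G ^+ 2 * B * `|t| + 2 * G * `|t| * n.
Proof.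
move=> k0 t0 /andP[e00 e01] /andP[e10 e11] eG G0 PB an.
have n0 : 0 <= n := le_trans (normr_ge0 a) an.
set P0 := psi s k u0 in PB *; set P1 := psi s k (u0 + t * a); set d := dpsi s k u0.
have T := psi_taylor s u0 (u0 + t * a) k0; have Lp := psi_lip s u0 (u0 + t * a) k0.
have [P00 _ d0 d1 _] := psi_bounds s u0 k0; rewrite -/P0 -/d in P00 d0 d1.
rewrite (addrC u0) addrK (addrC _ u0) -/P0 -/P1 -/d in T Lp.
have tp : 0 < `|t| by rewrite normr_gt0.
set e := (e1 - e0) / t.
have eE : e1 = e0 + t * e by rewrite /e mulrC divfK// addrC subrK.
have He : `|e| <= G by rewrite /e normrM normfV ler_pdivrMr// mulrC.
set q := (P1 - P0) / t.
have qE : P1 = P0 + t * q by rewrite /q mulrC divfK// addrC subrK.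
have Hq : `|q| <= n.
  rewrite /q normrM normfV ler_pdivrMr//; apply: (le_trans Lp).
  by rewrite normrM mulrC ler_wpM2r.
have Hqd : `|q - d * a| <= n * minr 1 (`|t| * n / k).
  have -> : q - d * a = (P1 - P0 - d * (t * a)) / t by rewrite /q; field.
  rewrite normrM normfV ler_pdivrMr//; apply: (le_trans T).
  rewrite normrM [leRHS](_ : _ = (`|t| * n) * minr 1 (`|t| * n / k)); last by ring.
  have tan : `|t| * `|a| <= `|t| * n by rewrite ler_wpM2l.
  apply: ler_pM => //; first by rewrite le_min ler01 divr_ge0 ?mulr_ge0// ltW.
  by rewrite le_min !ge_min lexx /= ler_pM2r ?invr_gt0// tan orbT.
have -> : (e1 ^+ 2 * P1 - e0 ^+ 2 * P0) / t - e0 ^+ 2 * d * a =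
   e0 ^+ 2 * (q - d * a) + e * (2 * e0 * P0 + t * e * P0 + (e0 + e1) * (t * q)).
  by rewrite qE eE; field.
have h1 : `|e0 ^+ 2 * (q - d * a)| <= n * minr 1 (`|t| * n / k).
  rewrite normrM ger0_norm ?sqr_ge0//; apply: le_trans Hqd; rewrite ler_piMl//.
  by rewrite expr_le1.
have h2 : `|2 * e0 * P0 + t * e * P0 + (e0 + e1) * (t * q)| <= 2 * e0 * P0 + `|t| * G * B + 2 * (`|t| * n).
  apply: (le_trans (ler_normD _ _)); apply: lerD.
    apply: (le_trans (ler_normD _ _)); apply: lerD.
      by rewrite ger0_norm// mulr_ge0// mulr_ge0.
    by rewrite 2!normrM -!mulrA ler_wpM2l// ler_pM// ger0_norm.
  rewrite normrM [X in _ * X]normrM; apply: ler_pM => //.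
    by rewrite ger0_norm ?addr_ge0//; lra.
  by rewrite ler_wpM2l.
apply: (le_trans (ler_normD _ _)); rewrite -2![leRHS]addrA lerD// normrM addrA.
have := ler_pM (normr_ge0 _) (normr_ge0 _) He h2 => h3; apply: (le_trans h3).
by rewrite le_eqVlt; apply/orP; left; apply/eqP; ring.
Qed.

(** The pointwise Caccioppoli inequality. Half of the coercivity [n^2 / 10] is spent on the gradient
    of the cut-off. The errors are that of the ellipticity, the cut-off term [G^2 y^2], and terms
    that vanish with [t]. *)
Lemma cell_lower s k t u0 a1 a2 b1 b2 e0 e1 e2 G B n E y : 0 < k -> t != 0 ->
  0 <= e0 <= 1 -> 0 <= e1 <= 1 -> 0 <= e2 <= 1 ->
  `|e1 - e0| <= `|t| * G -> `|e2 - e0| <= `|t| * G -> 0 <= G -> psi s k u0 <= B ->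
  0 <= n -> n ^+ 2 = a1 ^+ 2 + b1 ^+ 2 + a2 ^+ 2 + b2 ^+ 2 -> y = pp (u0 - s) ->
  (s < u0 -> n ^+ 2 / 10 - E <= a1 * b2 - a2 * b1) ->
  e0 ^+ 2 * dpsi s k u0 * (n ^+ 2 / 20) <=
    ((e1 ^+ 2 * psi s k (u0 + t * a1) - e0 ^+ 2 * psi s k u0) * (t * b2) -
     (e2 ^+ 2 * psi s k (u0 + t * a2) - e0 ^+ 2 * psi s k u0) * (t * b1)) / t ^+ 2 +
    (e0 ^+ 2 * dpsi s k u0 * E + 80 * (G ^+ 2 * y ^+ 2) +
     (2 * (minr 1 (`|t| * n / k) * n ^+ 2) + `|t| * ((1 + 4 * G) * n ^+ 2 + G ^+ 4 * B ^+ 2))).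
Proof.
move=> k0 t0 h0 h1 h2 eG1 eG2 G0 PB n0 nE yE HJ.
have le_n (x w : R) : 0 <= w -> n ^+ 2 = x ^+ 2 + w -> `|x| <= n.
  by move=> w0 e; rewrite -(ler_pXn2r (n := 2))// ?nnegrE// real_normK ?num_real// e; lra.
have [A1 A2 A3 A4] : [/\ `|a1| <= n, `|a2| <= n, `|b1| <= n & `|b2| <= n].
  have := sqr_ge0 a1; have := sqr_ge0 a2; have := sqr_ge0 b1; have := sqr_ge0 b2.
  move=> *; split; [apply: (le_n _ (b1^+2 + a2^+2 + b2^+2))|apply: (le_n _ (b1^+2 + a1^+2 + b2^+2))|apply: (le_n _ (a1^+2 + a2^+2 + b2^+2))|apply: (le_n _ (b1^+2 + a2^+2 + a1^+2))]; lra.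
have := quot_bound k0 t0 h0 h1 eG1 G0 PB A1; have := quot_bound k0 t0 h0 h2 eG2 G0 PB A2.
set q2 := _ / t; set q1 := (_ - _) / t.
set T := n * _ + _ + _ + _ => Q2 Q1.
have T0 : 0 <= T by apply: le_trans Q1.
have -> : ((e1 ^+ 2 * psi s k (u0 + t * a1) - e0 ^+ 2 * psi s k u0) * (t * b2) -
     (e2 ^+ 2 * psi s k (u0 + t * a2) - e0 ^+ 2 * psi s k u0) * (t * b1)) / t ^+ 2 = q1 * b2 - q2 * b1.
  by rewrite /q1 /q2; field.
have [P00 _ d0 d1 Py] := psi_bounds s u0 k0; rewrite -yE in Py.
set P0 := psi s k u0 in P00 Py T Q1 Q2 T0 PB *; set d := dpsi s k u0 in d0 d1 Py Q1 Q2 *.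
have J : e0 ^+ 2 * d * (n ^+ 2 / 10 - E) <= e0 ^+ 2 * d * (a1 * b2 - a2 * b1).
  have [us|us] := leP u0 s; last by apply: ler_wpM2l; [rewrite mulr_ge0// sqr_ge0|exact: HJ].
  by rewrite /d (psi0 k0 us).2 mulr0 !mul0r.
have X1 : `|(q1 - e0 ^+ 2 * d * a1) * b2| <= T * n by rewrite normrM ler_pM.
have X2 : `|(q2 - e0 ^+ 2 * d * a2) * b1| <= T * n by rewrite normrM ler_pM.
have X : e0 ^+ 2 * d * (n ^+ 2 / 10 - E) - 2 * (T * n) <= q1 * b2 - q2 * b1.
  have : q1 * b2 - q2 * b1 = e0 ^+ 2 * d * (a1 * b2 - a2 * b1) + (q1 - e0 ^+ 2 * d * a1) * b2 - (q2 - e0 ^+ 2 * d * a2) * b1 by ring.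
  by move: X1 X2; rewrite !ler_norml; lra.
(* Young's inequality: one twentieth of the square of [e0 sqrt(d) n - 40 G y] gives the constants
   1/20 and 80. *)
have Y1 : 4 * (G * e0 * P0 * n) <= e0 ^+ 2 * d * n ^+ 2 / 20 + 80 * (G ^+ 2 * y ^+ 2).
  have sd : Num.sqrt d ^+ 2 = d by rewrite sqr_sqrtr.
  have y0 : 0 <= y by rewrite yE pp_ge0.
  have PS : P0 <= Num.sqrt d * y.
    by rewrite -(ler_pXn2r (n := 2))// ?nnegrE ?mulr_ge0 ?sqrtr_ge0// [leRHS]exprMn sqr_sqrtr.
  have : 4 * (G * e0 * P0 * n) <= 4 * (G * e0 * (Num.sqrt d * y) * n).
    by rewrite ler_wpM2l// ler_wpM2r// ler_wpM2l// mulr_ge0//; case/andP: h0.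
  rewrite -[in X in _ -> _ <= X]sd; move: (Num.sqrt d) => r H; apply: (le_trans H).
  have := sqr_ge0 (e0 * r * n - 40 * (G * y)).
  rewrite [X in 0 <= X](_ : _ = e0 ^+ 2 * r ^+ 2 * n ^+ 2 - 80 * (G * e0 * (r * y) * n) + 1600 * (G ^+ 2 * y ^+ 2)); last by ring.
  lra.
have Y2 : 2 * (G ^+ 2 * B * `|t| * n) <= `|t| * (n ^+ 2 + G ^+ 4 * B ^+ 2).
  have := sqr_ge0 (n - G ^+ 2 * B) => H; have := mulr_ge0 (normr_ge0 t) H.
  rewrite [X in 0 <= X](_ : _ = `|t| * (n ^+ 2 + G ^+ 4 * B ^+ 2) - 2 * (G ^+ 2 * B * `|t| * n)); last by ring.
  by rewrite subr_ge0.
have TE : 2 * (T * n) = 2 * (minr 1 (`|t| * n / k) * n ^+ 2) + 4 * (G * e0 * P0 * n) + 2 * (G ^+ 2 * B * `|t| * n) + `|t| * (4 * G * n ^+ 2).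
  by rewrite /T; ring.
by move: X; rewrite TE; lra.
Qed.

End Pointwise.

(** * The Caccioppoli inequality and its consequence for superlevel sets *)

Section Energy.
Context {R : realType}.
Implicit Types (f g : pl R -> R).

Definition ind (b : bool) : R := b%:R.

Lemma ind_ge0 b : 0 <= ind b. Proof. by case: b; rewrite /ind. Qed.

Lemma measurable_gt (s : R) f : measurable_fun setT f ->
  measurable_fun setT (fun p : pl R => ind (s < f p)).
Proof.
move=> mf; have mS : measurable [set p | s < f p].
  rewrite -[X in measurable X]setTI.
  have -> : [set p | s < f p] = f @^-1` `]s, +oo[.
    by apply/seteqP; split=> p /=; rewrite in_itv /= andbT.
  exact: mf.
rewrite (_ : (fun p => _) = (\1_[set p | s < f p] : pl R -> R)); first exact: measurable_indic.
apply/funext => p; rewrite indicE /ind; congr (nat_of_bool _)%:R.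
by apply/idP/idP; rewrite inE.
Qed.

Lemma tameZ (c : R) f : tame f -> tame (fun p => c * f p).
Proof.
move=> [mf [B hB]]; split; first by meas.
have B0 : 0 <= B by apply: le_trans (hB (0, 0)).1.
exists (maxr B (`|c| * B)) => p; have [h1 h2] := hB p; split.
  by rewrite normrM le_max ler_wpM2l ?orbT.
move=> h; have /h2/boxP[k1 k2] : f p != 0 by apply: contraNneq h => ->; rewrite mulr0.
by apply/boxP; rewrite !le_max k1 k2.
Qed.

Lemma tame_sub f g (B : R) : measurable_fun setT f -> tame g -> (forall p, `|f p| <= B) ->
  (forall p, g p = 0 -> f p = 0) -> tame f.
Proof.
move=> mf [mg [D hD]] fB h; split=> //; exists (maxr B D) => p; split.
  by rewrite le_max fB.
move=> fp; have [_ hb] := hD p; have /hb/boxP[h1 h2] : g p != 0 by apply: contra_neq fp; exact: h.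
by apply/boxP; rewrite !le_max h1 h2 !orbT.
Qed.

(** Dominated convergence with majorant [gam^2]: the minimum is at most 1 and tends to 0 at every
    point. *)
Lemma min_mul_cvg0 (gam : pl R -> R) (k : R) (t_ : nat -> R) : 0 < k -> L2 gam ->
  (forall p, 0 <= gam p) -> t_ @ \oo --> 0 ->
  (II (fun p => (minr 1 (`|t_ n| * (2 * gam p) / k) * gam p ^+ 2)%R) @[n --> \oo] --> 0)%E.
Proof.
move=> k0 Lg g0 tc; have [mg g2] := Lg.
pose F n (p : pl R) := (minr 1 (`|t_ n| * (2 * gam p) / k) * gam p ^+ 2)%:E.
have b p n : 0 <= minr 1 (`|t_ n| * (2 * gam p) / k) <= 1.
  by rewrite le_min ler01 ge_min lexx !mulr_ge0// invr_ge0 ltW.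
have DC := @dominated_convergence _ _ _ (leb2 R) setT measurableT F (fun p => 0%E) (fun p => (gam p ^+ 2)%:E).
have m1 n : measurable_fun setT (F n) by apply/measurable_EFinP; meas.
have c1 : {ae leb2 R, forall p, [set: pl R] p -> F n p @[n --> \oo] --> 0%E}.
  apply: aeW => p _; apply: cvg_EFin; first exact: nearW.
  rewrite /comp /=; rewrite -[X in _ --> X](mul0r (gam p ^+ 2)).
  apply: cvgM; last exact: cvg_cst.
  apply: (@squeeze_cvgr _ _ _ _ (fun=> 0) (fun n => `|t_ n| * ((2 * gam p) / k))).
  - apply: nearW => n; have /andP[-> _] := b p n.
    by rewrite ge_min mulrA lexx orbT.
  - exact: cvg_cst.
  - rewrite -[X in _ --> X](mul0r ((2 * gam p) / k)); apply: cvgM; last exact: cvg_cst.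
    by rewrite -(normr0 R); exact: (cvg_norm tc).
have i1 : (leb2 R).-integrable setT (fun p : pl R => (gam p ^+ 2)%:E) by exact: (L2_integrable Lg).
have d1 : {ae leb2 R, forall p, forall n : nat, [set: pl R] p -> (`|F n p| <= (gam p ^+ 2)%:E)%E}.
  apply: aeW => p n _; rewrite /F lee_fin; have /andP[h1 h2] := b p n.
  by rewrite ger0_norm ?mulr_ge0 ?sqr_ge0// ler_piMl// sqr_ge0.
have [_ _ cv] := DC m1 (@measurable_cst _ _ _ _ setT 0%E) c1 i1 d1.
by rewrite integral0 in cv.
Qed.

Lemma near_le_of_cvg0 (x : nat -> \bar R) (d : R) : 0 < d -> x @ \oo --> 0%E ->
  (\forall n \near \oo, x n <= d%:E)%E.
Proof.
move=> d0 xc; have := xc `]-oo, d%:E[%classic => H; apply: (@filterS _ _ _ [set n | `]-oo, d%:E[%classic (x n)]).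
  by move=> n /=; rewrite in_itv /= => /ltW.
apply: H; apply: open_nbhs_nbhs; split; first exact: open_ereal_lt_ereal.
by rewrite /= in_itv /= lte_fin.
Qed.

Lemma half_inv_le (x th : R) : 0 <= x -> 0 < th -> (2 * th)^-1 * x <= x / th.
Proof.
move=> x0 th0; rewrite mulrC ler_wpM2l// lef_pV2 ?posrE ?mulr_gt0//; lra.
Qed.

Lemma energy_budget1 (e q d : R) : 40 * e + 3200 * q + d + q <= 40 * e + 3201 * q + d.
Proof. lra. Qed.

Lemma energy_budget2 (th m d t G c x y : R) : t * (G * (c + 1)) <= th * d -> x <= y ->
  th * m + x + t * G * (c + 1) <= th * (m + d) + y.
Proof. by rewrite -mulrA; lra. Qed.

Lemma le_mul_of_forall_pos (x m q : R) : 0 <= m -> 0 <= q ->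
  (forall d, 0 < d -> x <= 4 * (m + d) * (q + d)) -> x <= 4 * m * q.
Proof.
move=> m0 q0 h; rewrite leNgt; apply/negP => hx.
pose d := minr 1 ((x - 4 * m * q) / (8 * (m + q + 1))).
have c0 : 0 < 8 * (m + q + 1) by rewrite mulr_gt0//; lra.
have d0 : 0 < d by rewrite /d lt_min ltr01 divr_gt0// subr_gt0.
have d1 : d <= 1 by rewrite ge_min lexx.
have d2 : d * (8 * (m + q + 1)) <= x - 4 * m * q.
  by rewrite -ler_pdivlMr// ge_min lexx orbT.
have := h d d0; have : d * d <= d by rewrite ler_piMl// ltW.
nra.
Qed.

(** [u] and [v] will be truncated real and imaginary parts of [W], [eta] a cut-off with difference
    quotients at most [G], [E0] the error of the ellipticity, [gam] an L2 majorant for the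
    difference quotients, and [rho] a remainder that vanishes in L1 as the step tends to 0. Off [A]
    the test function is 0 at all vertices of a cell. *)
Variables (u v eta G E0 gam : pl R -> R) (rho : R -> pl R -> R) (A : set (pl R)).
Variables (s k Gb t0 : R) (t_ : nat -> R).
Hypotheses (k0 : 0 < k) (s0 : 0 <= s) (Gb0 : 0 <= Gb) (t00 : 0 < t0).
Hypotheses (tu : tame u) (tv : tame v).
Hypotheses (meta : measurable_fun setT eta) (eta01 : forall p, 0 <= eta p <= 1).
Hypotheses (mG : measurable_fun setT G) (G01 : forall p, 0 <= G p <= Gb).
Hypotheses (mA : measurable A) (tA : tame (\1_A : pl R -> R)).
Hypotheses (tpos : forall n, 0 < t_ n) (tcv : t_ @ \oo --> 0).
Hypothesis hA : forall t p, `|t| <= t0 -> ~ A p ->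
  [/\ eta p = 0 \/ u p <= s, eta (tr (t, 0) p) = 0 \/ u (tr (t, 0) p) <= s
    & eta (tr (0, t) p) = 0 \/ u (tr (0, t) p) <= s].
Hypothesis hG : forall t p, `|t| <= t0 -> A p ->
  `|eta (tr (t, 0) p) - eta p| <= `|t| * G p /\ `|eta (tr (0, t) p) - eta p| <= `|t| * G p.
Hypotheses (mE : measurable_fun setT E0) (E00 : forall p, 0 <= E0 p).
Hypotheses (L2_gam : L2 gam) (gam0 : forall p, 0 <= gam p).
Hypotheses (mrho : forall t, measurable_fun setT (rho t)) (rho0 : forall t p, 0 <= rho t p).
Hypothesis rhoc : (II (rho (t_ n)) @[n --> \oo] --> 0)%E.
Hypothesis rhocN : (II (rho (- t_ n)) @[n --> \oo] --> 0)%E.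

Definition nsq (t : R) (p : pl R) : R :=
  ((u (tr (t, 0) p) - u p) / t) ^+ 2 + ((v (tr (t, 0) p) - v p) / t) ^+ 2 +
  ((u (tr (0, t) p) - u p) / t) ^+ 2 + ((v (tr (0, t) p) - v p) / t) ^+ 2.

Hypothesis hJ : forall t, t != 0 -> `|t| <= t0 -> {ae leb2 R, forall p, A p -> s < u p ->
  nsq t p / 10 - (E0 p + rho t p) <= cell t u v p / t ^+ 2}.
Hypothesis hN : forall t, t != 0 -> `|t| <= t0 -> {ae leb2 R, forall p, A p ->
  nsq t p <= gam p ^+ 2 + rho t p}.

Lemma nsq_ge0 t p : 0 <= nsq t p.
Proof. by rewrite /nsq !addr_ge0 ?sqr_ge0. Qed.

Lemma measurable_nsq t : measurable_fun setT (nsq t).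
Proof. by have [mu _] := tu; have [mv _] := tv; rewrite /nsq; meas. Qed.

Definition Xe (t : R) (p : pl R) : R := eta p ^+ 2 * dpsi s k (u p) * nsq t p.

Lemma measurable_psi : measurable_fun setT (fun p : pl R => psi s k (u p)).
Proof. by have [mu _] := tu; rewrite /psi /phi /pp; meas. Qed.

Lemma measurable_dpsi : measurable_fun setT (fun p : pl R => dpsi s k (u p)).
Proof. by have [mu _] := tu; rewrite /dpsi /dphi /pp; meas. Qed.

Lemma measurable_Xe t : measurable_fun setT (Xe t).
Proof. by have := measurable_dpsi; have := measurable_nsq t; rewrite /Xe => ? ?; meas. Qed.

Lemma Xe_ge0 t p : 0 <= Xe t p.
Proof.
by have [_ _ h _ _] := psi_bounds s (u p) k0; rewrite /Xe mulr_ge0 ?nsq_ge0// mulr_ge0 ?sqr_ge0.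
Qed.

(** Paired with [v] in the null Lagrangian identity; the main term of its Jacobian is
    [eta^2 dpsi(u)] times that of [(u, v)]. *)
Definition feta (p : pl R) : R := eta p ^+ 2 * psi s k (u p).

Lemma tame_bound f : tame f -> exists2 B : R, 0 <= B & forall p, `|f p| <= B.
Proof. by move=> [_ [B h]]; exists B; [apply: le_trans (h (0, 0)).1|move=> p; case: (h p)]. Qed.

Lemma pp_le_norm (x : R) : pp (x - s) <= `|x|.
Proof. by rewrite /pp ge_max normr_ge0 /=; have := ler_norm x; have := s0; lra. Qed.

Lemma tame_feta : tame feta.
Proof.
have [B B0 hB] := tame_bound tu; have mp := measurable_psi.
apply: (tame_sub (B := B) _ tu); first by rewrite /feta; meas.
  move=> p; have [h1 h2 _ _ _] := psi_bounds s (u p) k0; have /andP[e0 e1] := eta01 p.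
  have f0 : 0 <= feta p by rewrite mulr_ge0// sqr_ge0.
  rewrite ger0_norm// /feta; apply: le_trans (hB p).
  apply: le_trans (pp_le_norm _); apply: le_trans h2; rewrite ler_piMl//.
  by rewrite expr_le1.
by move=> p up; rewrite /feta up (psi0 k0 s0).1 mulr0.
Qed.

(** Collects the errors that tend to 0 in L1 with the step. [B] bounds [u], and the indicator of [A]
    keeps the constant term integrable. *)
Definition Ze (B t : R) (p : pl R) : R :=
  4 * (minr 1 (`|t| * (2 * gam p) / k) * gam p ^+ 2) + (6 + 4 * Gb) * rho t p +
  `|t| * ((1 + 4 * Gb) * gam p ^+ 2 + Gb ^+ 4 * B ^+ 2 * \1_A p).

Lemma min_ge0 (x : R) : 0 <= x -> 0 <= minr 1 (x / k).
Proof. by move=> x0; rewrite le_min ler01 divr_ge0// ltW. Qed.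

Lemma Ze_ge0 B t p : 0 <= Ze B t p.
Proof.
have h1 := min_ge0 (mulr_ge0 (normr_ge0 t) (mulr_ge0 (ltW (ltr0Sn R 1)) (gam0 p))).
have := rho0 t p; have := sqr_ge0 (gam p); have g4 : 0 <= Gb ^+ 4 by rewrite exprn_ge0.
have i0 : 0 <= (\1_A p : R) by rewrite indicE.
have gb := Gb0; move=> h2 h3; rewrite /Ze; apply: addr_ge0; first apply: addr_ge0.
- by rewrite mulr_ge0// mulr_ge0.
- by rewrite mulr_ge0//; lra.
- rewrite mulr_ge0// addr_ge0//; first by rewrite mulr_ge0//; lra.
  by rewrite mulr_ge0// mulr_ge0// sqr_ge0.
Qed.

Lemma measurable_Ze B t : measurable_fun setT (Ze B t).
Proof.
have [mg _] := L2_gam; have mr := mrho t; have mi := measurable_indic (R := R) (D := setT) mA.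
by rewrite /Ze; meas.
Qed.

Lemma cell_feta_lower (t B : R) : (forall p, `|u p| <= B) -> t != 0 -> `|t| <= t0 -> `|t| <= 1 ->
  {ae leb2 R, forall p, Xe t p / 20 <= cell t feta v p / t ^+ 2 +
    (eta p ^+ 2 * ind (s < u p) * E0 p + 80 * (G p ^+ 2 * pp (u p - s) ^+ 2) + Ze B t p)}.
Proof.

have gb := Gb0.
move=> uB tn0 tt0 t1; apply: (ae_mono2 (hJ tn0 tt0) (hN tn0 tt0)) => p HJ HN.
have /andP[G0 GG] := G01 p.
have [Ap|nA] := pselect (A p); last first.
  have [h1 h2 h3] := hA tt0 nA.
  have f0 q : eta q = 0 \/ u q <= s -> feta q = 0.
    by rewrite /feta => -[->|h]; rewrite ?expr0n ?mul0r// (psi0 k0 h).1 mulr0.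
  have -> : Xe t p = 0.
    by rewrite /Xe; case: h1 => [->|h]; rewrite ?expr0n /= ?mul0r// (psi0 k0 h).2 mulr0 mul0r.
  rewrite /cell (f0 p h1) (f0 _ h2) (f0 _ h3) subrr !mul0r subrr mul0r add0r.
  apply: addr_ge0; last exact: Ze_ge0.
  apply: addr_ge0.
    by apply: mulr_ge0; [apply: mulr_ge0; [exact: sqr_ge0|exact: ind_ge0]|exact: E00].
  by apply: mulr_ge0 => //; apply: mulr_ge0; exact: sqr_ge0.
set n := Num.sqrt (nsq t p).
have nE : n ^+ 2 = nsq t p by rewrite sqr_sqrtr// nsq_ge0.
have n0 : 0 <= n by exact: sqrtr_ge0.
have [g1 g2] := hG tt0 Ap.
have PB : psi s k (u p) <= B.
  by have [_ h _ _ _] := psi_bounds s (u p) k0; rewrite (le_trans h)// (le_trans (pp_le_norm _)).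
set a1 := (u (tr (t, 0) p) - u p) / t; set a2 := (u (tr (0, t) p) - u p) / t.
set b1 := (v (tr (t, 0) p) - v p) / t; set b2 := (v (tr (0, t) p) - v p) / t.
have ea (x y : R) : y + t * ((x - y) / t) = x by rewrite [t * _]mulrC divfK// addrC subrK.
have eb (x y : R) : t * ((x - y) / t) = x - y by rewrite mulrC divfK.
have HH := @cell_lower R s k t (u p) a1 a2 b1 b2 (eta p) (eta (tr (t, 0) p)) (eta (tr (0, t) p)) (G p) B n (E0 p + rho t p) (pp (u p - s)) k0 tn0 (eta01 _) (eta01 _) (eta01 _) g1 g2 G0 PB n0 _ erefl _.
have := HH _ _; rewrite /a1 /a2 /b1 /b2 !ea !eb => {}HH.
have {}HH := HH nE _.
have : Xe t p / 20 <= cell t feta v p / t ^+ 2 + (eta p ^+ 2 * dpsi s k (u p) * (E0 p + rho t p) + 80 * (G p ^+ 2 * pp (u p - s) ^+ 2) +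
     (2 * (minr 1 (`|t| * n / k) * n ^+ 2) + `|t| * ((1 + 4 * G p) * n ^+ 2 + G p ^+ 4 * B ^+ 2))).
  rewrite /Xe -nE -mulrA; apply: HH => us.
  have hj := HJ Ap us; rewrite nE; apply: (le_trans hj).
  by rewrite le_eqVlt; apply/orP; left; apply/eqP; rewrite /cell; field.
move=> {}HH; apply: (le_trans HH); rewrite lerD2l.
have {HH}[_ _ d0 d1 _] := psi_bounds s (u p) k0.
have /andP[e0 e1] := eta01 p.
have ed0 : 0 <= eta p ^+ 2 * dpsi s k (u p) by rewrite mulr_ge0// sqr_ge0.
have ed1 : eta p ^+ 2 * dpsi s k (u p) <= 1 by rewrite mulr_ile1// ?sqr_ge0// expr_le1.
have H1 : eta p ^+ 2 * dpsi s k (u p) * (E0 p + rho t p) <= eta p ^+ 2 * ind (s < u p) * E0 p + rho t p.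
  rewrite mulrDr; apply: lerD; last by rewrite ler_piMl.
  rewrite ler_wpM2r// ler_wpM2l ?sqr_ge0//.
  by have [us|us] := ltP s (u p) => //; rewrite (psi0 k0 us).2.
have nn : n ^+ 2 <= gam p ^+ 2 + rho t p by rewrite nE; exact: HN.
(* Where [rho] exceeds [gam^2], [n^2] is at most [2 rho], which is small in L1; elsewhere
   [n <= 2 gam], and the minimum keeps its form. *)
have H2 : minr 1 (`|t| * n / k) * n ^+ 2 <= 2 * (minr 1 (`|t| * (2 * gam p) / k) * gam p ^+ 2) + 2 * rho t p.
  have m0 := min_ge0 (mulr_ge0 (normr_ge0 t) n0).
  have m1 : minr 1 (`|t| * n / k) <= 1 by rewrite ge_min lexx.
  have m0' := min_ge0 (mulr_ge0 (normr_ge0 t) (mulr_ge0 (ltW (ltr0Sn R 1)) (gam0 p))).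
  have [h|h] := leP (rho t p) (gam p ^+ 2).
    apply: (@le_trans _ _ (2 * (minr 1 (`|t| * (2 * gam p) / k) * gam p ^+ 2))); last first.
      by rewrite lerDl mulr_ge0.
    have n2 : n ^+ 2 <= 2 * gam p ^+ 2 by lra.
    rewrite [leRHS]mulrCA; apply: (ler_pM m0 (sqr_ge0 n) _ n2).
    have ng : n <= 2 * gam p.
      rewrite -(ler_pXn2r (n := 2))// ?nnegrE ?mulr_ge0//.
      by rewrite exprMn; have := sqr_ge0 (gam p); lra.
    by rewrite le_min !ge_min lexx /= ler_pM2r ?invr_gt0// ler_wpM2l ?orbT.
  apply: (@le_trans _ _ (1 * n ^+ 2)); first by rewrite ler_wpM2r ?sqr_ge0.
  have : 0 <= 2 * (minr 1 (`|t| * (2 * gam p) / k) * gam p ^+ 2) by rewrite mulr_ge0// mulr_ge0// sqr_ge0.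
  lra.
have H3 : `|t| * ((1 + 4 * G p) * n ^+ 2 + G p ^+ 4 * B ^+ 2) <=
    `|t| * ((1 + 4 * Gb) * gam p ^+ 2 + Gb ^+ 4 * B ^+ 2) + (1 + 4 * Gb) * rho t p.
  have t00' := normr_ge0 t.
  have h1 : (1 + 4 * G p) * n ^+ 2 <= (1 + 4 * Gb) * (gam p ^+ 2 + rho t p).
    by apply: ler_pM => //; [lra|exact: sqr_ge0|lra].
  have h2 : G p ^+ 4 * B ^+ 2 <= Gb ^+ 4 * B ^+ 2 by rewrite ler_wpM2r ?sqr_ge0// lerXn2r.
  have h3 : `|t| * ((1 + 4 * Gb) * rho t p) <= (1 + 4 * Gb) * rho t p.
    by rewrite ler_piMl// mulr_ge0//; lra.
  apply: (@le_trans _ _ (`|t| * ((1 + 4 * Gb) * (gam p ^+ 2 + rho t p) + Gb ^+ 4 * B ^+ 2))).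
    by rewrite ler_wpM2l// lerD.
  rewrite [leLHS](_ : _ = `|t| * ((1 + 4 * Gb) * gam p ^+ 2 + Gb ^+ 4 * B ^+ 2) + `|t| * ((1 + 4 * Gb) * rho t p)); last by ring.
  by rewrite lerD2l.
rewrite /Ze indicE mem_set// mulr1; lra.
Qed.


Lemma Ze_cvg (B : R) (tt : nat -> R) : tt @ \oo --> 0 ->
  (II (rho (tt n)) @[n --> \oo] --> 0)%E -> (II (Ze B (tt n)) @[n --> \oo] --> 0)%E.
Proof.
move=> ttc rc; have [mg g2] := L2_gam; have gb := Gb0.
have mi := measurable_indic (R := R) (D := setT) mA.
have i0 p : 0 <= (\1_A p : R) by rewrite indicE.
pose c p : R := (1 + 4 * Gb) * gam p ^+ 2 + Gb ^+ 4 * B ^+ 2 * \1_A p.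
have c0 p : 0 <= c p.
  by rewrite /c addr_ge0//; [rewrite mulr_ge0 ?sqr_ge0//; lra|rewrite mulr_ge0// mulr_ge0 ?sqr_ge0// exprn_ge0].
have mc : measurable_fun setT c by rewrite /c; meas.
have [C C0 hC] : exists2 C : R, 0 <= C & II c = C%:E.
  exists (fine (II c)); first by rewrite fine_ge0// II_ge0.
  rewrite fineK// fin_numElt (lt_le_trans (ltNyr 0))//=; last exact: II_ge0.
  rewrite /c IID; [|by meas|by meas|by move=> p; rewrite mulr_ge0 ?sqr_ge0//; lra|by move=> p; rewrite mulr_ge0// mulr_ge0 ?sqr_ge0// exprn_ge0].
  rewrite !IIZ//; [|by rewrite mulr_ge0 ?sqr_ge0// exprn_ge0|by meas|by move=> p; exact: sqr_ge0|lra].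
  apply: lte_add_pinfty; apply: lte_mul_pinfty => //; rewrite ?lee_fin; [lra| |].
    by rewrite mulr_ge0 ?sqr_ge0// exprn_ge0.
  have : inte (\1_A : pl R -> R) by exact: tame_integrable.
  by move/integrableP => [_]; under eq_integral do rewrite /= ger0_norm//.
pose mn n p : R := minr 1 (`|tt n| * (2 * gam p) / k) * gam p ^+ 2.
have mn0 n p : 0 <= mn n p.
  rewrite /mn mulr_ge0 ?sqr_ge0// min_ge0//; apply: mulr_ge0 => //; exact: mulr_ge0.
have mmn n : measurable_fun setT (mn n) by rewrite /mn; meas.
have E n : II (Ze B (tt n)) = (4%:E * II (mn n) + (6 + 4 * Gb)%:E * II (rho (tt n)) + (`|tt n| * C)%:E)%E.
  rewrite EFinM -hC -!IIZ//; last lra.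
  have mr := mrho (tt n).
  rewrite -IID; [|by have mm := mmn n; meas|by meas|by move=> p; exact: mulr_ge0|by move=> p; rewrite mulr_ge0//; lra].
  have mm := mmn n.
  rewrite -IID; [by []|by meas|by meas| |by move=> p; exact: mulr_ge0].
  by move=> p; apply: addr_ge0; [exact: mulr_ge0|rewrite mulr_ge0//; lra].
rewrite (_ : (fun n => _) = (fun n => 4%:E * II (mn n) + (6 + 4 * Gb)%:E * II (rho (tt n)) + (`|tt n| * C)%:E)%E); last by apply/funext => n; exact: E.
rewrite -[X in _ --> X](adde0 0%E); apply: cvgeD => //.
  rewrite -[X in _ --> X](adde0 0%E); apply: cvgeD => //.
    rewrite -[X in _ --> X](mule0 4%:E); apply: cvgeM => //; first exact: cvg_cst.
    exact: min_mul_cvg0.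
  by rewrite -[X in _ --> X](mule0 (6 + 4 * Gb)%:E); apply: cvgeM => //; exact: cvg_cst.
apply: cvg_EFin; first exact: nearW.
rewrite /comp /= -[X in _ --> X](mul0r C); apply: cvgM; last exact: cvg_cst.
by rewrite -(normr0 R); exact: (cvg_norm ttc).
Qed.

Lemma near_small (d : R) : 0 < d -> \forall n \near \oo, t_ n <= d.
Proof.
move=> d0; move/cvgrPdist_le : tcv => /(_ _ d0); apply: filterS => n.
by rewrite sub0r normrN; apply: le_trans; exact: ler_norm.
Qed.

(** Adding the cells of steps [t] and [-t] makes the integral of the Jacobians vanish. Dividing by
    the coercivity 1/20 gives [20 * 2 * (e + 80 * q)], and the energy for the step [-t] is
    dropped. *)
Lemma energy (e q d : R) : 0 <= e -> 0 <= q -> 0 < d ->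
  (II (fun p => (eta p ^+ 2 * ind (s < u p) * E0 p)%R) <= e%:E)%E ->
  (II (fun p => (G p ^+ 2 * pp (u p - s) ^+ 2)%R) <= q%:E)%E ->
  (\forall n \near \oo, II (Xe (t_ n)) <= (40 * e + 3200 * q + d)%:E)%E.
Proof.
move=> e0 q0 d0 he hq; have [B B0 hB] := tame_bound tu.
have [mu _] := tu; have mg := measurable_gt s mu.
have tcN : (- t_ n) @[n --> \oo] --> (0 : R) by rewrite -oppr0; exact: cvgN.
have d40 : 0 < d / 40 by rewrite divr_gt0.
have Z1 := near_le_of_cvg0 d40 (Ze_cvg B tcv rhoc).
have Z2 := near_le_of_cvg0 d40 (Ze_cvg B tcN rhocN).
have T1 := near_small t00; have T2 := near_small (ltr01 : 0 < 1 :> R).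
near=> n.
have tt1 : t_ n <= t0 by near: n.
have tt2 : t_ n <= 1 by near: n.
have Zn1 : (II (Ze B (t_ n)) <= (d / 40)%:E)%E by near: n.
have Zn2 : (II (Ze B (- t_ n)) <= (d / 40)%:E)%E by near: n.
set t := t_ n in tt1 tt2 Zn1 Zn2 *.
have tp : 0 < t by exact: tpos.
have tn0 : t != 0 by rewrite gt_eqF.
have tt0 : `|t| <= t0 by rewrite gtr0_norm.
have t1 : `|t| <= 1 by rewrite gtr0_norm.
pose W p : R := eta p ^+ 2 * ind (s < u p) * E0 p + 80 * (G p ^+ 2 * pp (u p - s) ^+ 2).
pose W1 p : R := eta p ^+ 2 * ind (s < u p) * E0 p.
pose W2 p : R := G p ^+ 2 * pp (u p - s) ^+ 2.
have W10 p : 0 <= W1 p by apply: mulr_ge0; [apply: mulr_ge0; [exact: sqr_ge0|exact: ind_ge0]|exact: E00].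
have W20 p : 0 <= W2 p by apply: mulr_ge0; exact: sqr_ge0.
have W0 p : 0 <= W p by apply: addr_ge0; [exact: W10|apply: mulr_ge0; [by []|exact: W20]].
have mW1 : measurable_fun setT W1 by rewrite /W1; meas.
have mW2 : measurable_fun setT W2 by rewrite /W2 /pp; meas.
have mW : measurable_fun setT W by rewrite /W -/(W1 _) -/(W2 _); apply: measurable_funD => //; exact: measurable_funM.
have mZ := measurable_Ze B t; have mZ' := measurable_Ze B (- t).
have mX := measurable_Xe t; have mX' := measurable_Xe (- t).
have Z0 p := Ze_ge0 B t p; have Z0' p := Ze_ge0 B (- t) p.
have IW : (II W <= (e + 80 * q)%:E)%E.
  rewrite [II W](_ : _ = II W1 + 80%:E * II W2)%E; last first.
    by rewrite -IIZ// -IID//; [exact: measurable_funM|move=> p; exact: mulr_ge0].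
  by rewrite (EFinD e) (EFinM 80); apply: leeD; [exact: he|apply: lee_wpmul2l; [by rewrite lee_fin|exact: hq]].
have tD : tame (fun p => (t ^+ 2)^-1 * (cell t feta v p + cell (- t) feta v p)).
  by apply: tameZ; apply: tameD; apply: tame_cell => //; exact: tame_feta.
have D0 : (\int[leb2 R]_p ((t ^+ 2)^-1 * (cell t feta v p + cell (- t) feta v p))%:E = 0)%E.
  have tc : tame (fun p => cell t feta v p + cell (- t) feta v p).
    by apply: tameD; apply: tame_cell => //; exact: tame_feta.
  have := integral_cell t tame_feta tv => c0.
  under eq_integral do rewrite EFinM.
  by rewrite integralZl//; [rewrite c0 mule0|exact: (tame_integrable tc)].
pose X p : R := Xe t p / 20 + Xe (- t) p / 20.
pose Y p : R := (W p + Ze B t p) + (W p + Ze B (- t) p).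
have mXX : measurable_fun setT X by rewrite /X; apply: measurable_funD; apply: measurable_funM.
have X0 p : 0 <= X p by apply: addr_ge0; apply: divr_ge0 => //; exact: Xe_ge0.
have mYY : measurable_fun setT Y by rewrite /Y; apply: measurable_funD; apply: measurable_funD.
have Y0 p : 0 <= Y p by apply: addr_ge0; apply: addr_ge0.
have leXY : (II X <= II Y)%E.
  apply: (integral_le_of_le_add mXX X0 mYY Y0 tD D0).
  have tN0 : - t != 0 by rewrite oppr_eq0.
  have tNt0 : `|- t| <= t0 by rewrite normrN.
  have tN1 : `|- t| <= 1 by rewrite normrN.
  apply: (ae_mono2 (cell_feta_lower hB tn0 tt0 t1) (cell_feta_lower hB tN0 tNt0 tN1)) => p.
  rewrite -/(W p) sqrrN /X /Y mulrDr => h1 h2.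
  rewrite ![_^-1 * _]mulrC; lra.
have IY : (II Y <= (2 * (e + 80 * q) + d / 40 + d / 40)%:E)%E.
  rewrite /Y IID; [|exact: measurable_funD|exact: measurable_funD|by move=> p; exact: addr_ge0|by move=> p; exact: addr_ge0].
  rewrite (IID mW mZ W0 Z0) (IID mW mZ' W0 Z0').
  have -> : 2 * (e + 80 * q) + d / 40 + d / 40 = (e + 80 * q + d / 40) + (e + 80 * q + d / 40) by ring.
  rewrite EFinD (EFinD (e + 80 * q)); by apply: leeD; apply: leeD.
rewrite [II (Xe t)](_ : _ = 20%:E * II (fun p => (Xe t p / 20)%R))%E; last first.
  rewrite -IIZ//; [by apply: II_ext => p; rewrite mulrC divfK|exact: measurable_funM|by move=> p; apply: divr_ge0 => //; exact: Xe_ge0].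
rewrite (_ : 40 * e + 3200 * q + d = 20 * (2 * (e + 80 * q) + d / 40 + d / 40)); last by field.
rewrite EFinM; apply: lee_wpmul2l => //; apply: le_trans IY; apply: le_trans leXY.
apply: II_le => //; [exact: measurable_funM|by move=> p; apply: divr_ge0 => //; exact: Xe_ge0|].
by move=> p; rewrite lerDl; apply: divr_ge0 => //; exact: Xe_ge0.
Unshelve. all: end_near. Qed.

(** If [u0 <= s + k] there is no decrease; otherwise [dpsi] is 1 at [u0], so the energy density
    there is the full squared gradient. Young's inequality with weight [th] trades it for the
    indicator of the superlevel set, which contributes the measure. *)
Lemma dec_cutoff_le (h0 h1 u0 u1 n2 g t th : R) : 0 <= h0 <= 1 -> 0 <= h1 <= 1 -> 0 < t -> 0 < th ->
  `|h1 - h0| <= t * g -> 0 <= g -> ((u1 - u0) / t) ^+ 2 <= n2 ->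
  maxr 0 (h0 * pp (u0 - s - k) - h1 * pp (u1 - s - k)) <=
  t * (th * ind (s + k < u0) + (h0 ^+ 2 * dpsi s k u0 * n2 + g ^+ 2 * pp (u0 - s) ^+ 2) / (2 * th) +
       t * (g * (1 + n2))).
Proof.
move=> /andP[h00 h01] /andP[h10 h11] t0' th0 hg g0 hn.
have k0' := k0; have n20 : 0 <= n2 := le_trans (sqr_ge0 _) hn.
have [_ _ d0 _ _] := psi_bounds s u0 k0.
have [us|us] := leP u0 (s + k).
  rewrite [pp (u0 - s - k)]pp_neg; last lra.
  rewrite mulr0 sub0r max_l; last by rewrite oppr_le0 mulr_ge0// pp_ge0.
  have i0 := ind_ge0 false.
  apply: mulr_ge0; first exact: ltW.
  apply: addr_ge0; last first.
    by apply: mulr_ge0; [exact: ltW|apply: mulr_ge0 => //; lra].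
  apply: addr_ge0; first by apply: mulr_ge0; [exact: ltW|exact: ind_ge0].
  apply: divr_ge0; last by rewrite mulr_ge0// ltW.
  apply: addr_ge0; first by apply: mulr_ge0 => //; apply: mulr_ge0 => //; exact: sqr_ge0.
  by apply: mulr_ge0; exact: sqr_ge0.
rewrite /ind /= mulr1 (dpsi1 k0 (ltW us)) mulr1.
set a := `|u1 - u0| / t; have aE : `|u1 - u0| = t * a by rewrite /a mulrC divfK// gt_eqF.
have a0 : 0 <= a by rewrite divr_ge0// ltW.
have a2 : a ^+ 2 <= n2 by apply: le_trans hn; rewrite /a !exprMn real_normK ?num_real.
have -> : pp (u0 - s - k) = u0 - s - k by rewrite pp_pos//; lra.
have -> : pp (u0 - s) = u0 - s by rewrite pp_pos//; lra.
have P1 : u0 - s - k - t * a <= pp (u1 - s - k).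
  apply: le_trans (pp_ge _); rewrite -aE; have := ler_norm (u0 - u1); rewrite distrC; lra.
have P2 : pp (u1 - s - k) <= u0 - s - k + t * a.
  rewrite /pp ge_max -aE; have := normr_ge0 (u1 - u0); have := ler_norm (u1 - u0); move=> *; apply/andP; split; lra.
have ta0 : 0 <= t * a by rewrite mulr_ge0// ltW.
have tg0 : 0 <= t * g by rewrite mulr_ge0// ltW.
have U10 := pp_ge0 (u1 - s - k).
set U1 := pp (u1 - s - k) in P1 P2 U10 *; set U0 := u0 - s - k.
have H1 : h0 * U0 - h1 * U1 <= t * (h0 * a + g * U0 + t * (g * a)).
  have q1 : h0 * (U0 - U1) <= h0 * (t * a) by rewrite ler_wpM2l// /U0; lra.
  have q2 : (h0 - h1) * U1 <= (t * g) * (U0 + t * a).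
    apply: (@le_trans _ _ ((t * g) * U1)); last by rewrite ler_wpM2l.
    by rewrite ler_wpM2r//; move: hg; rewrite distrC; apply: le_trans; exact: ler_norm.
  rewrite (_ : h0 * U0 - h1 * U1 = h0 * (U0 - U1) + (h0 - h1) * U1); last by ring.
  apply: (le_trans (lerD q1 q2)); rewrite le_eqVlt; apply/orP; left; apply/eqP; ring.
have U00 : 0 <= U0 by rewrite /U0; lra.
have H2 : 2 * (h0 * a) * th <= th ^+ 2 + h0 ^+ 2 * n2.
  have := sqr_ge0 (th - h0 * a).
  have := ler_wpM2l (sqr_ge0 h0) a2; rewrite !expr2; lra.
have H3 : 2 * (g * U0) * th <= th ^+ 2 + g ^+ 2 * (u0 - s) ^+ 2.
  have := sqr_ge0 (th - g * U0).
  have u2 : U0 ^+ 2 <= (u0 - s) ^+ 2 by rewrite lerXn2r ?nnegrE// /U0; lra.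
  have := ler_wpM2l (sqr_ge0 g) u2; rewrite !expr2; lra.
have H4 : h0 * a + g * U0 <= th + (h0 ^+ 2 * n2 + g ^+ 2 * (u0 - s) ^+ 2) / (2 * th).
  have th2 : 0 < 2 * th by rewrite mulr_gt0.
  rewrite -(ler_pM2r th2) mulrDl [in leRHS]mulrDl divfK ?gt_eqF//.
  by rewrite mulrA [in leRHS]mulrA; rewrite !expr2 in H2 H3 *; lra.
have H5 : a <= 1 + n2 by have := sqr_ge0 (a - 1); rewrite !expr2; rewrite expr2 in a2; lra.
rewrite ge_max; apply/andP; split.
  apply: mulr_ge0; first exact: ltW.
  apply: addr_ge0; last by apply: mulr_ge0; [exact: ltW|apply: mulr_ge0 => //; lra].
  by apply: le_trans H4; apply: addr_ge0; exact: mulr_ge0.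
apply: (le_trans H1); rewrite ler_pM2l// lerD// ler_pM2l// ler_wpM2l//.
Qed.


Definition fs (p : pl R) : R := eta p * pp (u p - s - k).

Lemma tame_fs : tame fs.
Proof.
have [B B0 hB] := tame_bound tu; have [mu _] := tu; have k0' := k0; have s0' := s0.
apply: (tame_sub (B := B) _ tu); first by rewrite /fs /pp; meas.
  move=> p; have /andP[e0 e1] := eta01 p.
  rewrite ger0_norm ?mulr_ge0 ?pp_ge0//; apply: le_trans (hB p).
  apply: (@le_trans _ _ (pp (u p - s - k))); first by rewrite ler_piMl// pp_ge0.
  by rewrite /pp ge_max normr_ge0 /=; have := ler_norm (u p); lra.
by move=> p up; rewrite /fs up pp_neg ?mulr0//; lra.
Qed.

Definition Ve (th t : R) (p : pl R) : R :=
  t * (th * ind (s + k < u p) + (Xe t p + G p ^+ 2 * pp (u p - s) ^+ 2) / (2 * th) +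
       t * (Gb * (\1_A p + gam p ^+ 2 + rho t p))).

Lemma dec_bound (th t : R) : 0 < t -> t <= t0 -> 0 < th ->
  {ae leb2 R, forall p, dec t fs p <= Ve th t p /\ decy t fs p <= Ve th t p}.
Proof.
move=> tp tt0 th0; have tn0 : t != 0 by rewrite gt_eqF.
have tt0' : `|t| <= t0 by rewrite gtr0_norm.
have gb := Gb0; have k0' := k0.
apply: (ae_mono (hN tn0 tt0')) => p HN; have /andP[G0 GG] := G01 p.
have i0 : 0 <= (\1_A p : R) by rewrite indicE.
have V0 : 0 <= Gb * (\1_A p + gam p ^+ 2 + rho t p).
  by rewrite mulr_ge0// addr_ge0// addr_ge0// sqr_ge0.
have [Ap|nA] := pselect (A p); last first.
  have [h1 h2 h3] := hA tt0' nA.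
  have f0 q : eta q = 0 \/ u q <= s -> fs q = 0.
    by rewrite /fs => -[->|h]; rewrite ?mul0r// pp_neg ?mulr0//; lra.
  rewrite /dec /decy (f0 _ h1) (f0 _ h2) (f0 _ h3) subrr max_l//.
  have : 0 <= Ve th t p.
    apply: mulr_ge0; first exact: ltW.
    apply: addr_ge0; last by apply: mulr_ge0 => //; exact: ltW.
    apply: addr_ge0; first by apply: mulr_ge0; [exact: ltW|exact: ind_ge0].
    apply: divr_ge0; last by rewrite mulr_ge0// ltW.
    by apply: addr_ge0; [exact: Xe_ge0|apply: mulr_ge0; exact: sqr_ge0].
  by split.
have [g1 g2] := hG tt0' Ap; rewrite (gtr0_norm tp) in g1 g2.
have HV : t * (th * ind (s + k < u p) + (eta p ^+ 2 * dpsi s k (u p) * nsq t p + G p ^+ 2 * pp (u p - s) ^+ 2) / (2 * th) +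
       t * (G p * (1 + nsq t p))) <= Ve th t p.
  rewrite /Ve ler_pM2l// lerD2l ler_pM2l//; apply: ler_pM => //.
    by rewrite addr_ge0// nsq_ge0.
  by rewrite indicE mem_set// -addrA lerD2l; exact: HN.
have sq4 (a b c d : R) : a ^+ 2 <= a ^+ 2 + b ^+ 2 + c ^+ 2 + d ^+ 2 /\ c ^+ 2 <= a ^+ 2 + b ^+ 2 + c ^+ 2 + d ^+ 2.
  by have := sqr_ge0 a; have := sqr_ge0 b; have := sqr_ge0 c; have := sqr_ge0 d; split; lra.
have [n1 n2] := sq4 ((u (tr (t, 0) p) - u p) / t) ((v (tr (t, 0) p) - v p) / t) ((u (tr (0, t) p) - u p) / t) ((v (tr (0, t) p) - v p) / t).
split; apply: le_trans HV.
  exact: (dec_cutoff_le (eta01 p) (eta01 _) tp th0 g1 G0 n1).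
exact: (dec_cutoff_le (eta01 p) (eta01 _) tp th0 g2 G0 n2).
Qed.

(* Sobolev's inequality bounds the square integral by the product of the two
   decrease rates; on the superlevel set each rate is at most [th * m + energy / (2 th)]
   for every [th > 0], hence the factor [m]. *)
Lemma energy_sobolev (m e q : R) : 0 <= m -> 0 <= e -> 0 <= q ->
  (II (fun p => (ind (s + k < u p))%R) <= m%:E)%E ->
  (II (fun p => (eta p ^+ 2 * ind (s < u p) * E0 p)%R) <= e%:E)%E ->
  (II (fun p => (G p ^+ 2 * pp (u p - s) ^+ 2)%R) <= q%:E)%E ->
  (II (fun p => ((eta p * pp (u p - s - k)) ^+ 2)%R) <= (4 * m * (40 * e + 3201 * q))%:E)%E.
Proof.
move=> m0 e0 q0 hm he hq; have gb := Gb0.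
have [mu _] := tu; have mg := measurable_gt (s + k) mu.
have [mgam g2] := L2_gam.
have mi := measurable_indic (R := R) (D := setT) mA.
have i0 p : 0 <= (\1_A p : R) by rewrite indicE.
have mG2 : measurable_fun setT (fun p => G p ^+ 2 * pp (u p - s) ^+ 2) by rewrite /pp; meas.
have [c c0 hc] : exists2 c : R, 0 <= c & (II (fun p => (\1_A p + gam p ^+ 2)%R) <= c%:E)%E.
  have fin : (II (fun p => (\1_A p + gam p ^+ 2)%R) < +oo)%E.
    rewrite IID; [|by meas|by meas|by []|by move=> p; exact: sqr_ge0].
    apply: lte_add_pinfty => //.
    have : inte (\1_A : pl R -> R) by exact: tame_integrable.
    by move/integrableP => [_]; under eq_integral do rewrite /= ger0_norm//.
  have p0 : (0 <= II (fun p => (\1_A p + gam p ^+ 2)%R))%E.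
    by apply: II_ge0 => p; rewrite addr_ge0// sqr_ge0.
  exists (fine (II (fun p => (\1_A p + gam p ^+ 2)%R))); first exact: fine_ge0.
  by rewrite fineK// ge0_fin_numE.
have [B B0 hB] := tame_bound tame_fs.
have [mfs _] := tame_fs.
have f0 p : 0 <= fs p by have /andP[h _] := eta01 p; rewrite mulr_ge0// pp_ge0.
set x := II _; have x0 : (0 <= x)%E by apply: II_ge0 => p; exact: sqr_ge0.
(* The coefficient 3201 is the 3200 of [energy] plus 1 for the cut-off term of [dec_cutoff_le]. *)
set Q := 40 * e + 3201 * q; have Q0 : 0 <= Q by rewrite /Q; lra.
have key (d : R) : 0 < d -> (x <= (4 * (m + d) * (Q + d))%:E)%E.
  (* The optimal weight: it makes the two terms of [a] equal, so that [a * a] is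
     [4 * (m + d) * (Q + d)]. The slack [d] keeps both factors positive. *)
  move=> d0; pose th := Num.sqrt ((Q + d) / (m + d)).
  have md : 0 < m + d by lra.
  have Qd : 0 < Q + d by lra.
  have th0 : 0 < th by rewrite sqrtr_gt0 divr_gt0.
  have thE : th ^+ 2 = (Q + d) / (m + d) by rewrite sqr_sqrtr// divr_ge0 ?ltW.
  pose a := th * (m + d) + (Q + d) / th.
  have a0 : 0 <= a by apply: addr_ge0; apply: ltW; [exact: mulr_gt0|exact: divr_gt0].
  have -> : 4 * (m + d) * (Q + d) = a * a.
    have -> : Q + d = th ^+ 2 * (m + d) by rewrite thE divfK// gt_eqF.
    rewrite /a; have -> : Q + d = th ^+ 2 * (m + d) by rewrite thE divfK// gt_eqF.
    by field; rewrite gt_eqF.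
  have Ed := energy e0 q0 d0 he hq.
  have Rd := near_le_of_cvg0 ltr01 rhoc.
  have T1 := near_small t00.
  have T2 : \forall n \near \oo, t_ n * (Gb * (c + 1)) <= th * d.
    have w0 : 0 < Gb * (c + 1) + 1 by rewrite ltr_wpDl// mulr_ge0// addr_ge0.
    have e1 : 0 < th * d / (Gb * (c + 1) + 1) by rewrite divr_gt0// mulr_gt0.
    apply: filterS (near_small e1) => n; rewrite ler_pdivlMr//; apply: le_trans.
    by apply: ler_wpM2l; [exact: ltW|rewrite lerDl].
  have VE : \forall n \near \oo, (II (Ve th (t_ n)) <= (t_ n * a)%:E)%E.
    near=> n.
    have h1 : (II (Xe (t_ n)) <= (40 * e + 3200 * q + d)%:E)%E by near: n.
    have h2 : (II (rho (t_ n)) <= 1%:E)%E by near: n.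
    have h3 : t_ n * (Gb * (c + 1)) <= th * d by near: n.
    have tp := tpos n; have mr := mrho (t_ n); have mX := measurable_Xe (t_ n).
    have r0 := rho0 (t_ n).
    pose V1 p : R := Xe (t_ n) p + G p ^+ 2 * pp (u p - s) ^+ 2.
    pose V2 p : R := (\1_A p + gam p ^+ 2) + rho (t_ n) p.
    have V10 p : 0 <= V1 p by apply: addr_ge0; [exact: Xe_ge0|apply: mulr_ge0; exact: sqr_ge0].
    have V20 p : 0 <= V2 p by rewrite addr_ge0// addr_ge0// sqr_ge0.
    have mV1 : measurable_fun setT V1 by exact: measurable_funD.
    have mV2 : measurable_fun setT V2 by rewrite /V2; meas.
    have IV1 : (II V1 <= (Q + d)%:E)%E.
      rewrite (IID mX mG2 (Xe_ge0 _) (fun p => mulr_ge0 (sqr_ge0 _) (sqr_ge0 _))).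
      apply: (le_trans (leeD h1 hq)); rewrite -EFinD lee_fin; exact: energy_budget1.
    have IV2 : (II V2 <= (c + 1)%:E)%E.
      rewrite IID//; [|by meas|by move=> p; rewrite addr_ge0// sqr_ge0].
      by rewrite EFinD; exact: leeD.
    have th2 : 0 <= (2 * th)^-1 by rewrite invr_ge0 mulr_ge0// ltW.
    rewrite [II _](_ : _ = (t_ n)%:E * (th%:E * II (fun p => (ind (s + k < u p))%R) + (2 * th)^-1%:E * II V1 + (t_ n * Gb)%:E * II V2))%E; last first.
      have w1 p : 0 <= th * ind (s + k < u p) by rewrite mulr_ge0 ?ind_ge0// ltW.
      have w2 p : 0 <= (2 * th)^-1 * V1 p by rewrite mulr_ge0.
      have w3 p : 0 <= t_ n * Gb * V2 p by rewrite mulr_ge0// mulr_ge0// ltW.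
      have k1 : 0 <= t_ n * Gb by rewrite mulr_ge0// ltW.
      have mm1 : measurable_fun setT (fun p => th * ind (s + k < u p)) by exact: measurable_funM.
      have mm2 : measurable_fun setT (fun p => (2 * th)^-1 * V1 p) by exact: measurable_funM.
      have mm3 : measurable_fun setT (fun p => t_ n * Gb * V2 p) by exact: measurable_funM.
      have mm12 := measurable_funD mm1 mm2.
      have w12 p : 0 <= th * ind (s + k < u p) + (2 * th)^-1 * V1 p by exact: addr_ge0.
      have w123 p : 0 <= th * ind (s + k < u p) + (2 * th)^-1 * V1 p + t_ n * Gb * V2 p by exact: addr_ge0.
      rewrite -(IIZ mg (fun p => ind_ge0 _) (ltW th0)) -(IIZ mV1 V10 th2) -(IIZ mV2 V20 k1).
      rewrite -(IID mm1 mm2 w1 w2) -(IID mm12 mm3 w12 w3) -(IIZ (measurable_funD mm12 mm3) w123 (ltW tp)).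
      by apply: II_ext => p; rewrite /Ve -/(V1 p) -/(V2 p); congr (_ * (_ + _ + _)); rewrite ?mulrA// mulrC.
    rewrite (EFinM _ a); apply: lee_wpmul2l; first by rewrite lee_fin ltW.
    have A1 : (th%:E * II (fun p => (ind (s + k < u p))%R) <= (th * m)%:E)%E.
      by rewrite EFinM; apply: lee_wpmul2l => //; rewrite lee_fin ltW.
    have A2 : ((2 * th)^-1%:E * II V1 <= ((2 * th)^-1 * (Q + d))%:E)%E.
      by rewrite EFinM; apply: lee_wpmul2l.
    have A3 : ((t_ n * Gb)%:E * II V2 <= (t_ n * Gb * (c + 1))%:E)%E.
      by rewrite (EFinM (t_ n * Gb)); apply: lee_wpmul2l => //; rewrite lee_fin mulr_ge0// ltW.
    apply: (le_trans (leeD (leeD A1 A2) A3)); rewrite -!EFinD lee_fin /a.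
    have q1 : (2 * th)^-1 * (Q + d) <= (Q + d) / th.
      exact: half_inv_le (ltW Qd) th0.
    exact: energy_budget2.
  have VE0 : forall n, (\int[leb2 R]_p (Ve th (t_ n) p)%:E)%E = II (Ve th (t_ n)) by [].
  have mV n : measurable_fun setT (Ve th (t_ n)).
    have mr := mrho (t_ n); have mX := measurable_Xe (t_ n); rewrite /Ve.
    apply: measurable_funM; first exact: measurable_cst.
    apply: measurable_funD; last by meas.
    apply: measurable_funD; first exact: measurable_funM.
    by apply: measurable_funM; [exact: measurable_funD|exact: measurable_cst].
  have VB n : t_ n <= t0 -> (II (dec (t_ n) fs) <= II (Ve th (t_ n)))%E /\ (II (decy (t_ n) fs) <= II (Ve th (t_ n)))%E.
    move=> tn.
    have V0 p : 0 <= Ve th (t_ n) p.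
      apply: mulr_ge0; first exact: ltW.
      apply: addr_ge0; last first.
        by apply: mulr_ge0; [exact: ltW|apply: mulr_ge0 => //; apply: addr_ge0 => //; apply: addr_ge0 => //; exact: sqr_ge0].
      apply: addr_ge0; first by apply: mulr_ge0; [exact: ltW|exact: ind_ge0].
      apply: divr_ge0; last by rewrite mulr_ge0// ltW.
      by apply: addr_ge0; [exact: Xe_ge0|apply: mulr_ge0; exact: sqr_ge0].
    have db := dec_bound (tpos n) tn th0.
    split; apply: II_le_ae => //.
    - exact: measurable_dec.
    - by move=> p; exact: dec_ge0.
    - by apply: (ae_mono db) => p [].
    - exact: measurable_decy.
    - by move=> p; exact: decy_ge0.
    - by apply: (ae_mono db) => p [].
  apply: (sobolev_dec tame_fs f0 tpos tcv a0 a0).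
  - by apply: filterS2 VE T1 => n h tn; apply: le_trans h; exact: (VB n tn).1.
  - by apply: filterS2 VE T1 => n h tn; apply: le_trans h; exact: (VB n tn).2.
have xfin : x \is a fin_num.
  by rewrite ge0_fin_numE//; apply: le_lt_trans (key 1 ltr01) _; exact: ltry.
rewrite -(fineK xfin) lee_fin; apply: le_mul_of_forall_pos => // d d0.
by rewrite -lee_fin (fineK xfin); exact: key.
Unshelve. all: end_near. Qed.

End Energy.

(** * The implicit coefficient W *)

Section Cmod.
Context {R : realType}.
Implicit Types (z w : C R) (x y : R).

Lemma cmodE z : cmod z = Num.sqrt (complex.Re z ^+ 2 + complex.Im z ^+ 2).
Proof. by rewrite /cmod normc_def. Qed.

Lemma normE z : `|z| = ((cmod z)%:C)%C.
Proof. by rewrite cmodE normc_def. Qed.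

Lemma cmod_ge0 z : 0 <= cmod z. Proof. by rewrite cmodE sqrtr_ge0. Qed.

Lemma sqr_cmod z : cmod z ^+ 2 = complex.Re z ^+ 2 + complex.Im z ^+ 2.
Proof. by rewrite cmodE sqr_sqrtr// addr_ge0 ?sqr_ge0. Qed.

Lemma cmodM z w : cmod (z * w) = cmod z * cmod w.
Proof.
by apply: complexI; rewrite rmorphM /= -!normE normrM.
Qed.

Lemma cmodN z : cmod (- z) = cmod z. Proof. by rewrite /cmod normrN. Qed.

Lemma cmod_dist z w : cmod (z - w) = cmod (w - z). Proof. by rewrite /cmod distrC. Qed.

Lemma cmodD z w : cmod (z + w) <= cmod z + cmod w.
Proof. by have := ler_normD z w; rewrite !normE -rmorphD /= lecR. Qed.

Lemma cmodB z w : cmod (z - w) <= cmod z + cmod w.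
Proof. by rewrite -(cmodN w) cmodD. Qed.

Lemma cmod_triangle z w v : cmod (z - w) <= cmod (z - v) + cmod (v - w).
Proof. by have := cmodD (z - v) (v - w); rewrite addrA subrK. Qed.

Lemma cmod0 : cmod (0 : C R) = 0. Proof. by rewrite /cmod normr0. Qed.

Lemma cmod1 : cmod (1 : C R) = 1. Proof. by rewrite /cmod normr1. Qed.

Lemma cmod0_eq z : cmod z = 0 -> z = 0.
Proof. by move=> h; apply/normr0_eq0; rewrite normE h. Qed.

Lemma cmod_gt0 z : (0 < cmod z) = (z != 0).
Proof.
rewrite lt_def cmod_ge0 andbT; apply/idP/idP; apply: contra => /eqP.
  by move=> ->; rewrite cmod0.
by move/cmod0_eq => ->.
Qed.

Lemma cmodV z : cmod z^-1 = (cmod z)^-1.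
Proof.
have [->|z0] := eqVneq z 0; first by rewrite invr0 cmod0 invr0.
have cz : cmod z != 0 by rewrite gt_eqF// cmod_gt0.
by apply: (mulIf cz); rewrite mulVf// -cmodM mulVf// cmod1.
Qed.

Lemma cmod_real x : cmod ((x%:C)%C : C R) = `|x|.
Proof. by rewrite cmodE /= expr0n /= addr0 sqrtr_sqr. Qed.

Lemma cmod_imunit : cmod (imunit R) = 1.
Proof. by rewrite cmodE /= expr0n /= add0r expr1n sqrtr1. Qed.

Lemma sqr_imunit : imunit R * imunit R = -1.
Proof. by apply/eqP; rewrite eq_complex /=; apply/andP; split; apply/eqP; ring. Qed.

Lemma Re_le_cmod z : `|complex.Re z| <= cmod z.
Proof. by rewrite cmodE -sqrtr_sqr ler_wsqrtr// lerDl sqr_ge0. Qed.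

Lemma Im_le_cmod z : `|complex.Im z| <= cmod z.
Proof. by rewrite cmodE -sqrtr_sqr ler_wsqrtr// lerDr sqr_ge0. Qed.

Lemma cmod_le_ReIm z : cmod z <= `|complex.Re z| + `|complex.Im z|.
Proof.
rewrite -(ler_pXn2r (n := 2))// ?nnegrE ?cmod_ge0 ?addr_ge0//.
rewrite sqr_cmod -(real_normK (num_real (complex.Re z))) -(real_normK (num_real (complex.Im z))).
have := mulr_ge0 (normr_ge0 (complex.Re z)) (normr_ge0 (complex.Im z)).
move: `|_| `|_| => a b; rewrite !expr2 mulrDl !mulrDr; lra.
Qed.

Lemma cmod_half z : cmod (2^-1 * z) = cmod z / 2.
Proof.
rewrite cmodM cmodV mulrC; congr (_ / _).
by have := cmod_real 2; rewrite rmorph_nat => ->; rewrite ger0_norm.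
Qed.

Lemma ReD z w : complex.Re (z + w) = complex.Re z + complex.Re w.
Proof. by case: z => ? ?; case: w. Qed.
Lemma ImD z w : complex.Im (z + w) = complex.Im z + complex.Im w.
Proof. by case: z => ? ?; case: w. Qed.
Lemma ReN z : complex.Re (- z) = - complex.Re z.
Proof. by case: z. Qed.
Lemma ImN z : complex.Im (- z) = - complex.Im z.
Proof. by case: z. Qed.
Lemma ReM z w : complex.Re (z * w) = complex.Re z * complex.Re w - complex.Im z * complex.Im w.
Proof. by case: z => ? ?; case: w. Qed.
Lemma ImM z w : complex.Im (z * w) = complex.Re z * complex.Im w + complex.Im z * complex.Re w.
Proof. by case: z => ? ?; case: w. Qed.

Lemma ReB z w : complex.Re (z - w) = complex.Re z - complex.Re w.
Proof. by rewrite ReD ReN. Qed.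
Lemma ImB z w : complex.Im (z - w) = complex.Im z - complex.Im w.
Proof. by rewrite ImD ImN. Qed.

Lemma Re_divr z x : complex.Re (z / (x%:C)%C) = complex.Re z / x /\ complex.Im (z / (x%:C)%C) = complex.Im z / x.
Proof.
have -> : ((x%:C)%C : C R)^-1 = ((x^-1)%:C)%C by rewrite -fmorphV.
by rewrite ReM ImM /= !mulr0 subr0 add0r; split=> //; rewrite mulrC.
Qed.

Lemma complex_eq z w : complex.Re z = complex.Re w -> complex.Im z = complex.Im w -> z = w.
Proof. by case: z => ? ?; case: w => ? ? /= -> ->. Qed.

Lemma cmod_conj z : cmod (conjc z) = cmod z.
Proof. by case: z => a b; rewrite !cmodE /= sqrrN. Qed.

End Cmod.

(** * Measurability of complex functions of the plane *)

Section Measurability.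
Context {R : realType}.
Implicit Types (f g : pl R -> R).

(** The set is the union of the countably many open rectangles with rational vertices that it
    contains. *)
Lemma measurable_sup_open (S : set (pl R)) :
  (forall p, S p -> exists2 e : R, 0 < e & forall q : pl R, `|q.1 - p.1| < e -> `|q.2 - p.2| < e -> S q) ->
  measurable S.
Proof.
move=> hS.
pose Q (q : rat * rat * (rat * rat)) : set (pl R) := obox (ratr q.1.1) (ratr q.1.2) (ratr q.2.1) (ratr q.2.2).
pose B n : set (pl R) := if @unpickle (rat * rat * (rat * rat))%type n is Some q then (if `[< Q q `<=` S >] then Q q else set0) else set0.
have -> : S = \bigcup_n B n.
  apply/seteqP; split=> p; last first.
    move=> [n _]; rewrite /B; case: unpickle => // q.
    by case: asboolP => // h; exact: h.
  move=> Sp; have [e e0 he] := hS p Sp.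
  have r (x y : R) : x < y -> exists q : rat, x < ratr q < y.
    by move=> /rat_in_itvoo[q]; rewrite in_itv /= => h; exists q.
  have [a ha] := r (p.1 - e) p.1 ltac:(lra).
  have [b hb] := r p.1 (p.1 + e) ltac:(lra).
  have [c hc] := r (p.2 - e) p.2 ltac:(lra).
  have [d hd] := r p.2 (p.2 + e) ltac:(lra).
  move: ha hb hc hd => /andP[a1 a2] /andP[b1 b2] /andP[c1 c2] /andP[d1 d2].
  have [n hn] : exists n, @unpickle (rat * rat * (rat * rat))%type n = Some ((a, b), (c, d)).
    by exists (pickle ((a, b), (c, d))); rewrite pickleK.
  exists n; first by [].
  rewrite /B hn.
  have sub : Q ((a, b), (c, d)) `<=` S.
    move=> q /oboxP /= [/andP[q1 q2] /andP[q3 q4]].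
    by apply: he; rewrite ltr_norml; apply/andP; split; lra.
  rewrite asboolT//; apply/oboxP => /=; split; apply/andP; split; lra.
apply: bigcupT_measurable => n; rewrite /B; case: unpickle => // q.
by case: asboolP => // _; exact: measurable_obox.
Qed.

Lemma measurable_lipschitz f (L : R) :
  (forall p q : R * R, `|f q - f p| <= L * (`|q.1 - p.1| + `|q.2 - p.2|)) ->
  measurable_fun setT f.
Proof.
move=> hL; apply: (measurability _ (RGenOInfty.measurableE R)) => // _ [_ [a ->] <-].
rewrite setTI; apply: measurable_sup_open => p; rewrite /= in_itv /= andbT => ap.
pose e := (f p - a) / (2 * (`|L| + 1)).
have L1 : 0 < 2 * (`|L| + 1) by have := normr_ge0 L; lra.
have e0 : 0 < e by rewrite divr_gt0// subr_gt0.
exists e => // q h1 h2; rewrite /= in_itv /= andbT.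
have h := hL p q.
have h3 : L * (`|q.1 - p.1| + `|q.2 - p.2|) <= `|L| * (2 * e).
  apply: (@le_trans _ _ (`|L| * (`|q.1 - p.1| + `|q.2 - p.2|))).
    by rewrite ler_wpM2r ?addr_ge0// ler_norm.
  by rewrite ler_wpM2l//; lra.
have h4 : `|L| * (2 * e) < f p - a.
  have : e * (2 * (`|L| + 1)) = f p - a by rewrite divfK// gt_eqF.
  rewrite !mulrDr mulr1 mulrCA; lra.
have := ler_norm (f p - f q); rewrite distrC; lra.
Qed.

Definition cmeas (f : pl R -> C R) := measurable_fun setT (fun p => complex.Re (f p)) /\
   measurable_fun setT (fun p => complex.Im (f p)).

Lemma cmeasD (f g : pl R -> C R) : cmeas f -> cmeas g -> cmeas (fun p => f p + g p).
Proof.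
move=> [f1 f2] [g1 g2]; split.
  rewrite (_ : (fun p => _) = (fun p => complex.Re (f p) + complex.Re (g p))); [by meas|by apply/funext => p; rewrite ReD].
rewrite (_ : (fun p => _) = (fun p => complex.Im (f p) + complex.Im (g p))); [by meas|by apply/funext => p; rewrite ImD].
Qed.

Lemma cmeasN (f : pl R -> C R) : cmeas f -> cmeas (fun p => - f p).
Proof.
move=> [f1 f2]; split.
  rewrite (_ : (fun p => _) = (fun p => - complex.Re (f p))); [by meas|by apply/funext => p; rewrite ReN].
rewrite (_ : (fun p => _) = (fun p => - complex.Im (f p))); [by meas|by apply/funext => p; rewrite ImN].
Qed.

Lemma cmeasM (f g : pl R -> C R) : cmeas f -> cmeas g -> cmeas (fun p => f p * g p).
Proof.
move=> [f1 f2] [g1 g2]; split.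
  rewrite (_ : (fun p => _) = (fun p => complex.Re (f p) * complex.Re (g p) - complex.Im (f p) * complex.Im (g p))); [by meas|by apply/funext => p; rewrite ReM].
rewrite (_ : (fun p => _) = (fun p => complex.Re (f p) * complex.Im (g p) + complex.Im (f p) * complex.Re (g p))); [by meas|by apply/funext => p; rewrite ImM].
Qed.

Lemma cmeas_cst (c : C R) : cmeas (fun=> c).
Proof. by split; meas. Qed.

Lemma measurable_sqrt f : measurable_fun setT f -> measurable_fun setT (fun p => Num.sqrt (f p)).
Proof.
move=> mf; apply: (measurableT_comp _ mf); apply: continuous_measurable_fun.
exact: sqrt_continuous.
Qed.

Lemma measurable_cmod (f : pl R -> C R) : cmeas f -> measurable_fun setT (fun p => cmod (f p)).
Proof.
move=> [f1 f2]; under eq_fun do rewrite cmodE.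
by apply: measurable_sqrt; meas.
Qed.

Lemma measurable_inv f : measurable_fun setT f -> (forall p, 0 <= f p) ->
  measurable_fun setT (fun p => (f p)^-1).
Proof.
move=> mf f0; apply: (measurability _ (RGenOInfty.measurableE R)) => // _ [_ [a ->] <-].
rewrite setTI; have [a0|a0] := leP 0 a; last first.
  rewrite (_ : _ @^-1` _ = setT)//; apply/seteqP; split=> p //= _.
  by rewrite in_itv /= andbT (lt_le_trans a0)// invr_ge0.
have [->|an0] := eqVneq a 0.
  rewrite (_ : _ @^-1` _ = f @^-1` `]0, +oo[); first by rewrite -[X in measurable X]setTI; exact: mf.
  by apply/seteqP; split=> p /=; rewrite !in_itv /= !andbT invr_gt0.
have ap : 0 < a by rewrite lt_def an0.
rewrite (_ : _ @^-1` _ = f @^-1` `]0, a^-1[); first by rewrite -[X in measurable X]setTI; exact: mf.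
apply/seteqP; split=> p /=; rewrite !in_itv /= !andbT => h.
  have fp : 0 < f p by rewrite -invr_gt0; exact: lt_trans h.
  by rewrite fp /= -(invrK (f p)) ltf_pV2 ?posrE// invr_gt0.
move: h => /andP[fp h]; by rewrite -(invrK a) ltf_pV2 ?posrE// invr_gt0.
Qed.

Lemma cmeasV (f : pl R -> C R) : cmeas f -> cmeas (fun p => (f p)^-1).
Proof.
move=> cf; have [f1 f2] := cf.
have E p : (f p)^-1 = Complex (complex.Re (f p) * (cmod (f p) ^+ 2)^-1) (- complex.Im (f p) * (cmod (f p) ^+ 2)^-1).
  rewrite sqr_cmod; case: (f p) => a b /=.
  by apply: complex_eq => //=; rewrite mulNr.
have mi : measurable_fun setT (fun p => (cmod (f p) ^+ 2)^-1).
  apply: measurable_inv; last by move=> p; exact: sqr_ge0.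
  by have mc := measurable_cmod cf; meas.
split.
  rewrite (_ : (fun p => _) = (fun p => complex.Re (f p) * (cmod (f p) ^+ 2)^-1)); [by meas|by apply/funext => p; rewrite E].
rewrite (_ : (fun p => _) = (fun p => - complex.Im (f p) * (cmod (f p) ^+ 2)^-1)); [by meas|by apply/funext => p; rewrite E].
Qed.

Lemma cmeas_toC : cmeas (@toC R : pl R -> C R).
Proof. by split; [exact: measurable_fst|exact: measurable_snd]. Qed.

Lemma cmeas_conj (f : pl R -> C R) : cmeas f -> cmeas (fun p => conjc (f p)).
Proof.
move=> [f1 f2]; split.
  by rewrite (_ : (fun p => _) = (fun p => complex.Re (f p)))//; apply/funext => p; case: (f p).
rewrite (_ : (fun p => _) = (fun p => - complex.Im (f p))); last by apply/funext => p; case: (f p).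
by meas.
Qed.

(** Meant for the field cut off at a frozen point: its Lipschitz bound makes compositions with it
    measurable. *)
Lemma cmeas_lip (K : C R -> C R) (L : R) (f : pl R -> C R) :
  (forall z w, cmod (K z - K w) <= L * cmod (z - w)) -> 0 <= L -> cmeas f -> cmeas (fun p => K (f p)).
Proof.
move=> hK L0 [f1 f2].
have lip (pr : C R -> R) : (forall z w, `|pr z - pr w| <= cmod (z - w)) ->
    measurable_fun setT (fun p : pl R => pr (K (toC p))).
  move=> hp; apply: (@measurable_lipschitz _ L) => p q.
  apply: (le_trans (hp _ _)); apply: (le_trans (hK _ _)); rewrite ler_wpM2l//.
  exact: cmod_le_ReIm.
have mp : measurable_fun setT (fun p : pl R => (complex.Re (f p), complex.Im (f p)) : pl R).
  by apply/measurable_fun_pairP; split.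
have E p : K (f p) = K (toC (complex.Re (f p), complex.Im (f p))) by rewrite /toC /=; case: (f p).
split; under eq_fun do rewrite E.
  apply: (measurableT_comp (lip _ _) mp) => z w; rewrite -ReB; exact: Re_le_cmod.
apply: (measurableT_comp (lip _ _) mp) => z w; rewrite -ImB; exact: Im_le_cmod.
Qed.

Lemma cmeas_tr (f : pl R -> C R) a : cmeas f -> cmeas (fun p => f (tr a p)).
Proof.
move=> [f1 f2]; split.
  exact: (measurableT_comp f1 (measurable_tr a)).
exact: (measurableT_comp f2 (measurable_tr a)).
Qed.

End Measurability.

(** * Discrete Wirtinger derivatives of the implicit coefficient *)

Section PointwiseComplex.
Context {R : realType}.

Lemma ellipticity_aux1 (n S x tau : R) : n * tau <= (2 * S) * (x / 100) -> n * x <= (2 * S) * x ->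
  n * tau / 2 + (n / 100) * (x + tau) / 2 <= x * (S * (201 / 10000)).
Proof. lra. Qed.

Lemma ellipticity_aux2 (P Q x a b r E0 S w : R) : Q * x <= b + r * x / 2 + w ->
  a <= P * x + r * x / 2 + w -> b <= a / 2 + x * E0 -> w <= x * (S * (201 / 10000)) ->
  Q * x <= (P / 2 + r * (3 / 4) + S * (201 / 10000) * (3 / 2) + E0) * x.
Proof. lra. Qed.

(** [P] and [Q] are the moduli of the discrete Wirtinger derivatives of [W], so [P^2 - Q^2] is the
    Jacobian and [2 (P^2 + Q^2)] the squared gradient. The ratio 55/100 is 1/2 plus the
    perturbations by the step and by the Lipschitz constant 1/100 of [K]. *)
Lemma ellipticity_aux3 (P Q E : R) : 0 <= P -> 0 <= Q -> 0 <= E ->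
  Q <= (55 / 100) * P + (104 / 100) * E ->
  2 * (P ^+ 2 + Q ^+ 2) / 10 - 4 * E ^+ 2 <= P ^+ 2 - Q ^+ 2.
Proof.
move=> P0 Q0 E0 HQ.
have : Q ^+ 2 <= ((55 / 100) * P + (104 / 100) * E) ^+ 2 by rewrite lerXn2r ?nnegrE//; lra.
have := sqr_ge0 ((55 / 100) * P - (104 / 100) * E).
have := sqr_ge0 P; have := sqr_ge0 E.
rewrite !expr2; lra.
Qed.

Lemma ellipticity_real (P Q n1 n2 x tau a b E0 rho : R) : 0 < x -> 0 <= P -> 0 <= Q -> 0 <= n1 -> 0 <= n2 ->
  0 <= tau -> tau <= x / 100 -> 0 <= rho -> 0 <= E0 ->
  Q * x <= b + rho / 2 + (n1 + n2) * tau / 2 + ((n1 + n2) / 100) * (x + tau) / 2 ->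
  a <= P * x + rho / 2 + (n1 + n2) * tau / 2 + ((n1 + n2) / 100) * (x + tau) / 2 ->
  b <= a / 2 + x * E0 -> n1 <= P + Q -> n2 <= P + Q -> n1 ^+ 2 + n2 ^+ 2 = 2 * (P ^+ 2 + Q ^+ 2) ->
  (n1 ^+ 2 + n2 ^+ 2) / 10 - 4 * (E0 + rho / x) ^+ 2 <= P ^+ 2 - Q ^+ 2.
Proof.
move=> x0 P0 Q0 n10 n20 t0 tx r0 E00 hQ ha hb h1 h2 hn.
set r := rho / x; have rE : rho = r * x by rewrite /r divfK// gt_eqF.
have r0' : 0 <= r by rewrite divr_ge0// ltW.
have S : (n1 + n2) * tau / 2 + ((n1 + n2) / 100) * (x + tau) / 2 <= x * ((P + Q) * (201 / 10000)).
  have q0 : n1 + n2 <= 2 * (P + Q) by rewrite [2 * _]mulr_natl mulr2n lerD.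
  apply: ellipticity_aux1; last by rewrite ler_pM2r.
  by apply: ler_pM => //; rewrite addr_ge0.
rewrite -addrA rE in hQ; rewrite -addrA rE in ha.
have := ellipticity_aux2 hQ ha hb S; rewrite ler_pM2r// => H.
rewrite hn; apply: ellipticity_aux3 => //; first by rewrite addr_ge0.
by move: H r0' E00 P0 Q0; clear; move: r => r; lra.
Qed.

(** The values of [F] and of the implicit [W] at the vertices [z], [z + t], [z + i t] of one
    triangle; [Fx] and [Fy] will be the weak derivatives of [F] at [z], and [r1], [r2] are the
    remainders of its difference quotients. *)
Variables (z W0 W1 W2 Fx Fy F0 F1 F2 : C R) (K : C R -> C R) (t : R).
Local Notation i := (imunit R).
Local Notation T := ((t%:C)%C : C R).
Hypotheses (t0 : t != 0).
Hypothesis hK : forall w w', cmod (K w - K w') <= cmod (w - w') / 100.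
Hypothesis e0 : F0 = W0 * z + K W0 * conjc z.
Hypothesis e1 : F1 = W1 * (z + T) + K W1 * conjc (z + T).
Hypothesis e2 : F2 = W2 * (z + i * T) + K W2 * conjc (z + i * T).
Let d1 := (W1 - W0) / T.
Let d2 := (W2 - W0) / T.
Let k1 := (K W1 - K W0) / T.
Let k2 := (K W2 - K W0) / T.
Let r1 := (F1 - F0) / T - Fx.
Let r2 := (F2 - F0) / T - Fy.

Let T0 : T != 0.
Proof. by apply/eqP => -[] /eqP; rewrite (negbTE t0). Qed.

Let conj1 : conjc (z + T) = conjc z + T.
Proof. by rewrite rmorphD /= oppr0. Qed.

Let conj2 : conjc (z + i * T) = conjc z - i * T.
Proof.
by apply: complex_eq; case: (z) => a b /=; ring.
Qed.

Let ii : i * i = -1 := sqr_imunit.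

Lemma quot_eq1 : d1 * (z + T) + k1 * (conjc z + T) + W0 + K W0 = Fx + r1.
Proof. by rewrite /r1 e0 e1 conj1 /d1 /k1; move: (conjc z) => zb; field. Qed.

Lemma quot_eq2 : d2 * (z + i * T) + k2 * (conjc z - i * T) + i * W0 - i * K W0 = Fy + r2.
Proof. by rewrite /r2 e0 e2 conj2 /d2 /k2; move: (conjc z) => zb; field. Qed.

Let p := 2^-1 * (d1 - i * d2).
Let m := 2^-1 * (d1 + i * d2).

Lemma two_neq0 : (2 : C R) != 0.
Proof. by rewrite pnatr_eq0. Qed.

(** This combination of [quot_eq1] and [quot_eq2] cancels [W0] and keeps [K W0]; in [p_eq] it is the
    other way round. Together they relate [m] and [p] to the deviations of the two derivatives of
    [F] from those of the affine solution. *)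
Lemma m_eq : m * z = (2^-1 * (Fx + i * Fy) - K W0) + 2^-1 * (r1 + i * r2)
  - 2^-1 * ((d1 - d2) * T) - 2^-1 * (k1 * (conjc z + T) + i * (k2 * (conjc z - i * T))).
Proof.
have h1 := quot_eq1; have h2 := quot_eq2; have h := ii; have n2 := two_neq0.
have -> : 2^-1 * (Fx + i * Fy) - K W0 + 2^-1 * (r1 + i * r2) = 2^-1 * ((Fx + r1) + i * (Fy + r2)) - K W0 by ring.
rewrite -h1 -h2 /m; move: (conjc z) (K W0) k1 k2 d1 d2 => zb k a b c d.
apply/eqP; rewrite -subr_eq0; apply/eqP.
transitivity ((i * i + 1) * (2^-1 * (- d * T - W0 + k))); last by rewrite h addNr mul0r.
by field.
Qed.

Lemma p_eq : 2^-1 * (Fx - i * Fy) - W0 = p * z - 2^-1 * (r1 - i * r2)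
  + 2^-1 * ((d1 + d2) * T) + 2^-1 * (k1 * (conjc z + T) - i * (k2 * (conjc z - i * T))).
Proof.
have h1 := quot_eq1; have h2 := quot_eq2; have h := ii; have n2 := two_neq0.
have -> : 2^-1 * (Fx - i * Fy) - W0 = 2^-1 * ((Fx + r1) - i * (Fy + r2)) - W0 - 2^-1 * (r1 - i * r2) by ring.
rewrite -h1 -h2 /p; move: (conjc z) (K W0) k1 k2 d1 d2 => zb k a b c d.
apply/eqP; rewrite -subr_eq0; apply/eqP.
transitivity ((i * i + 1) * (2^-1 * (- d * T - W0 + k))); last by rewrite h addNr mul0r.
by field.
Qed.

Let n1 := cmod d1.
Let n2 := cmod d2.
Let rho := cmod r1 + cmod r2.

Lemma kappa_le (W : C R) : cmod ((K W - K W0) / T) <= cmod ((W - W0) / T) / 100.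
Proof.
rewrite !cmodM cmodV cmod_real mulrAC ler_wpM2r ?invr_ge0//; exact: hK.
Qed.

Let c1 : cmod (conjc z + T) <= cmod z + `|t|.
Proof. by apply: (le_trans (cmodD _ _)); rewrite cmod_conj cmod_real. Qed.

Let c2 : cmod (conjc z - i * T) <= cmod z + `|t|.
Proof. by apply: (le_trans (cmodB _ _)); rewrite cmod_conj cmodM cmod_imunit mul1r cmod_real. Qed.

Lemma kappa_sum_le (s : C R) : cmod s = 1 ->
  cmod (2^-1 * (k1 * (conjc z + T) + s * (i * (k2 * (conjc z - i * T))))) <= ((n1 + n2) / 100) * (cmod z + `|t|) / 2.
Proof.
move=> s1; rewrite cmod_half ler_pM2r ?invr_gt0//; apply: (le_trans (cmodD _ _)).
rewrite (cmodM k1) (cmodM s) (cmodM i) (cmodM k2) s1 cmod_imunit !mul1r 2!mulrDl.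
by apply: lerD; apply: ler_pM (cmod_ge0 _) (cmod_ge0 _) (kappa_le _) _.
Qed.

(* Subtracting the two difference quotients of [F = W z + K(W) conj z] shows that the
   quotients [d1], [d2] of [W] satisfy [|d1 + i d2| <= k |d1 - i d2| + error] with [k < 1],
   so that the Jacobian dominates [|d1|^2 + |d2|^2]. *)
Lemma ellipticity (E0 : R) : 0 < cmod z -> `|t| <= cmod z / 100 -> 0 <= E0 ->
  cmod (2^-1 * (Fx + i * Fy) - K W0) <= cmod (2^-1 * (Fx - i * Fy) - W0) / 2 + cmod z * E0 ->
  (n1 ^+ 2 + n2 ^+ 2) / 10 - 4 * (E0 + rho / cmod z) ^+ 2 <=
    complex.Re d1 * complex.Im d2 - complex.Re d2 * complex.Im d1.
Proof.
move=> z0 tz E00 hB.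
have n20 := two_neq0.
have pm1 : d1 = p + m by rewrite /p /m; move: d1 d2 => a b; field.
have pm2 : d2 = i * (p - m).
  have -> : i * (p - m) = - (i * i) * d2 by rewrite /p /m; move: d1 d2 => a b; field.
  by rewrite ii opprK mul1r.
have hn1 : n1 <= cmod p + cmod m by rewrite /n1 pm1; exact: cmodD.
have hn2 : n2 <= cmod p + cmod m by rewrite /n2 pm2 cmodM cmod_imunit mul1r; exact: cmodB.
have Rp : complex.Re p = (complex.Re d1 + complex.Im d2) / 2 /\ complex.Im p = (complex.Im d1 - complex.Re d2) / 2.
  have [-> ->] : complex.Re d1 = complex.Re p + complex.Re m /\ complex.Im d1 = complex.Im p + complex.Im m by rewrite pm1 ReD ImD.
  by rewrite pm2 ReM ImM /= !ReB !ImB; split; field.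
have Rm : complex.Re m = (complex.Re d1 - complex.Im d2) / 2 /\ complex.Im m = (complex.Im d1 + complex.Re d2) / 2.
  have [-> ->] : complex.Re d1 = complex.Re p + complex.Re m /\ complex.Im d1 = complex.Im p + complex.Im m by rewrite pm1 ReD ImD.
  by rewrite pm2 ReM ImM /= !ReB !ImB; split; field.
have J : complex.Re d1 * complex.Im d2 - complex.Re d2 * complex.Im d1 = cmod p ^+ 2 - cmod m ^+ 2.
  by rewrite !sqr_cmod Rp.1 Rp.2 Rm.1 Rm.2; field.
have N : n1 ^+ 2 + n2 ^+ 2 = 2 * (cmod p ^+ 2 + cmod m ^+ 2).
  by rewrite /n1 /n2 !sqr_cmod Rp.1 Rp.2 Rm.1 Rm.2; field.
rewrite J.
have rl (s : C R) : cmod s = 1 -> cmod (2^-1 * (r1 + s * (i * r2))) <= rho / 2.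
  move=> s1; rewrite cmod_half ler_pM2r ?invr_gt0//; apply: (le_trans (cmodD _ _)).
  by rewrite (cmodM s) (cmodM i) s1 cmod_imunit !mul1r.
have dl (d : C R) : cmod d <= n1 + n2 -> cmod (2^-1 * (d * T)) <= (n1 + n2) * `|t| / 2.
  by move=> h; rewrite cmod_half ler_pM2r ?invr_gt0// cmodM cmod_real ler_wpM2r.
have mone : cmod (-1 : C R) = 1 by rewrite cmodN cmod1.
have r0 : 0 <= rho by rewrite addr_ge0// cmod_ge0.
apply: (ellipticity_real z0 (cmod_ge0 p) (cmod_ge0 m) (cmod_ge0 d1) (cmod_ge0 d2) (normr_ge0 t) tz r0 E00 _ _ hB hn1 hn2 N).
  rewrite -cmodM m_eq.
  have q1 := rl 1 cmod1; rewrite mul1r in q1.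
  have q2 := dl _ (cmodB d1 d2).
  have q3 := kappa_sum_le cmod1; rewrite mul1r in q3.
  apply: (le_trans (cmodB _ _)); apply: lerD => //.
  apply: (le_trans (cmodB _ _)); apply: lerD => //.
  apply: (le_trans (cmodD _ _)); exact: lerD.
rewrite p_eq.
have q1 := rl (-1) mone; rewrite mulN1r in q1.
have q2 := dl _ (cmodD d1 d2).
have q3 := kappa_sum_le mone; rewrite mulN1r in q3.
apply: (le_trans (cmodD _ _)); apply: lerD => //.
apply: (le_trans (cmodD _ _)); apply: lerD => //.
apply: (le_trans (cmodB _ _)); rewrite cmodM; exact: lerD.
Qed.

(** Valid for all sizes of [W], this supplies the L2 majorant of the difference quotients. The
    factor 2 absorbs the terms with [t] and with the constant 1/100. *)
Lemma quot_growth (M : R) : 0 < cmod z -> `|t| <= cmod z / 100 -> cmod (K W0) <= M ->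
  n1 <= 2 * (cmod Fx + cmod r1 + cmod W0 + M) / cmod z /\
  n2 <= 2 * (cmod Fy + cmod r2 + cmod W0 + M) / cmod z.
Proof.
move=> z0 tz hM.
have S (x y : R) : 0 <= x -> 0 <= y -> x * (cmod z - `|t|) <= y + x / 100 * (cmod z + `|t|) -> x <= 2 * y / cmod z.
  move=> x0 y0 h; rewrite ler_pdivlMr//.
  have q : x * `|t| <= x * (cmod z / 100) by rewrite ler_wpM2l.
  lra.
have lo (w : C R) : cmod w = `|t| -> cmod z - `|t| <= cmod (z + w).
  by move=> <-; have := cmodB (z + w) w; rewrite addrK; lra.
have tw1 : cmod T = `|t| by rewrite cmod_real.
have tw2 : cmod (i * T) = `|t| by rewrite cmodM cmod_imunit mul1r cmod_real.
have M0 : 0 <= M := le_trans (cmod_ge0 _) hM.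
split; apply: S; rewrite ?cmod_ge0//.
- by rewrite !addr_ge0 ?cmod_ge0.
- apply: (@le_trans _ _ (cmod (d1 * (z + T)))).
    by rewrite cmodM ler_wpM2l ?cmod_ge0//; exact: lo.
  have -> : d1 * (z + T) = ((Fx + r1) - (W0 + K W0)) - k1 * (conjc z + T) by rewrite -quot_eq1; ring.
  apply: (le_trans (cmodB _ _)); apply: lerD; last first.
    by rewrite cmodM; apply: ler_pM; rewrite ?cmod_ge0//; exact: kappa_le.
  apply: (le_trans (cmodB _ _)); have := cmodD Fx r1; have := cmodD W0 (K W0); lra.
- by rewrite !addr_ge0 ?cmod_ge0.
- apply: (@le_trans _ _ (cmod (d2 * (z + i * T)))).
    by rewrite cmodM ler_wpM2l ?cmod_ge0//; exact: lo.
  have -> : d2 * (z + i * T) = ((Fy + r2) - (i * W0 - i * K W0)) - k2 * (conjc z - i * T) by rewrite -quot_eq2; ring.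
  apply: (le_trans (cmodB _ _)); apply: lerD; last first.
    by rewrite cmodM; apply: ler_pM; rewrite ?cmod_ge0//; exact: kappa_le.
  apply: (le_trans (cmodB _ _)); have := cmodD Fy r2; have := cmodB (i * W0) (i * K W0).
  rewrite !cmodM cmod_imunit !mul1r; lra.
Qed.

End PointwiseComplex.

(** * Solving the implicit equation by a measurable function *)

Section FixedPoint.
Context {R : realType}.

Lemma cvg_of_geometric_diff (x : nat -> R) (c : R) : 0 <= c ->
  (forall n, `|x n.+1 - x n| <= c * 2^-1 ^+ n) -> cvgn x.
Proof.
move=> c0 h.
have hs : cvgn (series (telescope x)).
  apply: normed_cvg; apply: (@series_le_cvg _ _ (geometric c 2^-1)).
  - by move=> n /=.
  - by move=> n; rewrite /geometric /= mulr_ge0// exprn_ge0.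
  - by move=> n; exact: h.
  - by apply: is_cvg_geometric_series; rewrite ger0_norm// invf_lt1// ltr1n.
have -> : x = (fun n => x 0%N + series (telescope x) n) by apply/funext => n; exact: eq_sum_telescope.
by apply: is_cvgD => //; exact: is_cvg_cst.
Qed.

Lemma cmod_cvg_le (x y : nat -> R) (a b d : R) : x @ \oo --> a -> y @ \oo --> b ->
  0 < d -> \forall n \near \oo, cmod (Complex a b - Complex (x n) (y n) : C R) <= d.
Proof.
move=> xa yb d0; have d2 : 0 < d / 2 by lra.
move/cvgrPdist_le : xa => /(_ _ d2) xa; move/cvgrPdist_le : yb => /(_ _ d2) yb.
near=> n; apply: (le_trans (cmod_le_ReIm _)) => /=.
have h1 : `|a - x n| <= d / 2 by near: n.
have h2 : `|b - y n| <= d / 2 by near: n.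
lra.
Unshelve. all: end_near. Qed.

Variables (K : C R -> C R) (V q : pl R -> C R).
Hypothesis hK : forall w w', cmod (K w - K w') <= cmod (w - w') / 100.
Hypotheses (mV : cmeas V) (mq : cmeas q) (q1 : forall p, cmod (q p) <= 1).

(* Banach iteration for [W = V - q K(W)], a contraction because [K] is 1/100-Lipschitz. *)
Fixpoint Wn (n : nat) (p : pl R) : C R :=
  if n is n'.+1 then V p - q p * K (Wn n' p) else 0.

Lemma cmeas_Wn n : cmeas (Wn n).
Proof.
elim: n => [|n IH]; first exact: cmeas_cst.
apply: cmeasD => //; apply: cmeasN; apply: cmeasM => //.
apply: (@cmeas_lip _ K (100^-1)) => // z w; rewrite mulrC; exact: hK.
Qed.

Lemma Wn_step n p : cmod (Wn n.+2 p - Wn n.+1 p) <= cmod (Wn n.+1 p - Wn n p) * 2^-1.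
Proof.
have -> : Wn n.+2 p - Wn n.+1 p = - (q p * (K (Wn n.+1 p) - K (Wn n p))) by rewrite /=; ring.
rewrite cmodN cmodM; apply: (@le_trans _ _ (1 * (cmod (Wn n.+1 p - Wn n p) / 100))).
  by apply: ler_pM; rewrite ?cmod_ge0//; exact: hK.
by rewrite mul1r ler_wpM2l ?cmod_ge0// lef_pV2 ?posrE// ler_nat.
Qed.

Lemma Wn_geo n p : cmod (Wn n.+1 p - Wn n p) <= cmod (Wn 1 p - Wn 0 p) * 2^-1 ^+ n.
Proof.
elim: n => [|n IH]; first by rewrite expr0 mulr1.
by apply: (le_trans (Wn_step _ _)); rewrite exprSr mulrA ler_pM2r.
Qed.

(** The iterates are measurable functions of [p] and converge geometrically at every point, so the
    pointwise solution is measurable. *)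
Lemma fixpoint_exists : exists2 W : pl R -> C R, cmeas W & forall p, W p = V p - q p * K (W p).
Proof.
have cr p : cvgn (fun n => complex.Re (Wn n p)).
  apply: (@cvg_of_geometric_diff _ _ (cmod_ge0 (Wn 1 p - Wn 0 p))) => n.
  by rewrite -ReB; apply: le_trans (Re_le_cmod _) (Wn_geo _ _).
have ci p : cvgn (fun n => complex.Im (Wn n p)).
  apply: (@cvg_of_geometric_diff _ _ (cmod_ge0 (Wn 1 p - Wn 0 p))) => n.
  by rewrite -ImB; apply: le_trans (Im_le_cmod _) (Wn_geo _ _).
pose a p := limn (fun n => complex.Re (Wn n p)).
pose b p := limn (fun n => complex.Im (Wn n p)).
exists (fun p => Complex (a p) (b p) : C R).
  split=> /=.
    apply: (@measurable_fun_cvg _ _ _ _ (fun n p => complex.Re (Wn n p))) => [n|p _]; last exact: cr.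
    by have [] := cmeas_Wn n.
  apply: (@measurable_fun_cvg _ _ _ _ (fun n p => complex.Im (Wn n p))) => [n|p _]; last exact: ci.
  by have [] := cmeas_Wn n.
move=> p; set w : C R := Complex (a p) (b p).
apply/eqP; rewrite -subr_eq0; apply/eqP; apply: cmod0_eq.
apply/eqP; rewrite eq_le cmod_ge0 andbT; apply/ler_addgt0Pr => d d0; rewrite add0r.
have d2 : 0 < d / 2 by lra.
have h1 := cmod_cvg_le (cr p) (ci p) d2.
near \oo => n.
have hn : cmod (w - Wn n p) <= d / 2.
  by rewrite [Wn n p](_ : _ = Complex (complex.Re (Wn n p)) (complex.Im (Wn n p))); [near: n|case: (Wn n p)].
have hn1 : cmod (w - Wn n.+1 p) <= d / 2.
  rewrite [Wn n.+1 p](_ : _ = Complex (complex.Re (Wn n.+1 p)) (complex.Im (Wn n.+1 p))); last by case: (Wn n.+1 p).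
  near: n; case: h1 => N _ hN; exists N => // n /= Nn; exact: (hN n.+1 (leqW Nn)).
have -> : w - (V p - q p * K w) = (w - Wn n.+1 p) - q p * (K (Wn n p) - K w) by rewrite /=; ring.
apply: (le_trans (cmodB _ _)); rewrite cmodM.
have : cmod (q p) * cmod (K (Wn n p) - K w) <= 1 * (cmod (Wn n p - w) / 100).
  by apply: ler_pM; rewrite ?cmod_ge0//; exact: hK.
rewrite mul1r cmod_dist in hn *; lra.
Unshelve. all: end_near. Qed.

End FixedPoint.

(** * The energy inequality for the implicit coefficient on an annulus *)

Section Step.
Context {R : realType}.
Variables (r r' s O M : R) (F Fx Fy W : pl R -> C R) (K : C R -> C R) (E1 : pl R -> R).
Local Notation nz p := (cmod (toC p)).
Local Notation i := (imunit R).

Definition remx t (p : pl R) : C R := (F (tr (t, 0) p) - F p) / ((t%:C)%C : C R) - Fx p.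
Definition remy t (p : pl R) : C R := (F (tr (0, t) p) - F p) / ((t%:C)%C : C R) - Fy p.

Definition disc (d : R) : set (pl R) := [set p | nz p < d].

Hypotheses (r'0 : 0 < r') (r'r : r' < r) (s0 : 0 <= s) (M0 : 0 <= M) (O0 : 0 <= O).
Hypotheses (mF : cmeas F) (mFx : cmeas Fx) (mFy : cmeas Fy) (mW : cmeas W).
Hypotheses (LFx : L2 (fun p => cmod (Fx p))) (LFy : L2 (fun p => cmod (Fy p))).
Hypothesis hK : forall w w', cmod (K w - K w') <= cmod (w - w') / 100.
Hypothesis KM : forall w, cmod (K w) <= M.
Hypothesis FO : forall p, nz p < r -> cmod (F p) <= O.
Hypothesis WE : forall p, 0 < nz p -> F p = W p * toC p + K (W p) * conjc (toC p).
(** With [W_bound] this gives [|W| <= s] on the outer ring, so that the superlevel sets stay inside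
    the disc of radius [r']. *)
Hypothesis bd : forall p, r' <= nz p -> nz p < r -> O / nz p + M <= s.
Hypothesis remxc : forall r1 (t_ : nat -> R), r1 < r -> (forall n, t_ n != 0) -> t_ @ \oo --> 0 ->
  (II (fun p => (\1_(disc r1) p * cmod (remx (t_ n) p) ^+ 2)%R) @[n --> \oo] --> 0)%E.
Hypothesis remyc : forall r1 (t_ : nat -> R), r1 < r -> (forall n, t_ n != 0) -> t_ @ \oo --> 0 ->
  (II (fun p => (\1_(disc r1) p * cmod (remy (t_ n) p) ^+ 2)%R) @[n --> \oo] --> 0)%E.
Hypotheses (mE1 : measurable_fun setT E1) (E10 : forall p, 0 <= E1 p).
(** The null set is chosen before [w], so that [w] may be the value of [W] at the point. *)
Hypothesis heq : {ae leb2 R, forall p : pl R, nz p < r -> forall w, s <= cmod w ->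
  cmod (2^-1 * (Fx p + i * Fy p) - K w) <= cmod (2^-1 * (Fx p - i * Fy p) - w) / 2 + nz p * E1 p}.

Definition Uf (p : pl R) : R := \1_(disc r) p * complex.Re (W p).

Variables (eta G : pl R -> R) (delta Gb k : R).
Hypotheses (d0 : 0 < delta) (k0 : 0 < k) (Gb0 : 0 <= Gb).
Hypotheses (meta : measurable_fun setT eta) (eta01 : forall p, 0 <= eta p <= 1).
Hypotheses (mG : measurable_fun setT G) (G01 : forall p, 0 <= G p <= Gb).
Hypothesis eta0 : forall p, nz p <= delta -> eta p = 0.
Hypothesis etaG : forall (p q : pl R), delta / 2 <= nz p -> nz (q.1 - p.1, q.2 - p.2) <= delta / 200 ->
  `|eta q - eta p| <= nz (q.1 - p.1, q.2 - p.2) * G p.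

Lemma measurable_nz : measurable_fun setT (fun p : pl R => nz p).
Proof. exact: (measurable_cmod cmeas_toC). Qed.

Lemma measurable_disc d : measurable (disc d).
Proof.
rewrite -[X in measurable X]setTI (_ : disc d = (fun p : pl R => nz p) @^-1` `]-oo, d[).
  exact: measurable_nz.
by apply/seteqP; split=> p /=; rewrite in_itv.
Qed.

(** Cells are based in [A], and [A0] is a larger annulus that contains their vertices. [W] is
    bounded by [B] on it, whereas no bound is available near the origin; the choice of [t0] also
    keeps the step below [|z| / 100] on [A]. *)
Let A0 : set (pl R) := [set p | delta / 4 <= nz p < r].
Let r2 := (r' + r) / 2.
Let A : set (pl R) := [set p | delta / 2 <= nz p <= r2].
Let t0 := minr (delta / 200) ((r - r') / 4).
Let B := O / (delta / 4) + M.

Lemma measurable_nz_itv (j : interval R) : measurable [set p : pl R | nz p \in j].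
Proof.
rewrite -[X in measurable X]setTI (_ : mkset _ = (fun p : pl R => nz p) @^-1` [set` j])//.
exact: measurable_nz.
Qed.

Let mA0 : measurable A0.
Proof.
rewrite (_ : A0 = [set p : pl R | nz p \in `[delta / 4, r[]); first exact: measurable_nz_itv.
by apply/seteqP; split=> p /=; rewrite in_itv.
Qed.

Let mA : measurable A.
Proof.
rewrite (_ : A = [set p : pl R | nz p \in `[delta / 2, r2]]); first exact: measurable_nz_itv.
by apply/seteqP; split=> p /=; rewrite in_itv.
Qed.

Lemma disc_box d : disc d `<=` box d.
Proof.
move=> p h; apply/boxP; have := Re_le_cmod (toC p); have := Im_le_cmod (toC p).
by move=> /= h1 h2; split; [apply: le_trans h2 _|apply: le_trans h1 _]; exact: ltW.
Qed.

Let A0r : A0 `<=` box r.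
Proof. by move=> p /andP[_ h]; exact: disc_box. Qed.

Let r2r : r2 < r. Proof. by have h := r'r; rewrite /r2; lra. Qed.

Let AA0 : A `<=` disc r.
Proof. by move=> p /andP[_ h]; exact: le_lt_trans h r2r. Qed.

Let t00 : 0 < t0.
Proof.
have h1 := r'r; have h2 := d0.
by rewrite /t0 lt_min; apply/andP; split; lra.
Qed.

Lemma W_bound p : 0 < nz p -> nz p < r -> cmod (W p) <= O / nz p + M.
Proof.
move=> p0 pr; have h := WE p0; have hF := FO pr.
have E : W p * toC p = F p - K (W p) * conjc (toC p) by rewrite h addrK.
have : cmod (W p) * nz p <= O + M * nz p.
  rewrite -cmodM E; apply: (le_trans (cmodB _ _)); apply: lerD => //.
  by rewrite cmodM cmod_conj ler_wpM2r ?cmod_ge0.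
rewrite -(ler_pM2r p0 (cmod (W p))) mulrDl divfK ?gt_eqF//.
Qed.

Let WB p : A0 p -> cmod (W p) <= B.
Proof.
move=> /andP[p1 p2]; have d0' := d0.
have d4 : 0 < delta / 4 by lra.
have p0 : 0 < nz p := lt_le_trans d4 p1.
apply: (le_trans (W_bound p0 p2)); rewrite /B lerD2r ler_wpM2l// lef_pV2 ?posrE//.
Qed.

Let B0 : 0 <= B.
Proof. by have h := d0; rewrite /B addr_ge0// divr_ge0//; lra. Qed.

Let u p : R := \1_A0 p * complex.Re (W p).
Let v p : R := \1_A0 p * complex.Im (W p).

Let tame_cut (f : pl R -> R) : measurable_fun setT f -> (forall p, A0 p -> `|f p| <= B) ->
  tame (fun p => \1_A0 p * f p).
Proof.
move=> mf hf; have mi := measurable_indic (R := R) (D := setT) mA0.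
apply: (tame_sub (B := B) _ (tame_indic mA0 A0r)); first by meas.
  move=> p; rewrite indicE; case: (boolP (p \in A0)) => [/set_mem h|_]; first by rewrite mul1r hf.
  by rewrite mul0r normr0.
by move=> p ->; rewrite mul0r.
Qed.

Let tu : tame u.
Proof.
have [m1 _] := mW; apply: tame_cut => // p /WB; apply: le_trans; exact: Re_le_cmod.
Qed.

Let tv : tame v.
Proof.
have [_ m1] := mW; apply: tame_cut => // p /WB; apply: le_trans; exact: Im_le_cmod.
Qed.

Let near_nz (p q : pl R) (e : R) : nz (q.1 - p.1, q.2 - p.2) <= e -> nz p - e <= nz q /\ nz q <= nz p + e.
Proof.
have -> : toC (q.1 - p.1, q.2 - p.2) = toC q - toC p by apply: complex_eq.
move=> h; have := cmodD (toC p) (toC q - toC p); rewrite addrC subrK.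
have := cmodB (toC q) (toC q - toC p); rewrite opprB addrC subrK; lra.
Qed.

Let tr_nz (t : R) (p : pl R) : nz ((tr (t, 0) p).1 - p.1, (tr (t, 0) p).2 - p.2) = `|t| /\
  nz ((tr (0, t) p).1 - p.1, (tr (0, t) p).2 - p.2) = `|t|.
Proof.
rewrite /tr /= !addr0 !subrr !(addrC _ t) !addrK; split.
  by rewrite cmodE /= expr0n addr0 sqrtr_sqr.
by rewrite cmodE /= expr0n add0r sqrtr_sqr.
Qed.

(** A point near the complement of [A] is either close to the origin, where [eta] vanishes, or
    beyond the radius [r'], where [bd] applies or [u] is truncated to 0. *)
Let hA0 (p q : pl R) : ~ A p -> nz (q.1 - p.1, q.2 - p.2) <= t0 -> eta q = 0 \/ u q <= s.
Proof.
move=> nA hq; have d0' := d0; have s0' := s0; have r'r' := r'r; have r'0' := r'0.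
have [h1 h2] : t0 <= delta / 200 /\ t0 <= (r - r') / 4.
  by rewrite /t0; split; rewrite ge_min lexx ?orbT.
have [k1 k2] := near_nz hq.
have [pd|pd] := ltP (nz p) (delta / 2); first by left; apply: eta0; lra.
have [pr|pr] := leP (nz p) r2; first by exfalso; apply: nA; rewrite /A /= pd pr.
right; rewrite /u indicE; case: (boolP (q \in A0)) => [/set_mem/andP[q1 q2]|_]; last by rewrite mul0r.
rewrite mul1r; apply: (le_trans (ler_norm _)); apply: (le_trans (Re_le_cmod _)).
have q3 : r' <= nz q by rewrite /r2 in pr; lra.
by apply: (le_trans (W_bound _ q2) (bd q3 q2)); lra.
Qed.

Let trA0 (p q : pl R) : A p -> nz (q.1 - p.1, q.2 - p.2) <= t0 -> A0 q.
Proof.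
move=> /andP[p1 p2] hq; have d0' := d0; have r'r' := r'r.
have [h1 h2] : t0 <= delta / 200 /\ t0 <= (r - r') / 4.
  by rewrite /t0; split; rewrite ge_min lexx ?orbT.
have [k1 k2] := near_nz hq; rewrite /r2 in p2.
by rewrite /A0 /=; apply/andP; split; lra.
Qed.

(** The powers of [1 / delta] come from [1 / |z| <= 2 / delta] on [A], and the numerical constants
    from [sq_bound2] and [sq_bound3]. *)
Let cc := 64 / delta ^+ 2.
Let rho (t : R) (p : pl R) : R := cc * (\1_A p * (cmod (remx t p) ^+ 2) + \1_A p * (cmod (remy t p) ^+ 2)).
Let gam (p : pl R) : R := (8 / delta) * (\1_A p * (cmod (Fx p) + cmod (Fy p) + 2 * (B + M))).

Let cc0 : 0 <= cc. Proof. by rewrite divr_ge0// sqr_ge0. Qed.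

Let iA p : 0 <= (\1_A p : R). Proof. by rewrite indicE. Qed.

Let mremx t : cmeas (remx t).
Proof.
apply: cmeasD; last exact: cmeasN.
apply: cmeasM; last exact: cmeas_cst.
by apply: cmeasD; [exact: cmeas_tr|exact: cmeasN].
Qed.

Let mremy t : cmeas (remy t).
Proof.
apply: cmeasD; last exact: cmeasN.
apply: cmeasM; last exact: cmeas_cst.
by apply: cmeasD; [exact: cmeas_tr|exact: cmeasN].
Qed.

Let mrho t : measurable_fun setT (rho t).
Proof.
have mi := measurable_indic (R := R) (D := setT) mA.
have m1 := measurable_cmod (mremx t); have m2 := measurable_cmod (mremy t).
by rewrite /rho; meas.
Qed.

Let rho0 t p : 0 <= rho t p.
Proof. by rewrite /rho mulr_ge0// addr_ge0// mulr_ge0// sqr_ge0. Qed.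

Let rhoc (t_ : nat -> R) : (forall n, t_ n != 0) -> t_ @ \oo --> 0 -> (II (rho (t_ n)) @[n --> \oo] --> 0)%E.
Proof.
move=> tn tc.
pose r1 := (r2 + r) / 2; have r1r : r1 < r by have h := r2r; rewrite /r1; lra.
have Ar p : (\1_A p : R) <= \1_(disc r1) p.
  rewrite !indicE; case: (boolP (p \in A)) => [/set_mem/andP[_ h]|_]; last by case: (_ \in _).
  by rewrite mem_set//= /disc /=; have h2 := r2r; rewrite /r1; lra.
have i1 p : 0 <= (\1_(disc r1) p : R) by rewrite indicE.
have mi := measurable_indic (R := R) (D := setT) (measurable_disc r1).
have miA := measurable_indic (R := R) (D := setT) mA.
apply: (@squeeze_cvge _ _ _ _ (fun=> 0%E) _ (fun n => cc%:E * (II (fun p => (\1_(disc r1) p * cmod (remx (t_ n) p) ^+ 2)%R) + II (fun p => (\1_(disc r1) p * cmod (remy (t_ n) p) ^+ 2)%R)))%E).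
- apply: nearW => n; rewrite II_ge0 /=; last by move=> p; exact: rho0.
  have m1 := measurable_cmod (mremx (t_ n)); have m2 := measurable_cmod (mremy (t_ n)).
  have q0 (f : R) (x : R) : 0 <= x -> 0 <= x * f ^+ 2 by move=> x0; rewrite mulr_ge0// sqr_ge0.
  rewrite -IID; [|by meas|by meas|by move=> p; exact: q0|by move=> p; exact: q0].
  rewrite -IIZ//; [|by meas|by move=> p; rewrite addr_ge0// q0].
  apply: II_le; [by apply: mrho|by meas|by move=> p; exact: rho0|].
  by move=> p; rewrite /rho ler_wpM2l// lerD// ler_wpM2r ?sqr_ge0.
- exact: cvg_cst.
- rewrite -[X in _ --> X](mule0 cc%:E); apply: cvgeM => //; first exact: cvg_cst.
  by rewrite -[X in _ --> X](adde0 0%E); apply: cvgeD => //; [exact: remxc|exact: remyc].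
Qed.

Let gam0 p : 0 <= gam p.
Proof.
have h := d0; apply: mulr_ge0; first by rewrite divr_ge0// ltW.
apply: mulr_ge0 => //; apply: addr_ge0; first by apply: addr_ge0; exact: cmod_ge0.
by apply: mulr_ge0 => //; exact: addr_ge0.
Qed.

Let tA : tame (\1_A : pl R -> R).
Proof. by apply: (tame_indic mA (B := r)) => p /AA0; exact: disc_box. Qed.

Let L2_gam : L2 gam.
Proof.
apply: L2Z.
have L1 (f : pl R -> R) : L2 f -> L2 (fun p => \1_A p * f p).
  move=> Lf; have [mf _] := Lf; have mi := measurable_indic (R := R) (D := setT) mA.
  apply: (@L2_le _ _ (fun p => f p ^+ 2)).
  - by meas.
  - by move=> p; exact: sqr_ge0.
  - exact: L2_integrable.
  - move=> p; rewrite exprMn indicE; case: (_ \in _); rewrite ?expr1n ?mul1r// expr0n mul0r sqr_ge0//.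
have Lc : L2 (fun p => \1_A p * (2 * (B + M))).
  apply: (@tame_L2 R); have := tameZ (2 * (B + M)) tA; congr tame; apply/funext => p; exact: mulrC.
have E p : \1_A p * (cmod (Fx p) + cmod (Fy p) + 2 * (B + M)) = \1_A p * (cmod (Fx p) + cmod (Fy p)) + \1_A p * (2 * (B + M)).
  by rewrite mulrDr.
rewrite (_ : (fun p => _) = (fun p => \1_A p * (cmod (Fx p) + cmod (Fy p)) + \1_A p * (2 * (B + M)))); last by apply/funext.
by apply: L2D => //; apply: L1; apply: L2D.
Qed.

Let uvE p : A0 p -> u p = complex.Re (W p) /\ v p = complex.Im (W p).
Proof. by move=> h; rewrite /u /v indicE mem_set// !mul1r. Qed.

Let toC_tr (t : R) (p : pl R) : toC (tr (t, 0) p) = toC p + (t%:C)%C /\ toC (tr (0, t) p) = toC p + i * (t%:C)%C.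
Proof. by split; apply: complex_eq => /=; ring. Qed.

Let dW (t : R) (p q : pl R) : A0 p -> A0 q -> 
  (u q - u p) / t = complex.Re ((W q - W p) / (t%:C)%C) /\ (v q - v p) / t = complex.Im ((W q - W p) / (t%:C)%C).
Proof.
move=> Ap Aq; have [-> ->] := uvE Ap; have [-> ->] := uvE Aq.
by have [-> ->] := Re_divr (W q - W p) t; rewrite ReB ImB.
Qed.

Let nsqE (t : R) (p : pl R) : A p -> `|t| <= t0 ->
  nsq u v t p = cmod ((W (tr (t, 0) p) - W p) / (t%:C)%C) ^+ 2 + cmod ((W (tr (0, t) p) - W p) / (t%:C)%C) ^+ 2.
Proof.
move=> Ap tt; have [n1 n2] := tr_nz t p.
have Ap0 : A0 p by apply: (trA0 Ap); rewrite !subrr cmod0 ltW.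
have A1 : A0 (tr (t, 0) p) by apply: (trA0 Ap); rewrite n1.
have A2 : A0 (tr (0, t) p) by apply: (trA0 Ap); rewrite n2.
have [a1 a2] := dW t Ap0 A1; have [b1 b2] := dW t Ap0 A2.
by rewrite /nsq a1 a2 b1 b2 !sqr_cmod addrA.
Qed.

Let small (t : R) (p : pl R) : A p -> `|t| <= t0 -> 0 < nz p /\ `|t| <= nz p / 100.
Proof.
move=> /andP[p1 _] tt; have h := d0.
have h1 : t0 <= delta / 200 by rewrite /t0 ge_min lexx.
by split; lra.
Qed.

Let FE (t : R) (p : pl R) : A p -> `|t| <= t0 -> 
  [/\ F p = W p * toC p + K (W p) * conjc (toC p),
   F (tr (t, 0) p) = W (tr (t, 0) p) * (toC p + (t%:C)%C) + K (W (tr (t, 0) p)) * conjc (toC p + (t%:C)%C) &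
   F (tr (0, t) p) = W (tr (0, t) p) * (toC p + i * (t%:C)%C) + K (W (tr (0, t) p)) * conjc (toC p + i * (t%:C)%C)].
Proof.
move=> Ap tt; have [n1 n2] := tr_nz t p; have [<- <-] := toC_tr t p.
have d4 : 0 < delta / 4 by have h := d0; lra.
have pos q : A0 q -> 0 < nz q by move=> /andP[h _]; exact: lt_le_trans h.
split; apply: WE; apply: pos; apply: (trA0 Ap); rewrite ?n1 ?n2//.
by rewrite !subrr cmod0 ltW.
Qed.

Lemma sq_bound2 (a b c x d : R) : 0 <= a -> 0 <= b -> 0 <= c -> 0 < d -> d / 2 <= x ->
   4 * (a + (b + c) / x) ^+ 2 <= 8 * a ^+ 2 + (64 / d ^+ 2) * (b ^+ 2 + c ^+ 2).
Proof.
move=> a0 b0 c0 d0' dx; have x0 : 0 < x by lra.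
have xi : x^-1 <= 2 / d.
  by rewrite -(invrK (2 / d)) lef_pV2 ?posrE ?invr_gt0 ?divr_gt0// invf_div.
have h : (b + c) / x <= (b + c) * (2 / d) by rewrite ler_wpM2l// addr_ge0.
have h0 : 0 <= (b + c) / x by rewrite divr_ge0 ?addr_ge0// ltW.
apply: (@le_trans _ _ (8 * a ^+ 2 + 8 * ((b + c) / x) ^+ 2)).
  by have := sqr_ge0 (a - (b + c) / x); move: ((b + c) / x) => y; rewrite !expr2; lra.
rewrite lerD2l; apply: (@le_trans _ _ (8 * ((b + c) * (2 / d)) ^+ 2)).
  by rewrite ler_pM2l// lerXn2r// ?nnegrE// (le_trans h0).
have -> : 8 * ((b + c) * (2 / d)) ^+ 2 = 32 / d ^+ 2 * (b + c) ^+ 2 by field; rewrite gt_eqF.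
have -> : 64 / d ^+ 2 * (b ^+ 2 + c ^+ 2) = 32 / d ^+ 2 * (2 * (b ^+ 2 + c ^+ 2)) by field; rewrite gt_eqF.
rewrite ler_wpM2l ?divr_ge0 ?sqr_ge0//; have := sqr_ge0 (b - c); rewrite !expr2; lra.
Qed.

Lemma sq_bound3 (n1 n2 f1 f2 b c w m x d : R) : 0 <= n1 -> 0 <= n2 -> 0 <= f1 -> 0 <= f2 -> 0 <= b -> 0 <= c ->
   0 <= w -> 0 <= m -> 0 < d -> d / 2 <= x ->
   n1 <= 2 * (f1 + b + w + m) / x -> n2 <= 2 * (f2 + c + w + m) / x ->
   n1 ^+ 2 + n2 ^+ 2 <= ((8 / d) * (f1 + f2 + 2 * (w + m))) ^+ 2 + (64 / d ^+ 2) * (b ^+ 2 + c ^+ 2).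
Proof.
move=> n10 n20 f10 f20 b0 c0 w0 m0 d0' dx h1 h2; have x0 : 0 < x by lra.
have xi : x^-1 <= 2 / d.
  by rewrite -(invrK (2 / d)) lef_pV2 ?posrE ?invr_gt0 ?divr_gt0// invf_div.
have S (n f e : R) : 0 <= n -> 0 <= f -> 0 <= e -> n <= 2 * (f + e + w + m) / x ->
    n ^+ 2 <= (64 / d ^+ 2) * ((f + w + m) ^+ 2 + e ^+ 2).
  move=> n0 f0 e0 h.
  have {}h : n <= 2 * (f + e + w + m) * (2 / d).
    by apply: (le_trans h); rewrite ler_wpM2l// mulr_ge0// !addr_ge0.
  apply: (@le_trans _ _ ((2 * (f + e + w + m) * (2 / d)) ^+ 2)).
    by rewrite lerXn2r// ?nnegrE// (le_trans n0).
  have -> : (2 * (f + e + w + m) * (2 / d)) ^+ 2 = 16 / d ^+ 2 * (f + e + w + m) ^+ 2 by field; rewrite gt_eqF.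
  have -> : 64 / d ^+ 2 * ((f + w + m) ^+ 2 + e ^+ 2) = 16 / d ^+ 2 * (4 * ((f + w + m) ^+ 2 + e ^+ 2)) by field; rewrite gt_eqF.
  rewrite ler_wpM2l ?divr_ge0 ?sqr_ge0//.
  have := sqr_ge0 (f + w + m - e); have := sqr_ge0 e; have := sqr_ge0 (f + w + m).
  have -> : f + e + w + m = (f + w + m) + e by ring.
  move: (f + w + m) => y; rewrite !expr2; lra.
have k1 := S _ _ _ n10 f10 b0 h1; have k2 := S _ _ _ n20 f20 c0 h2.
apply: (le_trans (lerD k1 k2)).
have -> : ((8 / d) * (f1 + f2 + 2 * (w + m))) ^+ 2 = (64 / d ^+ 2) * (f1 + f2 + 2 * (w + m)) ^+ 2 by field; rewrite gt_eqF.
rewrite -!mulrDr ler_wpM2l ?divr_ge0 ?sqr_ge0//.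
have y10 : 0 <= f1 + w + m by rewrite !addr_ge0.
have y20 : 0 <= f2 + w + m by rewrite !addr_ge0.
have -> : f1 + f2 + 2 * (w + m) = (f1 + w + m) + (f2 + w + m) by ring.
move: (f1 + w + m) (f2 + w + m) y10 y20 => y1 y2 y10 y20.
have := mulr_ge0 y10 y20; rewrite !expr2; lra.
Qed.

Let hJ t : t != 0 -> `|t| <= t0 -> {ae leb2 R, forall p, A p -> s < u p ->
  nsq u v t p / 10 - (8 * E1 p ^+ 2 + rho t p) <= cell t u v p / t ^+ 2}.
Proof.
move=> tn tt; apply: (ae_mono heq) => p hp Ap us.
have [f0 f1 f2] := FE Ap tt; have [z0 tz] := small Ap tt.
have [n1 n2] := tr_nz t p.
have Ap0 : A0 p by apply: (trA0 Ap); rewrite !subrr cmod0 ltW.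
have A1 : A0 (tr (t, 0) p) by apply: (trA0 Ap); rewrite n1.
have A2 : A0 (tr (0, t) p) by apply: (trA0 Ap); rewrite n2.
have sW : s <= cmod (W p).
  apply: (le_trans (ltW us)); have [-> _] := uvE Ap0.
  exact: le_trans (ler_norm _) (Re_le_cmod _).
have hb := hp (AA0 Ap) _ sW.
have := ellipticity tn hK f0 f1 f2 z0 tz (E10 p) hb.
rewrite -(nsqE Ap tt) -/(remx t p) -/(remy t p) => H.
have [a1 a2] := dW t Ap0 A1; have [b1 b2] := dW t Ap0 A2.
have -> : cell t u v p / t ^+ 2 = complex.Re ((W (tr (t, 0) p) - W p) / (t%:C)%C) * complex.Im ((W (tr (0, t) p) - W p) / (t%:C)%C) -
   complex.Re ((W (tr (0, t) p) - W p) / (t%:C)%C) * complex.Im ((W (tr (t, 0) p) - W p) / (t%:C)%C).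
  by rewrite -a1 -a2 -b1 -b2 /cell; field.
apply: le_trans H; rewrite lerD2l lerN2.
have /andP[dz _] := Ap.
apply: (le_trans (sq_bound2 (E10 p) (cmod_ge0 _) (cmod_ge0 _) d0 dz)).
by rewrite lerD2l /rho indicE mem_set// !mul1r.
Qed.

Let hN t : t != 0 -> `|t| <= t0 -> {ae leb2 R, forall p, A p -> nsq u v t p <= gam p ^+ 2 + rho t p}.
Proof.
move=> tn tt; apply: aeW => p Ap.
have [f0 f1 f2] := FE Ap tt; have [z0 tz] := small Ap tt.
have Ap0 : A0 p by apply: (trA0 Ap); rewrite !subrr cmod0 ltW.
have [h1 h2] := quot_growth (Fx p) (Fy p) tn hK f0 f1 f2 z0 tz (KM (W p)).
rewrite (nsqE Ap tt); have /andP[dz _] := Ap.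
rewrite /gam /rho indicE mem_set// !mul1r.
have wb := WB Ap0.
have up (a b : R) : 2 * (a + b + cmod (W p) + M) / nz p <= 2 * (a + b + B + M) / nz p.
  by rewrite ler_pM2r ?invr_gt0// ler_pM2l// lerD2r lerD2l.
exact: (sq_bound3 (cmod_ge0 _) (cmod_ge0 _) (cmod_ge0 _) (cmod_ge0 _) (cmod_ge0 _) (cmod_ge0 _) B0 M0 d0 dz
  (le_trans h1 (up _ _)) (le_trans h2 (up _ _))).
Qed.

(** Truncating to [A0] changes [Uf] only where [eta] vanishes; by [u_pp] it creates no new points
    above the level [s]. *)
Let uU p : eta p != 0 -> u p = Uf p.
Proof.
move=> e0; rewrite /u /Uf; congr (_ * _); rewrite !indicE; congr (nat_of_bool _)%:R.
have pd : delta < nz p by rewrite ltNge; apply: contra_neqN e0; exact: eta0.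
have d0' := d0; apply/idP/idP; rewrite !inE /A0 /disc /= => h; first by case/andP: h.
by rewrite h andbT; lra.
Qed.

Let u_pp p : u p <= s \/ u p = Uf p.
Proof.
have s0' := s0; rewrite /u /Uf !indicE; case: (boolP (p \in A0)) => [/set_mem/andP[_ h]|_]; last by left; rewrite mul0r.
by right; rewrite (mem_set (A := disc r)).
Qed.

Lemma measurable_Uf : measurable_fun setT Uf.
Proof.
have [m1 _] := mW; have mi := measurable_indic (R := R) (D := setT) (measurable_disc r).
by rewrite /Uf; meas.
Qed.

(** [energy_sobolev] for the truncated pair, restated with [Uf]: the bound is then free of [delta],
    and the cut-off can be varied while the function stays the same. *)
Lemma superlevel_step (m e q : R) : 0 <= m -> 0 <= e -> 0 <= q ->
  (II (fun p => (ind (s + k < Uf p))%R) <= m%:E)%E ->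
  (II (fun p => (ind (s < Uf p) * (8 * E1 p ^+ 2))%R) <= e%:E)%E ->
  (II (fun p => (G p ^+ 2 * pp (Uf p - s) ^+ 2)%R) <= q%:E)%E ->
  (II (fun p => ((eta p * pp (Uf p - s - k)) ^+ 2)%R) <= (4 * m * (40 * e + 3201 * q))%:E)%E.
Proof.
move=> m0 e0 q0 hm he hq.
pose t_ (n : nat) : R := 2^-1 ^+ n.
have tpos n : 0 < t_ n by rewrite exprn_gt0.
have tcv : t_ @ \oo --> 0.
  by apply: cvg_expr; rewrite ger0_norm// invf_lt1// ltr1n.
have tn n : t_ n != 0 by rewrite gt_eqF.
have tnN n : - t_ n != 0 by rewrite oppr_eq0.
have tcN : (fun n => - t_ n) @ \oo --> (0 : R) by rewrite -oppr0; exact: cvgN.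
have mU := measurable_Uf; have [mu _] := tu; have k0' := k0.
have hA t p : `|t| <= t0 -> ~ A p -> [/\ eta p = 0 \/ u p <= s, eta (tr (t, 0) p) = 0 \/ u (tr (t, 0) p) <= s
    & eta (tr (0, t) p) = 0 \/ u (tr (0, t) p) <= s].
  move=> tt nA; have [n1 n2] := tr_nz t p.
  by split; apply: (hA0 nA); rewrite ?n1 ?n2// !subrr cmod0 ltW.
have hG t p : `|t| <= t0 -> A p -> `|eta (tr (t, 0) p) - eta p| <= `|t| * G p /\ `|eta (tr (0, t) p) - eta p| <= `|t| * G p.
  move=> tt /andP[dz _]; have [n1 n2] := tr_nz t p.
  have h1 : t0 <= delta / 200 by rewrite /t0 ge_min lexx.
  have td := le_trans tt h1.
  have := etaG (q := tr (t, 0) p) dz; have := etaG (q := tr (0, t) p) dz.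
  by rewrite n1 n2 => g2 g1; split; [exact: g1|exact: g2].
have mE8 : measurable_fun setT (fun p => 8 * E1 p ^+ 2) by meas.
have E80 p : 0 <= 8 * E1 p ^+ 2 by rewrite mulr_ge0// sqr_ge0.
have mg1 := measurable_gt s mU; have mg2 := measurable_gt (s + k) mU.
have mg3 := measurable_gt s mu; have mg4 := measurable_gt (s + k) mu.
have ES := @energy_sobolev R u v eta G (fun p => 8 * E1 p ^+ 2) gam rho A s k Gb t0 t_ k0 s0 Gb0 t00 tu tv meta eta01 mG G01 mA tA tpos tcv hA hG mE8 E80 L2_gam gam0 mrho rho0 (rhoc tn tcv) (rhoc tnN tcN) hJ hN m e q m0 e0 q0.
apply: le_trans (ES _ _ _).
- rewrite (@II_ext R _ (fun p => (eta p * pp (u p - s - k)) ^+ 2))// => p.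
  by have [->|h] := eqVneq (eta p) 0; rewrite ?mul0r// uU.
- apply: le_trans hm; apply: II_le; [exact: mg4|exact: mg2|by move=> p; exact: ind_ge0|].
  move=> p; have [h|->//] := u_pp p.
  by rewrite {1}/ind; case: ltP => [h'|_]; [exfalso; lra|exact: ind_ge0].
- apply: le_trans he; apply: II_le; [by meas|by meas| |].
    by move=> p; rewrite mulr_ge0// mulr_ge0 ?sqr_ge0 ?ind_ge0.
  move=> p; rewrite ler_wpM2r//.
  have i0 : ind (s < u p) <= ind (s < Uf p) :> R.
    have [h|->//] := u_pp p; by rewrite {1}/ind; case: ltP => [h'|_]; [exfalso; lra|exact: ind_ge0].
  have /andP[h0 h1] := eta01 p.
  apply: le_trans i0; rewrite ler_piMl ?ind_ge0//; exact: exprn_ile1.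
- apply: le_trans hq; apply: II_le; [by rewrite /pp; meas|by rewrite /pp; meas| |].
    by move=> p; rewrite mulr_ge0 ?sqr_ge0.
  move=> p; have [h|->//] := u_pp p.
  by rewrite (pp_neg (x := u p - s)) ?subr_le0// expr0n mulr0 mulr_ge0 ?sqr_ge0.
Qed.

End Step.

(** * Logarithmic cut-offs and De Giorgi's iteration *)

Section Dyadic.
Context {R : realType}.
Local Notation nz p := (cmod (toC p)).

Definition hl (n : nat) : R := 2^-1 ^+ n.

Lemma hl_gt0 n : 0 < hl n. Proof. by rewrite exprn_gt0. Qed.

Lemma hl_le n m : (n <= m)%N -> hl m <= hl n.
Proof. by move=> nm; apply: ler_wiXn2l => //; rewrite invf_le1// ler1n. Qed.

Lemma hl_le1 n : hl n <= 1.
Proof. by rewrite exprn_ile1// invf_le1// ler1n. Qed.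

Lemma mul_aux (x y z : R) : x * y * (4 * z) = 4 * x * (y * z).
Proof. ring. Qed.

Lemma hlS n : hl n.+1 = hl n / 2. Proof. by rewrite /hl exprSr. Qed.

Lemma hl_cvg : hl @ \oo --> 0.
Proof. by apply: cvg_expr; rewrite ger0_norm// invf_lt1// ltr1n. Qed.

Lemma hl_small (e : R) : 0 < e -> exists n, hl n < e.
Proof.
move=> e0; have e2 : 0 < e / 2 by lra.
have /cvgrPdist_le/(_ _ e2) [N _ h] := hl_cvg; exists N; have := h N (leqnn N).
rewrite /= sub0r normrN (ger0_norm (ltW (hl_gt0 N))) => h'; lra.
Qed.

Lemma dyadic (x : R) k : 0 < x -> x <= hl k -> exists j, [/\ (k <= j)%N, hl j.+1 < x & x <= hl j].
Proof.
move=> x0 xk; have ex : exists n, hl n < x by exact: hl_small.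
case: (ex_minnP ex) => [[|j] hj hm].
  have := lt_le_trans hj xk; have := hl_le (leq0n k); lra.
exists j; split=> //.
  rewrite -ltnS ltnNge; apply/negP => jk; have := lt_le_trans hj xk; have := hl_le jk; lra.
by rewrite leNgt; apply/negP => /hm; rewrite ltnn.
Qed.

Lemma ind_indic (c : bool) (S : set (pl R)) p : (S p <-> c) -> ind c = \1_S p :> R.
Proof.
by rewrite /ind indicE => h; congr (nat_of_bool _)%:R; apply/idP/idP; rewrite inE => /h.
Qed.

Lemma II_disc n : (II (fun p : pl R => ind (nz p <= hl n)%R) <= (4 * (hl n * hl n))%:E)%E.
Proof.
have mS : measurable [set p : pl R | nz p <= hl n].
  rewrite (_ : mkset _ = [set p : pl R | nz p \in `]-oo, hl n]]); first exact: measurable_nz_itv.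
  by apply/seteqP; split=> p /=; rewrite in_itv.
have -> : II (fun p : pl R => ind (nz p <= hl n)) = leb2 R [set p : pl R | nz p <= hl n].
  rewrite -[X in _ = leb2 R X]setIT -integral_indic//; apply: eq_integral => p _.
  by congr (_%:E); apply: ind_indic.
rewrite -expr2 -(leb2_boxE (ltW (hl_gt0 n))); apply: le_measure; rewrite ?inE//; first exact: measurable_box.
move=> p /= h; apply/boxP; have := Re_le_cmod (toC p); have := Im_le_cmod (toC p) => /=.
by move=> h1 h2; split; [apply: le_trans h2 h|apply: le_trans h1 h].
Qed.

(** [w] is at most the sum of [c j] times the indicators of the discs of radius [2^-j], whose
    measures are at most [4 * 4^-j]. *)
Lemma II_dyadic (w : pl R -> R) (c : nat -> R) (B : R) : measurable_fun setT w -> (forall p, 0 <= w p) ->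
  (forall j, 0 <= c j) -> (forall p, w p = 0 \/ exists2 j, nz p <= hl j & w p <= c j) ->
  (forall N, \sum_(0 <= j < N) c j * (4 * (hl j * hl j)) <= B) -> (II w <= B%:E)%E.
Proof.
move=> mw w0 c0 hw hB.
pose f j (p : pl R) : \bar R := (c j * ind (nz p <= hl j))%:E.
have f0 j p : (0 <= f j p)%E by rewrite lee_fin mulr_ge0// ind_ge0.
have mi j : measurable_fun setT (fun p : pl R => ind (nz p <= hl j) : R).
  rewrite (_ : (fun p => _) = (\1_[set p : pl R | nz p \in `]-oo, hl j]] : pl R -> R)).
    by apply: measurable_indic; exact: measurable_nz_itv.
  apply/funext => p; rewrite indicE /ind; congr (nat_of_bool _)%:R.
  by apply/idP/idP; rewrite inE /= in_itv.
have mf j : measurable_fun setT (f j) by have m := mi j; apply/measurable_EFinP; meas.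
apply: (@le_trans _ _ (\int[leb2 R]_p (\sum_(0 <= j <oo) f j p))%E).
  apply: ge0_le_integral => //.
  - by move=> p _; rewrite lee_fin.
  - exact/measurable_EFinP.
  - by apply: ge0_emeasurable_sum.
  - move=> p _; case: (hw p) => [->|[j h1 h2]]; first by apply: nneseries_ge0.
    apply: (@le_trans _ _ (f j p)); first by rewrite /f /ind h1 mulr1 lee_fin.
    apply: (@le_trans _ _ (\sum_(0 <= i < j.+1) f i p)%E); last by apply: nneseries_lim_ge.
    by rewrite big_nat_recr//= leeDr// sume_ge0.
rewrite integral_nneseries//.
apply: lime_le; first by apply: is_cvg_nneseries => n _ _; exact: integral_ge0.
apply: nearW => N; apply: le_trans (_ : ((\sum_(0 <= j < N) c j * (4 * (hl j * hl j)))%:E <= _)%E); last by rewrite lee_fin.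
rewrite -sumEFin; apply: lee_sum => j _.
have -> : (\int[leb2 R]_x f j x = (c j)%:E * II (fun p => ind (nz p <= hl j)%R))%E.
  by rewrite -IIZ// => p; exact: ind_ge0.
by rewrite EFinM; apply: lee_wpmul2l; [rewrite lee_fin|exact: II_disc].
Qed.

Lemma ln_le_sub1 (x : R) : 0 < x -> ln x <= x - 1.
Proof.
move=> x0; have := expR_ge1Dx (ln x); rewrite lnK ?posrE//; lra.
Qed.

Lemma ln_lip (a b m : R) : 0 < m -> m <= a -> m <= b -> `|ln a - ln b| <= `|a - b| / m.
Proof.
move=> m0.
have H (x y : R) : m <= x -> m <= y -> ln x - ln y <= `|x - y| / m.
  move=> mx my; have x0 := lt_le_trans m0 mx; have y0 := lt_le_trans m0 my.
  rewrite -ln_div ?posrE//; apply: (le_trans (ln_le_sub1 (divr_gt0 x0 y0))).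
  have -> : x / y - 1 = (x - y) / y by field; rewrite gt_eqF.
  apply: (@le_trans _ _ (`|x - y| / y)).
    by rewrite ler_pM2r ?invr_gt0// ler_norm.
  by rewrite ler_wpM2l// lef_pV2 ?posrE.
move=> ma mb; rewrite ler_norml; have := H a b ma mb; have := H b a mb ma.
by rewrite (distrC b a) => *; apply/andP; split; lra.
Qed.

Lemma ln2_ge : 2^-1 <= ln 2 :> R.
Proof.
have := @ln_le_sub1 2^-1 ltac:(by []); rewrite lnV ?posrE//; lra.
Qed.

Lemma hl_nat n : hl n * 2 ^+ n = 1.
Proof. by rewrite /hl -exprMn mulVf ?expr1n. Qed.

Lemma ln_hl n : ln (hl n) = - (n%:R * ln 2).
Proof. by rewrite /hl exprVn lnV ?posrE ?exprn_gt0// lnXn// mulr_natl. Qed.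

(* The logarithmic cut-off between the radii [4^-n] and [2^-n]; [Gn n] bounds its
   difference quotients, and its energy tends to 0 because points have capacity 0. *)
Definition cutoff (n : nat) (p : pl R) : R :=
  minr 1 ((ln (maxr (nz p) (hl (n + n))) - ln (hl (n + n))) / (n%:R * ln 2)).

Definition Gn (n : nat) (p : pl R) : R :=
  \1_[set p : pl R | nz p \in `[hl (n + n) / 2, 2 * hl n]] p * (4 / (n%:R * nz p)).

Lemma nln2_gt0 n : (0 < n)%N -> 0 < n%:R * ln 2 :> R.
Proof. by move=> n0; rewrite mulr_gt0 ?ltr0n// ln_gt0// ltr1n. Qed.

Lemma measurable_cutoff n : measurable_fun setT (cutoff n).
Proof.
have mz := @measurable_nz R.
have m1 : measurable_fun setT (fun p : pl R => ln (maxr (nz p) (hl (n + n)))).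
  by apply: (measurableT_comp (@measurable_ln R)); meas.
by rewrite /cutoff; meas.
Qed.

Lemma measurable_Gn n : measurable_fun setT (Gn n).
Proof.
have m1 := measurable_indic (R := R) (D := setT) (measurable_nz_itv (`[hl (n + n) / 2, 2 * hl n])).
have mz := @measurable_nz R.
have m2 : measurable_fun setT (fun p : pl R => (n%:R * nz p)^-1).
  by apply: measurable_inv; [meas|move=> p; rewrite mulr_ge0 ?cmod_ge0].
by rewrite /Gn; meas.
Qed.

Lemma cutoff_bounds n p : (0 < n)%N -> 0 <= cutoff n p <= 1.
Proof.
move=> n0; rewrite /cutoff ge_min lexx andbT le_min ler01 /=; apply: divr_ge0; last exact: ltW (nln2_gt0 n0).
rewrite subr_ge0.
by rewrite ler_ln ?posrE ?lt_max ?hl_gt0 ?orbT// le_max lexx orbT.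
Qed.

Lemma cutoff_eq0 n p : nz p <= hl (n + n) -> cutoff n p = 0.
Proof. by move=> h; rewrite /cutoff max_r// subrr mul0r min_r. Qed.

Lemma cutoff_eq1 n p : (0 < n)%N -> hl n <= nz p -> cutoff n p = 1.
Proof.
move=> n0 h; rewrite /cutoff min_l// ler_pdivlMr ?nln2_gt0// mul1r.
have : ln (hl n) <= ln (maxr (nz p) (hl (n + n))).
  by rewrite ler_ln ?posrE ?lt_max ?hl_gt0 ?orbT// le_max h.
by rewrite !ln_hl natrD; lra.
Qed.

Lemma min1_lip (x y : R) : `|minr 1 x - minr 1 y| <= `|x - y|.
Proof.
have [h|h] := leP 1 x; have [h'|h'] := leP 1 y; rewrite ?subrr ?normr0 ?normr_ge0//.
  rewrite !ger0_norm; lra.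
rewrite distrC (distrC x) !ger0_norm; lra.
Qed.

Lemma max_lip (x y z : R) : `|maxr x z - maxr y z| <= `|x - y|.
Proof.
have [h|h] := leP x z; have [h'|h'] := leP y z; rewrite ?subrr ?normr0 ?normr_ge0//.
  rewrite distrC (distrC x) !ger0_norm; lra.
rewrite !ger0_norm; lra.
Qed.

Lemma Gn_bound n p : (0 < n)%N -> 0 <= Gn n p <= 8 / (n%:R * hl (n + n)).
Proof.
move=> n0; have hn : 0 < n%:R :> R by rewrite ltr0n.
have h0 := hl_gt0 (n + n).
have c0 : 0 <= 8 / (n%:R * hl (n + n)) by rewrite divr_ge0// mulr_ge0// ltW.
rewrite /Gn indicE; case: (boolP (p \in _)) => [|_]; last by rewrite mul0r lexx.
rewrite inE /= in_itv /= => /andP[h1 h2].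
have z0 : 0 < nz p by lra.
rewrite mul1r divr_ge0 ?mulr_ge0 ?cmod_ge0 ?ler0n//=.
rewrite ler_pdivrMr ?mulr_gt0// mulrAC ler_pdivlMr ?mulr_gt0//.
have : n%:R * hl (n + n) <= n%:R * (2 * nz p) by rewrite ler_pM2l//; lra.
lra.
Qed.

Lemma cutoff_lip n (p q : pl R) : (0 < n)%N -> hl (n + n) / 2 <= nz p ->
  nz (q.1 - p.1, q.2 - p.2) <= hl (n + n) / 200 ->
  `|cutoff n q - cutoff n p| <= nz (q.1 - p.1, q.2 - p.2) * Gn n p.
Proof.
move=> n0 hp hq; set d := nz (_, _) in hq *.
have h0 := hl_gt0 (n + n); have hn : 0 < n%:R :> R by rewrite ltr0n.
have d0 : 0 <= d by exact: cmod_ge0.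
have qp : `|nz q - nz p| <= d.
  have -> : d = cmod (toC q - toC p) by rewrite /d; congr cmod; exact: complex_eq.
  have := cmodB (toC q) (toC q - toC p); have := cmodD (toC p) (toC q - toC p).
  have -> : toC p + (toC q - toC p) = toC q by ring.
  have -> : toC q - (toC q - toC p) = toC p by ring.
  by rewrite ler_norml => *; apply/andP; split; lra.
have /andP[qp1 qp2] : - d <= nz q - nz p <= d by rewrite -ler_norml.
(* Beyond the support of [Gn] both points lie outside the disc of radius [2^-n], where the cut-off
   is constantly 1. *)
have [big|small] := ltP (2 * hl n) (nz p).
  have hh : hl (n + n) <= hl n by apply: hl_le; rewrite leq_addl.
  rewrite !cutoff_eq1//; [|lra|lra].
  rewrite subrr normr0 mulr_ge0//; by have /andP[] := Gn_bound p n0.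
rewrite /Gn indicE mem_set; last by rewrite /= in_itv /= hp small.
rewrite mul1r /cutoff; apply: (le_trans (min1_lip _ _)).
rewrite -mulrBl normrM (gtr0_norm (x := _^-1)) ?invr_gt0 ?nln2_gt0//.
have z0 : 0 < nz p by lra.
have -> : ln (maxr (nz q) (hl (n + n))) - ln (hl (n + n)) - (ln (maxr (nz p) (hl (n + n))) - ln (hl (n + n))) =
  ln (maxr (nz q) (hl (n + n))) - ln (maxr (nz p) (hl (n + n))) by ring.
have p2 : 0 < nz p / 2 by lra.
have L : `|ln (maxr (nz q) (hl (n + n))) - ln (maxr (nz p) (hl (n + n)))| <= d / (nz p / 2).
  apply: (le_trans (ln_lip p2 _ _)); rewrite ?le_max; try by apply/orP; left; lra.
  by rewrite ler_pM2r ?invr_gt0//; apply: le_trans (max_lip _ _ _) qp.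
rewrite ler_pdivrMr ?nln2_gt0//; apply: (le_trans L).
have -> : d / (nz p / 2) = (d / nz p) * 2 by field; rewrite gt_eqF.
have -> : d * (4 / (n%:R * nz p)) * (n%:R * ln 2) = (d / nz p) * (4 * ln 2) by field; rewrite !gt_eqF.
apply: ler_wpM2l; first by rewrite divr_ge0// ltW.
by have := ln2_ge; lra.
Qed.

Lemma sum_cutoff (x : R) m N : 0 <= x -> \sum_(0 <= j < N) (if (j < m)%N then x else 0) <= m%:R * x.
Proof.
move=> x0; have -> : \sum_(0 <= j < N) (if (j < m)%N then x else 0) = (minn N m)%:R * x.
  elim: N => [|N IH]; first by rewrite big_nil min0n mul0r.
  rewrite big_nat_recr//= IH; case: (ltnP N m) => h.
    by rewrite (minn_idPl h) -natr1; ring.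
  by rewrite (minn_idPr (leqW h)) addr0.
by rewrite ler_wpM2r// ler_nat geq_minr.
Qed.

(** At most [2 n + 2] dyadic shells meet the support, and each contributes at most [256 / n^2] since
    [1 / |z|^2] has scale invariant integrals; moreover [2 n + 2 <= 4 n]. *)
Lemma II_Gn n : (0 < n)%N -> (II (fun p => (Gn n p ^+ 2)%R) <= (1024 / n%:R)%:E)%E.
Proof.
move=> n0; have hn : 1 <= n%:R :> R by rewrite ler1n.
have hn0 : 0 < n%:R :> R by rewrite ltr0n.
pose c j : R := if (j < n + n + 2)%N then 16 / n%:R ^+ 2 * (hl j.+1 ^+ 2)^-1 else 0.
apply: (@II_dyadic _ c).
- by have m := measurable_Gn n; meas.
- by move=> p; exact: sqr_ge0.
- by move=> j; rewrite /c; case: ifP => // _; rewrite mulr_ge0 ?divr_ge0 ?sqr_ge0// invr_ge0 sqr_ge0.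
- move=> p; rewrite {1}/Gn indicE; case: (boolP (p \in _)) => [|_]; last by left; rewrite mul0r expr0n.
  rewrite inE /= in_itv /= => /andP[h1 h2]; right.
  have h0 := hl_gt0 (n + n).
  have z0 : 0 < nz p by lra.
  have z1 : nz p <= hl 0.
    apply: (le_trans h2); have : hl n <= hl 1 by exact: hl_le.
    by rewrite /hl expr1 expr0; lra.
  have [j [_ j1 j2]] := dyadic z0 z1; exists j => //.
  have jn : (j < n + n + 2)%N.
    rewrite ltnNge; apply/negP => h.
    have : hl j <= hl (n + n).+2 by apply: hl_le; rewrite -addn2.
    by rewrite !hlS; lra.
  rewrite /Gn indicE mem_set ?mul1r /c ?jn; last by rewrite /= in_itv /= h1 h2.
  have hj := hl_gt0 j.+1.
  have -> : (4 / (n%:R * nz p)) ^+ 2 = 16 / n%:R ^+ 2 * (nz p ^+ 2)^-1 by field; rewrite !gt_eqF.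
  rewrite ler_wpM2l ?divr_ge0 ?sqr_ge0// lef_pV2 ?posrE ?exprn_gt0//.
  by apply: lerXn2r; rewrite ?nnegrE ?cmod_ge0 ?(ltW hj) ?(ltW j1).
- move=> N; pose x : R := 256 / n%:R ^+ 2.
  have x0 : 0 <= x by apply: divr_ge0; [exact: ler0n|exact: sqr_ge0].
  have E j : c j * (4 * (hl j * hl j)) = if (j < n + n + 2)%N then x else 0.
    rewrite /c; case: ifP => _; last by rewrite mul0r.
    rewrite hlS /x; field; rewrite !gt_eqF ?hl_gt0//.
  under eq_bigr do rewrite E.
  apply: (le_trans (sum_cutoff _ _ x0)).
  have -> : 1024 / n%:R = (4 * n%:R) * x by rewrite /x; field; rewrite gt_eqF.
  rewrite ler_wpM2r// !natrD; lra.
Qed.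

End Dyadic.

Lemma level_gap {R : realType} (s d u : R) : s + 2 * d < u -> d <= u - s - d.
Proof. lra. Qed.

(** * De Giorgi's iteration with a singular weight *)

Section DeGiorgi.
Context {R : realType}.
Local Notation nz p := (cmod (toC p)).
Variables (M1 al : R).
Hypotheses (M10 : 0 <= M1) (al0 : 0 < al) (al1 : al < 1).

(** The Hoelder error [M1 |z|^al] of freezing the field, divided by the factor [|z|] that
    accompanies the derivatives of [W]. *)
Definition E1 (p : pl R) : R := M1 * nz p `^ (al - 1).

(** Halving the radius multiplies the weight by [A], hence its square by [A^2], and the measure of
    the disc by 1/4; [b < 1] is the integrability of the squared weight. *)
Let A : R := 2 `^ (1 - al).
Let b : R := A ^+ 2 / 4.

Lemma A_gt0 : 0 < A. Proof. by rewrite powR_gt0. Qed.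

Lemma A_lt2 : A < 2.
Proof.
have h1 := al1; have h0 := al0; have a0 := A_gt0.
have E : A * 2 `^ al = 2 by rewrite /A -powRD ?pnatr_eq0 ?implybT// subrK powRr1.
have : 1 < 2 `^ al :> R.
  by have := gt0_ltr_powR h0 (x := 1) (y := 2); rewrite !nnegrE powR1; apply; rewrite // ltr1n.
by rewrite -(ltr_pM2l a0) mulr1 E.
Qed.

Lemma b_bounds : 0 < b < 1.
Proof.
have h0 := A_gt0; have h2 := A_lt2; rewrite /b divr_gt0 ?exprn_gt0//= ltr_pdivrMr// mul1r.
have : A ^+ 2 < 2 ^+ 2 by rewrite ltrXn2r// ?nnegrE ltW.
by rewrite (_ : 2 ^+ 2 = 4 :> R)//; ring.
Qed.

Lemma powR_dyadic (x : R) m : 0 < x -> hl m <= x -> x `^ (al - 1) <= A ^+ m.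
Proof.
move=> x0 hx; have h1 := al1; have a0 := A_gt0.
have h : 0 <= 1 - al by lra.
have -> : al - 1 = - (1 - al) by ring.
rewrite powRN -(invrK (A ^+ m)) lef_pV2 ?posrE ?invr_gt0 ?exprn_gt0 ?powR_gt0//.
have e : hl m `^ (1 - al) * A ^+ m = 1.
  rewrite -(powR_mulrn m (ltW a0)) /A powRAC powR_mulrn// -powRM ?exprn_ge0 ?hl_nat ?powR1//.
have -> : (A ^+ m)^-1 = hl m `^ (1 - al).
  have An : A ^+ m != 0 by rewrite expf_neq0// gt_eqF.
  by apply: (mulIf An); rewrite mulVf// e.
by apply: ge0_ler_powR; rewrite ?nnegrE// ltW// hl_gt0.
Qed.

Lemma measurable_E1 : measurable_fun setT E1.
Proof.
have mz := @measurable_nz R.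
have m : measurable_fun setT (fun p : pl R => nz p `^ (al - 1)).
  exact: (measurableT_comp (measurable_powR _) mz).
by rewrite /E1; meas.
Qed.

Lemma E1_ge0 p : 0 <= E1 p. Proof. by rewrite /E1 mulr_ge0// powR_ge0. Qed.

Lemma sum_geom (k N : nat) : \sum_(0 <= j < N) (if (k <= j)%N then b ^+ j else 0) <= b ^+ k / (1 - b).
Proof.
have /andP[b0 b1] := b_bounds; have b1' : 0 < 1 - b by lra.
have : \sum_(0 <= j < N) (if (k <= j)%N then b ^+ j else 0) + b ^+ (maxn N k) / (1 - b) = b ^+ k / (1 - b).
  elim: N => [|N IH]; first by rewrite big_nil max0n add0r.
  rewrite big_nat_recr//= -IH; case: (leqP k N) => h.
    by rewrite (maxn_idPl (leqW h)) exprSr; field; rewrite gt_eqF.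
  by rewrite (maxn_idPr h) addr0.
move=> <-; rewrite lerDl divr_ge0 ?exprn_ge0// ltW//.
Qed.

(* [C1 * b ^+ k] bounds the integral of [8 E1 ^+ 2] over sets of measure at most
   [4 * 4^-k]: the weight is radially decreasing, so a disc is the worst case. *)
Definition C1 : R := 32 * M1 ^+ 2 * (A ^+ 2 / (1 - b) + 1) + 1.

Lemma C1_gt0 : 0 < C1.
Proof.
have /andP[b0 b1] := b_bounds; rewrite /C1 ltr_wpDl// mulr_ge0 ?mulr_ge0 ?sqr_ge0// addr_ge0//.
by rewrite divr_ge0 ?sqr_ge0// subr_ge0 ltW.
Qed.

Lemma pow4 k : hl k * hl k = (4^-1 : R) ^+ k.
Proof. by rewrite /hl -exprMn; congr (_ ^+ _); field. Qed.

(** The set is cut by the disc of radius [2^-k]: inside, the dyadic shells sum to a geometric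
    series; outside, the squared power of [|z|] is at most [A^(2k)] and the bound on the measure is
    used. *)
Lemma weight_bound (k : nat) (S : pl R -> bool) : measurable_fun setT (fun p => ind (S p) : R) ->
  (forall p, S p -> nz p < 1) ->
  (II (fun p => (ind (S p))%R) <= (4 * (hl k * hl k))%:E)%E ->
  (II (fun p => (ind (S p) * (8 * E1 p ^+ 2))%R) <= (C1 * b ^+ k)%:E)%E.
Proof.
move=> mS S1 hS; have /andP[b0 b1] := b_bounds; have a0 := A_gt0.
have mz := @measurable_nz R; have mE := measurable_E1.
pose om (p : pl R) : R := (nz p `^ (al - 1)) ^+ 2.
have mom : measurable_fun setT om.
  have m : measurable_fun setT (fun p : pl R => nz p `^ (al - 1)).
    exact: (measurableT_comp (measurable_powR _) mz).
  by rewrite /om; meas.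
have om0 p : 0 <= om p by exact: sqr_ge0.
have mi : measurable_fun setT (fun p : pl R => ind (nz p <= hl k) : R).
  rewrite (_ : (fun p => _) = (\1_[set p : pl R | nz p \in `]-oo, hl k]] : pl R -> R)).
    by apply: measurable_indic; exact: measurable_nz_itv.
  apply/funext => p; rewrite indicE /ind; congr (nat_of_bool _)%:R.
  by apply/idP/idP; rewrite inE /= in_itv.
have i0 (c : bool) : 0 <= ind c :> R by exact: ind_ge0.
have om00 p : nz p = 0 -> om p = 0.
  by rewrite /om => ->; rewrite powR0 ?expr0n//; have h := al1; apply/eqP; lra.
have W1 : (II (fun p => (ind (nz p <= hl k) * om p)%R) <= (4 * A ^+ 2 * (b ^+ k / (1 - b)))%:E)%E.
  apply: (@II_dyadic R _ (fun j => if (k <= j)%N then (A ^+ j.+1) ^+ 2 else 0)).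
  - by meas.
  - by move=> p; rewrite mulr_ge0.
  - by move=> j; case: ifP => // _; exact: sqr_ge0.
  - move=> p; have [z0|z0] := eqVneq (nz p) 0; first by left; rewrite om00 ?mulr0.
    have zp : 0 < nz p by rewrite lt_def z0 cmod_ge0.
    have [h|h] := leP (nz p) (hl k); last by left; rewrite /ind mul0r.
    have [j [j0 j1 j2]] := dyadic zp h; right; exists j => //.
    rewrite j0 /ind mul1r /om; apply: lerXn2r; rewrite ?nnegrE ?powR_ge0 ?exprn_ge0 ?(ltW a0)//.
    by apply: powR_dyadic => //; exact: ltW.
  - move=> N; apply: le_trans (_ : 4 * A ^+ 2 * \sum_(0 <= j < N) (if (k <= j)%N then b ^+ j else 0) <= _).
      rewrite mulr_sumr; apply: ler_sum => j _; case: ifP => _; last by rewrite mul0r mulr0.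
      have e1 : (A ^+ j.+1) ^+ 2 = A ^+ 2 * (A ^+ 2) ^+ j by rewrite -exprS -!exprM mulnC.
      have e2 : b ^+ j = (A ^+ 2) ^+ j * 4^-1 ^+ j by rewrite /b exprMn.
      by rewrite pow4 e1 e2 le_eqVlt; apply/orP; left; apply/eqP; exact: mul_aux.
    by rewrite ler_wpM2l ?sum_geom// mulr_ge0 ?sqr_ge0.
have W2 : (II (fun p => ((A ^+ k) ^+ 2 * ind (S p))%R) <= (4 * b ^+ k)%:E)%E.
  rewrite IIZ ?sqr_ge0//.
  apply: (@le_trans _ _ (((A ^+ k) ^+ 2)%:E * (4 * (hl k * hl k))%:E)%E).
    by apply: lee_wpmul2l; rewrite // lee_fin sqr_ge0.
  have e1 : (A ^+ k) ^+ 2 = (A ^+ 2) ^+ k by rewrite -!exprM mulnC.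
  have e2 : b ^+ k = (A ^+ 2) ^+ k * 4^-1 ^+ k by rewrite /b exprMn.
  by rewrite -EFinM lee_fin pow4 e1 e2 mulrCA.
have le1 p : ind (S p) * (8 * E1 p ^+ 2) <= (8 * M1 ^+ 2) * (ind (nz p <= hl k) * om p + (A ^+ k) ^+ 2 * ind (S p)).
  have -> : ind (S p) * (8 * E1 p ^+ 2) = (8 * M1 ^+ 2) * (ind (S p) * om p) by rewrite /E1 /om; ring.
  rewrite ler_wpM2l ?mulr_ge0 ?sqr_ge0//.
  case: (boolP (S p)) => Sp; last first.
    by rewrite {1}/ind mul0r addr_ge0// mulr_ge0 ?sqr_ge0.
  rewrite {1}/ind mul1r; have [h|h] := leP (nz p) (hl k).
    by rewrite {1}/ind mul1r lerDl mulr_ge0 ?sqr_ge0.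
  have zp : 0 < nz p := lt_trans (hl_gt0 k) h.
  rewrite {1}/ind mul0r add0r /ind mulr1 /om; apply: lerXn2r; rewrite ?nnegrE ?powR_ge0 ?exprn_ge0 ?(ltW a0)//.
  by apply: powR_dyadic => //; exact: ltW.
have c0 : 0 <= 8 * M1 ^+ 2 by rewrite mulr_ge0 ?sqr_ge0.
apply: (@le_trans _ _ ((8 * M1 ^+ 2)%:E * (II (fun p => (ind (nz p <= hl k) * om p)%R) + II (fun p => ((A ^+ k) ^+ 2 * ind (S p))%R)))%E).
  rewrite -IID; [|by meas|by meas|by move=> p; rewrite mulr_ge0|by move=> p; rewrite mulr_ge0 ?sqr_ge0].
  have q0 p : 0 <= ind (nz p <= hl k) * om p + (A ^+ k) ^+ 2 * ind (S p).
    by apply: addr_ge0; apply: mulr_ge0 => //; exact: sqr_ge0.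
  have mq : measurable_fun setT (fun p => ind (nz p <= hl k) * om p + (A ^+ k) ^+ 2 * ind (S p)) by meas.
  rewrite -(IIZ mq q0 c0).
  apply: II_le; [by meas|exact: measurable_funM| |exact: le1].
  by move=> p; apply: mulr_ge0 => //; apply: mulr_ge0 => //; exact: sqr_ge0.
apply: (@le_trans _ _ ((8 * M1 ^+ 2)%:E * ((4 * A ^+ 2 * (b ^+ k / (1 - b)))%:E + (4 * b ^+ k)%:E))%E).
  by apply: lee_wpmul2l; [rewrite lee_fin|exact: leeD].
rewrite -EFinD -EFinM lee_fin /C1.
rewrite [leLHS](_ : _ = 32 * M1 ^+ 2 * (A ^+ 2 / (1 - b) + 1) * b ^+ k); last by ring.
by apply: ler_wpM2r; [rewrite exprn_ge0// ltW|rewrite lerDl].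
Qed.

(* The sum of the level increments [2 * sqrt (640 * C1 * b ^+ k)] of the iteration. *)
Definition C0 : R := 2 * Num.sqrt (640 * C1) / (1 - Num.sqrt b).

Variables (U : pl R -> R) (s : R).
Hypotheses (s0 : 0 <= s) (mU : measurable_fun setT U).
Hypothesis U_supp : forall p, s < U p -> nz p < 1.
Hypothesis stepH : forall n s' k m e q, (0 < n)%N -> s <= s' -> 0 < k -> 0 <= m -> 0 <= e -> 0 <= q ->
  (II (fun p => (ind (s' + k < U p))%R) <= m%:E)%E ->
  (II (fun p => (ind (s' < U p) * (8 * E1 p ^+ 2))%R) <= e%:E)%E ->
  (II (fun p => (Gn n p ^+ 2 * pp (U p - s') ^+ 2)%R) <= q%:E)%E ->
  (II (fun p => ((cutoff n p * pp (U p - s' - k)) ^+ 2)%R) <= (4 * m * (40 * e + 3201 * q))%:E)%E.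
Hypothesis cut : forall d N, 0 < d -> exists2 n, (N < n)%N &
  (II (fun p => (Gn n p ^+ 2 * pp (U p - s) ^+ 2)%R) <= d%:E)%E.

Lemma pp_homo (x y : R) : x <= y -> pp x <= pp y.
Proof. by move=> xy; rewrite /pp ge_max !le_max lexx /= xy orbT. Qed.

(** One [d] is used up by the truncation in [stepH], the other by Chebyshev's inequality. Up to
    cut-off terms that can be made arbitrarily small, [d^2] times the new measure is at most
    [160 * m * e], and the choice of [d] turns this into a quarter of the old bound. *)
Lemma level_halving s' k d : s <= s' -> 0 < d -> 640 * (C1 * b ^+ k) <= d ^+ 2 ->
  (II (fun p => (ind (s' < U p))%R) <= (4 * (hl k * hl k))%:E)%E ->
  (II (fun p => (ind (s' + 2 * d < U p))%R) <= (4 * (hl k.+1 * hl k.+1))%:E)%E.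
Proof.
move=> ss' d0 hd hm; have /andP[b0 b1] := b_bounds; have c1 := C1_gt0.
have i0 (c : bool) : 0 <= ind c :> R by exact: ind_ge0.
have mg1 := measurable_gt s' mU; have mg2 := measurable_gt (s' + d) mU; have mg3 := measurable_gt (s' + 2 * d) mU.
set m : R := 4 * (hl k * hl k) in hm *.
have m0 : 0 <= m by rewrite mulr_ge0// mulr_ge0// ltW ?hl_gt0.
have he := weight_bound mg1 (fun p h => U_supp (le_lt_trans ss' h)) hm.
set e := C1 * b ^+ k in hd he.
have e0 : 0 <= e by rewrite /e mulr_ge0 ?exprn_ge0// ltW.
have hm2 : (II (fun p => (ind (s' + d < U p))%R) <= m%:E)%E.
  apply: le_trans hm; apply: II_le => // p.
  rewrite {1}/ind; case: ltP => // h.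
  by rewrite /ind (lt_trans _ h)//; lra.
set x := II _.
have x0 : (0 <= x)%E by exact: II_ge0.
have xm : (x <= m%:E)%E.
  apply: le_trans hm; apply: II_le => // p.
  rewrite {1}/ind; case: ltP => // h.
  by rewrite /ind (lt_trans _ h)//; lra.
have xf : x \is a fin_num by rewrite ge0_fin_numE//; apply: le_lt_trans xm _; exact: ltry.
rewrite -(fineK xf) lee_fin; set y := fine x.
have y0 : 0 <= y by exact: fine_ge0.
have d20 : 0 < d ^+ 2 by rewrite exprn_gt0.
have key : d ^+ 2 * y <= 160 * m * e.
  apply/ler_addgt0Pr => t t0.
  have [c c0 cE] : exists2 c : R, 0 < c & 4 * 3201 = c.
    by refine (ex_intro2 _ _ (4 * 3201) _ erefl); lra.
  have cm : 0 < c * (m + 1) by rewrite mulr_gt0// ltr_wpDl.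
  (* The slack [t] is split in halves: one pays for the cut-off energy [q], the other for the small
     disc on which the cut-off is not known to be 1. Using [m + 1] avoids a division by 0. *)
  pose q := t / (2 * (c * (m + 1))).
  have q0 : 0 < q by rewrite /q divr_gt0// mulr_gt0.
  have tq : c * m * q <= t / 2.
    have cn : c * (m + 1) != 0 by rewrite gt_eqF.
    have -> : t / 2 = c * (m + 1) * q by rewrite /q; move: (c * (m + 1)) cn => X cn; field.
    by rewrite ler_pM2r// ler_pM2l// lerDl.
  have t8 : 0 < t / (8 * d ^+ 2) by rewrite divr_gt0// mulr_gt0.
  have [N hN] := hl_small t8.
  have [n Nn hq] := cut N q0.
  have n0 : (0 < n)%N by exact: leq_ltn_trans Nn.
  have hq' : (II (fun p => (Gn n p ^+ 2 * pp (U p - s') ^+ 2)%R) <= q%:E)%E.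
    have mG := measurable_Gn (R := R) n.
    apply: le_trans hq; apply: II_le; [by rewrite /pp; meas|by rewrite /pp; meas| |].
      by move=> p; rewrite mulr_ge0 ?sqr_ge0.
    move=> p; rewrite ler_wpM2l ?sqr_ge0// lerXn2r ?nnegrE ?pp_ge0//.
    by apply: pp_homo; rewrite lerD2l lerN2.
  have S := stepH n0 ss' d0 m0 e0 (ltW q0) hm2 he hq'.
  have dn : (II (fun p => (d ^+ 2 * ind (nz p <= hl n))%R) <= (t / 2)%:E)%E.
    have mi : measurable_fun setT (fun p : pl R => ind (nz p <= hl n) : R).
      rewrite (_ : (fun p => _) = (\1_[set p : pl R | nz p \in `]-oo, hl n]] : pl R -> R)).
        by apply: measurable_indic; exact: measurable_nz_itv.
      apply/funext => p; rewrite indicE /ind; congr (nat_of_bool _)%:R.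
      by apply/idP/idP; rewrite inE /= in_itv.
    rewrite IIZ//; last exact: ltW.
    apply: (@le_trans _ _ ((d ^+ 2)%:E * (4 * (hl n * hl n))%:E)%E).
      by apply: lee_wpmul2l; [rewrite lee_fin ltW|exact: II_disc].
    rewrite -EFinM lee_fin.
    have h1 : hl n <= t / (8 * d ^+ 2) by apply: le_trans (ltW hN); apply: hl_le; exact: ltnW.
    have h2 : (hl n : R) <= 1 by exact: hl_le1.
    have h3 : hl n * hl n <= t / (8 * d ^+ 2).
      by apply: le_trans h1; rewrite ler_piMl// ltW ?hl_gt0.
    have d24 : 0 <= d ^+ 2 * 4 by rewrite mulr_ge0// ltW.
    rewrite (mulrA (d ^+ 2) 4); apply: (le_trans (ler_wpM2l d24 h3)).
    by rewrite le_eqVlt; apply/orP; left; apply/eqP; field; rewrite gt_eqF.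
  have T : ((d ^+ 2 * y)%:E <= (4 * m * (40 * e + 3201 * q))%:E + (t / 2)%:E)%E.
    rewrite EFinM (fineK xf) -IIZ//; last exact: ltW.
    have mi : measurable_fun setT (fun p : pl R => ind (nz p <= hl n) : R).
      rewrite (_ : (fun p => _) = (\1_[set p : pl R | nz p \in `]-oo, hl n]] : pl R -> R)).
        by apply: measurable_indic; exact: measurable_nz_itv.
      apply/funext => p; rewrite indicE /ind; congr (nat_of_bool _)%:R.
      by apply/idP/idP; rewrite inE /= in_itv.
    have me := measurable_cutoff (R := R) n.
    have md : measurable_fun setT (fun p => (cutoff n p * pp (U p - s' - d)) ^+ 2) by rewrite /pp; meas.
    apply: le_trans (leeD S dn).
    rewrite -IID//; [|by meas|by move=> p; exact: sqr_ge0|by move=> p; rewrite mulr_ge0 ?sqr_ge0].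
    apply: II_le; [by meas|by meas|by move=> p; rewrite mulr_ge0 ?sqr_ge0|].
    move=> p; rewrite {1}/ind; case: ltP => h; last by rewrite mulr0 addr_ge0 ?sqr_ge0// mulr_ge0 ?sqr_ge0.
    rewrite mulr1; have [hn|hn] := leP (nz p) (hl n).
      by rewrite /ind mulr1 lerDr sqr_ge0.
    rewrite /ind mulr0 addr0 (cutoff_eq1 n0 (ltW hn)) mul1r; apply: lerXn2r; rewrite ?nnegrE ?pp_ge0 ?(ltW d0)//.
    by apply: le_trans (pp_ge _); exact: level_gap.
  move: T; rewrite -EFinD lee_fin => T; apply: (le_trans T).
  have -> : 4 * m * (40 * e + 3201 * q) + t / 2 = 160 * m * e + ((4 * 3201) * m * q + t / 2) by ring.
  by rewrite cE lerD2l [leRHS]splitr lerD2r.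
have h4 : d ^+ 2 * y <= d ^+ 2 * (m / 4).
  apply: (le_trans key); have := ler_wpM2r m0 hd; lra.
rewrite ler_pM2l// in h4; apply: (le_trans h4).
by rewrite /m !hlS le_eqVlt; apply/orP; left; apply/eqP; field.
Qed.

(** The level rises by [2 D be^k] with [be] the square root of [b], so that [(D be^k)^2] is exactly
    the [640 C1 b^k] asked for by [level_halving]. The increments are summable with total [C0],
    while the measures tend to 0. *)
Lemma de_giorgi : {ae leb2 R, forall p, U p <= s + C0}.
Proof.
have /andP[b0 b1] := b_bounds; have c1 := C1_gt0; have s0' := s0.
set be := Num.sqrt b; set D := Num.sqrt (640 * C1).
have beE : be ^+ 2 = b by rewrite sqr_sqrtr// ltW.
have be0 : 0 < be by rewrite sqrtr_gt0.
have be1 : be < 1 by rewrite -(ltr_pXn2r (n := 2))// ?nnegrE ?(ltW be0)// beE expr1n.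
have C64 : 0 < 640 * C1 by apply: mulr_gt0; [lra|exact: c1].
have DE : D ^+ 2 = 640 * C1 by rewrite /D; apply: sqr_sqrtr; exact: ltW.
have D0 : 0 < D by rewrite sqrtr_gt0; exact: C64.
pose sk k := s + 2 * (D * ((1 - be ^+ k) / (1 - be))).
have b1' : 0 < 1 - be by lra.
have bk k : 0 <= be ^+ k <= 1 by rewrite (exprn_ge0 _ (ltW be0)) (exprn_ile1 _ (ltW be0) (ltW be1)).
have sk_ge k : s <= sk k.
  have /andP[h1 h2] := bk k.
  by rewrite lerDl; apply: mulr_ge0 => //; apply: mulr_ge0; [exact: ltW|apply: divr_ge0; [lra|exact: ltW]].
have skS k : sk k.+1 = sk k + 2 * (D * be ^+ k) by rewrite /sk exprSr; field; rewrite gt_eqF.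
have P k : (II (fun p => (ind (sk k < U p))%R) <= (4 * (hl k * hl k))%:E)%E.
  elim: k => [|k IH].
    (* The iteration starts because the superlevel set lies in the unit disc. *)
    have := II_disc (R := R) 0; apply: le_trans.
    have mi : measurable_fun setT (fun p : pl R => ind (nz p <= hl 0) : R).
      rewrite (_ : (fun p => _) = (\1_[set p : pl R | nz p \in `]-oo, hl 0]] : pl R -> R)).
        by apply: measurable_indic; exact: measurable_nz_itv.
      apply/funext => p; rewrite indicE /ind; congr (nat_of_bool _)%:R.
      by apply/idP/idP; rewrite inE /= in_itv.
    apply: II_le; [exact: measurable_gt|exact: mi|by move=> p; exact: ind_ge0|].
    move=> p; rewrite {1}/ind; case: ltP => h; last exact: ind_ge0.
    have h1 : nz p < 1 by apply: U_supp; exact: le_lt_trans (sk_ge 0%N) h.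
    by rewrite /ind /hl expr0 (ltW h1).
  rewrite skS; apply: (level_halving (sk_ge k) _ _ IH); first by rewrite mulr_gt0// exprn_gt0.
  have e : (D * be ^+ k) ^+ 2 = D ^+ 2 * (be ^+ 2) ^+ k by rewrite [LHS]exprMn exprAC.
  by rewrite e beE DE mulrA.
have z : (II (fun p => (ind (s + C0 < U p))%R) = 0)%E.
  apply/eqP; rewrite eq_le II_ge0 ?andbT; last by move=> p; exact: ind_ge0.
  apply/lee_addgt0Pr => t t0; rewrite add0e.
  have t4 : 0 < t / 4 by lra.
  have [k hk] := hl_small t4.
  apply: (@le_trans _ _ (II (fun p => (ind (sk k < U p))%R))).
    apply: II_le; [exact: measurable_gt|exact: measurable_gt|by move=> p; exact: ind_ge0|].
    move=> p; rewrite {1}/ind; case: ltP => h; last exact: ind_ge0.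
    rewrite /ind (le_lt_trans _ h)// lerD2l /C0 -/D -/be -[leRHS]mulrA ler_pM2l// ler_pM2l//.
    have /andP[h1 h2] := bk k.
    by rewrite ler_pdivrMr// mulVf ?gt_eqF//; lra.
  apply: (le_trans (P k)); rewrite lee_fin.
  have h2 : (hl k : R) <= 1 by exact: hl_le1.
  have : (hl k : R) * hl k <= hl k by rewrite ler_piMl// ltW ?hl_gt0.
  lra.
have mS : measurable [set p | s + C0 < U p].
  rewrite -[X in measurable X]setTI (_ : mkset _ = U @^-1` `]s + C0, +oo[); first exact: mU.
  by apply/seteqP; split=> p /=; rewrite in_itv /= andbT.
have h : leb2 R [set p | s + C0 < U p] = 0%E.
  rewrite -z -[X in leb2 R X]setIT -integral_indic//; apply: eq_integral => p _.
  by congr (_%:E); symmetry; apply: ind_indic.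
by exists [set p | s + C0 < U p]; split=> // p /= /negP; rewrite -ltNge.
Qed.

End DeGiorgi.

Lemma sqrD_le2 {R : realType} (x y : R) : (x + y) ^+ 2 <= 2 * x ^+ 2 + 2 * y ^+ 2.
Proof. by have := sqr_ge0 (x - y); rewrite !expr2; lra. Qed.

Lemma W_point {R : realType} (f w z k : C R) (M : R) : f = w * z + k * conjc z -> 0 < cmod z ->
  cmod k <= M -> cmod w <= cmod f / cmod z + M.
Proof.
move=> e z0 kM; have E : w * z = f - k * conjc z by rewrite e addrK.
have : cmod w * cmod z <= cmod f + M * cmod z.
  rewrite -cmodM E; apply: (le_trans (cmodB _ _)); apply: lerD => //.
  by rewrite cmodM cmod_conj ler_wpM2r ?cmod_ge0.
by rewrite -(ler_pM2r z0 (cmod w)) mulrDl divfK ?gt_eqF.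
Qed.

(** * From the bound on the implicit coefficient to the growth of the increment *)

Section Growth.
Context {R : realType}.
Local Notation nz p := (cmod (toC p)).
Local Notation i := (imunit R).
Variables (r r' s O M M1 al : R).
Hypotheses (M10 : 0 <= M1) (al0 : 0 < al) (al1 : al < 1).
Hypotheses (r'0 : 0 < r') (r'r : r' < r) (r1 : r <= 1) (s0 : 0 <= s) (M0 : 0 <= M) (O0 : 0 <= O).
Hypothesis bd : forall p : pl R, r' <= nz p -> nz p < r -> O / nz p + M <= s.

(** [de_giorgi] applied to [Re W]. Since [|W| <= |F| / |z| + M], its cut-off energy is bounded by
    that of [|F| / |z|], which is small by assumption for suitable [n], plus a multiple of
    [M^2 / n]. *)
Lemma Re_bound (F Fx Fy W : pl R -> C R) (K : C R -> C R) :
  cmeas F -> cmeas Fx -> cmeas Fy -> cmeas W ->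
  L2 (fun p => cmod (Fx p)) -> L2 (fun p => cmod (Fy p)) ->
  (forall w w', cmod (K w - K w') <= cmod (w - w') / 100) -> (forall w, cmod (K w) <= M) ->
  (forall p : pl R, nz p < r -> cmod (F p) <= O) ->
  (forall p : pl R, 0 < nz p -> F p = W p * toC p + K (W p) * conjc (toC p)) ->
  (forall r1 (t_ : nat -> R), r1 < r -> (forall n, t_ n != 0) -> t_ @ \oo --> 0 ->
    (II (fun p => (\1_(disc r1) p * cmod (remx F Fx (t_ n) p) ^+ 2)%R) @[n --> \oo] --> 0)%E) ->
  (forall r1 (t_ : nat -> R), r1 < r -> (forall n, t_ n != 0) -> t_ @ \oo --> 0 ->
    (II (fun p => (\1_(disc r1) p * cmod (remy F Fy (t_ n) p) ^+ 2)%R) @[n --> \oo] --> 0)%E) ->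
  {ae leb2 R, forall p : pl R, nz p < r -> forall w, s <= cmod w ->
    cmod (2^-1 * (Fx p + i * Fy p) - K w) <= cmod (2^-1 * (Fx p - i * Fy p) - w) / 2 + nz p * E1 M1 al p} ->
  (forall d N, 0 < d -> exists2 n, (N < n)%N &
    (II (fun p => (Gn n p ^+ 2 * (\1_(disc r) p * (cmod (F p) / nz p) ^+ 2))%R) <= d%:E)%E) ->
  {ae leb2 R, forall p : pl R, nz p < r -> complex.Re (W p) <= s + C0 M1 al}.
Proof.
move=> mF mFx mFy mW LFx LFy hK KM FO WE rx ry heq cut.
have mE1 := measurable_E1 M1 al; have E10 := E1_ge0 al M10.
have mU := measurable_Uf r mW.
have s0' := s0.
have Usupp p : s < Uf r W p -> nz p < 1.
  rewrite /Uf indicE; case: (boolP (p \in disc r)) => [/set_mem h _|_]; last by rewrite mul0r; lra.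
  exact: lt_le_trans h r1.
have stepH n s' k m e q : (0 < n)%N -> s <= s' -> 0 < k -> 0 <= m -> 0 <= e -> 0 <= q ->
  (II (fun p => (ind (s' + k < Uf r W p))%R) <= m%:E)%E ->
  (II (fun p => (ind (s' < Uf r W p) * (8 * E1 M1 al p ^+ 2))%R) <= e%:E)%E ->
  (II (fun p => (Gn n p ^+ 2 * pp (Uf r W p - s') ^+ 2)%R) <= q%:E)%E ->
  (II (fun p => ((cutoff n p * pp (Uf r W p - s' - k)) ^+ 2)%R) <= (4 * m * (40 * e + 3201 * q))%:E)%E.
  move=> n0 ss' k0.
  have bd' (p : pl R) : r' <= nz p -> nz p < r -> O / nz p + M <= s'.
    by move=> h1 h2; apply: le_trans ss'; exact: bd.
  have heq' : {ae leb2 R, forall p : pl R, nz p < r -> forall w, s' <= cmod w ->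
    cmod (2^-1 * (Fx p + i * Fy p) - K w) <= cmod (2^-1 * (Fx p - i * Fy p) - w) / 2 + nz p * E1 M1 al p}.
    by apply: (ae_mono heq) => p h pr w sw; apply: h => //; exact: le_trans sw.
  have Gb0 : 0 <= 8 / (n%:R * hl (n + n)) :> R.
    by rewrite divr_ge0// mulr_ge0// ltW// hl_gt0.
  apply: (superlevel_step r'0 r'r (le_trans s0 ss') M0 O0 mF mFx mFy mW LFx LFy hK KM FO WE bd' rx ry mE1 E10 heq'
    (hl_gt0 (n + n)) k0 Gb0 (measurable_cutoff n) (fun p => cutoff_bounds p n0) (measurable_Gn n) (fun p => Gn_bound p n0)).
  - by move=> p; exact: cutoff_eq0.
  - by move=> p q'; exact: cutoff_lip.
have cut' d N : 0 < d -> exists2 n, (N < n)%N & (II (fun p => (Gn n p ^+ 2 * pp (Uf r W p - s) ^+ 2)%R) <= d%:E)%E.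
  move=> d0; have d4 : 0 < d / 4 by lra.
  have [N' hN'] : exists N' : nat, 2 * M ^+ 2 * 1024 <= (d / 2) * N'%:R.
    have d2 : 0 < d / 2 by lra.
    have [N' h] : exists N' : nat, 2 * M ^+ 2 * 1024 / (d / 2) <= N'%:R.
      by exists (Num.trunc (2 * M ^+ 2 * 1024 / (d / 2))).+1; apply: ltW; exact: truncnS_gt.
    exists N'; move: h; rewrite (ler_pdivrMr _ _ d2) (mulrC N'%:R).
    by [].
  have [n Nn hn] := cut (d / 4) (maxn N N') d4; exists n; first exact: leq_ltn_trans (leq_maxl _ _) Nn.
  have n0 : (0 < n)%N by exact: leq_ltn_trans Nn.
  have nN' : N'%:R <= n%:R :> R by rewrite ler_nat ltnW// (leq_ltn_trans (leq_maxr N N') Nn).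
  have mG := measurable_Gn (R := R) n.
  have mi := measurable_indic (R := R) (D := setT) (measurable_disc r).
  have mz := @measurable_nz R.
  have mc := measurable_cmod mF.
  have mzi : measurable_fun setT (fun p : pl R => (nz p)^-1) by apply: measurable_inv => // p; exact: cmod_ge0.
  have m1 : measurable_fun setT (fun p => Gn n p ^+ 2 * (\1_(disc r) p * (cmod (F p) / nz p) ^+ 2)) by meas.
  have m2 : measurable_fun setT (fun p : pl R => Gn n p ^+ 2) by meas.
  have p1 p : 0 <= Gn n p ^+ 2 * (\1_(disc r) p * (cmod (F p) / nz p) ^+ 2).
    by apply: mulr_ge0; [exact: sqr_ge0|apply: mulr_ge0; [rewrite indicE|exact: sqr_ge0]].
  have p2 (p : pl R) : 0 <= Gn n p ^+ 2 by exact: sqr_ge0.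
  have M20 : 0 <= 2 * M ^+ 2 by rewrite mulr_ge0 ?sqr_ge0.
  apply: (@le_trans _ _ (2%:E * II (fun p => (Gn n p ^+ 2 * (\1_(disc r) p * (cmod (F p) / nz p) ^+ 2))%R) + (2 * M ^+ 2)%:E * II (fun p => (Gn n p ^+ 2)%R))%E).
    rewrite -(IIZ m1 p1)// -(IIZ m2 p2 M20).
    rewrite -IID; [|exact: measurable_funM|exact: measurable_funM|by move=> p; exact: mulr_ge0|by move=> p; exact: mulr_ge0].
    apply: II_le; [by rewrite /pp; meas|by apply: measurable_funD; exact: measurable_funM|by move=> p; rewrite mulr_ge0 ?sqr_ge0|].
    move=> p; rewrite [leRHS](_ : _ = Gn n p ^+ 2 * (2 * (\1_(disc r) p * (cmod (F p) / nz p) ^+ 2) + 2 * M ^+ 2)); last by ring.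
    have [z0|z0] := eqVneq (nz p) 0.
      have -> : Gn n p = 0; last by rewrite expr0n !mul0r.
      rewrite /Gn indicE; case: (boolP (p \in _)) => [|_]; last by rewrite mul0r.
      rewrite inE /= in_itv /= z0 => /andP[h _]; have := hl_gt0 (R := R) (n + n); lra.
    have zp : 0 < nz p by rewrite lt_def z0 cmod_ge0.
    apply: ler_wpM2l; first exact: sqr_ge0.
    rewrite /Uf indicE; case: (boolP (p \in disc r)) => [/set_mem h|_]; last first.
      by rewrite /= !mul0r mulr0 !add0r pp_neg; [rewrite (expr2 0) mul0r|rewrite oppr_le0].
    rewrite !mul1r.
    have /andP[w1 w2] : 0 <= pp (complex.Re (W p) - s) <= cmod (F p) / nz p + M.
      rewrite pp_ge0 /=; rewrite /pp ge_max; apply/andP; split.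
        by rewrite addr_ge0// divr_ge0 ?cmod_ge0.
      have hW : cmod (W p) <= cmod (F p) / nz p + M.
        exact: (W_point (WE p zp) zp (KM _)).
      rewrite lerBlDr; apply: (le_trans (ler_norm _)); apply: (le_trans (Re_le_cmod _)).
      by apply: (le_trans hW); exact: ler_wpDr.
    have h2 : pp (complex.Re (W p) - s) ^+ 2 <= (cmod (F p) / nz p + M) ^+ 2.
      by apply: lerXn2r; rewrite ?nnegrE//; exact: le_trans w2.
    by apply: (le_trans h2); exact: sqrD_le2.
  apply: (@le_trans _ _ (2%:E * (d / 4)%:E + (2 * M ^+ 2)%:E * (1024 / n%:R)%:E)%E).
    apply: leeD; apply: lee_wpmul2l; rewrite ?lee_fin//; exact: II_Gn.
  rewrite -!EFinM -EFinD lee_fin.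
  have hn0 : 0 < n%:R :> R by rewrite ltr0n.
  have : 2 * M ^+ 2 * (1024 / n%:R) <= d / 2.
    rewrite mulrA ler_pdivrMr//; apply: (le_trans hN'); rewrite ler_wpM2l//; lra.
  lra.
have D := de_giorgi M10 al0 al1 s0 mU Usupp stepH cut'.
apply: (ae_mono D) => p h pr; move: h; rewrite /Uf indicE mem_set// mul1r.
by [].
Qed.


Lemma cmod_unit_mul (c w : C R) : cmod c = 1 -> cmod (c * w) = cmod w.
Proof. by move=> c1; rewrite cmodM c1 mul1r. Qed.

(** The four half-planes bound a square whose corners have modulus [sqrt 2 * T]; 3/2 is a rational
    bound for [sqrt 2]. *)
Lemma cmod_le_of_Re (w : C R) (T : R) : complex.Re w <= T -> complex.Re (-1 * w) <= T ->
  complex.Re (- i * w) <= T -> complex.Re (i * w) <= T -> cmod w <= 3 / 2 * T.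
Proof.
rewrite !ReM !ReN !ImN /= => a b c d.
have {}b : - complex.Re w <= T by lra.
have {}c : complex.Im w <= T by lra.
have {}d : - complex.Im w <= T by lra.
have T0 : 0 <= T by lra.
have /= e := sqr_cmod w.
have p0 : 0 <= 3 / 2 * T by lra.
rewrite -(ler_pXn2r (n := 2)) ?nnegrE ?cmod_ge0// e.
have h1 : complex.Re w ^+ 2 <= T ^+ 2 by nra.
have h2 : complex.Im w ^+ 2 <= T ^+ 2 by nra.
nra.
Qed.

(** The hypotheses are invariant under rotation: for [|c| = 1] the functions [c F] and [c W] satisfy
    them with the field [w -> c K(c^-1 w)], so [Re_bound] holds in four directions. *)
Lemma growth_estimate (F Fx Fy : pl R -> C R) (K : C R -> C R) :
  cmeas F -> cmeas Fx -> cmeas Fy ->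
  L2 (fun p => cmod (Fx p)) -> L2 (fun p => cmod (Fy p)) ->
  (forall w w', cmod (K w - K w') <= cmod (w - w') / 100) -> (forall w, cmod (K w) <= M) ->
  (forall p : pl R, nz p < r -> cmod (F p) <= O) ->
  (forall r1 (t_ : nat -> R), r1 < r -> (forall n, t_ n != 0) -> t_ @ \oo --> 0 ->
    (II (fun p => (\1_(disc r1) p * cmod (remx F Fx (t_ n) p) ^+ 2)%R) @[n --> \oo] --> 0)%E) ->
  (forall r1 (t_ : nat -> R), r1 < r -> (forall n, t_ n != 0) -> t_ @ \oo --> 0 ->
    (II (fun p => (\1_(disc r1) p * cmod (remy F Fy (t_ n) p) ^+ 2)%R) @[n --> \oo] --> 0)%E) ->
  {ae leb2 R, forall p : pl R, nz p < r -> forall w, s <= cmod w ->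
    cmod (2^-1 * (Fx p + i * Fy p) - K w) <= cmod (2^-1 * (Fx p - i * Fy p) - w) / 2 + nz p * E1 M1 al p} ->
  (forall d N, 0 < d -> exists2 n, (N < n)%N &
    (II (fun p => (Gn n p ^+ 2 * (\1_(disc r) p * (cmod (F p) / nz p) ^+ 2))%R) <= d%:E)%E) ->
  {ae leb2 R, forall p : pl R, 0 < nz p -> nz p < r ->
    cmod (F p) <= (3 / 2 * (s + C0 M1 al) + M) * nz p}.
Proof.
move=> mF mFx mFy LFx LFy hK KM FO rx ry heq cut.
(* Dividing the implicit equation by [z] gives the fixed point equation
   [W = F / z - (conj z / z) K(W)]; at [z = 0] the inverse is 0, and the coefficient is still
   bounded by 1. *)
have mq : cmeas (fun p => conjc (toC p) * (toC p)^-1 : C R).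
  by apply: cmeasM; [apply: cmeas_conj|apply: cmeasV]; exact: cmeas_toC.
have q1 (p : pl R) : cmod (conjc (toC p) * (toC p)^-1 : C R) <= 1.
  rewrite cmodM cmodV cmod_conj; have [->|h] := eqVneq (nz p) 0; first by rewrite mul0r.
  by rewrite divff.
have [W mW hW] := fixpoint_exists hK (cmeasM mF (cmeasV cmeas_toC)) mq q1.
have WE (p : pl R) : 0 < nz p -> F p = W p * toC p + K (W p) * conjc (toC p).
  rewrite cmod_gt0 => z0; rewrite {1}hW mulrBl divfK//.
  have -> : conjc (toC p) * (toC p)^-1 * K (W p) * toC p = K (W p) * conjc (toC p).
    by rewrite mulrAC divfK// mulrC.
  by rewrite subrK.
have rot (c : C R) : cmod c = 1 -> {ae leb2 R, forall p : pl R, nz p < r -> complex.Re (c * W p) <= s + C0 M1 al}.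
  move=> c1; have c0 : c != 0 by rewrite -cmod_gt0 c1.
  have cu w := cmod_unit_mul w c1.
  have cV w : cmod (c^-1 * w) = cmod w by rewrite cmodM cmodV c1 invr1 mul1r.
  have mc (f : pl R -> C R) : cmeas f -> cmeas (fun p => c * f p) by move=> mf; apply: cmeasM => //; exact: cmeas_cst.
  have rE (f g : pl R -> C R) t p : cmod (remx (fun p => c * f p) (fun p => c * g p) t p) = cmod (remx f g t p).
    by rewrite /remx -mulrBr -mulrA -mulrBr cu.
  have rE' (f g : pl R -> C R) t p : cmod (remy (fun p => c * f p) (fun p => c * g p) t p) = cmod (remy f g t p).
    by rewrite /remy -mulrBr -mulrA -mulrBr cu.
  apply: (@Re_bound (fun p => c * F p) (fun p => c * Fx p) (fun p => c * Fy p) (fun p => c * W p)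
    (fun w => c * K (c^-1 * w))); [exact: mc|exact: mc|exact: mc|exact: mc|..].
  - by rewrite (_ : (fun _ => _) = (fun p => cmod (Fx p))) //; apply/funext => p; rewrite cu.
  - by rewrite (_ : (fun _ => _) = (fun p => cmod (Fy p))) //; apply/funext => p; rewrite cu.
  - by move=> w w'; rewrite -mulrBr cu; apply: (le_trans (hK _ _)); rewrite -mulrBr cV.
  - by move=> w; rewrite cu.
  - by move=> p h; rewrite cu; exact: FO.
  - by move=> p z0; rewrite mulKf// (WE p z0) mulrDr !mulrA.
  - move=> r2 t_ h1 h2 h3; under eq_fun do under eq_fun do rewrite rE.
    exact: rx.
  - move=> r2 t_ h1 h2 h3; under eq_fun do under eq_fun do rewrite rE'.
    exact: ry.
  - apply: (ae_mono heq) => p h pr w sw.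
    have -> : 2^-1 * (c * Fx p + i * (c * Fy p)) - c * K (c^-1 * w) = c * (2^-1 * (Fx p + i * Fy p) - K (c^-1 * w)) by ring.
    have -> : 2^-1 * (c * Fx p - i * (c * Fy p)) - w = c * (2^-1 * (Fx p - i * Fy p) - c^-1 * w).
      by rewrite [RHS]mulrBr mulVKf//; ring.
    by rewrite !cu; apply: h; rewrite ?cV.
  - move=> d N d0; have [n h1 h2] := cut d N d0; exists n => //.
    by under eq_fun do rewrite cu.
have cN1 : cmod (-1 : C R) = 1 by rewrite cmodN cmod1.
have cNi : cmod (- i) = 1 by rewrite cmodN cmod_imunit.
apply: (ae_mono2 (ae_mono2 (rot 1 (@cmod1 R)) (rot _ cN1) (fun p a b => conj a b)) (ae_mono2 (rot _ cNi) (rot _ (@cmod_imunit R)) (fun p a b => conj a b))).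
move=> p [a1 a2] [a3 a4] z0 pr.
have hw : cmod (W p) <= 3 / 2 * (s + C0 M1 al).
  apply: cmod_le_of_Re; [by have := a1 pr; rewrite mul1r|exact: a2|exact: a3|exact: a4].
rewrite (WE p z0); apply: (le_trans (cmodD _ _)); rewrite !cmodM cmod_conj mulrDl.
by apply: lerD; apply: ler_wpM2r; rewrite ?cmod_ge0.
Qed.

End Growth.

(** * Complex Sobolev functions *)

Section Swap.
Context {R : realType}.
Implicit Types (U w : pl R -> R).

Lemma Iint_sw (g : pl R -> R) : measurable_fun setT g -> Iint (fun p => g (sw p)) = Iint g.
Proof.
move=> mg; rewrite /Iint /Rintegral; congr fine.
transitivity (\int[leb2 R]_p ((EFin \o g) (sw p)))%E; first by [].
have mE : measurable_fun setT (EFin \o g) by apply/measurable_EFinP.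
rewrite [LHS]integralE [RHS]integralE; congr (_ - _)%E.
  rewrite -[RHS](ge0_integral_swap); [|exact: measurable_funepos|by []].
  by apply: eq_integral => p _; rewrite !funeposE.
rewrite -[RHS](ge0_integral_swap); [|exact: measurable_funeneg|by []].
by apply: eq_integral => p _; rewrite !funenegE.
Qed.

(** Exchanging the coordinates reduces vertical derivatives to horizontal ones, so that the analysis
    is done in one direction only. *)
Definition weak_y U w (O : set (R * R)) :=
  weak_x (fun p => U (sw p)) (fun p => w (sw p)) (sw @^-1` O).

Lemma measurable_sw_pre (S : set (pl R)) : measurable S -> measurable (sw @^-1` S : set (pl R)).
Proof. by move=> mS; rewrite -[X in measurable X]setTI; exact: measurable_sw. Qed.

Lemma margin_sw (O S : set (R * R)) e : margin O S e -> margin (sw @^-1` O) (sw @^-1` S) e.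
Proof. by move=> m p Sp q h1 h2; apply: (m (sw p)). Qed.

Variables (U w : pl R -> R) (O : set (R * R)).
Hypotheses (LU : L2 U) (Lw : L2 w) (weak : weak_y U w O).

Lemma rem_y_cvg (S : set (pl R)) e (t_ : nat -> R) : measurable S -> 0 < e -> margin O S e ->
  (forall n, t_ n != 0) -> t_ @ \oo --> 0 ->
  (II (fun p => (\1_S p * ((U (tr (0, t_ n) p) - U p) / t_ n - w p) ^+ 2)%R) @[n --> \oo] --> 0)%E.
Proof.
move=> mS e0 hS t0 tc.
have := rem_x_cvg (L2_sw LU) (L2_sw Lw) weak (measurable_sw_pre mS) e0 (margin_sw hS) t0 tc.
set l := (fun n => II _); move=> h; set l' := (fun n => II _); suff -> : l' = l by [].
apply/funext => n; rewrite /l' /l {l l' h}.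
have [mU _] := LU; have [mw _] := Lw.
rewrite -II_sw; first by apply: II_ext => p; rewrite /rem_x !indicE.
- apply: measurable_funM; [exact: measurable_indic|by meas].
- by move=> p; rewrite mulr_ge0// sqr_ge0.
Qed.

Lemma translation_y (S : set (pl R)) e t : measurable S -> margin O S (2 * e) -> `|t| <= e ->
  (II (fun p => (\1_S p * (U (tr (0, t) p) - U p) ^+ 2)%R) <= (2 * t ^+ 2)%:E * II (fun p => (w p ^+ 2)%R))%E.
Proof.
move=> mS hS te; have [mU _] := LU; have [mw _] := Lw.
have := translation_x (L2_sw LU) (L2_sw Lw) weak (measurable_sw_pre mS) (margin_sw hS) te.
rewrite (II_sw (f := fun p => w p ^+ 2)); [|by meas|by move=> p; exact: sqr_ge0].
move=> h; rewrite -II_sw//.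
- apply: measurable_funM; [exact: measurable_indic|by meas].
- by move=> p; rewrite mulr_ge0// sqr_ge0.
Qed.

Lemma ftc_margin_y (S : set (R * R)) (e t : R) : t != 0 -> `|t| <= e -> margin O S (2 * e) ->
  {ae leb2 R, forall p, S p -> U (tr (0, t) p) - U p = t * savg t (fun q => w (sw q)) (sw p)}.
Proof.
move=> t0 te hS.
by apply: (ae_mono (ae_sw (ftc_margin (L2_sw LU) (L2_sw Lw) weak t0 te (margin_sw hS)))) => -[x y].
Qed.

End Swap.

Section WeakLink.
Context {R : realType}.
Variables (Omega : set (C R)).
Local Notation OP := (@toC R @^-1` Omega).

Definition patch0 (u : C R -> R) (p : pl R) : R := if p \in OP then u (toC p) else 0.

Lemma test_tensor (al be : R -> R) a b c d : (forall n, C1n n al) -> (forall n, C1n n be) ->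
  (forall x, ~ (a <= x <= b) -> al x = 0) -> (forall y, ~ (c <= y <= d) -> be y = 0) ->
  `[a, b] `*` `[c, d] `<=` OP -> test_function Omega (fun p => al p.1 * be p.2).
Proof.
move=> hal hbe sa sb bO.
have cb : compact (`[a, b] `*` `[c, d] : set (R * R)).
  by apply: compact_setX; exact: segment_compact.
have cl : closed (`[a, b] `*` `[c, d] : set (R * R)).
  by apply: compact_closed cb; exact: norm_hausdorff.
have sub : Defs.support (fun p : R * R => al p.1 * be p.2) `<=` (`[a, b] `*` `[c, d] : set (R * R)).
  rewrite /Defs.support ((closure_id _).1 cl); apply: closure_subset.
  move=> p /= hp.
  split; rewrite /= in_itv /=; apply/negP => /negP/negP; last first.
    by move=> h; apply: hp; rewrite sb ?mulr0//; exact/negP.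
  by move=> h; apply: hp; rewrite sa ?mul0r//; exact/negP.
split; first by move=> n; exact: Cn_tensor.
- by apply: subclosed_compact cb sub; exact: closed_closure.
- exact: subset_trans sub bO.
Qed.

Lemma Iint_patch (u : C R -> R) (ph : pl R -> R) :
  Iint (fun p => patch0 u p * ph p) = \int[leb2 R]_(p in OP) (u (toC p) * ph p).
Proof.
rewrite /Iint [RHS]Rintegral_mkcond; apply: eq_Rintegral => p _.
by rewrite /patch0 patchE; case: ifP => // _; rewrite mul0r.
Qed.

Lemma weak_x_partial (u w : C R -> R) : weak_partial Omega (ex R) u w ->
  weak_x (patch0 u) (patch0 w) OP.
Proof.
move=> h al be al' a b c d hal hbe hd sa sb bO.
rewrite !Iint_patch -(h _ (test_tensor hal hbe sa sb bO)).
apply: eq_Rintegral => p _; congr (_ * _).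
by have [_ ->] := is_derive_tensor_x be (hd p.1).
Qed.

Lemma weak_y_partial (u w : C R -> R) : measurable_fun setT (patch0 u) -> measurable_fun setT (patch0 w) ->
  weak_partial Omega (ey R) u w -> weak_y (patch0 u) (patch0 w) OP.
Proof.
move=> mu mw h al be al' a b c d hal hbe hd sa sb bO.
have bO' : `[c, d] `*` `[a, b] `<=` OP by move=> [x y] [/= h1 h2]; exact: (bO (y, x)).
have mco (f : R -> R) (pi : pl R -> measurableTypeR R) : continuous f -> measurable_fun setT pi ->
    measurable_fun setT (fun p => f (pi p)).
  by move=> cf mpi; apply: (measurableT_comp _ mpi); exact: continuous_measurable_fun.
have cal : continuous al := hal 0.
have cbe : continuous be := hbe 0.
have cal' : continuous al'.
  have [f [df cf]] := hal 1.
  suff -> : al' = f by [].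
  by apply/funext => x; have [_ <-] := hd x; have [_ <-] := df x.
rewrite -(Iint_sw (g := fun p => patch0 u (sw p) * (al' p.1 * be p.2))); last first.
  apply: measurable_funM; first exact: (measurableT_comp mu measurable_sw).
  by apply: measurable_funM; [apply: mco => //; exact: measurable_fst|apply: mco => //; exact: measurable_snd].
rewrite -(Iint_sw (g := fun p => patch0 w (sw p) * (al p.1 * be p.2))); last first.
  apply: measurable_funM; first exact: (measurableT_comp mw measurable_sw).
  by apply: measurable_funM; [apply: mco => //; exact: measurable_fst|apply: mco => //; exact: measurable_snd].
have e (v : C R -> R) (f g : R -> R) : Iint (fun p => patch0 v (sw (sw p)) * (f (sw p).1 * g (sw p).2)) =
    Iint (fun p => patch0 v p * (g p.1 * f p.2)).
  by apply: Iint_ext => -[x y] /=; rewrite /sw /= [f y * _]mulrC.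
rewrite !e !Iint_patch -(h _ (test_tensor hbe hal sb sa bO')).
apply: eq_Rintegral => p _; congr (_ * _).
by have [_ ->] := is_derive_tensor_y be (hd p.2).
Qed.

End WeakLink.

Section WeakAe.
Context {R : realType}.
Implicit Types (U V w : pl R -> R).

Lemma Iint_ae (f g : pl R -> R) : measurable_fun setT f -> measurable_fun setT g ->
  {ae leb2 R, forall p, f p = g p} -> Iint f = Iint g.
Proof.
move=> mf mg fg; rewrite /Iint /Rintegral; congr fine.
apply: ae_eq_integral => //; [exact/measurable_EFinP|exact/measurable_EFinP|].
by apply: (ae_mono fg) => p -> _.
Qed.

Lemma weak_x_ae U V w (O : set (R * R)) : measurable_fun setT U -> measurable_fun setT V ->
  {ae leb2 R, forall p, U p = V p} -> weak_x U w O -> weak_x V w O.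
Proof.
move=> mU mV UV h al be al' a b c d hal hbe hd sa sb bO.
rewrite -(h _ _ _ _ _ _ _ hal hbe hd sa sb bO).
have cbe : continuous be := hbe 0.
have cal' : continuous al'.
  have [f [df cf]] := hal 1.
  suff -> : al' = f by [].
  by apply/funext => x; have [_ <-] := hd x; have [_ <-] := df x.
have m : measurable_fun setT (fun p : pl R => al' p.1 * be p.2).
  apply: measurable_funM.
    by apply: (measurableT_comp _ measurable_fst); exact: continuous_measurable_fun.
  by apply: (measurableT_comp _ measurable_snd); exact: continuous_measurable_fun.
apply: Iint_ae; [exact: measurable_funM|exact: measurable_funM|].
by apply: (ae_mono UV) => p ->.
Qed.

Lemma weak_y_ae U V w (O : set (R * R)) : measurable_fun setT U -> measurable_fun setT V ->
  {ae leb2 R, forall p, U p = V p} -> weak_y U w O -> weak_y V w O.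
Proof.
move=> mU mV UV; apply: weak_x_ae; [exact: measurable_comp_sw|exact: measurable_comp_sw|].
exact: ae_sw UV.
Qed.

End WeakAe.

Section Fubini.
Context {R : realType}.

Lemma leb2_sigma_finite : sigma_finite setT (leb2 R).
Proof.
exists (fun n => box n%:R : set (pl R)).
  apply/esym/seteqP; split=> // p _.
  exists (Num.trunc (`|p.1| + `|p.2|)).+1 => //; apply/boxP.
  have h := ltW (truncnS_gt (`|p.1| + `|p.2|)).
  split; apply: le_trans h; rewrite ?lerDl ?lerDr; exact: normr_ge0.
move=> n; split; first exact: measurable_box.
by rewrite leb2_boxE// ltry.
Qed.

(* A copy of [leb2] that can carry the sigma-finite structure Fubini's theorem asks for. *)
Definition leb2f : set (pl R) -> \bar R := leb2 R.
HB.instance Definition _ := isMeasure.Build _ _ _ leb2f (measure0 (leb2 R)) (measure_ge0 (leb2 R))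
  (@measure_semi_sigma_additive _ _ _ (leb2 R)).
HB.instance Definition _ := Measure_isSigmaFinite.Build _ _ _ leb2f leb2_sigma_finite.

Lemma integral_leb2f (g : pl R -> \bar R) : (\int[leb2 R]_a g a = \int[leb2f]_a g a)%E.
Proof. by apply: eq_measure_integral. Qed.

Lemma leb2_fubini_tonelli (f : pl R * pl R -> \bar R) : measurable_fun setT f -> (forall x, 0 <= f x)%E ->
  (\int[leb2 R]_a \int[leb2 R]_b f (a, b) = \int[leb2 R]_b \int[leb2 R]_a f (a, b))%E.
Proof.
move=> mf f0; rewrite !integral_leb2f.
under eq_integral => a _ do rewrite integral_leb2f.
under [RHS]eq_integral => a _ do rewrite integral_leb2f.
exact: (@fubini_tonelli _ _ _ _ _ leb2f leb2f f).
Qed.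

Lemma measurable_leb2_fubini (f : pl R * pl R -> \bar R) : measurable_fun setT f -> (forall x, 0 <= f x)%E ->
  measurable_fun setT (fun a => \int[leb2 R]_b f (a, b))%E.
Proof.
move=> mf f0; under eq_fun do rewrite integral_leb2f.
exact: (@measurable_fun_fubini_tonelli_F _ _ _ _ _ leb2f f).
Qed.

End Fubini.

(** * L2 bounds for translations and small cut-off energy at almost every centre *)

Section Sobolev2.
Context {R : realType}.
Local Notation nz p := (cmod (toC p)).
Variables (O : set (pl R)) (h hx hy : pl R -> C R).
Hypotheses (mh : cmeas h) (mhx : cmeas hx) (mhy : cmeas hy).
Hypotheses (Lh : L2 (fun p => cmod (h p))) (Lhx : L2 (fun p => cmod (hx p))) (Lhy : L2 (fun p => cmod (hy p))).
Hypothesis wxRe : weak_x (fun p => complex.Re (h p)) (fun p => complex.Re (hx p)) O.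
Hypothesis wxIm : weak_x (fun p => complex.Im (h p)) (fun p => complex.Im (hx p)) O.
Hypothesis wyRe : weak_y (fun p => complex.Re (h p)) (fun p => complex.Re (hy p)) O.
Hypothesis wyIm : weak_y (fun p => complex.Im (h p)) (fun p => complex.Im (hy p)) O.

Lemma L2_ReIm (f : pl R -> C R) : cmeas f -> L2 (fun p => cmod (f p)) ->
  L2 (fun p => complex.Re (f p)) /\ L2 (fun p => complex.Im (f p)).
Proof.
move=> [m1 m2] L; have [mc _] := L.
by split; apply: (L2_le _ _ (L2_integrable L)) => // p; rewrite ?sqr_ge0// sqr_cmod; nra.
Qed.

Lemma II_cmod (S : set (pl R)) (f : pl R -> C R) : measurable S -> cmeas f ->
  (II (fun p => (\1_S p * cmod (f p) ^+ 2)%R) =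
   II (fun p => (\1_S p * complex.Re (f p) ^+ 2)%R) + II (fun p => (\1_S p * complex.Im (f p) ^+ 2)%R))%E.
Proof.
move=> mS [m1 m2]; have mi := measurable_indic (R := R) (D := setT) mS.
rewrite -IID; [by apply: II_ext => p; rewrite sqr_cmod mulrDr|by meas|by meas|..];
  by move=> p; rewrite mulr_ge0// ?sqr_ge0// indicE.
Qed.

Let mremx t : cmeas (remx h hx t).
Proof.
apply: cmeasD; last exact: cmeasN.
by apply: cmeasM; [apply: cmeasD; [exact: cmeas_tr|exact: cmeasN]|exact: cmeas_cst].
Qed.

Let mremy t : cmeas (remy h hy t).
Proof.
apply: cmeasD; last exact: cmeasN.
by apply: cmeasM; [apply: cmeasD; [exact: cmeas_tr|exact: cmeasN]|exact: cmeas_cst].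
Qed.

Lemma remx_cvg (S : set (pl R)) e (t_ : nat -> R) : measurable S -> 0 < e -> margin O S e ->
  (forall n, t_ n != 0) -> t_ @ \oo --> 0 ->
  (II (fun p => (\1_S p * cmod (remx h hx (t_ n) p) ^+ 2)%R) @[n --> \oo] --> 0)%E.
Proof.
move=> mS e0 hS t0 tc.
have [LR LI] := L2_ReIm mh Lh; have [LxR LxI] := L2_ReIm mhx Lhx.
rewrite (funext (fun n => II_cmod mS (mremx (t_ n)))) -(adde0 0%E); apply: cvgeD => //.
  apply: cvg_trans (rem_x_cvg LR LxR wxRe mS e0 hS t0 tc); apply: near_eq_cvg; near=> n.
  apply: II_ext => p; have [eR _] := Re_divr (h (tr (t_ n, 0) p) - h p) (t_ n).
  by rewrite /rem_x /remx ReB eR ReB.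
apply: cvg_trans (rem_x_cvg LI LxI wxIm mS e0 hS t0 tc); apply: near_eq_cvg; near=> n.
apply: II_ext => p; have [_ eI] := Re_divr (h (tr (t_ n, 0) p) - h p) (t_ n).
by rewrite /rem_x /remx ImB eI ImB.
Unshelve. all: by end_near.
Qed.

Lemma remy_cvg (S : set (pl R)) e (t_ : nat -> R) : measurable S -> 0 < e -> margin O S e ->
  (forall n, t_ n != 0) -> t_ @ \oo --> 0 ->
  (II (fun p => (\1_S p * cmod (remy h hy (t_ n) p) ^+ 2)%R) @[n --> \oo] --> 0)%E.
Proof.
move=> mS e0 hS t0 tc.
have [LR LI] := L2_ReIm mh Lh; have [LxR LxI] := L2_ReIm mhy Lhy.
rewrite (funext (fun n => II_cmod mS (mremy (t_ n)))) -(adde0 0%E); apply: cvgeD => //.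
  apply: cvg_trans (rem_y_cvg LR LxR wyRe mS e0 hS t0 tc); apply: near_eq_cvg; near=> n.
  apply: II_ext => p; have [eR _] := Re_divr (h (tr (0, t_ n) p) - h p) (t_ n).
  by rewrite /remy ReB eR ReB.
apply: cvg_trans (rem_y_cvg LI LxI wyIm mS e0 hS t0 tc); apply: near_eq_cvg; near=> n.
apply: II_ext => p; have [_ eI] := Re_divr (h (tr (0, t_ n) p) - h p) (t_ n).
by rewrite /remy ImB eI ImB.
Unshelve. all: by end_near.
Qed.

Let D := (II (fun p => (cmod (hx p) ^+ 2)%R) + II (fun p => (cmod (hy p) ^+ 2)%R))%E.

Lemma translation_cx (S : set (pl R)) e t : measurable S -> margin O S (2 * e) -> `|t| <= e ->
  (II (fun p => (\1_S p * cmod (h (tr (t, 0) p) - h p) ^+ 2)%R) <= (2 * t ^+ 2)%:E * II (fun p => (cmod (hx p) ^+ 2)%R))%E.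
Proof.
move=> mS hS te; have [LR LI] := L2_ReIm mh Lh; have [LxR LxI] := L2_ReIm mhx Lhx.
have md : cmeas (fun p => h (tr (t, 0) p) - h p) by apply: cmeasD; [exact: cmeas_tr|exact: cmeasN].
rewrite (II_cmod mS md).
have -> : II (fun p => (cmod (hx p) ^+ 2)%R) = (II (fun p => (complex.Re (hx p) ^+ 2)%R) + II (fun p => (complex.Im (hx p) ^+ 2)%R))%E.
  have [m1 m2] := mhx.
  by rewrite -IID; [apply: II_ext => p; rewrite sqr_cmod|meas|meas|move=> p; exact: sqr_ge0|move=> p; exact: sqr_ge0].
rewrite ge0_muleDr; [|by apply: II_ge0 => p; exact: sqr_ge0|by apply: II_ge0 => p; exact: sqr_ge0].
apply: leeD.
  apply: le_trans (translation_x LR LxR wxRe mS hS te); rewrite le_eqVlt; apply/orP; left; apply/eqP.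
  by apply: II_ext => p; rewrite ReB.
apply: le_trans (translation_x LI LxI wxIm mS hS te); rewrite le_eqVlt; apply/orP; left; apply/eqP.
by apply: II_ext => p; rewrite ImB.
Qed.

Lemma translation_cy (S : set (pl R)) e t : measurable S -> margin O S (2 * e) -> `|t| <= e ->
  (II (fun p => (\1_S p * cmod (h (tr (0, t) p) - h p) ^+ 2)%R) <= (2 * t ^+ 2)%:E * II (fun p => (cmod (hy p) ^+ 2)%R))%E.
Proof.
move=> mS hS te; have [LR LI] := L2_ReIm mh Lh; have [LxR LxI] := L2_ReIm mhy Lhy.
have md : cmeas (fun p => h (tr (0, t) p) - h p) by apply: cmeasD; [exact: cmeas_tr|exact: cmeasN].
rewrite (II_cmod mS md).
have -> : II (fun p => (cmod (hy p) ^+ 2)%R) = (II (fun p => (complex.Re (hy p) ^+ 2)%R) + II (fun p => (complex.Im (hy p) ^+ 2)%R))%E.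
  have [m1 m2] := mhy.
  by rewrite -IID; [apply: II_ext => p; rewrite sqr_cmod|meas|meas|move=> p; exact: sqr_ge0|move=> p; exact: sqr_ge0].
rewrite ge0_muleDr; [|by apply: II_ge0 => p; exact: sqr_ge0|by apply: II_ge0 => p; exact: sqr_ge0].
apply: leeD.
  apply: le_trans (translation_y LR LxR wyRe mS hS te); rewrite le_eqVlt; apply/orP; left; apply/eqP.
  by apply: II_ext => p; rewrite ReB.
apply: le_trans (translation_y LI LxI wyIm mS hS te); rewrite le_eqVlt; apply/orP; left; apply/eqP.
by apply: II_ext => p; rewrite ImB.
Qed.

Lemma cmod_sqr_split (a b c : C R) : cmod (a - b) ^+ 2 <= 2 * cmod (a - c) ^+ 2 + 2 * cmod (c - b) ^+ 2.
Proof.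
have t := cmod_triangle a b c; have := cmod_ge0 (a - b); move: t.
move: (cmod (a - b)) (cmod (a - c)) (cmod (c - b)) => x y z t x0.
have : 0 <= (y - z) ^+ 2 by exact: sqr_ge0.
nra.
Qed.

(** A horizontal step is followed by a vertical one that starts in the translated set [S']; the
    translation costs one more [e] of margin. *)
Lemma translation_xy (S : set (pl R)) e (z : R * R) : measurable S -> margin O S (3 * e) -> nz z <= e ->
  (II (fun p => (\1_S p * cmod (h (tr z p) - h p) ^+ 2)%R) <= (4 * nz z ^+ 2)%:E * D)%E.
Proof.
case: z => x y mS hS ze.
have x1 : `|x| <= e by apply: le_trans ze; exact: (Re_le_cmod (toC (x, y))).
have y1 : `|y| <= e by apply: le_trans ze; exact: (Im_le_cmod (toC (x, y))).
have e0 : 0 <= e by exact: le_trans x1.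
have trE p : tr (x, y) p = tr (0, y) (tr (x, 0) p) by rewrite /tr /= !addr0.
have hS2 : margin O S (2 * e) by move=> p Sp q h1 h2; apply: (hS p Sp); lra.
pose S' : set (pl R) := tr (- x, 0) @^-1` S.
have mS' : measurable S' by rewrite -[X in measurable X]setTI; exact: measurable_tr.
have hS' : margin O S' (2 * e).
  move=> p Sp q h1 h2; apply: (hS _ Sp); rewrite /tr /=; last first.
    rewrite addr0; lra.
  rewrite (_ : q.1 - (p.1 - x) = (q.1 - p.1) + x); last by ring.
  apply: (le_trans (ler_normD _ _)); lra.
have mi := measurable_indic (R := R) (D := setT) mS.
have mi' := measurable_indic (R := R) (D := setT) mS'.
have md1 : measurable_fun setT (fun p => cmod (h (tr (x, 0) p) - h p)).
  by apply: measurable_cmod; apply: cmeasD; [exact: cmeas_tr|exact: cmeasN].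
have md2 : measurable_fun setT (fun p => cmod (h (tr (0, y) p) - h p)).
  by apply: measurable_cmod; apply: cmeasD; [exact: cmeas_tr|exact: cmeasN].
have md2' := measurableT_comp md2 (measurable_tr (x, 0)).
have md3 : measurable_fun setT (fun p => cmod (h (tr (x, y) p) - h p)).
  by apply: measurable_cmod; apply: cmeasD; [exact: cmeas_tr|exact: cmeasN].
have I0 (T : set (pl R)) p (c : R) : 0 <= \1_T p * c ^+ 2 by rewrite mulr_ge0// ?sqr_ge0// indicE.
have m1 : measurable_fun setT (fun p => \1_S p * cmod (h (tr (x, 0) p) - h p) ^+ 2) by meas.
have m2 : measurable_fun setT (fun p => \1_S' p * cmod (h (tr (0, y) p) - h p) ^+ 2) by meas.
have m2' := measurableT_comp m2 (measurable_tr (x, 0)).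
apply: (@le_trans _ _ (2%:E * II (fun p => \1_S p * cmod (h (tr (x, 0) p) - h p) ^+ 2)%R +
    2%:E * II (fun p => \1_S' p * cmod (h (tr (0, y) p) - h p) ^+ 2)%R)%E).
  rewrite -(II_tr (x, 0) m2); last by move=> p; exact: I0.
  rewrite -(IIZ (k := 2) m1 (fun p => I0 S p _))//.
  rewrite -(IIZ (k := 2) m2' (fun p => I0 S' _ _))//.
  rewrite -IID; [|exact: measurable_funM|exact: measurable_funM|by move=> p; rewrite mulr_ge0// I0|by move=> p; rewrite mulr_ge0// I0].
  apply: II_le; [by meas|by apply: measurable_funD; exact: measurable_funM|by move=> p; exact: I0|].
  move=> p /=; have -> : \1_S' (tr (x, 0) p) = \1_S p :> R.
    have E : tr (- x, 0) (tr (x, 0) p) = p by case: p => u v; rewrite /tr /= !addr0 addrK.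
    by rewrite !indicE -[in RHS]E.
  rewrite trE !(mulrCA 2 (\1_S p)) -mulrDr.
  apply: ler_wpM2l; first by rewrite indicE.
  rewrite [leRHS]addrC; exact: cmod_sqr_split.
have xz : x ^+ 2 + y ^+ 2 = nz (x, y) ^+ 2 by rewrite sqr_cmod.
have Dx0 : (0 <= II (fun p => (cmod (hx p) ^+ 2)%R))%E by apply: II_ge0 => p; exact: sqr_ge0.
have Dy0 : (0 <= II (fun p => (cmod (hy p) ^+ 2)%R))%E by apply: II_ge0 => p; exact: sqr_ge0.
rewrite /D (ge0_muleDr _ Dx0 Dy0); apply: leeD.
  apply: (@le_trans _ _ (2%:E * ((2 * x ^+ 2)%:E * II (fun p => (cmod (hx p) ^+ 2)%R)))%E).
    by apply: lee_wpmul2l => //; exact: translation_cx x1.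
  rewrite muleA; apply: lee_wpmul2r => //; rewrite -EFinM lee_fin -xz; have := sqr_ge0 y; lra.
apply: (@le_trans _ _ (2%:E * ((2 * y ^+ 2)%:E * II (fun p => (cmod (hy p) ^+ 2)%R)))%E).
  by apply: lee_wpmul2l => //; exact: translation_cy y1.
rewrite muleA; apply: lee_wpmul2r => //; rewrite -EFinM lee_fin -xz; have := sqr_ge0 x; lra.
Qed.


Let kern (n : nat) (S : set (pl R)) (q : pl R * pl R) : R :=
  \1_S q.1 * (Gn n q.2 ^+ 2 * (cmod (h (tr q.2 q.1) - h q.1) / nz q.2) ^+ 2).

Let kern_ge0 n S q : 0 <= kern n S q.
Proof. by rewrite /kern mulr_ge0// ?indicE//; apply: mulr_ge0; exact: sqr_ge0. Qed.

Let measurable_kern n (S : set (pl R)) : measurable S -> measurable_fun setT (kern n S).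
Proof.
move=> mS; have [hR hI] := mh.
have mt : measurable_fun setT (fun q : pl R * pl R => tr q.2 q.1 : pl R).
  have m1 : measurable_fun setT (fun q : pl R * pl R => q.1) by exact: measurable_fst.
  have m2 : measurable_fun setT (fun q : pl R * pl R => q.2) by exact: measurable_snd.
  apply: measurable_fun_pair; apply: measurable_funD.
  - by apply: measurableT_comp m1; exact: measurable_fst.
  - by apply: measurableT_comp m2; exact: measurable_fst.
  - by apply: measurableT_comp m1; exact: measurable_snd.
  - by apply: measurableT_comp m2; exact: measurable_snd.
have a1 := measurableT_comp (measurable_indic (R := R) (D := setT) mS) (@measurable_fst _ _ (pl R) (pl R)).
have a2 := measurableT_comp (measurable_Gn (R := R) n) (@measurable_snd _ _ (pl R) (pl R)).
have mzi : measurable_fun setT (fun p : pl R => (nz p)^-1).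
  by apply: measurable_inv => [|p]; [exact: measurable_nz|exact: cmod_ge0].
have a3 := measurableT_comp mzi (@measurable_snd _ _ (pl R) (pl R)).
have b1 := measurableT_comp hR mt.
have b2 := measurableT_comp hI mt.
have b3 := measurableT_comp hR (@measurable_fst _ _ (pl R) (pl R)).
have b4 := measurableT_comp hI (@measurable_fst _ _ (pl R) (pl R)).
rewrite (_ : kern n S = fun q : pl R * pl R => \1_S q.1 * (Gn n q.2 ^+ 2 *
  (((complex.Re (h (tr q.2 q.1)) - complex.Re (h q.1)) ^+ 2 + (complex.Im (h (tr q.2 q.1)) - complex.Im (h q.1)) ^+ 2)
   * (nz q.2)^-1 ^+ 2))); last first.
  by apply/funext => q; rewrite /kern (exprMn _ _ (_^-1)) sqr_cmod ReB ImB.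
by meas.
Qed.

(** For a fixed displacement [b], the factor [|b|^2] of [translation_xy] cancels the [1 / |b|^2] of
    the kernel. *)
Lemma kern_int n (S : set (pl R)) e (b : pl R) : (0 < n)%N -> measurable S -> margin O S (3 * e) -> 2 * hl n <= e ->
  (II (fun a => kern n S (a, b)) <= (4 * Gn n b ^+ 2)%:E * D)%E.
Proof.
move=> n0 mS hS ne.
have D0 : (0 <= D)%E by apply: adde_ge0; apply: II_ge0 => p; exact: sqr_ge0.
have [z|z] := eqVneq (Gn n b) 0.
  rewrite (II_ext (g := fun=> 0)); last by move=> a; rewrite /kern /= z (expr2 0) !mul0r mulr0.
  by rewrite /II integral0 mule_ge0// lee_fin mulr_ge0// sqr_ge0.
have {z} : nz b \in `[hl (n + n) / 2, 2 * hl n].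
  by apply/negP => /negP h0; move/eqP: z; apply; rewrite /Gn indicE memNset ?mul0r//; exact/negP.
rewrite in_itv /= => /andP[z1 z2].
have z0 : 0 < nz b by apply: lt_le_trans z1; rewrite divr_gt0// hl_gt0.
have md : measurable_fun setT (fun a => cmod (h (tr b a) - h a)).
  by apply: measurable_cmod; apply: cmeasD; [exact: cmeas_tr|exact: cmeasN].
have mi := measurable_indic (R := R) (D := setT) mS.
have m1 : measurable_fun setT (fun a => \1_S a * cmod (h (tr b a) - h a) ^+ 2) by meas.
rewrite (II_ext (g := fun a => (Gn n b ^+ 2 / nz b ^+ 2) * (\1_S a * cmod (h (tr b a) - h a) ^+ 2))); last first.
  by move=> a; rewrite /kern /= (exprMn _ _ (_^-1)) exprVn; ring.
have c0 : 0 <= Gn n b ^+ 2 / nz b ^+ 2 by rewrite divr_ge0// sqr_ge0.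
rewrite (IIZ m1)//; last by move=> a; rewrite mulr_ge0 ?sqr_ge0// indicE.
apply: (le_trans (lee_wpmul2l _ (translation_xy mS hS (le_trans z2 ne)))); first by rewrite lee_fin.
rewrite muleA -EFinM (_ : Gn n b ^+ 2 / nz b ^+ 2 * (4 * nz b ^+ 2) = 4 * Gn n b ^+ 2)//.
by field; rewrite gt_eqF.
Qed.

(** By Tonelli's theorem the energy integrated over the centres is at most a multiple of [1 / n].
    Convergence in L1 yields, at almost every centre, arbitrarily large [n] with small energy, and
    this is all that removing the singularity asks for. *)
Lemma ae_small_cutoff_energy (S : set (pl R)) e : measurable S -> 0 < e -> margin O S (3 * e) ->
  {ae leb2 R, forall a, S a -> forall d N, 0 < d -> exists2 n, (N < n)%N &
    (II (fun p => (Gn n p ^+ 2 * (cmod (h (tr a p) - h a) / nz p) ^+ 2)%R) <= d%:E)%E}.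
Proof.
move=> mS e0 hS.
have D0 : (0 <= D)%E by apply: adde_ge0; apply: II_ge0 => p; exact: sqr_ge0.
have Dfin : (D < +oo)%E by have [_ ?] := Lhx; have [_ ?] := Lhy; apply: lte_add_pinfty.
pose Phi n (a : pl R) := (\int[leb2 R]_b (kern n S (a, b))%:E)%E.
have mk n : measurable_fun setT (EFin \o kern n S) by apply/measurable_EFinP; exact: measurable_kern.
have mPhi n : measurable_fun setT (Phi n).
  by apply: (measurable_leb2_fubini (f := EFin \o kern n S)) => // q; rewrite lee_fin.
have Phi0 n a : (0 <= Phi n a)%E by apply: integral_ge0 => b _; rewrite lee_fin.
have PhiI n : (0 < n)%N -> 2 * hl n <= e -> (\int[leb2 R]_a Phi n a <= (4 * (1024 / n%:R))%:E * D)%E.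
  move=> n0 ne; rewrite (leb2_fubini_tonelli (f := EFin \o kern n S)) => [|//|q]; last by rewrite lee_fin.
  have mG : measurable_fun setT (fun b : pl R => Gn n b ^+ 2) by have := measurable_Gn (R := R) n => m; meas.
  have mG' : measurable_fun setT (fun b : pl R => (4 * Gn n b ^+ 2)%:E).
    by apply/measurable_EFinP; apply: measurable_funM.
  apply: (@le_trans _ _ (\int[leb2 R]_b ((4 * Gn n b ^+ 2)%:E * D))%E).
    apply: ge0_le_integral => //.
    - by move=> b _; apply: integral_ge0 => a _; rewrite lee_fin.
    - have mk' : measurable_fun setT (fun q : pl R * pl R => (kern n S (q.2, q.1))%:E).
        apply: (measurableT_comp (mk n)); apply: measurable_fun_pair; [exact: measurable_snd|exact: measurable_fst].
      by apply: (measurable_leb2_fubini mk') => q; rewrite lee_fin.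
    - by apply: emeasurable_funM => //; exact: measurable_cst.
    - by move=> b _; exact: (kern_int b n0 mS hS ne).
  have -> : D = (fine D)%:E by rewrite fineK// ge0_fin_numE.
  rewrite ge0_integralZr//; [|by move=> b _; rewrite lee_fin mulr_ge0// sqr_ge0|by rewrite lee_fin fine_ge0].
  apply: lee_wpmul2r; first by rewrite lee_fin fine_ge0.
  have := IIZ (k := 4) mG (fun b => sqr_ge0 _); rewrite /II => -> //.
  rewrite EFinM; apply: lee_wpmul2l => //; exact: II_Gn.
(* The centres whose energy stays at least [1 / (k + 1)] for every [n > N]; Chebyshev's inequality
   bounds the measure by a multiple of [1 / n] for all large [n], hence by 0. *)
pose A (k N : nat) : set (pl R) := S `&` \bigcap_(n in [set n | (N < n)%N]) [set a | (k.+1%:R^-1%:E <= Phi n a)%E].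
have mA k N : measurable (A k N).
  apply: measurableI => //; apply: bigcap_measurable => // [|n _]; first by exists N.+1 => /=.
  rewrite -[X in measurable X]setTI; exact: emeasurable_fun_c_infty.
have A0 k N : leb2 R (A k N) = 0%E.
  have k0 : 0 < k.+1%:R^-1 :> R by rewrite invr_gt0.
  have le n : (maxn N 0 < n)%N -> 2 * hl n <= e -> (k.+1%:R^-1%:E * leb2 R (A k N) <= (4 * (1024 / n%:R))%:E * D)%E.
    rewrite maxn0 => Nn ne; apply: le_trans (PhiI n (leq_ltn_trans _ Nn) ne) => //.
    have mi := measurable_indic (R := R) (D := setT) (mA k N).
    have -> : leb2 R (A k N) = II (fun a => (\1_(A k N) a)%R) by rewrite /II integral_indic// setIT.
    rewrite -(IIZ mi _ (ltW k0)); last by move=> a; rewrite indicE.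
    apply: ge0_le_integral => //.
    - by apply/measurable_EFinP; apply: measurable_funM.
    - move=> a _; rewrite indicE; case: (boolP (a \in A k N)) => [/set_mem [_ h1]|_].
        by rewrite mulr1; exact: h1.
      by rewrite mulr0.
  apply/eqP; rewrite eq_le measure_ge0 andbT.
  rewrite -(@lee_pmul2l _ k.+1%:R^-1%:E)// mule0.
  apply/lee_addgt0Pr => d d0; rewrite add0e.
  have e2 : 0 < e / 2 by lra.
  have [n1 hn1] := hl_small e2.
  pose x := 4 * 1024 * fine D / d.
  pose n := (maxn (maxn N 0) (maxn n1 (Num.trunc x))).+1.
  have h1 : (maxn N 0 < n)%N by rewrite ltnS leq_maxl.
  have h2 : 2 * hl n <= e.
    have : hl n <= hl n1 :> R.
      by apply: hl_le; apply: leqW; apply: leq_trans (leq_maxr _ _); exact: leq_maxl.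
    lra.
  have h3 : x <= n%:R.
    apply: ltW; apply: lt_le_trans (truncnS_gt x) _; rewrite ler_nat ltnS.
    by apply: leq_trans (leq_maxr _ _); exact: leq_maxr.
  apply: (le_trans (le n h1 h2)).
  have -> : D = (fine D)%:E by rewrite fineK// ge0_fin_numE.
  have n0 : 0 < n%:R :> R by rewrite ltr0n.
  rewrite -EFinM lee_fin mulrA mulrAC ler_pdivrMr//.
  by move: h3; rewrite /x ler_pdivrMr// [d * _]mulrC.
have all : {ae leb2 R, forall a, forall k N, ~ A k N a}.
  apply/ae_foralln => k; apply/ae_foralln => N; exists (A k N); split=> // a /=.
  by move=> /contrapT.
apply: (ae_mono all) => a nA Sa d N d0.
have [k hk] : exists k : nat, k.+1%:R^-1 <= d.
  exists (Num.trunc d^-1); rewrite -[leRHS]invrK lef_pV2 ?posrE ?invr_gt0//; exact: ltW (truncnS_gt _).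
have /not_andP[//|] := nA k N; rewrite -existsNP => -[n]; rewrite not_implyE => -[Nn /negP].
rewrite -ltNge => hn; exists n => //; apply: le_trans (le_trans (ltW hn) _); last by rewrite lee_fin.
rewrite /Phi le_eqVlt; apply/orP; left; apply/eqP; apply: II_ext => b.
rewrite /kern /= indicE mem_set// mul1r; congr (_ * (cmod (h _ - _) / _) ^+ 2).
by rewrite /tr /= ![b.1 + _]addrC ![b.2 + _]addrC.
Qed.

End Sobolev2.

(** * The growth estimate at almost every point *)

Section StructureField.
Context {R : realType}.
Variables (Omega : set (C R)) (Hf : C R -> C R -> C R) (rad L M al : R).
Hypotheses (rad0 : 0 <= rad) (L0 : 0 <= L) (M0 : 0 <= M) (al0 : 0 < al).
Hypothesis Hb : forall z xi, Omega z -> rad < cmod xi -> cmod (Hf z xi) <= M.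
Hypothesis Hh : forall z1 z2 xi, Omega z1 -> Omega z2 -> rad < cmod xi ->
  cmod (Hf z1 xi - Hf z2 xi) <= M * cmod (z1 - z2) `^ al.
Hypothesis Hl : forall z w1 w2, Omega z -> rad < cmod w1 -> rad < cmod w2 ->
  cmod (Hf z w1 - Hf z w2) <= L * cmod (w1^-1 - w2^-1).

(* [Kz z] extends [Hf z] from [|w| >= 2 Lam0] to the whole plane; the ramp and the size of
   [Lam0] make it 1/100-Lipschitz. *)
Definition Lam0 : R := rad + 200 * (M + L + 1).
Definition ramp (x : R) : R := minr 1 (maxr 0 ((x - Lam0) / Lam0)).
Definition Kz (z w : C R) : C R := ((ramp (cmod w))%:C)%C * Hf z w.

Lemma Lam0_bounds : [/\ rad < Lam0, 200 * M <= Lam0, 200 * L <= Lam0 & 200 <= Lam0].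
Proof. have a := rad0; have b := L0; have c := M0; rewrite /Lam0; split; lra. Qed.

Lemma ramp_bounds x : 0 <= ramp x <= 1.
Proof. by rewrite /ramp le_min ge_min lexx /= ler01 le_max lexx. Qed.

Lemma ramp_eq0 x : x <= Lam0 -> ramp x = 0.
Proof.
have [_ _ _ h] := Lam0_bounds => xl; rewrite /ramp max_l ?min_r//.
have l0 : 0 < Lam0 by lra.
by rewrite ler_pdivrMr// mul0r subr_le0.
Qed.

Lemma ramp_eq1 x : 2 * Lam0 <= x -> ramp x = 1.
Proof.
have [_ _ _ h] := Lam0_bounds => xl; have l0 : 0 < Lam0 by lra.
have h1 : 1 <= (x - Lam0) / Lam0 by rewrite ler_pdivlMr// mul1r; lra.
by rewrite /ramp max_r ?min_l//; apply: le_trans h1.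
Qed.

Lemma ramp_lip x y : `|ramp x - ramp y| <= `|x - y| / Lam0.
Proof.
have [_ _ _ h] := Lam0_bounds; have l0 : 0 < Lam0 by lra.
apply: (le_trans (min1_lip _ _)); rewrite ![maxr 0 _]maxC; apply: (le_trans (max_lip _ _ _)).
by rewrite -mulrBl normrM [`|_^-1|]gtr0_norm ?invr_gt0//; rewrite opprB addrA subrK.
Qed.

Lemma cmod_invB (a b : C R) : 0 < cmod a -> 0 < cmod b ->
  cmod (a^-1 - b^-1) = cmod (a - b) / (cmod a * cmod b).
Proof.
rewrite !cmod_gt0 => a0 b0.
have -> : a^-1 - b^-1 = (b - a) * (a^-1 * b^-1) by field; rewrite a0 b0.
by rewrite !cmodM !cmodV invfM cmod_dist.
Qed.

Lemma Hl_div z w1 w2 c : Omega z -> 0 < c -> rad < cmod w1 -> rad < cmod w2 -> c * L <= cmod w1 * cmod w2 ->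
  cmod (Hf z w1 - Hf z w2) <= cmod (w1 - w2) / c.
Proof.
move=> Oz c0 r1 r2 hc; have a := rad0.
have w10 : 0 < cmod w1 by exact: le_lt_trans r1.
have w20 : 0 < cmod w2 by exact: le_lt_trans r2.
apply: (le_trans (Hl Oz r1 r2)); rewrite cmod_invB//.
have ww : 0 < cmod w1 * cmod w2 by exact: mulr_gt0.
rewrite mulrA ler_pdivrMr// mulrAC ler_pdivlMr//.
by rewrite [L * _]mulrC -mulrA [L * c]mulrC; apply: ler_wpM2l => //; exact: cmod_ge0.
Qed.

Lemma K_bound z w : Omega z -> cmod (Kz z w) <= M.
Proof.
move=> Oz; rewrite /Kz cmodM cmod_real; have /andP[r0 r1] := ramp_bounds (cmod w).
rewrite ger0_norm//; have [h|h] := leP (cmod w) Lam0; first by rewrite ramp_eq0// mul0r.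
have [h1 _ _ _] := Lam0_bounds.
have hb := Hb Oz (lt_trans h1 h).
by apply: le_trans hb; rewrite ler_piMl ?cmod_ge0.
Qed.

Lemma K_big z w : 2 * Lam0 <= cmod w -> Kz z w = Hf z w.
Proof. by move=> h; rewrite /Kz ramp_eq1// mul1r. Qed.

(** The constant is split in halves: the ramp costs at most 1/200 because [Lam0 >= 200 * M], and so
    does the field, because [|w| |w'| >= 200 * L] beyond [Lam0]. *)
Lemma K_lip z w w' : Omega z -> cmod (Kz z w - Kz z w') <= cmod (w - w') / 100.
Proof.
move=> Oz; have [lr lM lL l200] := Lam0_bounds; have l0 : 0 < Lam0 by lra.
have dw : `|cmod w - cmod w'| <= cmod (w - w').
  have := cmod_triangle w 0 w'; have := cmod_triangle w' 0 w.
  by rewrite !subr0 (cmod_dist w' w) ler_norml; lra.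
wlog ww : w w' dw / cmod w <= cmod w'.
  move=> h; have [|/ltW] := leP (cmod w) (cmod w'); first exact: h.
  by rewrite cmod_dist (cmod_dist w); apply: h; rewrite distrC (cmod_dist w').
have rl : `|ramp (cmod w) - ramp (cmod w')| * M <= cmod (w - w') / 200.
  apply: (@le_trans _ _ (cmod (w - w') / Lam0 * M)).
    apply: ler_wpM2r => //; apply: (le_trans (ramp_lip _ _)).
    by rewrite ler_wpM2r// invr_ge0 ltW.
  rewrite -mulrA; apply: ler_wpM2l; first exact: cmod_ge0.
  by rewrite mulrC ler_pdivrMr// mulrC ler_pdivlMr// mulrC.
have d0 := cmod_ge0 (w - w').
have [h|h] := leP (cmod w) Lam0.
  have [h'|h'] := leP (cmod w') Lam0.
    by rewrite /Kz !ramp_eq0// !mul0r subrr cmod0 divr_ge0.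
  rewrite {1}/Kz ramp_eq0// mul0r sub0r cmodN /Kz cmodM cmod_real.
  move: rl; rewrite (ramp_eq0 h) sub0r normrN => rl.
  apply: (@le_trans _ _ (cmod (w - w') / 200)); last by lra.
  by apply: le_trans rl; apply: ler_wpM2l => //; apply: Hb => //; exact: lt_trans h'.
have h' : Lam0 < cmod w' by exact: lt_le_trans ww.
have -> : Kz z w - Kz z w' = ((ramp (cmod w) - ramp (cmod w'))%:C)%C * Hf z w +
    ((ramp (cmod w'))%:C)%C * (Hf z w - Hf z w').
  by rewrite /Kz rmorphB /=; ring.
apply: (le_trans (cmodD _ _)); rewrite !cmodM !cmod_real.
have a1 : `|ramp (cmod w) - ramp (cmod w')| * cmod (Hf z w) <= cmod (w - w') / 200.
  by apply: le_trans rl; apply: ler_wpM2l => //; apply: Hb => //; exact: lt_trans h.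
have a2 : `|ramp (cmod w')| * cmod (Hf z w - Hf z w') <= cmod (w - w') / 200.
  have /andP[r0 r1] := ramp_bounds (cmod w'); rewrite ger0_norm//.
  apply: (@le_trans _ _ (cmod (Hf z w - Hf z w'))); first by rewrite ler_piMl ?cmod_ge0.
  apply: Hl_div => //; [exact: lt_trans h|exact: lt_trans h'|].
  apply: (le_trans lL); rewrite -[leLHS]mulr1; apply: ler_pM; lra.
lra.
Qed.

(** [A] and [B] are the two derivatives of [h] at [z']. For large [A] the Lipschitz condition gives
    the factor 1/2 and the Hoelder condition the error. For [|A| <= Lam0] the distance from [A] to
    [w] is so large that half of it exceeds [N + M]; this dictates the lower bound on [s]. *)
Lemma field_deviation z z' A B w N s : Omega z -> Omega z' -> (rad < cmod A -> B = Hf z' A) -> cmod B <= N ->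
  2 * N + 2 * M + 2 * Lam0 <= s -> s <= cmod w ->
  cmod (B - Kz z w) <= cmod (A - w) / 2 + M * cmod (z' - z) `^ al.
Proof.
move=> Oz Oz' hB BN hs sw; have [lr lM lL l200] := Lam0_bounds; have M0' := M0.
have N0' : 0 <= N by apply: le_trans BN; exact: cmod_ge0.
have wl : 2 * Lam0 <= cmod w by lra.
have p0 : 0 <= M * cmod (z' - z) `^ al by rewrite mulr_ge0// powR_ge0.
have [h|h] := ltP Lam0 (cmod A); last first.
  have h1 := cmodB B (Kz z w); have h2 := K_bound w Oz.
  have h3 := cmod_triangle w 0 A; rewrite !subr0 cmod_dist in h3.
  lra.
have rA : rad < cmod A by exact: lt_trans h.
rewrite (hB rA) (K_big _ wl).
apply: (le_trans (cmod_triangle _ _ (Hf z A))); rewrite addrC; apply: lerD; last exact: Hh.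
apply: Hl_div => //; first by lra.
apply: (@le_trans _ _ Lam0); first by have := L0; lra.
rewrite -[leLHS]mulr1; apply: ler_pM; lra.
Qed.

End StructureField.

(** * Choice of the level and the estimate about almost every centre *)

Section Key.
Context {R : realType}.
Local Notation nz p := (cmod (toC p)).
Local Notation i := (imunit R).
Variables (Omega : set (C R)) (Hf : C R -> C R -> C R) (rad L M al N : R).
Hypotheses (rad0 : 0 <= rad) (L0 : 0 <= L) (M0 : 0 <= M) (al0 : 0 < al) (al1 : al < 1) (N0 : 0 <= N).
Hypothesis Hb : forall z xi, Omega z -> rad < cmod xi -> cmod (Hf z xi) <= M.
Hypothesis Hh : forall z1 z2 xi, Omega z1 -> Omega z2 -> rad < cmod xi ->
  cmod (Hf z1 xi - Hf z2 xi) <= M * cmod (z1 - z2) `^ al.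
Hypothesis Hl : forall z w1 w2, Omega z -> rad < cmod w1 -> rad < cmod w2 ->
  cmod (Hf z w1 - Hf z w2) <= L * cmod (w1^-1 - w2^-1).
Local Notation O := (@toC R @^-1` Omega).
Hypothesis openO : forall p, O p -> exists2 e : R, 0 < e &
  forall q : R * R, `|q.1 - p.1| <= e -> `|q.2 - p.2| <= e -> O q.
Variables (h hx hy : pl R -> C R).
Hypotheses (mh : cmeas h) (mhx : cmeas hx) (mhy : cmeas hy).
Hypotheses (Lh : L2 (fun p => cmod (h p))) (Lhx : L2 (fun p => cmod (hx p))) (Lhy : L2 (fun p => cmod (hy p))).
Hypothesis wxRe : weak_x (fun p => complex.Re (h p)) (fun p => complex.Re (hx p)) O.
Hypothesis wxIm : weak_x (fun p => complex.Im (h p)) (fun p => complex.Im (hx p)) O.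
Hypothesis wyRe : weak_y (fun p => complex.Re (h p)) (fun p => complex.Re (hy p)) O.
Hypothesis wyIm : weak_y (fun p => complex.Im (h p)) (fun p => complex.Im (hy p)) O.
Hypothesis eqn : {ae leb2 R, forall p : pl R, O p -> rad < cmod (2^-1 * (hx p - i * hy p)) ->
  2^-1 * (hx p + i * hy p) = Hf (toC p) (2^-1 * (hx p - i * hy p))}.
Hypothesis zbarN : {ae leb2 R, forall p : pl R, O p -> cmod (2^-1 * (hx p + i * hy p)) <= N}.

(** The rate of [growth_estimate] at the level required by [field_deviation] and by the outer ring;
    the 1 leaves room for a ring between [r'] and [r]. *)
Definition Lam (x : R) : R := 3 / 2 * (x + 2 * N + 2 * M + 2 * Lam0 rad L M + 1 + C0 M al) + M.

(** An exhaustion of the open set by sets with uniform margins, as integrals of translates demand.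
    The strict inequality makes each of them open, hence measurable. *)
Definition core (k : nat) : set (pl R) := [set p | exists2 e : R, 3 * hl k < e &
  forall q : R * R, `|q.1 - p.1| <= e -> `|q.2 - p.2| <= e -> O q].

Lemma margin_core k : margin O (core k) (3 * hl k).
Proof. by move=> p [e h1 h2] q a b; apply: h2; apply: le_trans (ltW h1). Qed.

Lemma measurable_core k : measurable (core k).
Proof.
apply: measurable_sup_open => p [e h1 h2]; exists ((e - 3 * hl k) / 2); first by lra.
move=> q q1 q2; exists ((e + 3 * hl k) / 2); first by lra.
move=> x x1 x2; apply: h2.
  have -> : x.1 - p.1 = (x.1 - q.1) + (q.1 - p.1) by ring.
  by apply: (le_trans (ler_normD _ _)); lra.
have -> : x.2 - p.2 = (x.2 - q.2) + (q.2 - p.2) by ring.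
by apply: (le_trans (ler_normD _ _)); lra.
Qed.

Lemma core_exhaust p : O p -> exists k, core k p.
Proof.
move=> /openO[e e0 he]; have e4 : 0 < e / 4 by lra.
have [k hk] := hl_small e4; exists k; exists e => //; lra.
Qed.

Lemma trC (a b : R * R) : tr a b = tr b a.
Proof. by rewrite /tr [b.1 + _]addrC [b.2 + _]addrC. Qed.

Lemma trA (a b p : R * R) : tr a (tr b p) = tr b (tr a p).
Proof. by rewrite /tr /= [p.1 + _ + _]addrAC [p.2 + _ + _]addrAC. Qed.

Lemma toC_trD (a p : R * R) : toC (tr a p) = toC a + toC p :> C R.
Proof. by rewrite trC. Qed.

Lemma nz_le_coord (p : R * R) e : `|p.1| <= e -> `|p.2| <= e -> nz p <= 2 * e.
Proof. by move=> a b; have := cmod_le_ReIm (toC p); rewrite /=; lra. Qed.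

(** The exceptional centres come from the cut-off energies alone, a countable family over the cores;
    [r] and [Osc] can therefore be chosen afterwards, depending on the centre. *)
Lemma key_estimate : {ae leb2 R, forall a : pl R, O a -> forall r Osc : R, 0 < r -> r <= 1 ->
  (forall p : pl R, nz p < r -> O (tr a p)) -> 0 <= Osc ->
  (forall p : pl R, nz p < r -> cmod (h (tr a p) - h a) <= Osc) ->
  {ae leb2 R, forall p : pl R, 0 < nz p -> nz p < r -> cmod (h (tr a p) - h a) <= Lam (Osc / r) * nz p}}.
Proof.
have cutk := ae_foralln (fun k => ae_small_cutoff_energy mh mhx mhy Lh Lhx Lhy wxRe wxIm wyRe wyIm
  (measurable_core k) (hl_gt0 k) (@margin_core k)).
apply: (ae_mono cutk) => a hcut Oa r Osc r0 r1 hr Osc0 hO.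
have [k Sa] := core_exhaust Oa.
have cut := hcut k Sa => {hcut Sa}.
have [lr lM lL l200] := Lam0_bounds rad0 L0 M0.
have M0' := M0; have N0' := N0.
pose s := Osc / r + 2 * N + 2 * M + 2 * Lam0 rad L M + 1.
have Or0 : 0 <= Osc / r by rewrite divr_ge0// ltW.
have s0 : 0 <= s by rewrite /s; lra.
have Or : 0 < Osc + r by lra.
(* The bound [Osc / |p| <= Osc / r + 1] holds once [|p| >= Osc r / (Osc + r)]. The added [r / 2]
   keeps [r'] positive when [Osc] is 0, and still below [r]. *)
pose r' := (Osc + r / 2) * r / (Osc + r).
have r'0 : 0 < r' by rewrite /r' divr_gt0// mulr_gt0//; lra.
have r'r : r' < r by rewrite /r' ltr_pdivrMr// mulrC ltr_pM2l//; lra.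
have bd (p : pl R) : r' <= nz p -> nz p < r -> Osc / nz p + M <= s.
  move=> h1 _; have p0 : 0 < nz p by exact: lt_le_trans h1.
  suff : Osc / nz p <= Osc / r + 1 by rewrite /s; lra.
  rewrite ler_pdivrMr// (_ : Osc / r + 1 = (Osc + r) / r); last by field; rewrite gt_eqF.
  rewrite mulrAC ler_pdivlMr//.
  move: h1; rewrite /r' ler_pdivrMr// => h1.
  rewrite mulrC in h1.
  have : 0 <= r * r by exact: mulr_ge0 (ltW r0) (ltW r0).
  move: h1; nra.
pose F (p : pl R) : C R := h (tr a p) - h a.
have mF : cmeas F by apply: cmeasD; [exact: cmeas_tr|exact: cmeas_cst].
have mFx : cmeas (fun p => hx (tr a p)) by exact: cmeas_tr.
have mFy : cmeas (fun p => hy (tr a p)) by exact: cmeas_tr.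
have LFx := L2_tr a Lhx.
have LFy := L2_tr a Lhy.
have hK w w' := K_lip rad0 L0 M0 Hb Hl w w' Oa.
have KM w := K_bound rad0 L0 M0 Hb w Oa.
pose S r1 : set (pl R) := [set q | nz (tr (- a.1, - a.2) q) < r1].
have mS r2 : measurable (S r2).
  rewrite -[X in measurable X]setTI.
  exact: (measurable_tr (- a.1, - a.2) measurableT (measurable_disc r2)).
have trN p : tr (- a.1, - a.2) (tr a p) = p by rewrite /tr /= !addrK; case: p.
have trN' p : tr a (tr (- a.1, - a.2) p) = p by rewrite /tr /= !subrK; case: p.
have mg r2 : r2 < r -> margin O (S r2) ((r - r2) / 2).
  move=> h2 p Sp q q1 q2; rewrite -(trN' q); apply: hr.
  have -> : toC (tr (- a.1, - a.2) q) = toC (tr (- a.1, - a.2) p) + toC (q.1 - p.1, q.2 - p.2) :> C R.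
    by apply: complex_eq; rewrite /= /tr /=; ring.
  apply: (le_lt_trans (cmodD _ _)); have := nz_le_coord (p := (q.1 - p.1, q.2 - p.2)) q1 q2; move: Sp; rewrite /S /=; lra.
have indS r2 p : \1_(disc r2) p = \1_(S r2) (tr a p) :> R.
  by rewrite !indicE -[in LHS](trN p).
have rx r2 (t_ : nat -> R) : r2 < r -> (forall n, t_ n != 0) -> t_ @ \oo --> 0 ->
    (II (fun p => (\1_(disc r2) p * cmod (remx F (fun p => hx (tr a p)) (t_ n) p) ^+ 2)%R) @[n --> \oo] --> 0)%E.
  move=> h2 t0 tc; have e0 : 0 < (r - r2) / 2 by lra.
  apply: cvg_trans (remx_cvg mh mhx Lh Lhx wxRe wxIm (mS r2) e0 (mg _ h2) t0 tc); apply: near_eq_cvg; near=> n.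
  have mr : measurable_fun setT (fun p => \1_(S r2) p * cmod (remx h hx (t_ n) p) ^+ 2).
    apply: measurable_funM; first exact: measurable_indic.
    apply: measurable_funX; apply: measurable_cmod; apply: cmeasD; last exact: cmeasN.
    by apply: cmeasM; [apply: cmeasD; [exact: cmeas_tr|exact: cmeasN]|exact: cmeas_cst].
  rewrite -(II_tr a mr); last by move=> p; rewrite mulr_ge0 ?sqr_ge0// indicE.
  apply: II_ext => p; rewrite indS; congr (_ * cmod _ ^+ 2).
  by rewrite /remx /F opprB addrA subrK trA.
have ry r2 (t_ : nat -> R) : r2 < r -> (forall n, t_ n != 0) -> t_ @ \oo --> 0 ->
    (II (fun p => (\1_(disc r2) p * cmod (remy F (fun p => hy (tr a p)) (t_ n) p) ^+ 2)%R) @[n --> \oo] --> 0)%E.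
  move=> h2 t0 tc; have e0 : 0 < (r - r2) / 2 by lra.
  apply: cvg_trans (remy_cvg mh mhy Lh Lhy wyRe wyIm (mS r2) e0 (mg _ h2) t0 tc); apply: near_eq_cvg; near=> n.
  have mr : measurable_fun setT (fun p => \1_(S r2) p * cmod (remy h hy (t_ n) p) ^+ 2).
    apply: measurable_funM; first exact: measurable_indic.
    apply: measurable_funX; apply: measurable_cmod; apply: cmeasD; last exact: cmeasN.
    by apply: cmeasM; [apply: cmeasD; [exact: cmeas_tr|exact: cmeasN]|exact: cmeas_cst].
  rewrite -(II_tr a mr); last by move=> p; rewrite mulr_ge0 ?sqr_ge0// indicE.
  apply: II_ext => p; rewrite indS; congr (_ * cmod _ ^+ 2).
  by rewrite /remy /F opprB addrA subrK trA.
have heq : {ae leb2 R, forall p : pl R, nz p < r -> forall w, s <= cmod w ->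
    cmod (2^-1 * (hx (tr a p) + i * hy (tr a p)) - Kz Hf rad L M (toC a) w) <=
    cmod (2^-1 * (hx (tr a p) - i * hy (tr a p)) - w) / 2 + nz p * E1 M al p}.
  apply: (ae_mono2 (ae_tr a eqn) (ae_tr a zbarN)) => p h1 h2 pr w sw.
  have Op := hr p pr.
  have hs : 2 * N + 2 * M + 2 * Lam0 rad L M <= s by rewrite /s; lra.
  have := field_deviation rad0 L0 M0 Hb Hh Hl Oa Op (h1 Op) (h2 Op) hs sw.
  congr (_ <= _ + _); rewrite toC_trD addrAC subrr add0r /E1 mulrCA mulr_powRB1//.
  exact: cmod_ge0.
have cut' d m : 0 < d -> exists2 n, (m < n)%N &
    (II (fun p => (Gn n p ^+ 2 * (\1_(disc r) p * (cmod (F p) / nz p) ^+ 2))%R) <= d%:E)%E.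
  move=> d0; have [n mn hn] := cut d m d0; exists n => //.
  apply: le_trans hn; have mG := measurable_Gn (R := R) n.
  have mc := measurable_cmod mF.
  have mi := measurable_indic (R := R) (D := setT) (measurable_disc r).
  have mzi : measurable_fun setT (fun p : pl R => (nz p)^-1).
    by apply: measurable_inv => [|p]; [exact: measurable_nz|exact: cmod_ge0].
  apply: II_le; [by meas|by rewrite /F in mc; meas|by move=> p; rewrite mulr_ge0 ?sqr_ge0// mulr_ge0 ?sqr_ge0// indicE|].
  move=> p; apply: ler_wpM2l; first exact: sqr_ge0.
  by apply: ler_piMl; [exact: sqr_ge0|rewrite indicE; case: (_ \in _)].
exact: (growth_estimate M0 al0 al1 r'0 r'r r1 s0 M0 Osc0 bd mF mFx mFy LFx LFy hK KM hO rx ry heq cut').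
Unshelve. all: by end_near.
Qed.

End Key.

(** * The Lipschitz representative and its gradient *)

Section Representative.
Context {R : realType}.
Local Notation nz p := (cmod (toC p)).

Definition dst (p q : R * R) : R := cmod (toC p - toC q : C R).

Lemma dst_ge0 p q : 0 <= dst p q.
Proof. exact: cmod_ge0. Qed.

Lemma dst_sym p q : dst p q = dst q p.
Proof. exact: cmod_dist. Qed.

Lemma dst_triangle p q x : dst p q <= dst p x + dst x q.
Proof. exact: cmod_triangle. Qed.

Lemma dst0_eq p q : dst p q = 0 -> p = q.
Proof. by move=> /cmod0_eq/subr0_eq; case: p q => [a b] [c d] [-> ->]. Qed.

Lemma dstxx p : dst p p = 0.
Proof. by rewrite /dst subrr cmod0. Qed.

Lemma dst_coord (p q : R * R) e : `|p.1 - q.1| <= e -> `|p.2 - q.2| <= e -> dst p q <= 2 * e.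
Proof. by move=> a b; have := cmod_le_ReIm (toC p - toC q); rewrite -/(dst _ _) ReB ImB /=; lra. Qed.

Lemma coord_dst (p q : R * R) : `|p.1 - q.1| <= dst p q /\ `|p.2 - q.2| <= dst p q.
Proof.
by have a := Re_le_cmod (toC p - toC q); have b := Im_le_cmod (toC p - toC q); rewrite ReB in a; rewrite ImB in b.
Qed.

Lemma ae_dense (P : pl R -> Prop) (c : R * R) (e : R) : {ae leb2 R, forall p, P p} -> 0 < e ->
  exists2 q, dst q c < e & P q.
Proof.
move=> [N [mN N0 sN]] e0; apply: contrapT => /forall2NP h.
have e3 : 0 < e / 3 by lra.
pose Sq : set (pl R) := `[c.1 - e / 3, c.1 + e / 3] `*` `[c.2 - e / 3, c.2 + e / 3].
have sub : Sq `<=` N.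
  move=> q [/=]; rewrite !in_itv /= => /andP[a1 a2] /andP[b1 b2]; apply: sN => /= Pq.
  have [|//] := h q; apply.
  apply: (@le_lt_trans _ _ (2 * (e / 3))); last by lra.
  by apply: dst_coord; rewrite ler_norml; lra.
have mB : measurable Sq by apply: measurableX.
have : (leb2 R Sq <= leb2 R N)%E by apply: le_measure; rewrite ?inE.
rewrite N0 /Sq leb2_box; [|lra|lra].
rewrite lee_fin leNgt => /negP; apply; apply: mulr_gt0; lra.
Qed.

Lemma tr_sub (a q : R * R) : tr a (q.1 - a.1, q.2 - a.2) = q.
Proof. by rewrite /tr /= !subrK; case: q. Qed.

Lemma nz_sub_dst (a q : R * R) : nz (q.1 - a.1, q.2 - a.2) = dst q a.
Proof. by congr (cmod _); apply: complex_eq; rewrite ?ReB ?ImB. Qed.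

Lemma dst_tr (a p : R * R) : dst (tr a p) a = nz p.
Proof. by rewrite /dst toC_trD addrAC subrr add0r. Qed.

Variables (O : set (R * R)).

(* The centres [a] at which the growth estimate holds with rate [Lm (Osc / r)] on each disc
   of radius [r] about [a] where the oscillation from [a] is at most [Osc]. *)
Definition kgood (h : pl R -> C R) (Lm : R -> R) (a : pl R) : Prop :=
  forall r Osc : R, 0 < r -> r <= 1 -> (forall q, dst q a < r -> O q) -> 0 <= Osc ->
  (forall q, dst q a < r -> cmod (h q - h a) <= Osc) ->
  {ae leb2 R, forall q, dst q a < r -> cmod (h q - h a) <= Lm (Osc / r) * dst q a}.

Lemma kgood_of_key (h : pl R -> C R) (Lm : R -> R) (a : pl R) :
  (forall r Osc : R, 0 < r -> r <= 1 -> (forall p : pl R, nz p < r -> O (tr a p)) -> 0 <= Osc ->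
  (forall p : pl R, nz p < r -> cmod (h (tr a p) - h a) <= Osc) ->
  {ae leb2 R, forall p : pl R, 0 < nz p -> nz p < r -> cmod (h (tr a p) - h a) <= Lm (Osc / r) * nz p}) ->
  kgood h Lm a.
Proof.
move=> H r Osc r0 r1 hO O0 hB.
have K : {ae leb2 R, forall p : pl R, 0 < nz p -> nz p < r -> cmod (h (tr a p) - h a) <= Lm (Osc / r) * nz p}.
  apply: H => // p pr; [by apply: hO; rewrite dst_tr|by apply: hB; rewrite dst_tr].
have E (q : R * R) : tr (- a.1, - a.2) q = (q.1 - a.1, q.2 - a.2) by [].
apply: (ae_mono (ae_tr (- a.1, - a.2) K)) => q; rewrite E nz_sub_dst tr_sub => h1 h2.
have := dst_ge0 q a; rewrite le_eqVlt => /orP[/eqP/esym e|h3]; last exact: h1.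
by rewrite (dst0_eq e) subrr cmod0 dstxx mulr0.
Qed.

Hypothesis openO : forall p, O p -> exists2 e : R, 0 < e &
  forall q : R * R, `|q.1 - p.1| <= e -> `|q.2 - p.2| <= e -> O q.
Variables (h : pl R -> C R) (B : R) (Lm : R -> R).
Hypothesis Lm0 : forall x, 0 <= x -> 0 <= Lm x.
Hypothesis hB : forall p, cmod (h p) <= B.
Hypothesis key : {ae leb2 R, forall a, O a -> kgood h Lm a}.

Lemma ball_in p : O p -> exists r : R, [/\ 0 < r, r <= 1 & forall q, dst q p < r -> O q].
Proof.
move=> /openO[e e0 he]; exists (minr e 1); split; [by rewrite lt_min e0 ltr01|by rewrite ge_min lexx orbT|].
move=> q; rewrite lt_min => /andP[h1 _]; have [a b] := coord_dst q p.
by apply: he; [exact: le_trans a (ltW h1)|exact: le_trans b (ltW h1)].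
Qed.

Let B0 : 0 <= B.
Proof. by apply: le_trans (hB (0, 0)); exact: cmod_ge0. Qed.

(* Compare both points with a third one nearby where both growth estimates hold. *)
Lemma two_point x y r : kgood h Lm x -> kgood h Lm y -> 0 < r -> r <= 1 ->
  (forall q, dst q x < r -> O q) -> (forall q, dst q y < r -> O q) -> 3 * dst x y < r ->
  cmod (h x - h y) <= 3 * Lm (2 * B / r) * dst x y.
Proof.
move=> kx ky r0 r1 ox oy d3.
have := dst_ge0 x y; rewrite le_eqVlt => /orP[/eqP/esym e|d0].
  by rewrite (dst0_eq e) subrr cmod0 dstxx mulr0.
have hB' := hB.
have b2 p q : cmod (h p - h q) <= 2 * B.
  by apply: (le_trans (cmodB _ _)); have := hB' p; have := hB' q; lra.
have B20 : 0 <= 2 * B by rewrite mulr_ge0.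
have K0 : 0 <= Lm (2 * B / r) by apply: Lm0; rewrite divr_ge0// ltW.
have [q q1 [q2 q3]] := ae_dense x (ae_mono2 (kx r _ r0 r1 ox B20 (fun q _ => b2 q x)) (ky r _ r0 r1 oy B20 (fun q _ => b2 q y))
  (fun q a b => conj a b)) d0.
have t1 := dst_triangle q y x.
have a1 := q2 (lt_trans q1 (ltac:(lra) : dst x y < r)).
have a2 := q3 (ltac:(lra) : dst q y < r).
apply: (le_trans (cmod_triangle _ _ (h q))); rewrite (cmod_dist (h x)).
move: K0 a1 a2; set K := Lm _ => K0 a1 a2.
have : K * dst q x <= K * dst x y by apply: ler_wpM2l => //; exact: ltW.
have : K * dst q y <= K * (2 * dst x y) by apply: ler_wpM2l => //; lra.
lra.
Qed.

Lemma good_lip p : O p -> exists e K : R, [/\ 0 < e, 0 <= K, (forall q, dst q p < e -> O q) &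
  forall x y, kgood h Lm x -> kgood h Lm y -> dst x p < e -> dst y p < e -> cmod (h x - h y) <= K * dst x y].
Proof.
move=> /ball_in[r [r0 r1 hr]]; exists (r / 16), (3 * Lm (2 * B / (r / 2))).
have r2 : 0 < r / 2 by lra.
split; first by lra.
- by rewrite mulr_ge0// Lm0// divr_ge0 ?mulr_ge0// ltW.
- by move=> q hq; apply: hr; lra.
move=> x y kx ky xp yp.
have t := dst_triangle x y p; rewrite (dst_sym p y) in t.
have near z : dst z p < r / 16 -> forall q, dst q z < r / 2 -> O q.
  by move=> zp q qz; apply: hr; have := dst_triangle q p z; lra.
by apply: two_point => //; [lra|exact: near|exact: near|lra].
Qed.

(** Good centres are dense, and near [p] the values of [h] at them are Lipschitz by [good_lip];
    hence they converge along good centres [Q (p, n)] within [2^-n] of [p], and the limit defines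
    [g]. *)
Lemma approx_exists : exists g : C R -> C R, forall p, O p -> forall d e : R, 0 < d -> 0 < e ->
  exists q, [/\ O q, kgood h Lm q, dst q p < e & cmod (g (toC p) - h q) <= d].
Proof.
have [Q hQ] : {Q : (R * R) * nat -> R * R & forall x, dst (Q x) x.1 < hl x.2 /\ (O (Q x) -> kgood h Lm (Q x))}.
  apply: (@boolp.choice _ _ (fun x q => dst q x.1 < hl x.2 /\ (O q -> kgood h Lm q))) => -[p n] /=.
  by have [q q1 q2] := ae_dense p key (hl_gt0 n); exists q.
pose g (z : C R) : C R := let p := (complex.Re z, complex.Im z) in
  Complex (limn (fun n => complex.Re (h (Q (p, n))))) (limn (fun n => complex.Im (h (Q (p, n))))).
exists g => p Op d e d0 e0; have [e1 [K [e10 K0 eO eL]]] := good_lip Op.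
have m0 : 0 < minr e e1 by rewrite lt_min e0.
have [n0 hn0] := hl_small m0.
have near n : (n0 <= n)%N -> dst (Q (p, n)) p < minr e e1.
  move=> nn; have [/= q1 _] := hQ (p, n); apply: (lt_trans q1); apply: le_lt_trans hn0; exact: hl_le.
have good n : (n0 <= n)%N -> [/\ O (Q (p, n)), kgood h Lm (Q (p, n)), dst (Q (p, n)) p < e & dst (Q (p, n)) p < e1].
  move=> /near; rewrite lt_min => /andP[a b]; have [_ q2] := hQ (p, n).
  by have Oq := eO _ b; split=> //; exact: q2.
(* The second term covers the indices below [n0], where only the bound [2 B] is available and
   [2^n0 * 2^-n >= 1]. *)
pose c := 2 * K + 2 * B * 2 ^+ n0.
have c0 : 0 <= c by rewrite addr_ge0 ?mulr_ge0// exprn_ge0.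
have step n : cmod (h (Q (p, n.+1)) - h (Q (p, n))) <= c * 2^-1 ^+ n.
  have pn : 0 < 2^-1 ^+ n :> R by exact: (hl_gt0 n).
  rewrite /c mulrDl; have [nn|nn] := leqP n0 n.
    have [_ k1 _ a1] := good n nn; have [_ k2 _ a2] := good n.+1 (leqW nn).
    apply: (le_trans (eL _ _ k2 k1 a2 a1)).
    have [/= b1 _] := hQ (p, n); have [/= b2 _] := hQ (p, n.+1).
    have hs := hl_le (R := R) (leqnSn n).
    have t := dst_triangle (Q (p, n.+1)) (Q (p, n)) p; rewrite (dst_sym p) in t.
    have : K * dst (Q (p, n.+1)) (Q (p, n)) <= K * (2 * hl n) by apply: ler_wpM2l => //; lra.
    have : 0 <= 2 * B * 2 ^+ n0 * 2^-1 ^+ n by rewrite !mulr_ge0// ?exprn_ge0// ltW.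
    rewrite /hl; lra.
  have hB' := hB; apply: (le_trans (cmodB _ _)).
  have h1 := hB' (Q (p, n)); have h2 := hB' (Q (p, n.+1)).
  have : 1 <= 2 ^+ n0 * 2^-1 ^+ n :> R.
    have : hl n0 <= hl n :> R by apply: hl_le; exact: ltnW.
    have := hl_nat (R := R) n0; have : 0 < 2 ^+ n0 :> R by rewrite exprn_gt0.
    rewrite /hl; move: (2 ^+ n0) (2^-1 ^+ n0) (2^-1 ^+ n) => a b b' a0 e2 bb.
    by rewrite -e2 mulrC ler_wpM2l// ltW.
  have B0' := B0; have : 0 <= 2 * K * 2^-1 ^+ n by rewrite !mulr_ge0// ltW.
  rewrite -(mulrA (2 * B)); move: (2 ^+ n0 * _) => y; nra.
have cR : cvgn (fun n => complex.Re (h (Q (p, n)))).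
  apply: (cvg_of_geometric_diff c0) => n; apply: le_trans (step n); rewrite -ReB; exact: Re_le_cmod.
have cI : cvgn (fun n => complex.Im (h (Q (p, n)))).
  apply: (cvg_of_geometric_diff c0) => n; apply: le_trans (step n); rewrite -ImB; exact: Im_le_cmod.
have := cmod_cvg_le cR cI d0.
move=> [n1 _ hn1].
pose n := maxn n0 n1.
have [g1 g2 g3 g4] := good n (leq_maxl _ _).
exists (Q (p, n)); split=> //.
have gE : g (toC p) = Complex (limn (fun n => complex.Re (h (Q (p, n))))) (limn (fun n => complex.Im (h (Q (p, n))))).
  by rewrite /g /=; case: (p).
have cE (z : C R) : Complex (complex.Re z) (complex.Im z) = z by case: z.
by have := hn1 n (leq_maxr _ _); rewrite gE cE.
Qed.

(** At a good centre the Lipschitz bound among good centres identifies [g] with [h]; the Lipschitz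
    bound for [g] follows by moving both points to good centres nearby. *)
Lemma representative : exists g : C R -> C R, [/\ {ae leb2 R, forall p : pl R, O p -> g (toC p) = h p},
  (forall p, O p -> cmod (g (toC p)) <= B) &
  forall p, O p -> exists e K : R, [/\ 0 < e, 0 <= K, (forall q, dst q p < e -> O q) &
    forall x y, dst x p < e -> dst y p < e -> cmod (g (toC x) - g (toC y)) <= K * dst x y]].
Proof.
have [g ap] := approx_exists; exists g.
have small K d : 0 <= K -> 0 < d -> exists2 e : R, 0 < e & K * e <= d.
  move=> K0 d0; have K1 : 0 < K + 1 by lra.
  exists (d / (K + 1)); first exact: divr_gt0.
  by rewrite mulrA ler_pdivrMr// mulrC ler_pM2l//; lra.
split.
- apply: (ae_mono key) => p kp Op; have kp' := kp Op; have [e [K [e0 K0 eO eL]]] := good_lip Op.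
  apply/subr0_eq/cmod0_eq/eqP; rewrite eq_le cmod_ge0 andbT; apply/ler_addgt0Pr => d d0; rewrite add0r.
  have d2 : 0 < d / 2 by lra.
  have [e' e'0 he'] := small K _ K0 d2.
  have m0 : 0 < minr e e' by rewrite lt_min e0.
  have [q [Oq kq]] := ap p Op _ _ d2 m0; rewrite lt_min => /andP[q1 q2] q3.
  apply: (le_trans (cmod_triangle _ _ (h q))).
  have := eL q p kq kp' q1; rewrite dstxx => /(_ e0) h1.
  have : K * dst q p <= K * e' by apply: ler_wpM2l => //; exact: ltW.
  lra.
- move=> p Op; apply/ler_addgt0Pr => d d0; have [q [_ _ _ q3]] := ap p Op _ _ d0 d0.
  have := cmodD (g (toC p) - h q) (h q); rewrite subrK; have hB' := hB; have := hB' q; lra.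
move=> p Op; have [e [K [e0 K0 eO eL]]] := good_lip Op; exists (e / 2), K; split=> //; first by lra.
  by move=> q qe; apply: eO; lra.
move=> x y xe ye; apply/ler_addgt0Pr => d d0; have d4 : 0 < d / 4 by lra.
have [e' e'0 he'] := small K _ K0 d4.
have e2 : 0 < e / 2 by lra.
have m0 : 0 < minr (e / 2) e' by rewrite lt_min e2.
have Ox : O x by apply: eO; lra.
have Oy : O y by apply: eO; lra.
have [q [_ kq]] := ap x Ox _ _ d4 m0; rewrite lt_min => /andP[q1 q2] q3.
have [q' [_ kq']] := ap y Oy _ _ d4 m0; rewrite lt_min => /andP[q1' q2'] q3'.
have t1 := dst_triangle q p x; have t2 := dst_triangle q' p y.
have h1 := eL q q' kq kq' (ltac:(lra)) (ltac:(lra)).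
have t3 := dst_triangle q q' x; have t4 := dst_triangle x q' y; rewrite (dst_sym y q') in t4.
have : K * dst q q' <= K * (dst x y + 2 * e') by apply: ler_wpM2l => //; lra.
rewrite mulrDr mulrCA => h2.
have t5 := cmod_triangle (g (toC x)) (g (toC y)) (h q).
have t6 := cmod_triangle (h q) (g (toC y)) (h q'); rewrite (cmod_dist (h q') (g _)) in t6.
lra.
Qed.

End Representative.

(** * Weak derivatives bounded by the rate of growth *)

Section Gradient.
Context {R : realType}.
Local Notation nz p := (cmod (toC p)).
Implicit Types (w : pl R -> R).

Lemma savg_cvg w (t_ : nat -> R) : L2 w -> (forall n, t_ n != 0) -> t_ @ \oo --> 0 ->
  {ae leb2 R, forall p, savg (t_ n) w p @[n --> \oo] --> w p}.
Proof.
move=> Lw t0 tc; have [m1 i1] := L2_pos_part Lw; have [m2 i2] := L2_neg_part Lw.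
apply: (ae_mono2 (avg_cvg m1 (pos_part_ge0 w) i1 t0 tc) (avg_cvg m2 (neg_part_ge0 w) i2 t0 tc)) => p c1 c2.
by rewrite pos_neg_part; exact: cvgB c1 c2.
Qed.

Lemma hl_neq0 n : hl n != 0 :> R.
Proof. by rewrite gt_eqF// hl_gt0. Qed.

Lemma lim_bound (v : C R) (x y : nat -> R) (q : nat -> C R) (K : R) n0 :
  x @ \oo --> complex.Re v -> y @ \oo --> complex.Im v ->
  (forall n, (n0 <= n)%N -> [/\ complex.Re (q n) = hl n * x n, complex.Im (q n) = hl n * y n & cmod (q n) <= K * hl n]) ->
  cmod v <= K.
Proof.
move=> xc yc hq; apply/ler_addgt0Pr => d d0; have [n1 _ hn1] := cmod_cvg_le xc yc d0.
pose n := maxn n0 n1; have [h1 h2 h3] := hq n (leq_maxl _ _).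
have := hn1 n (leq_maxr _ _).
have -> : Complex (complex.Re v) (complex.Im v) = v by case: (v).
move=> h4.
have e : q n = ((hl n)%:C)%C * (Complex (x n) (y n) : C R).
  by apply: complex_eq; rewrite ?ReM ?ImM /= ?h1 ?h2 mul0r ?subr0 ?addr0.
have p0 := hl_gt0 (R := R) n.
move: h3; rewrite e cmodM cmod_real gtr0_norm// mulrC ler_pM2r// => h5.
have := cmodD (v - (Complex (x n) (y n) : C R)) (Complex (x n) (y n)); rewrite subrK; lra.
Qed.

Variables (Omega : set (C R)).
Local Notation O := (@toC R @^-1` Omega).
Hypothesis openO : forall p, O p -> exists2 e : R, 0 < e &
  forall q : R * R, `|q.1 - p.1| <= e -> `|q.2 - p.2| <= e -> O q.
Variables (g hx hy : pl R -> C R) (Lm : R -> R).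
Hypotheses (mg : cmeas g) (mhx : cmeas hx) (mhy : cmeas hy).
Hypotheses (Lg : L2 (fun p => cmod (g p))) (Lhx : L2 (fun p => cmod (hx p))) (Lhy : L2 (fun p => cmod (hy p))).
Hypothesis wxRe : weak_x (fun p => complex.Re (g p)) (fun p => complex.Re (hx p)) O.
Hypothesis wxIm : weak_x (fun p => complex.Im (g p)) (fun p => complex.Im (hx p)) O.
Hypothesis wyRe : weak_y (fun p => complex.Re (g p)) (fun p => complex.Re (hy p)) O.
Hypothesis wyIm : weak_y (fun p => complex.Im (g p)) (fun p => complex.Im (hy p)) O.
Hypothesis Lm0 : forall x, 0 <= x -> 0 <= Lm x.
Hypothesis cont : forall p, O p -> forall d : R, 0 < d -> exists2 e : R, 0 < e & forall q, dst q p < e -> cmod (g q - g p) <= d.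
Hypothesis key : {ae leb2 R, forall a, O a -> kgood O g Lm a}.

(** Continuity removes the exceptional null set: difference quotients evaluate [g] at the specific
    points [a + 2^-n e1] and [a + 2^-n e2]. *)
Lemma bound_everywhere a r K : 0 <= K -> (forall q, dst q a < r -> O q) ->
  {ae leb2 R, forall q, dst q a < r -> cmod (g q - g a) <= K * dst q a} ->
  forall q, dst q a < r -> cmod (g q - g a) <= K * dst q a.
Proof.
move=> K0 rO hae p pr; apply/ler_addgt0Pr => d d0; have d2 : 0 < d / 2 by lra.
have [e e0 he] := cont (rO p pr) d2.
have K1 : 0 < K + 1 by lra.
have d3 : 0 < d / 2 / (K + 1) by exact: divr_gt0.
have m0 : 0 < minr (minr e (r - dst p a)) (d / 2 / (K + 1)).
  by rewrite !lt_min e0 d3 andbT /= subr_gt0.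
have [q + hq] := ae_dense p hae m0; rewrite !lt_min -andbA => /and3P[q1 q2 q3].
have t := dst_triangle q a p; have t' := dst_triangle q a p.
have h1 := hq (ltac:(lra)).
have h2 := he q q1; have := cmod_triangle (g p) (g a) (g q); rewrite (cmod_dist (g p) (g q)).
have : K * dst q a <= K * (dst p a + d / 2 / (K + 1)) by apply: ler_wpM2l => //; lra.
rewrite mulrDr; have : K * (d / 2 / (K + 1)) <= d / 2.
  by rewrite mulrA ler_pdivrMr// mulrC ler_pM2l//; lra.
lra.
Qed.

Lemma dst_tr_x (t : R) (a : R * R) : dst (tr (t, 0) a) a = `|t| /\ dst (tr (0, t) a) a = `|t|.
Proof.
rewrite !(trC _ a) !dst_tr !cmodE /= !expr0n /= addr0 add0r sqrtr_sqr.
by [].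
Qed.

(** Only countably many steps and cores occur, so one null set serves all dyadic difference
    quotients. *)
Lemma ftc_dyadic (U w : pl R -> R) : L2 U -> L2 w -> weak_x U w O ->
  {ae leb2 R, forall a, forall k n, (k <= n)%N -> core Omega k a ->
    U (tr (hl n, 0) a) - U a = hl n * savg (hl n) w a}.
Proof.
move=> LU Lw W; apply/ae_foralln => k; apply/ae_foralln => n.
have [kn|kn] := leqP k n; last by apply: aeW.
have m : margin O (core Omega k) (2 * hl k).
  move=> p Sp q q1 q2; apply: (margin_core Sp); have := hl_gt0 (R := R) k; lra.
have le : `|hl n| <= hl k :> R by rewrite gtr0_norm ?hl_gt0// hl_le.
by apply: (ae_mono (ftc_margin LU Lw W (hl_neq0 n) le m)) => a + _.
Qed.

Lemma ftc_dyadic_y (U w : pl R -> R) : L2 U -> L2 w -> weak_y U w O ->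
  {ae leb2 R, forall a, forall k n, (k <= n)%N -> core Omega k a ->
    U (tr (0, hl n) a) - U a = hl n * savg (hl n) (fun q => w (sw q)) (sw a)}.
Proof.
move=> LU Lw W; apply/ae_foralln => k; apply/ae_foralln => n.
have [kn|kn] := leqP k n; last by apply: aeW.
have m : margin O (core Omega k) (2 * hl k).
  move=> p Sp q q1 q2; apply: (margin_core Sp); have := hl_gt0 (R := R) k; lra.
have le : `|hl n| <= hl k :> R by rewrite gtr0_norm ?hl_gt0// hl_le.
by apply: (ae_mono (ftc_margin_y LU Lw W (hl_neq0 n) le m)) => a + _.
Qed.

(** A dyadic difference quotient is an average of the weak derivative and converges to it by
    Lebesgue differentiation, while the growth estimate bounds it. *)
Lemma gradient_bound : {ae leb2 R, forall a, O a -> forall r Osc : R, 0 < r -> r <= 1 ->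
  (forall q, dst q a < r -> O q) -> 0 <= Osc -> (forall q, dst q a < r -> cmod (g q - g a) <= Osc) ->
  cmod (hx a) <= Lm (Osc / r) /\ cmod (hy a) <= Lm (Osc / r)}.
Proof.
have [LgR LgI] := L2_ReIm mg Lg; have [LxR LxI] := L2_ReIm mhx Lhx; have [LyR LyI] := L2_ReIm mhy Lhy.
have fx := ae_mono2 (ftc_dyadic LgR LxR wxRe) (ftc_dyadic LgI LxI wxIm) (fun a b c => conj b c).
have fy := ae_mono2 (ftc_dyadic_y LgR LyR wyRe) (ftc_dyadic_y LgI LyI wyIm) (fun a b c => conj b c).
have cx := ae_mono2 (savg_cvg LxR hl_neq0 hl_cvg) (savg_cvg LxI hl_neq0 hl_cvg) (fun a b c => conj b c).
have cy := ae_mono2 (ae_sw (savg_cvg (L2_sw LyR) hl_neq0 hl_cvg)) (ae_sw (savg_cvg (L2_sw LyI) hl_neq0 hl_cvg))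
  (fun a b c => conj b c).
have fc := ae_mono2 (ae_mono2 fx fy (fun a b c => conj b c)) (ae_mono2 cx cy (fun a b c => conj b c)) (fun a b c => conj b c).
apply: (ae_mono2 fc key) => a [[[fxR fxI] [fyR fyI]] [[cxR cxI] [cyR cyI]]] kg Oa r Osc r0 r1 rO O0 hO.
have [k ka] := core_exhaust openO Oa.
have K0 : 0 <= Lm (Osc / r) by apply: Lm0; rewrite divr_ge0// ltW.
have ev := bound_everywhere K0 rO (kg Oa r Osc r0 r1 rO O0 hO).
have [n1 hn1] := hl_small r0.
have sm n : (n1 <= n)%N -> `|hl n| < r.
  by move=> nn; rewrite gtr0_norm ?hl_gt0//; apply: le_lt_trans hn1; exact: hl_le.
split.
  apply: (lim_bound (q := fun n => g (tr (hl n, 0) a) - g a) (n0 := maxn k n1) cxR cxI) => n.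
  rewrite geq_max => /andP[kn nn]; have [e _] := dst_tr_x (hl n) a.
  split; [by rewrite ReB; exact: fxR ka|by rewrite ImB; exact: fxI ka|].
  by have := ev (tr (hl n, 0) a); rewrite e => /(_ (sm _ nn)); rewrite gtr0_norm ?hl_gt0.
have swE : sw (sw a) = a by case: (a).
rewrite swE in cyR; rewrite swE in cyI.
apply: (lim_bound (q := fun n => g (tr (0, hl n) a) - g a) (n0 := maxn k n1) cyR cyI) => n.
rewrite geq_max => /andP[kn nn]; have [_ e] := dst_tr_x (hl n) a.
split; [by rewrite ReB; exact: fyR ka|by rewrite ImB; exact: fyI ka|].
by have := ev (tr (0, hl n) a); rewrite e => /(_ (sm _ nn)); rewrite gtr0_norm ?hl_gt0.
Qed.

End Gradient.

(** * Conclusion *)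

Section PlaneTopology.
Context {R : realType}.
Implicit Types (z w : C R) (A Omega : set (C R)).

(** Balls of [C R] have radii in [C R]; a positive element for its partial order has imaginary part
    0. *)
Lemma nbhs_cmodP z A : nbhs z A <-> exists2 e : R, 0 < e & forall w, cmod (w - z) < e -> A w.
Proof.
split=> [/nbhs_ballP[e /= e0]|[e e0 he]].
  rewrite -ball_normE => he; move: e0; rewrite ltcE /= => /andP[/eqP i0 r0]; exists (complex.Re e) => // w wz; apply: he.
  by rewrite /ball_ /= normE cmod_dist ltcE /= i0 eqxx.
apply/nbhs_ballP; exists ((e%:C)%C : C R); first by rewrite /= ltcR.
by move=> w; rewrite -ball_normE /ball_ /= normE ltcR cmod_dist; exact: he.
Qed.

Lemma open_cmodP A : open A <-> forall z, A z -> exists2 e : R, 0 < e & forall w, cmod (w - z) < e -> A w.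
Proof.
rewrite openE; split=> [h z /h|h z Az]; first by move/nbhs_cmodP.
by apply/nbhs_cmodP; exact: h.
Qed.

Lemma closure_cmod A z : closure A z -> forall e : R, 0 < e -> exists2 w, A w & cmod (w - z) < e.
Proof.
move=> cz e e0; have : nbhs z [set w | cmod (w - z) < e] by apply/nbhs_cmodP; exists e.
by move=> /cz[w [Aw we]]; exists w.
Qed.

Lemma toC_ReIm z : toC (complex.Re z, complex.Im z) = z.
Proof. by case: z. Qed.

Lemma open_sup_box Omega : open Omega -> forall p : R * R, Omega (toC p) ->
  exists2 e : R, 0 < e & forall q : R * R, `|q.1 - p.1| <= e -> `|q.2 - p.2| <= e -> Omega (toC q).
Proof.
move=> /open_cmodP h p /h[e e0 he]; exists (e / 3) => [|q q1 q2]; first by lra.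
by apply: he; have := dst_coord q1 q2; rewrite /dst; lra.
Qed.

Lemma measurable_open Omega : open Omega -> measurable (@toC R @^-1` Omega : set (pl R)).
Proof.
move=> oO; apply: measurable_sup_open => p /(open_sup_box oO)[e e0 he]; exists e => // q q1 q2.
by apply: he; exact: ltW.
Qed.

(** The segment from [a] to [z] misses the boundary, so the parameters that it sends into [Omega]
    form a nonempty relatively open and closed part of [[0, 1]]. *)
Lemma ball_subset Omega a r : open Omega -> Omega a -> (r%:E <= dist a (bdry Omega))%E ->
  forall z, cmod (z - a) < r -> Omega z.
Proof.
move=> oO Oa hr z zr.
pose gam (t : R) : C R := a + (t%:C)%C * (z - a).
have gamE s t : cmod (gam s - gam t) = `|s - t| * cmod (z - a).
  have -> : gam s - gam t = ((s - t)%:C)%C * (z - a) by rewrite /gam rmorphB /=; ring.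
  by rewrite cmodM cmod_real.
have cg : continuous gam.
  move=> t A /nbhs_cmodP[e e0 he]; have c1 : 0 < cmod (z - a) + 1 by have := cmod_ge0 (z - a); lra.
  apply/nbhs_ballP; exists (e / (cmod (z - a) + 1)); first exact: divr_gt0.
  move=> s; rewrite -ball_normE /ball_ /= distrC => hs; apply: he; rewrite gamE.
  move: hs; rewrite ltr_pdivlMr// mulrDr mulr1; have := normr_ge0 (s - t); lra.
have away t : 0 <= t -> t <= 1 -> ~ bdry Omega (gam t).
  move=> t0 t1 b; have : (dist a (bdry Omega) <= (cmod (a - gam t))%:E)%E by apply: ereal_inf_lbound; exists (gam t).
  move=> /(le_trans hr); rewrite lee_fin (_ : cmod (a - gam t) = t * cmod (z - a)).
    by have := cmod_ge0 (z - a); nra.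
  have := gamE 0 t; rewrite {1}/gam mul0r addr0 => ->; by rewrite sub0r normrN ger0_norm.
pose A : set R := `[0, 1] `&` gam @^-1` Omega.
have A0 : A !=set0.
  by exists 0; split; [rewrite /= in_itv /= lexx ler01|rewrite /= /gam mul0r addr0].
have Ao : exists2 U : set R, open U & A = `[0, 1] `&` U.
  by exists (gam @^-1` Omega) => //; exact: (@continuousP _ _ gam).1 cg _ oO.
have Ac : exists2 U : set R, closed U & A = `[0, 1] `&` U.
  exists (gam @^-1` closure Omega); first exact: (@continuous_closedP _ _ gam).1 cg _ (@closed_closure _ Omega).
  apply/seteqP; split=> t [h1 h2]; split=> //; first exact: subset_closure.
  move: (h1); rewrite /= in_itv /= => /andP[t0 t1].
  by apply: contrapT => h; apply: (away t t0 t1); split=> // /interior_subset.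
have AE := @segment_connected _ 0 1 A A0 Ao Ac.
have : A 1 by rewrite AE /= in_itv /= ler01 lexx.
by move=> [_]; rewrite /= /gam mul1r addrC subrK.
Qed.

Lemma dist_gt0 Omega a : open Omega -> Omega a -> exists2 e : R, 0 < e & (e%:E <= dist a (bdry Omega))%E.
Proof.
move=> oO Oa; have [e e0 he] := (open_cmodP Omega).1 oO a Oa; exists e => //.
apply: le_ereal_inf_tmp => _ [w [_ nw] <-]; rewrite lee_fin leNgt cmod_dist; apply/negP => h.
by apply: nw; move: oO; rewrite openE; apply; exact: he.
Qed.

End PlaneTopology.

(** * Extension by zero and Lebesgue norms *)

Section LpFacts.
Context {R : realType}.
Variables (Omega : set (C R)) (oO : open Omega).
Local Notation O := (@toC R @^-1` Omega).

Definition cpatch (f : C R -> C R) (p : pl R) : C R := if p \in O then f (toC p) else 0.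

(** Selects the case of the definition of the L-infinity norm in which it is an essential
    supremum. *)
Lemma leb2_setT_gt0 : (0 < leb2 R [set: pl R])%E.
Proof.
apply: (@lt_le_trans _ _ (leb2 R (box 1))); last by apply: le_measure; rewrite ?inE//; exact: measurable_box.
by rewrite leb2_boxE// lte_fin mulr_gt0// exprn_gt0.
Qed.

Lemma cmeas_cpatch f : cmeasurable Omega f -> cmeas (cpatch f).
Proof.
move=> [m1 m2]; have mO := measurable_open oO; split.
  rewrite (_ : (fun _ => _) = (fun p => complex.Re (f (toC p))) \_ O); last first.
    by apply/funext => p; rewrite patchE /cpatch; case: ifP.
  by apply/measurable_restrict => //; rewrite setTI.
rewrite (_ : (fun _ => _) = (fun p => complex.Im (f (toC p))) \_ O); last first.
  by apply/funext => p; rewrite patchE /cpatch; case: ifP.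
by apply/measurable_restrict => //; rewrite setTI.
Qed.

Lemma cmod_cpatch f : patch (cst 0) O (fun q => (cmod (f (toC q)))%:E) = (fun p => (cmod (cpatch f p))%:E).
Proof. by apply/funext => p; rewrite patchE /cpatch; case: ifP => // _; rewrite cmod0. Qed.

Lemma L2_cpatch f : in_Lp Omega 2%:E f -> L2 (fun p => cmod (cpatch f p)).
Proof.
move=> [mf]; rewrite /Lpnorm cmod_cpatch => hf; split; first exact: measurable_cmod (cmeas_cpatch mf).
have n2 : (2 : R) != 0 by rewrite pnatr_eq0.
have := poweR_Lnorm (leb2 R) (fun p => (cmod (cpatch f p))%:E) n2.
under eq_integral => p _ do rewrite gee0_abs ?lee_fin ?cmod_ge0// poweR_EFin powR_mulrn ?cmod_ge0//.
by move=> <-; exact: poweR_lty.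
Qed.

Lemma Linf_cpatch f : in_Lp Omega +oo%E f -> exists2 N : R, 0 <= N & Lpnorm Omega +oo%E f = N%:E /\
  {ae leb2 R, forall p, cmod (cpatch f p) <= N}.
Proof.
move=> [mf]; rewrite /Lpnorm => hf.
have n0 := Lnorm_ge0 (leb2 R) +oo%E (patch (cst 0%E) O (fun q => (cmod (f (toC q)))%:E)).
have nf : ('N[leb2 R]_+oo [patch (cst 0%E) O (fun q => (cmod (f (toC q)))%:E)])%E \is a fin_num by rewrite ge0_fin_numE.
exists (fine ('N[leb2 R]_+oo [patch (cst 0%E) O (fun q => (cmod (f (toC q)))%:E)])%E); first exact: fine_ge0.
rewrite fineK//; split=> //.
have := ess_sup_ge (leb2 R) (abse \o (fun p => (cmod (cpatch f p))%:E)).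
move: nf; rewrite cmod_cpatch unlock /Lnorm leb2_setT_gt0 => nf h.
apply: (ae_mono h) => p; rewrite /= -(fineK nf) lee_fin ger0_norm ?cmod_ge0//.
Qed.

End LpFacts.

Lemma C0_ge0 {R : realType} (M1 al : R) : 0 < al -> al < 1 -> 0 <= C0 M1 al.
Proof.
move=> al0 al1; have /andP[b0 b1] := b_bounds al0 al1.
rewrite /C0 divr_ge0 ?mulr_ge0 ?sqrtr_ge0// subr_ge0.
by rewrite -[leRHS]sqrtr1 ler_sqrt// ltW.
Qed.

(** * The representative with its gradient bound *)

Section Regularity.
Context {R : realType}.
Local Notation i := (imunit R).
Variables (Omega : set (C R)) (Hf : C R -> C R -> C R) (rad L M al N : R).
Hypotheses (oO : open Omega).
Hypotheses (rad0 : 0 <= rad) (L0 : 0 <= L) (M0 : 0 <= M) (al0 : 0 < al) (al1 : al < 1) (N0 : 0 <= N).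
Hypothesis Hb : forall z xi, Omega z -> rad < cmod xi -> cmod (Hf z xi) <= M.
Hypothesis Hh : forall z1 z2 xi, Omega z1 -> Omega z2 -> rad < cmod xi ->
  cmod (Hf z1 xi - Hf z2 xi) <= M * cmod (z1 - z2) `^ al.
Hypothesis Hl : forall z w1 w2, Omega z -> rad < cmod w1 -> rad < cmod w2 ->
  cmod (Hf z w1 - Hf z w2) <= L * cmod (w1^-1 - w2^-1).
Local Notation O := (@toC R @^-1` Omega).
Variables (h hx hy : C R -> C R).
Hypothesis hW : W12 Omega h hx hy.
Hypothesis hinf : in_Lp Omega +oo%E h.
Hypothesis zbarN : {ae leb2 R, forall p, cmod (cpatch Omega (d_zbar hx hy) p) <= N}.
Hypothesis sol : ae_on Omega (fun z => rad < cmod (d_z hx hy z) -> d_zbar hx hy z = Hf z (d_z hx hy z)).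

(** One sixth of the part of [Lam] that involves neither the oscillation nor [N], so that it depends
    on the bounds of the field only. *)
Definition lamc : R := (3 / 2 * (2 * M + 2 * Lam0 rad L M + 1 + C0 M al) + M) / 6.

Lemma cpatch_in f p : O p -> cpatch Omega f p = f (toC p).
Proof. by move=> Op; rewrite /cpatch mem_set. Qed.

Lemma patch0_Re f : (fun p => complex.Re (cpatch Omega f p)) = patch0 Omega (fun z => complex.Re (f z)).
Proof. by apply/funext => p; rewrite /patch0 /cpatch; case: ifP. Qed.

Lemma patch0_Im f : (fun p => complex.Im (cpatch Omega f p)) = patch0 Omega (fun z => complex.Im (f z)).
Proof. by apply/funext => p; rewrite /patch0 /cpatch; case: ifP. Qed.

Lemma L2_le_ae (u v : pl R -> R) : L2 u -> measurable_fun setT v -> {ae leb2 R, forall p, v p = u p} -> L2 v.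
Proof.
move=> [mu iu] mv uv; split=> //; apply: le_lt_trans iu; apply: II_le_ae.
- by meas.
- by meas.
- by move=> p; exact: sqr_ge0.
- by move=> p; exact: sqr_ge0.
- by apply: (ae_mono uv) => p ->.
Qed.

Let mhx : cmeas (cpatch Omega hx).
Proof. by have [_ [m _] _ _ _] := hW; exact: cmeas_cpatch. Qed.
Let mhy : cmeas (cpatch Omega hy).
Proof. by have [_ _ [m _] _ _] := hW; exact: cmeas_cpatch. Qed.
Let mh : cmeas (cpatch Omega h).
Proof. by have [[m _] _ _ _ _] := hW; exact: cmeas_cpatch. Qed.
Let Lhx : L2 (fun p => cmod (cpatch Omega hx p)).
Proof. by have [_ m _ _ _] := hW; exact: L2_cpatch. Qed.
Let Lhy : L2 (fun p => cmod (cpatch Omega hy p)).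
Proof. by have [_ _ m _ _] := hW; exact: L2_cpatch. Qed.
Let Lh : L2 (fun p => cmod (cpatch Omega h p)).
Proof. by have [m _ _ _ _] := hW; exact: L2_cpatch. Qed.

Let weak_ae (f : pl R -> C R) : cmeas f -> {ae leb2 R, forall p, cpatch Omega h p = f p} ->
  [/\ weak_x (fun p => complex.Re (f p)) (fun p => complex.Re (cpatch Omega hx p)) O,
      weak_x (fun p => complex.Im (f p)) (fun p => complex.Im (cpatch Omega hx p)) O,
      weak_y (fun p => complex.Re (f p)) (fun p => complex.Re (cpatch Omega hy p)) O &
      weak_y (fun p => complex.Im (f p)) (fun p => complex.Im (cpatch Omega hy p)) O].
Proof.
move=> [mf1 mf2] hf; have [_ _ _ [wxR wxI] [wyR wyI]] := hW.
have [m1 m2] := mh; have [m3 m4] := mhy.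
have eR : {ae leb2 R, forall p, complex.Re (cpatch Omega h p) = complex.Re (f p)} by apply: (ae_mono hf) => p ->.
have eI : {ae leb2 R, forall p, complex.Im (cpatch Omega h p) = complex.Im (f p)} by apply: (ae_mono hf) => p ->.
split.
- by apply: (weak_x_ae m1 mf1 eR); rewrite !patch0_Re; exact: weak_x_partial.
- by apply: (weak_x_ae m2 mf2 eI); rewrite !patch0_Im; exact: weak_x_partial.
- apply: (weak_y_ae m1 mf1 eR); rewrite patch0_Re in m1; rewrite patch0_Re in m3.
  by rewrite !patch0_Re; exact: weak_y_partial.
- apply: (weak_y_ae m2 mf2 eI); rewrite patch0_Im in m2; rewrite patch0_Im in m4.
  by rewrite !patch0_Im; exact: weak_y_partial.
Qed.

Let eqn : {ae leb2 R, forall p : pl R, O p ->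
  rad < cmod (2^-1 * (cpatch Omega hx p - i * cpatch Omega hy p)) ->
  2^-1 * (cpatch Omega hx p + i * cpatch Omega hy p) =
  Hf (toC p) (2^-1 * (cpatch Omega hx p - i * cpatch Omega hy p))}.
Proof. by apply: (ae_mono sol) => p hp Op; rewrite !cpatch_in//; exact: hp. Qed.

Let zb : {ae leb2 R, forall p : pl R, O p -> cmod (2^-1 * (cpatch Omega hx p + i * cpatch Omega hy p)) <= N}.
Proof. by apply: (ae_mono zbarN) => p hp Op; move: hp; rewrite !cpatch_in. Qed.

Let kgood_ae (f : pl R -> C R) : cmeas f -> L2 (fun p => cmod (f p)) -> {ae leb2 R, forall p, cpatch Omega h p = f p} ->
  {ae leb2 R, forall a, O a -> kgood O f (Lam rad L M al N) a}.
Proof.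
move=> mf Lf hf; have [w1 w2 w3 w4] := weak_ae mf hf.
apply: (ae_mono (key_estimate rad0 L0 M0 al0 al1 N0 Hb Hh Hl (open_sup_box oO) mf mhx mhy Lf Lhx Lhy w1 w2 w3 w4 eqn zb)).
by move=> a ka Oa; apply: kgood_of_key; exact: ka.
Qed.

Lemma Lam_ge0 x : 0 <= x -> 0 <= Lam rad L M al N x.
Proof.
move=> x0; have [_ _ _ l200] := Lam0_bounds rad0 L0 M0; have c := C0_ge0 M al0 al1.
have M0' := M0; have N0' := N0; rewrite /Lam; lra.
Qed.

Lemma regularity : exists g : C R -> C R,
  [/\ ae_on Omega (fun z => g z = h z),
      (exists B : R, forall z, Omega z -> cmod (g z) <= B),
      (forall p, O p -> exists e K : R, [/\ 0 < e, 0 <= K, (forall q, dst q p < e -> O q) &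
        forall x y, dst x p < e -> dst y p < e -> cmod (g (toC x) - g (toC y)) <= K * dst x y]) &
      {ae leb2 R, forall a : pl R, O a -> forall r Osc : R, 0 < r -> r <= 1 ->
        (forall q, dst q a < r -> O q) -> 0 <= Osc ->
        (forall q, dst q a < r -> cmod (g (toC q) - g (toC a)) <= Osc) ->
        gradmod hx hy (toC a) <= 3 * (Osc / r) + 4 * N + 6 * lamc}].
Proof.
have [B B0 [_ hB]] := Linf_cpatch hinf.
(* [representative] uses a bound at every point, whereas [h] has an essential one; [f] sets [h] to 0
   where the bound fails. *)
pose f p : C R := ((1 - ind (B < cmod (cpatch Omega h p)))%:C)%C * cpatch Omega h p.
have mf : cmeas f.
  apply: cmeasM => //; split => /=; last exact: measurable_cst.
  by apply: measurable_funB; [exact: measurable_cst|apply: measurable_gt; exact: measurable_cmod].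
have fB p : cmod (f p) <= B.
  rewrite /f cmodM cmod_real; have [hp|hp] := ltP B (cmod (cpatch Omega h p)).
    by rewrite /ind /= subrr normr0 mul0r.
  by rewrite /ind /= subr0 normr1 mul1r.
have hf : {ae leb2 R, forall p, cpatch Omega h p = f p}.
  by apply: (ae_mono hB) => p hp; rewrite /f /ind ltNge hp /= subr0 mul1r.
have Lf : L2 (fun p => cmod (f p)).
  by apply: (L2_le_ae Lh); [exact: measurable_cmod|apply: (ae_mono hf) => p ->].
have [g [g1 g2 g3]] := representative (open_sup_box oO) Lam_ge0 fB (kgood_ae mf Lf hf).
have gh : ae_on Omega (fun z => g z = h z).
  by apply: (ae_mono2 g1 hf) => p e1 e2 Op; rewrite e1// -e2 cpatch_in.
exists g; split=> //.
  by exists B => z; rewrite -(toC_ReIm z) => /g2.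
have contO p : O p -> forall d : R, 0 < d -> exists2 e : R, 0 < e &
    forall q, dst q p < e -> O q /\ cmod (g (toC q) - g (toC p)) <= d.
  move=> /g3[e [K [e0 K0 eO eL]]] d d0; have K1 : 0 < K + 1 by lra.
  exists (minr e (d / (K + 1))); first by rewrite lt_min e0 divr_gt0.
  move=> q; rewrite lt_min => /andP[q1 q2]; split; first exact: eO.
  apply: (le_trans (eL q p q1 _)); first by rewrite dstxx.
  move: q2; rewrite ltr_pdivlMr// => q2; have := dst_ge0 q p; lra.
have mO := measurable_open oO.
(* [g] is continuous inside [Omega] only, and its extension by 0 may jump: the superlevel set inside
   [Omega] is open, and the complement is added when [P 0] exceeds the level. *)
have mpart (P : C R -> R) : (forall z w, `|P z - P w| <= cmod (z - w)) ->
    measurable_fun setT (fun p => P (cpatch Omega g p)).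
  move=> Plip.
  have mc c : measurable ([set p | O p /\ c < P (g (toC p))] : set (pl R)).
    apply: measurable_sup_open => p [Op cp].
    have d0 : 0 < (P (g (toC p)) - c) / 2 by lra.
    have [e e0 he] := contO p Op _ d0; exists (e / 3); first by lra.
    move=> q q1 q2; have qe : dst q p < e.
      by apply: le_lt_trans (dst_coord (ltW q1) (ltW q2)) _; lra.
    have [Oq dq] := he q qe; split=> //.
    have := le_trans (Plip (g (toC q)) (g (toC p))) dq; rewrite ler_norml; lra.
  apply: (measurability _ (RGenOInfty.measurableE R)) => // _ [_ [c ->] <-].
  have -> : setT `&` (fun p => P (cpatch Omega g p)) @^-1` `]c, +oo[%classic =
      [set p | O p /\ c < P (g (toC p))] `|` (if c < P 0 then ~` O else set0).
    apply/seteqP; split=> p; rewrite /= in_itv /= andbT.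
      move=> [_]; rewrite /cpatch; case: ifPn => [/set_mem Op|nO] hc; first by left.
      by right; rewrite hc => Op; move/negP: nO; apply; exact/mem_set.
    move=> [[Op cp]|]; first by rewrite cpatch_in.
    by case: ifP => // c0 nO; rewrite /cpatch memNset.
  apply: measurableU => //; case: ifP => _ //; exact: measurableC.
have mg : cmeas (cpatch Omega g).
  split; apply: mpart => z w; [rewrite -ReB; exact: Re_le_cmod|rewrite -ImB; exact: Im_le_cmod].
have hg : {ae leb2 R, forall p, cpatch Omega h p = cpatch Omega g p}.
  by apply: (ae_mono gh) => p e; rewrite /cpatch; case: ifPn => // /set_mem Op; rewrite e.
have Lg : L2 (fun p => cmod (cpatch Omega g p)).
  by apply: (L2_le_ae Lh); [exact: measurable_cmod|apply: (ae_mono hg) => p ->].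
have [w1 w2 w3 w4] := weak_ae mg hg.
have contg p : O p -> forall d : R, 0 < d -> exists2 e : R, 0 < e &
    forall q, dst q p < e -> cmod (cpatch Omega g q - cpatch Omega g p) <= d.
  move=> Op d d0; have [e e0 he] := contO p Op d d0; exists e => // q qe.
  by have [Oq ?] := he q qe; rewrite !cpatch_in.
have G := gradient_bound (open_sup_box oO) mg mhx mhy Lg Lhx Lhy w1 w2 w3 w4 Lam_ge0 contg (kgood_ae mg Lg hg).
apply: (ae_mono2 G zb) => a ga za Oa r Osc r0 r1 rO Osc0 hO.
have [|b1 b2] := ga Oa r Osc r0 r1 rO Osc0.
  by move=> q qr; rewrite !cpatch_in//; [exact: hO|exact: rO].
have b3 := za Oa.
rewrite !cpatch_in// in b1 b2 b3.
(* The z-derivative is at most half of [|h_x| + |h_y|], hence at most [Lam (Osc / r)], and the other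
   one is at most [N]. As [Lam] contains [3 / 2 * (Osc / r + 2 * N)], the coefficient of [N] becomes
   [3 + 1]. *)
rewrite /gradmod /d_zbar /d_z cmod_half.
have t := cmodB (hx (toC a)) (i * hy (toC a)).
rewrite cmodM cmod_imunit mul1r in t.
have Or0 : 0 <= Osc / r by rewrite divr_ge0// ltW.
move: b1 b2; rewrite /Lam /lamc; lra.
Qed.

End Regularity.

(** * Local Lipschitz property, interior estimate and boundary limits *)

Section Boundary.
Context {R : realType}.
Variables (Omega : set (C R)) (oO : open Omega).
Local Notation O := (@toC R @^-1` Omega).
Implicit Types (g : C R -> C R).

(** Locality is meant for pairs of points. Near the diagonal the local Lipschitz constant serves;
    near a pair of distinct points the increment is at most [2 B] while [|u - v|] stays above
    [|x - y| / 2]. *)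
Lemma locally_lipschitz g (B : R) : (forall z, Omega z -> cmod (g z) <= B) ->
  (forall p, O p -> exists e K : R, [/\ 0 < e, 0 <= K, (forall q, dst q p < e -> O q) &
        forall x y, dst x p < e -> dst y p < e -> cmod (g (toC x) - g (toC y)) <= K * dst x y]) ->
  [locally [lipschitz g z | z in Omega]].
Proof.
move=> gB gL; rewrite /locally_of => -[x y] /= [Ox Oy].
have [K [e [K0 e0 he]]] : exists K e : R, [/\ 0 <= K, 0 < e & forall u v, Omega u -> Omega v -> cmod (u - x) < e ->
    cmod (v - y) < e -> cmod (g u - g v) <= K * cmod (u - v)].
  have := cmod_ge0 (x - y); rewrite le_eqVlt => /orP[/eqP/esym/cmod0_eq/subr0_eq xy|d0].
    have Op : O (complex.Re x, complex.Im x) by rewrite /preimage /= toC_ReIm.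
    have [e [K [e0 K0 _ eL]]] := gL _ Op; exists K, e; split=> // u v _ _ ux vy.
    have := eL (complex.Re u, complex.Im u) (complex.Re v, complex.Im v).
    by rewrite /dst !toC_ReIm; apply=> //; rewrite xy.
  exists (4 * B / cmod (x - y)), (cmod (x - y) / 4).
  have B0 : 0 <= B by apply: le_trans (gB x Ox); exact: cmod_ge0.
  split; [by rewrite divr_ge0 ?mulr_ge0// ltW|by rewrite divr_gt0|].
  move=> u v Ou Ov ux vy; apply: (@le_trans _ _ (2 * B)).
    by apply: (le_trans (cmodB _ _)); have := gB u Ou; have := gB v Ov; lra.
  have t1 := cmod_triangle x y u; have t2 := cmod_triangle u y v; rewrite (cmod_dist x u) in t1.
  rewrite mulrAC ler_pdivlMr//.
  have : B * (cmod (x - y) / 2) <= B * cmod (u - v) by apply: ler_wpM2l => //; lra.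
  lra.
rewrite /lipschitz_on; near=> k.
have kK : (K%:C)%C <= k :> C R.
  by near: k; apply: nbhs_pinfty_ge; rewrite realE lecR K0.
rewrite /dominated_by /within /=.
have : nbhs (x, y) [set q : C R * C R | cmod (q.1 - x) < e /\ cmod (q.2 - y) < e].
  exists ([set u | cmod (u - x) < e], [set v | cmod (v - y) < e]) => /=.
    by split; apply/nbhs_cmodP; exists e.
  by move=> [u v] [].
apply: filterS => -[u v] /= [ux vy] [Ou Ov].
rewrite /self_sub /= !normE; apply: (@le_trans _ _ ((K%:C)%C * ((cmod (u - v))%:C)%C : C R)).
  by rewrite -rmorphM lecR; exact: he.
by apply: ler_wpM2r => //; rewrite lecR cmod_ge0.
Unshelve. all: by end_near.
Qed.

Lemma osc_fin g (B : R) : Omega !=set0 -> (forall z, Omega z -> cmod (g z) <= B) ->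
  exists2 D : R, 0 <= D & osc Omega g = D%:E /\
    forall a b, Omega a -> Omega b -> cmod (g a - g b) <= D.
Proof.
move=> [z0 Oz0] gB.
have up : (osc Omega g <= (2 * B)%:E)%E.
  apply: ge_ereal_sup => _ [a Oa] [b Ob] <-; rewrite lee_fin; apply: (le_trans (cmodB _ _)).
  by have := gB a Oa; have := gB b Ob; lra.
have mem a b : Omega a -> Omega b -> ((cmod (g a - g b))%:E <= osc Omega g)%E.
  by move=> Oa Ob; apply: ereal_sup_ubound; exists a => //; exists b.
have lo : (0 <= osc Omega g)%E by have := mem z0 z0 Oz0 Oz0; rewrite subrr cmod0.
have fin : osc Omega g \is a fin_num.
  by rewrite ge0_fin_numE//; apply: le_lt_trans up _; rewrite ltry.
exists (fine (osc Omega g)); first exact: fine_ge0.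
by rewrite fineK//; split=> // a b Oa Ob; rewrite -lee_fin fineK//; exact: mem.
Qed.

Variables (g hx hy : C R -> C R) (N lam : R).
Hypothesis grad : {ae leb2 R, forall a : pl R, O a -> forall r Osc : R, 0 < r -> r <= 1 ->
  (forall q, dst q a < r -> O q) -> 0 <= Osc ->
  (forall q, dst q a < r -> cmod (g (toC q) - g (toC a)) <= Osc) ->
  gradmod hx hy (toC a) <= 3 * (Osc / r) + 4 * N + 6 * lam}.

Lemma ball_preimage (a : R * R) r : O a -> (r%:E <= dist (toC a) (bdry Omega))%E -> forall q, dst q a < r -> O q.
Proof. by move=> Oa hr q; exact: (ball_subset oO Oa hr). Qed.

Lemma interior_bound (D : R) : 0 <= D -> (forall a b, Omega a -> Omega b -> cmod (g a - g b) <= D) ->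
  ae_on Omega (fun z => let r := fine (Order.min (dist z (bdry Omega)) 1%:E) in
    gradmod hx hy z <= 3 / r * D + 4 * N + 6 * lam).
Proof.
move=> D0 gD; apply: (ae_mono grad) => a ga Oa /=.
have [e e0 he] := dist_gt0 oO Oa.
set m := Order.min _ _; set r := fine m.
have m0 : (0 < m)%E by rewrite lt_min lte01 andbT; apply: lt_le_trans he.
have m1 : (m <= 1%:E)%E by rewrite ge_min lexx orbT.
have mfin : m \is a fin_num by rewrite ge0_fin_numE ?ltW//; apply: le_lt_trans m1 _; rewrite ltry.
have rE : r%:E = m by rewrite fineK.
have r0 : 0 < r by rewrite -lte_fin rE.
have r1 : r <= 1 by rewrite -lee_fin rE.
have rO : forall q, dst q a < r -> O q by apply: ball_preimage => //; rewrite rE ge_min lexx.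
rewrite (_ : 3 / r * D = 3 * (D / r)); last by ring.
by apply: ga => // q qr; apply: gD => //; exact: rO.
Qed.

(** Multiplying the gradient bound by [r], the distance to the boundary, leaves [3 * K] plus a
    multiple of [r], and [r] is at most the distance to [w]. Only the oscillation on the disc of
    radius [r] enters, so [K] may be local. *)
Lemma limsup_le w (K d0 : R) : bdry Omega w -> 0 <= K -> 0 < d0 ->
  (forall z z', Omega z -> Omega z' -> cmod (z - w) < d0 -> cmod (z' - z) < cmod (z - w) -> cmod (g z' - g z) <= K) ->
  (ess_limsup Omega w (fun z => (gradmod hx hy z)%:E * dist z (bdry Omega)) <= (3 * K)%:E)%E.
Proof.
move=> bw K0 d00 hK; apply/lee_addgt0Pr => e e0.
pose c := `|4 * N + 6 * lam| + 1.
have c0 : 0 < c by have := normr_ge0 (4 * N + 6 * lam); rewrite /c; lra.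
pose d := minr (minr d0 1) (e / c).
have dp : 0 < d by rewrite !lt_min d00 ltr01 divr_gt0.
apply: (@ge_ereal_inf _ _ _); eexists; first by exists d.
apply/ess_supP; apply: (ae_mono grad) => a ga.
rewrite /patch; case: ifPn => [/set_mem [Oa aw]|_]; last exact: leNye.
have [e1 e10 he1] := dist_gt0 oO Oa.
have dw : (dist (toC a) (bdry Omega) <= (cmod (toC a - w))%:E)%E by apply: ereal_inf_lbound; exists w.
have fin : dist (toC a) (bdry Omega) \is a fin_num.
  rewrite ge0_fin_numE; first by apply: le_lt_trans dw _; rewrite ltry.
  by apply: le_trans he1; rewrite lee_fin ltW.
move: dw he1; rewrite -(fineK fin); set r := fine _ => dw he1.
rewrite !lee_fin in dw he1.
have r0 : 0 < r by exact: lt_le_trans he1.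
move: aw; rewrite /d !lt_min -andbA => /and3P[aw1 aw2 aw3].
have rO : forall q, dst q a < r -> O q by apply: ball_preimage => //; rewrite fineK.
have G := ga Oa r K r0 (ltac:(lra)) rO K0.
have {}G : gradmod hx hy (toC a) <= 3 * (K / r) + 4 * N + 6 * lam.
  apply: G => q qr; apply: hK => //; first exact: rO.
  exact: lt_le_trans qr dw.
rewrite -EFinM -EFinD lee_fin.
have : gradmod hx hy (toC a) * r <= (3 * (K / r) + 4 * N + 6 * lam) * r by apply: ler_wpM2r => //; exact: ltW.
have -> : (3 * (K / r) + 4 * N + 6 * lam) * r = 3 * K + (4 * N + 6 * lam) * r by field; rewrite gt_eqF.
have h1 : (4 * N + 6 * lam) * r <= c * r.
  by apply: ler_wpM2r; [exact: ltW|rewrite /c; have := ler_norm (4 * N + 6 * lam); lra].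
have h2 : c * r <= e by rewrite mulrC -ler_pdivlMr//; lra.
lra.
Qed.

(** Every neighbourhood of [w] meets [Omega] in a set with interior points; by [ae_dense] the
    essential supremum dominates the value at one of its points, which is nonnegative. *)
Lemma limsup_ge0 w : bdry Omega w ->
  (0 <= ess_limsup Omega w (fun z => (gradmod hx hy z)%:E * dist z (bdry Omega)))%E.
Proof.
move=> [cw _]; apply: le_ereal_inf_tmp => _ [d /= d0 <-].
have [z Oz zw] := closure_cmod cw d0; have [e e0 he] := (open_cmodP Omega).1 oO z Oz.
have m0 : 0 < minr e (d - cmod (z - w)) by rewrite lt_min e0 subr_gt0.
have [q] := ae_dense (complex.Re z, complex.Im z) (ess_sup_ge (leb2 R)
  (patch (cst -oo%E) (@toC R @^-1` [set z | Omega z /\ cmod (z - w) < d])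
     (fun q => ((gradmod hx hy (toC q))%:E * dist (toC q) (bdry Omega))%E))) m0.
rewrite /dst toC_ReIm lt_min => /andP[q1 q2].
have Oq : Omega (toC q) by exact: he.
rewrite /patch mem_set; last first.
  by split=> //; have := cmod_triangle (toC q) w z; lra.
apply: le_trans; apply: mule_ge0; first by rewrite lee_fin addr_ge0 ?cmod_ge0.
by have [e' e'0 h'] := dist_gt0 oO Oq; apply: le_trans h'; rewrite lee_fin ltW.
Qed.

Lemma limsup_eq0 w (G : C R -> C R) : {within closure Omega, continuous G} -> (forall z, Omega z -> G z = g z) ->
  bdry Omega w -> ess_limsup Omega w (fun z => ((gradmod hx hy z)%:E * dist z (bdry Omega))%E) = 0%E.
Proof.
move=> cG Gg bw; apply/eqP; rewrite eq_le limsup_ge0// andbT.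
apply/lee_addgt0Pr => e e0; rewrite add0e.
have e6 : 0 < e / 6 by lra.
have e3 : 0 <= e / 3 by lra.
have [cw _] := bw.
have nG : nbhs (G w) [set v | cmod (v - G w) < e / 6] by apply/nbhs_cmodP; exists (e / 6).
have := (subspace_continuousP _ _).1 cG w cw _ nG.
rewrite nbhs_simpl /= => /nbhs_cmodP[d d0 hd].
(* A point closer to [z] than [w] is lies within [2 |z - w|] of [w], hence the radius [d / 2]; the
   two deviations of [e / 6] add up to [e / 3]. *)
have := limsup_le bw e3 (ltac:(lra) : 0 < d / 2).
rewrite (_ : 3 * (e / 3) = e); last by field.
apply=> z z' Oz Oz' zw z'z.
have h1 : cmod (G z - G w) < e / 6 := hd z (ltac:(lra)) (subset_closure Oz).
have t := cmod_triangle z' w z.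
have h2 : cmod (G z' - G w) < e / 6 := hd z' (ltac:(lra)) (subset_closure Oz').
rewrite (Gg z Oz) in h1; rewrite (Gg z' Oz') in h2.
have := cmod_triangle (g z') (g z) (G w); rewrite (cmod_dist (G w) (g z)); lra.
Qed.

End Boundary.

Unset Implicit Arguments.

Theorem theorem3p1 (R : realType) (Omega : set (C R)) (rad L M alpha : R)
    (H : C R -> Csphere R -> C R)
    (Omega_domain : domain Omega)
    (rad_ge0 : 0 <= rad) (L_ge0 : 0 <= L) (M_ge0 : 0 <= M)
    (alpha_gt0 : 0 < alpha) (alpha_lt1 : alpha < 1)
    (H_cont : {within Omega `*` outside rad,
       continuous (fun p : C R * Csphere R => H p.1 p.2)})
    (H_lip : forall (z : C R) (xi1 xi2 : Csphere R),
       Omega z -> outside rad xi1 -> outside rad xi2 ->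
       cmod (H z xi1 - H z xi2) <= L * cmod (sinv xi1 - sinv xi2))
    (H_holder : forall xi : C R, rad < cmod xi ->
       (sup_mod Omega (fun z => H z (finite_pt xi))
        + holder_seminorm Omega alpha (fun z => H z (finite_pt xi))
        <= M%:E)%E) :
  exists lambda : R,
  forall h hx hy : C R -> C R,
    W12 Omega h hx hy ->
    in_Lp Omega +oo%E h ->
    in_Lp Omega +oo%E (d_zbar hx hy) ->
    is_solution Omega rad H h hx hy ->
    (* [g] is the continuous representative of [h] *)
    exists g : C R -> C R,
      [/\ ae_on Omega (fun z => g z = h z),
          [locally [lipschitz g z | z in Omega]],
          ae_on Omega (fun z =>
            let r := fine (Order.min (dist z (bdry Omega)) 1%:E) in
            ((gradmod hx hy z)%:E <=
              (3 / r)%:E * osc Omega g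
              + 4%:E * Lpnorm Omega +oo (d_zbar hx hy)
              + (6 * lambda)%:E)%E),
          (forall w : C R, bdry Omega w ->
            (ess_limsup Omega w
               (fun z => (gradmod hx hy z)%:E * dist z (bdry Omega))
             <= 3%:E * osc Omega g)%E)
        & (exists G : C R -> C R,
             {within closure Omega, continuous G} /\
             (forall z, Omega z -> G z = g z)) ->
          forall w : C R, bdry Omega w ->
            ess_limsup Omega w
              (fun z => ((gradmod hx hy z)%:E * dist z (bdry Omega))%E)
            = 0%E].
Proof.
have [oO _ [z0 Oz0]] := Omega_domain.
pose Hf z xi := H z (finite_pt xi).
have hb xi : rad < cmod xi -> (forall z, Omega z -> cmod (Hf z xi) <= M) /\
    (forall z1 z2, Omega z1 -> Omega z2 -> cmod (Hf z1 xi - Hf z2 xi) <= M * cmod (z1 - z2) `^ alpha).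
  move=> rx; have := H_holder xi rx; set s1 := sup_mod _ _; set s2 := holder_seminorm _ _ _ => hs.
  have m1 z : Omega z -> ((cmod (Hf z xi))%:E <= s1)%E by move=> Oz; apply: ereal_sup_ubound; exists z.
  have m2 z1 z2 : Omega z1 -> Omega z2 -> z1 <> z2 ->
      ((cmod (Hf z1 xi - Hf z2 xi) / cmod (z1 - z2) `^ alpha)%:E <= s2)%E.
    by move=> O1 O2 n12; apply: ereal_sup_ubound; exists z1, z2.
  have s10 : (0 <= s1)%E by apply: le_trans (m1 _ Oz0); rewrite lee_fin cmod_ge0.
  (* A supremum over the empty set would be [-oo]. Since [Omega] is open it has a second point near
     [z0], and the quotient of two distinct points is nonnegative; this sign is needed to bound [s1]
     by the sum. *)
  have s20 : (0 <= s2)%E.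
    have [e e0 he] := (open_cmodP Omega).1 oO z0 Oz0.
    have d : cmod (z0 + ((e / 2)%:C)%C - z0) = e / 2.
      by rewrite addrAC subrr add0r cmod_real ger0_norm// ltW// divr_gt0.
    have O1 : Omega (z0 + ((e / 2)%:C)%C) by apply: he; rewrite d; lra.
    apply: le_trans (m2 _ _ O1 Oz0 _); first by rewrite lee_fin divr_ge0 ?cmod_ge0 ?powR_ge0.
    by move=> E; move: d; rewrite E subrr cmod0; lra.
  have M1 : (s1 <= M%:E)%E by apply: le_trans hs; rewrite leeDl.
  have M2 : (s2 <= M%:E)%E by apply: le_trans hs; rewrite leeDr.
  split=> [z Oz|z1 z2 O1 O2]; first by rewrite -lee_fin; exact: le_trans (m1 z Oz) M1.
  have [->|/eqP n12] := eqVneq z1 z2; first by rewrite subrr cmod0 mulr_ge0 ?powR_ge0.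
  have := le_trans (m2 _ _ O1 O2 n12) M2; rewrite lee_fin ler_pdivrMr// powR_gt0// cmod_gt0 subr_eq0.
  exact/eqP.
have Hb z xi : Omega z -> rad < cmod xi -> cmod (Hf z xi) <= M by move=> Oz /hb[h _]; exact: h.
have Hh z1 z2 xi : Omega z1 -> Omega z2 -> rad < cmod xi ->
    cmod (Hf z1 xi - Hf z2 xi) <= M * cmod (z1 - z2) `^ alpha by move=> O1 O2 /hb[_ h]; exact: h.
have Hl z w1 w2 : Omega z -> rad < cmod w1 -> rad < cmod w2 ->
    cmod (Hf z w1 - Hf z w2) <= L * cmod (w1^-1 - w2^-1).
  by move=> Oz r1 r2; exact: (H_lip z (finite_pt w1) (finite_pt w2)).
(* The witness is built from the bounds of the field alone and precedes [h]; the norm of the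
   conjugate derivative enters only afterwards, as [N]. *)
exists (lamc rad L M alpha) => h hx hy hW hinf zinf [_ sol].
have [N N0 [NE Nae]] := Linf_cpatch zinf.
have [g [gh [B gB] gL gG]] := regularity oO rad_ge0 L_ge0 M_ge0 alpha_gt0 alpha_lt1 N0 Hb Hh Hl hW hinf Nae sol.
have [D D0 [DE gD]] := osc_fin (ex_intro _ z0 Oz0) gB.
exists g; split=> //.
- exact: locally_lipschitz gB gL.
- apply: (ae_mono (interior_bound oO gG D0 gD)) => p hp Op.
  move=> r; have : gradmod hx hy (toC p) <= 3 / r * D + 4 * N + 6 * lamc rad L M alpha := hp Op.
  by rewrite -lee_fin DE NE.
- move=> w bw; rewrite DE -EFinM.
  by apply: (limsup_le oO gG bw D0 ltr01) => z z' Oz Oz' _ _; exact: gD.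
- by move=> [G [cG Gg]] w bw; exact: (limsup_eq0 oO gG cG Gg bw).
Qed.
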